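(* Let $H=H(X)$ satisfy $H\to\infty$ and $\frac{\log H}{\log X}\to0$ as $X\to\infty$, and choose an integer $n\in[1,X]$ uniformly at random. Suppose $B$ is a sieving set such that $\langle B\rangle$ is regularly varying of index $\alpha\in(0,1)$, and $\varphi$ is a real-valued function of bounded variation, supported in a compact subset of $[0,\infty)$ and non-vanishing on some open interval. Then the random variable \[ \frac1{\sqrt{C_2(H;\varphi)}}\left(\sum_{u\in\mathbb{Z}}\varphi\!\left(\frac{u-n}H\right)\mathbf{1}_{B\text{-free}}(u)-\mathcal{M}_B\sum_{h\in\mathbb{Z}}\varphi\!\left(\frac hH\right)\right) \] converges in distribution to the standard normal distribution as $X\to\infty$.
   Context: A sieving set is a non-empty set $B \subset \{2,3,\dots\}$ of pairwise coprime integers with $\sum_{b\in B}1/b<\infty$. A positive integer is $B$-free if divisible by no element of $B$; $\mathbf{1}_{B\text{-free}}$ is its indicator and $\mathcal{M}_B=\prod_{b\in B}(1-1/b)$. $\langle B\rangle$ is the multiplicative semigroup generated by $B$ (including $1$). For $J\subset\mathbb{N}$, $N_J(x)=|\{n\le x:n\in J\}|$; a positive finite measurable $L$ on some $[K,\infty)$ is slowly varying if $L(ax)/L(x)\to1$ for all $a>0$; $J$ is regularly varying of index $\alpha$ if $N_J(x)\sim x^\alpha L(x)$ with $L$ slowly varying. Define $\mu_B(n)=0$ if $n\notin\langle B\rangle$ or some $b\in B$ has $b^2\mid n$, $\mu_B(n)=(-1)^k$ if $n$ is a product of $k$ distinct elements of $B$; $[B]=\{n:\mu_B(n)^2=1\}$;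 $g(n)=\frac{\mu_B(n)}n\prod_{b\in B,\,b\nmid n}(1-b^{-1})$; $\Phi_H(t)=\sum_{m\in\mathbb{Z}}e(mt)\varphi(m/H)$ with $e(u)=e^{2\pi iu}$; $\mathcal{R}_B(r)=\{a/r:1\le a\le r,\ \gcd(a,r)\ B\text{-free}\}\subset\mathbb{R}/\mathbb{Z}$; and \[ C_2(H;\varphi)=\sum_{\substack{r_1,r_2>1\\ r_1,r_2\in[B]}} g(r_1)g(r_2)\sum_{\substack{\sigma_i\in\mathcal{R}_B(r_i)\\ \sigma_1+\sigma_2\in\mathbb{Z}}}\Phi_H(\sigma_1)\Phi_H(\sigma_2). \] *)

(* Defs.v *)
From HB Require Import structures.
From mathcomp Require Import all_boot all_order all_algebra finmap.
From mathcomp Require Import complex.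
From mathcomp Require Import all_classical all_reals all_analysis.
From mathcomp.analysis.showcase Require summability.

Set Implicit Arguments.
Unset Strict Implicit.
Unset Printing Implicit Defensive.

Import Order.TTheory GRing.Theory Num.Theory.
Import numFieldNormedType.Exports.

Local Open Scope classical_set_scope.
Local Open Scope ring_scope.
Local Open Scope complex_scope.

Section SievingSets.
Context {R : realType}.
Implicit Types (B J : set nat) (n r : nat).

Definition sieving_set B : Prop :=
  [/\ B !=set0,
      B `<=` [set b | 2 <= b]%N,
      {in B &, forall b c, b != c -> coprime b c}
    & (\esum_(b in B) (b%:R^-1 : R)%:E < +oo)%E].

Definition B_free B : set nat :=
  [set n | (0 < n)%N /\ forall b, B b -> ~~ (b %| n)%N].

(* The products over sieving sets converge absolutely, so the increasing order
   of the factors is immaterial; if [A] is finite the limit is the product. *)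
Definition euler_prod (A : set nat) : R :=
  limn (fun N => \prod_(0 <= b < N | b \in A) (1 - b%:R^-1) : R).

Definition sieve_density B : R := euler_prod B.

(* The empty sequence gives [1]. *)
Definition generated_semigroup B : set nat :=
  [set n | exists2 s : seq nat, {in s, forall b, B b} & n = \prod_(b <- s) b].

Definition distinct_factorization B n : set (seq nat) :=
  [set s | [/\ uniq s, {in s, forall b, B b} & n = \prod_(b <- s) b]].

(* [xget] chooses a factorization of [n] into distinct elements of [B]; one
   exists in the second branch, and its length does not depend on the choice,
   the elements of [B] being pairwise coprime and at least [2]. *)
Definition mu_B B n : int :=
  if `[< ~ generated_semigroup B n \/ exists2 b, B b & (b ^ 2 %| n)%N >] then 0
  else (-1) ^+ size (xget [::] (distinct_factorization B n)).

Definition B_squarefree B : set nat := [set n | mu_B B n ^+ 2 = 1].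

Definition g_B B n : R :=
  (mu_B B n)%:~R / n%:R * euler_prod (B `&` [set b | ~~ (b %| n)%N]).

(* Each class of [R / Z] is given by its representative in ]0, 1]. *)
Definition reduced_fractions B r : set R :=
  [set a%:R / r%:R | a in [set a | (1 <= a <= r)%N /\ B_free B (gcdn a r)]].

Definition counting_function J (x : R) : R :=
  #|` fset_set [set n | J n /\ n%:R <= x] |%:R.

Definition slowly_varying (L : R -> R) : Prop :=
  (exists K : R, measurable_fun `[K, +oo[ L /\ forall x, K <= x -> 0 < L x) /\
  forall a, 0 < a -> L (a * x) / L x @[x --> +oo] --> (1 : R).

Definition regularly_varying J (alpha : R) : Prop :=
  exists2 L, slowly_varying L &
    counting_function J x / (x `^ alpha * L x) @[x --> +oo] --> (1 : R).

Implicit Types (phi : R -> R) (h t : R).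

Definition bounded_variation_line phi : Prop :=
  exists M, forall a b, a <= b -> ubound (variations a b phi) M.

Definition e_ (u : R) : R[i] := cos (2 * pi * u) +i* sin (2 * pi * u).

(* For [h > 0] and [phi] of compact support, the sum has finite support, as
   have the sums over [int] in [weighted_deviation]. *)
Definition Phi_ phi h t : R[i] :=
  \sum_(m \in [set: int]) e_ (m%:~R * t) * (phi (m%:~R / h))%:C.

Definition C2_term B phi h (r1 r2 : nat) : R[i] :=
  (g_B B r1 * g_B B r2)%:C *
  \sum_(s1 \in reduced_fractions B r1)
    \sum_(s2 \in reduced_fractions B r2 `&` [set s2 | s1 + s2 \is a Num.int])
      Phi_ phi h s1 * Phi_ phi h s2.

(* Unordered sum over all pairs, in the topology of the complex numbers. *)
Definition C2_complex B phi h : R[i] :=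
  let D := B_squarefree B `&` [set r | (1 < r)%N] in
  summability.sum (fun r : nat * nat =>
    (if (r.1 \in D) && (r.2 \in D) then C2_term B phi h r.1 r.2 else 0)
      : R[i]^o).

(* For real [phi] the sum is real: [Phi_ phi h (- t)] is the conjugate of
   [Phi_ phi h t], and [s1 + s2] is an integer. *)
Definition C2 B phi h : R := complex.Re (C2_complex B phi h).

Definition weighted_deviation B phi h n : R :=
  \sum_(u \in [set: int])
    phi ((u%:~R - n%:R) / h) * \1_([set k%:Z | k in B_free B]) u
  - sieve_density B * \sum_(k \in [set: int]) phi (k%:~R / h).

(* Uniform law on [{1, ..., floor x}]; for [x < 1] it is [\d_0]. *)
Definition uniform_upto (x : R) : probability nat R :=
  mnormalize (msum (fun k : nat => \d_(k.+1) : {measure set nat -> \bar R})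
                (Num.truncn x))
    (\d_0%N : probability nat R).

Lemma measurable_fun_nat (f : nat -> R) : f \in @mfun _ _ nat R.
Proof. by apply/mem_set => _ Y mY. Qed.

Definition nat_RV (P : probability nat R) (f : nat -> R) : {RV P >-> R} :=
  mfun_Sub (measurable_fun_nat f).

End SievingSets.

(* The sample space may vary with the index. *)
Definition cvg_in_distribution {R : realType} {I : Type} (F : set_system I)
    (d : I -> measure_display) (T : forall i, measurableType (d i))
    (P : forall i, probability (T i) R) (X : forall i, {RV (P i) >-> R})
    (Q : probability (measurableTypeR R) R) : Prop :=
  forall t : R, {for t, continuous (fun s : R => Q `]-oo, s]%classic)} ->
    cdf (X i) t @[i --> F] --> Q `]-oo, t]%classic.

(* Main.v *)
(* The deviation is expanded as the trigonometric polynomial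
     sum over r > 1 in [B] and a reduced modulo r of g(r) Phi_H(a/r) e(an/r),
   up to an error that is small in mean, and C_2 is its variance.  Since phi has bounded
   variation, Phi_H(s) is at most of the order of 1/|s|, so that by regular
   variation all but a small proportion of C_2 comes from the fractions a/r with
   H/q <= r <= qH and |a| <= q^3.  For these, the k-th moment over n <= X is a
   sum over k-tuples of fractions with integral sum, because H^m = o(X) for each
   m.  The tuples that split into opposite pairs give the Gaussian moment; the
   number of tuples without opposite pairs is, up to factors r^epsilon, at most
   the number of possible m in <B> below a power of H smaller than the one which
   the variance produces.  The moments determine the limit: trigonometric
   functions are reached by Taylor expansion, and indicators of half-lines by
   Bernstein polynomials in sin(wx). *)

Require Import Defs.
From HB Require Import structures.
From mathcomp Require Import all_boot all_order all_algebra finmap complex.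
From mathcomp Require Import ring lra zify.
From mathcomp Require Import all_classical all_reals all_analysis measurable_realfun.
From mathcomp.analysis.showcase Require summability.

Set Implicit Arguments.
Unset Strict Implicit.
Unset Printing Implicit Defensive.
Import Order.TTheory GRing.Theory Num.Theory.
Import numFieldNormedType.Exports.
Local Open Scope classical_set_scope.
Local Open Scope ring_scope.

(** * Method of moments *)

Section TrigTaylor.
Context {R : realType}.
Implicit Types (x y : R) (n k : nat).

(** The scale of the moments is $s = \sqrt{N(H)}$, with $N$ the counting function of $\langle
    B\rangle$. Since $|g(r)| \le 1/r$ and $\Phi_H(a/r)$ is of order at most $r/|a|$, the
    coefficients kept after truncation are bounded, and for fixed $q$ both their number and their
    variance are of order $N(H)$. In a $k$-tuple with integral sum each element of $B$ occurs in at
    least two denominators, so their least common multiple $L$ satisfies $L^2 \ll H^k$. This alone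
    leaves about $N(H^{k/2})$ choices, as many as in the main term up to $H^\epsilon$. The saving
    comes from the part of $L$ shared by exactly two denominators: without opposite pairs it divides
    a nonzero integer fixed by the other data, hence costs only a divisor function. The rest of $L$
    is $\ll H^{k/2 - 1/(2k)}$, and the gain $H^{\alpha/(2k)}$ absorbs every epsilon. The parameter
    $q$ depends only on the accuracy $d$ asked of the distribution function. High moments are
    computed for the truncated polynomial alone; the deviation is compared with it in
    probability. *)

Definition cos_taylor n x : R := \sum_(j < n) (-1) ^+ j * x ^+ j.*2 / (j.*2)`!%:R.
Definition sin_taylor n x : R :=
  \sum_(j < n) (-1) ^+ j * x ^+ j.*2.+1 / (j.*2.+1)`!%:R.

Lemma fact_inv_cancel n : n.+1%:R / (n.+1)`!%:R = (n`!%:R)^-1 :> R.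
Proof.
rewrite factS natrM invfM mulrA divff ?mul1r//.
Qed.

Lemma is_derive_sum_ord n (f : 'I_n -> R -> R) (df : 'I_n -> R) x :
  (forall i, is_derive x (1 : R) (f i) (df i)) ->
  is_derive x (1 : R) (fun y => \sum_(i < n) f i y) (\sum_(i < n) df i).
Proof.
move=> H; rewrite -[X in is_derive _ _ X](_ : \sum_(i < n) f i = _) //.
  exact: is_derive_sum.
by apply/funext => y; rewrite fct_sumE.
Qed.

Lemma is_derive_monomial (c : R) n x d : c * (n%:R * x ^+ n.-1) = d ->
  is_derive x (1 : R) (fun y : R => c * y ^+ n) d.
Proof.
move=> <-.
have D : is_derive x (1 : R) (fun y : R => y ^+ n) (n%:R * x ^+ n.-1).
  have := @is_deriveX R R (@id R) n x 1 1 (is_derive_id x 1).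
  rewrite /GRing.scale /= mulr1 => D; congr (is_derive _ _ _ _): D.
  by apply/funext => y; rewrite exprfctE.
have := is_deriveZ c D; exact.
Qed.

Lemma is_derive_sin_taylor n x :
  is_derive x (1 : R) (sin_taylor n) (cos_taylor n x).
Proof.
apply: is_derive_sum_ord => i.
have -> : (fun y : R => (-1) ^+ i * y ^+ i.*2.+1 / (i.*2.+1)`!%:R) =
   (fun y : R => ((-1) ^+ i / (i.*2.+1)`!%:R) * y ^+ i.*2.+1).
  by apply/funext => y /=; rewrite mulrAC.
apply: is_derive_monomial.
by rewrite /= -[in RHS]fact_inv_cancel; ring.
Qed.

Lemma is_derive_cos_taylor n x :
  is_derive x (1 : R) (cos_taylor n.+1) (- sin_taylor n x).
Proof.
rewrite /cos_taylor.
have -> : (fun y : R => \sum_(j < n.+1) (-1) ^+ j * y ^+ j.*2 / (j.*2)`!%:R) =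
  (fun y => 1 + \sum_(j < n) (-1) ^+ j.+1 * y ^+ (j.*2.+2) / (j.*2.+2)`!%:R).
  apply/funext => y; rewrite big_ord_recl /= expr0 mul1r expr0 fact0 divr1.
  by congr (_ + _); apply: eq_bigr => i _.
rewrite -[X in is_derive _ _ _ X]add0r; apply: is_deriveD.
rewrite /sin_taylor -sumrN.
apply: is_derive_sum_ord => i.
have -> : (fun y : R => (-1) ^+ i.+1 * y ^+ i.*2.+2 / (i.*2.+2)`!%:R) =
   (fun y : R => ((-1) ^+ i.+1 / (i.*2.+2)`!%:R) * y ^+ i.*2.+2).
  by apply/funext => y /=; rewrite mulrAC.
apply: is_derive_monomial.
by rewrite /= -[in RHS]fact_inv_cancel exprS; ring.
Qed.

Lemma ge0_of_derive (f df : R -> R) :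
  (forall x, is_derive x (1 : R) f (df x)) -> 0 <= f 0 ->
  (forall x, 0 <= x -> 0 <= df x) -> forall x, 0 <= x -> 0 <= f x.
Proof.
move=> fdf f0 dfge x; rewrite le_eqVlt => /predU1P[<-//|x0].
have [c cI] : exists2 c, c \in `]0, x[ & f x - f 0 = df c * (x - 0).
  apply: MVT => //; apply: derivable_within_continuous => y _.
  exact: ex_derive.
rewrite subr0 => /eqP; rewrite subr_eq => /eqP ->.
apply: addr_ge0 => //; apply: mulr_ge0; last exact: ltW.
by apply: dfge; move: cI; rewrite in_itv/= => /andP[/ltW].
Qed.

(** The remainder of sine has the remainder of cosine as derivative, and the latter has minus the
    remainder of sine. All vanish at [0], so the sign propagates along $[0, \infty)$, starting from
    $\cos \le 1$. Two consecutive signs bound each remainder by the first omitted term. *)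
Lemma trig_taylor_sign n :
  (forall x, 0 <= x -> 0 <= (-1) ^+ n.+1 * (cos x - cos_taylor n.+1 x)) /\
  (forall x, 0 <= x -> 0 <= (-1) ^+ n.+1 * (sin x - sin_taylor n.+1 x)).
Proof.
have sin_of n' : (forall x, 0 <= x -> 0 <= (-1) ^+ n' * (cos x - cos_taylor n' x)) ->
  (forall x, 0 <= x -> 0 <= (-1) ^+ n' * (sin x - sin_taylor n' x)).
  move=> H; apply: (@ge0_of_derive (fun x => (-1) ^+ n' * (sin x - sin_taylor n' x))
    (fun x => (-1) ^+ n' * (cos x - cos_taylor n' x))); last exact: H.
    move=> x; have := is_derive_sin_taylor n' x => D1.
    have D2 : is_derive x (1 : R) (sin - sin_taylor n') (cos x - cos_taylor n' x).
      exact: is_deriveB.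
    have -> : (fun x => (-1) ^+ n' * (sin x - sin_taylor n' x)) = ((-1) ^+ n') \*: (sin - sin_taylor n' : R -> R).
      by apply/funext.
    exact: is_deriveZ.
  rewrite sin0 /sin_taylor big1 ?subrr ?mulr0// => i _.
  by rewrite expr0n /= mulr0 mul0r.
elim: n => [|n [_ IHs]].
  have c1 : forall x, 0 <= x -> 0 <= (-1) ^+ 1 * (cos x - cos_taylor 1 x) :> R.
    move=> x _; rewrite /cos_taylor big_ord_recl big_ord0 /= expr0 !mul1r fact0 invr1 addr0.
    by rewrite expr1 mulN1r opprB subr_ge0 cos_le1.
  by split => //; exact: sin_of.
suff c1 : forall x, 0 <= x -> 0 <= (-1) ^+ n.+2 * (cos x - cos_taylor n.+2 x) :> R.
  by split => //; exact: sin_of.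
apply: (@ge0_of_derive (fun x => (-1) ^+ n.+2 * (cos x - cos_taylor n.+2 x))
  (fun x => (-1) ^+ n.+1 * (sin x - sin_taylor n.+1 x))); last exact: IHs.
  move=> x; have := is_derive_cos_taylor n.+1 x => D1.
  have D2 : is_derive x (1 : R) (cos - cos_taylor n.+2) (- sin x - - sin_taylor n.+1 x).
    exact: is_deriveB.
  have -> : (fun x => (-1) ^+ n.+2 * (cos x - cos_taylor n.+2 x)) = ((-1) ^+ n.+2) \*: (cos - cos_taylor n.+2 : R -> R).
    by apply/funext.
  have -> : (-1) ^+ n.+1 * (sin x - sin_taylor n.+1 x) = (-1) ^+ n.+2 *: (- sin x - - sin_taylor n.+1 x).
    by rewrite /GRing.scale/= [in RHS]exprS; ring.
  exact: is_deriveZ.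
rewrite cos0 /cos_taylor big_ord_recl /= expr0 !mul1r fact0 invr1.
rewrite big1 ?addr0 ?subrr ?mulr0// => i _.
by rewrite expr0n /= mulr0 mul0r.
Qed.

Lemma sign_flip (s c t w : R) : s * s = 1 ->
  -1 * s * (c - (t + s * w)) = w - s * (c - t).
Proof.
move=> ss; transitivity (s * s * w - s * (c - t)); first by ring.
by rewrite ss mul1r.
Qed.

Lemma exprN_double x k : (- x) ^+ k.*2 = x ^+ k.*2.
Proof. by rewrite exprNn -signr_odd odd_double expr0 mul1r. Qed.

Lemma cos_taylor_bound n x : (0 < n)%N ->
  `|cos x - cos_taylor n x| <= x ^+ n.*2 / (n.*2)`!%:R.
Proof.
case: n => // n _; wlog x0 : x / 0 <= x.
  move=> H; have [|/ltW x0] := leP 0 x; first exact: H.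
  have := H (- x); rewrite oppr_ge0 cosN => /(_ x0).
  rewrite exprN_double /cos_taylor.
  by under eq_bigr => i _ do rewrite exprN_double.
have [/(_ x x0) h1 _] := trig_taylor_sign n.
have [/(_ x x0) h2 _] := trig_taylor_sign n.+1.
move: h2; rewrite /cos_taylor big_ord_recr /= -/(cos_taylor n.+1 x) => h2.
have -> : `|cos x - cos_taylor n.+1 x| = (-1) ^+ n.+1 * (cos x - cos_taylor n.+1 x).
  by rewrite -[RHS]ger0_norm// normrM normrX normrN1 expr1n mul1r.
rewrite -subr_ge0; apply: le_trans h2 _.
by rewrite exprS -[(-1) ^+ _ * _ / _]mulrA (sign_flip _ _ _ (_ : _ * _ = 1))// -expr2 sqrr_sign.
Qed.

(** The usual bound $|x|^{2n+1}/(2n+1)!$ is weakened through $|x|^{2n+1} \le x^{2n} + x^{2n+2}$, so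
    that the majorant is a polynomial in even powers, whose normal mean is explicit. *)
Lemma sin_taylor_bound n x : (0 < n)%N ->
  `|sin x - sin_taylor n x| <= (x ^+ n.*2 + x ^+ n.*2.+2) / (n.*2.+1)`!%:R.
Proof.
case: n => // n _.
apply: (@le_trans _ _ (`|x| ^+ n.+1.*2.+1 / (n.+1.*2.+1)`!%:R)); last first.
  rewrite ler_wpM2r ?invr_ge0//.
  have e y k : odd k = false -> `|y| ^+ k = y ^+ k :> R.
    by move=> ok; rewrite -normrX ger0_norm// exprn_even_ge0 ?ok.
  rewrite -(e x n.+1.*2) ?odd_double// -(e x n.+1.*2.+2) /= ?odd_double//.
  rewrite !exprS; move: (`|x|) (normr_ge0 x) (`|x| ^+ _) (exprn_ge0 (n.*2) (normr_ge0 x)) => y y0 w w0.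
  rewrite -subr_ge0.
  have -> : y * (y * w) + y * (y * (y * (y * w))) - y * (y * (y * w)) = (y * y * w) * (1 + y * y - y) by ring.
  by apply: mulr_ge0; [rewrite !mulr_ge0|nra].
wlog x0 : x / 0 <= x.
  move=> H; have [|/ltW x0] := leP 0 x; first exact: H.
  have := H (- x); rewrite oppr_ge0 sinN normrN => /(_ x0).
  rewrite /sin_taylor; under eq_bigr => i _ do
    rewrite exprS exprN_double mulNr -exprS mulrN mulNr.
  by rewrite sumrN -opprD normrN.
have [_ /(_ x x0) h1] := trig_taylor_sign n.
have [_ /(_ x x0) h2] := trig_taylor_sign n.+1.
move: h2; rewrite /sin_taylor big_ord_recr /= -/(sin_taylor n.+1 x) => h2.
have -> : `|sin x - sin_taylor n.+1 x| = (-1) ^+ n.+1 * (sin x - sin_taylor n.+1 x).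
  by rewrite -[RHS]ger0_norm// normrM normrX normrN1 expr1n mul1r.
rewrite ger0_norm// -subr_ge0; apply: le_trans h2 _.
by rewrite exprS -[(-1) ^+ _ * _ / _]mulrA (sign_flip _ _ _ (_ : _ * _ = 1))// -expr2 sqrr_sign.
Qed.

End TrigTaylor.

Section MethodOfMoments.
Context {R : realType}.
Implicit Types (f g h : R -> R) (E : (R -> R) -> R).

(** The class of test functions: it contains polynomials, trigonometric functions and indicators of
    half-lines, and its members are integrable against the normal density. *)
Definition poly_growth f := measurable_fun setT f /\
  exists C k, forall x, `|f x| <= C * (1 + x ^+ 2) ^+ k.

Lemma one_le_oneDsqr_pow (x : R) k : 1 <= (1 + x ^+ 2) ^+ k.
Proof. by apply: exprn_ege1; rewrite lerDl sqr_ge0. Qed.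

Lemma poly_growthD f g : poly_growth f -> poly_growth g ->
  poly_growth (fun x => f x + g x).
Proof.
move=> [mf [C [k fC]]] [mg [D [l gD]]]; split; first exact: measurable_funD.
exists (C + D), (k + l)%N => x; apply: le_trans (ler_normD _ _) _.
have ge0 (A c : R) (m : nat) : `|A| <= c * (1 + x ^+ 2) ^+ m -> 0 <= c.
  move=> /(le_trans (normr_ge0 _)); rewrite pmulr_lge0//.
  exact: lt_le_trans (one_le_oneDsqr_pow x m).
have C0 := ge0 _ _ _ (fC x); have D0 := ge0 _ _ _ (gD x).
rewrite mulrDl; apply: lerD; [apply: le_trans (fC x) _|apply: le_trans (gD x) _].
  rewrite ler_wpM2l// exprD ler_peMr ?one_le_oneDsqr_pow//.
  exact: le_trans (one_le_oneDsqr_pow _ _).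
rewrite ler_wpM2l// exprD ler_peMl ?one_le_oneDsqr_pow//.
exact: le_trans (one_le_oneDsqr_pow _ _).
Qed.

Lemma poly_growthM f g : poly_growth f -> poly_growth g ->
  poly_growth (fun x => f x * g x).
Proof.
move=> [mf [C [k fC]]] [mg [D [l gD]]]; split; first exact: measurable_funM.
exists (C * D), (k + l)%N => x; rewrite normrM exprD mulrACA.
by apply: ler_pM.
Qed.

Lemma poly_growth_bounded f c : measurable_fun setT f ->
  (forall x, `|f x| <= c) -> poly_growth f.
Proof. by move=> mf fc; split => //; exists c, 0%N => x; rewrite expr0 mulr1. Qed.

Lemma poly_growth_cst c : poly_growth (fun=> c).
Proof. exact: (@poly_growth_bounded _ `|c|). Qed.

Lemma poly_growthZ c f : poly_growth f -> poly_growth (fun x => c * f x).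
Proof. by move=> ?; apply: poly_growthM => //; exact: poly_growth_cst. Qed.

Lemma poly_growthX f n : poly_growth f -> poly_growth (fun x => f x ^+ n).
Proof.
move=> pf; elim: n => [|n IH].
  by under eq_fun do rewrite expr0; exact: poly_growth_cst.
by under eq_fun do rewrite exprS; exact: poly_growthM.
Qed.

Lemma poly_growth_id : poly_growth (fun x => x).
Proof.
split; first exact: measurable_id.
exists 1, 1%N => x; rewrite mul1r expr1.
have := normr_ge0 x; rewrite -[x ^+ 2]real_normK ?num_real//; move: `|x| => y y0; nra.
Qed.

Lemma poly_growth_pow n : poly_growth (fun x => x ^+ n).
Proof. exact/poly_growthX/poly_growth_id. Qed.

Lemma poly_growth_cos w : poly_growth (fun x => cos (w * x)).
Proof.
apply: (@poly_growth_bounded _ 1) => [|x]; last exact: cos_max.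
apply: continuous_measurable_fun => x; apply: continuous_comp.
  exact: (@mulrl_continuous _ w x).
exact: continuous_cos.
Qed.

Lemma poly_growth_sin w : poly_growth (fun x => sin (w * x)).
Proof.
apply: (@poly_growth_bounded _ 1) => [|x]; last exact: sin_max.
apply: continuous_measurable_fun => x; apply: continuous_comp.
  exact: (@mulrl_continuous _ w x).
exact: continuous_sin.
Qed.

Lemma poly_growth_le_indic (t : R) : poly_growth (fun x => (x <= t)%R%:R).
Proof.
apply: (@poly_growth_bounded _ 1) => [|x]; last by case: (x <= t); rewrite ?normr0// normr1.
rewrite (_ : (fun x => _) = \1_(`]-oo, t]%classic)); first exact: measurable_indic.
by apply/funext => x; rewrite indicE; congr (nat_of_bool _)%:R; apply/idP/idP; rewrite inE /= in_itv.
Qed.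

(** Common abstraction of the average over integers up to a bound and of the mean under the normal
    law. Additivity and monotonicity are asked on [poly_growth] only, where the normal mean is an
    honest integral. *)
Record mean_functional E : Prop := MeanFunctional {
  meanD : forall f g, poly_growth f -> poly_growth g ->
    E (fun x => f x + g x) = E f + E g;
  meanZ : forall c f, poly_growth f -> E (fun x => c * f x) = c * E f;
  mean_le : forall f g, poly_growth f -> poly_growth g ->
    (forall x, f x <= g x) -> E f <= E g;
  mean1 : E (fun=> 1) = 1 }.

Lemma mean_cst E c : mean_functional E -> E (fun=> c) = c.
Proof.
move=> mE; have := meanZ mE c (poly_growth_cst 1); rewrite mean1// mulr1 => {2}<-.
by congr E; apply/funext => x; rewrite mulr1.
Qed.

Lemma mean_dist E f g h : mean_functional E ->
  poly_growth f -> poly_growth g -> poly_growth h ->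
  (forall x, `|f x - g x| <= h x) -> `|E f - E g| <= E h.
Proof.
move=> mE pf pg ph fgh; rewrite ler_norml; apply/andP; split.
  rewrite lerNl opprB lerBlDr -meanD//; apply: mean_le => //; first exact: poly_growthD.
  by move=> x; rewrite -lerBlDr; apply: le_trans (fgh x); rewrite distrC ler_norm.
rewrite lerBlDr -meanD//; apply: mean_le => //; first exact: poly_growthD.
by move=> x; rewrite -lerBlDr; apply: le_trans (fgh x); rewrite ler_norm.
Qed.

Section Limit.
Context {I : Type} (F : set_system I) {FF : Filter F}.
Variables (E : I -> (R -> R) -> R) (Z : (R -> R) -> R).
Hypothesis mE : forall i, mean_functional (E i).
Hypothesis mZ : mean_functional Z.

Definition mean_cvg f := poly_growth f /\ E i f @[i --> F] --> Z f.

Hypothesis mean_cvg_pow : forall n, mean_cvg (fun x => x ^+ n).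
Hypothesis Z_even : forall n,
  Z (fun x => x ^+ n.*2) = (n.*2)`!%:R / (2 ^+ n * n`!%:R).

Lemma mean_cvgD f g : mean_cvg f -> mean_cvg g -> mean_cvg (fun x => f x + g x).
Proof.
move=> [pf cf] [pg cg]; split; first exact: poly_growthD.
under eq_fun => i do rewrite meanD//.
by rewrite meanD//; exact: cvgD.
Qed.

Lemma mean_cvgZ c f : mean_cvg f -> mean_cvg (fun x => c * f x).
Proof.
move=> [pf cf]; split; first exact: poly_growthZ.
under eq_fun => i do rewrite meanZ//.
by rewrite meanZ//; exact: cvgMr.
Qed.

Lemma mean_cvg_sum n (f : 'I_n -> R -> R) :
  (forall i, mean_cvg (f i)) -> mean_cvg (fun x => \sum_(i < n) f i x).
Proof.
elim: n f => [|n IH] f Hf.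
  under eq_fun do rewrite big_ord0.
  split; first exact: poly_growth_cst.
  under eq_fun do rewrite mean_cst//.
  by rewrite mean_cst//; exact: cvg_cst.
under eq_fun do rewrite big_ord_recl; apply: mean_cvgD => //.
exact: (IH (fun i => f (lift ord0 i))).
Qed.

(** The majorant [h] of the error has itself a convergent mean, so smallness of [Z h] carries over
    to [E i h] eventually; no uniform approximation of [f] is required. *)
Lemma mean_cvg_approx f : poly_growth f ->
  (forall e : R, 0 < e -> exists g h, [/\ mean_cvg g, mean_cvg h,
     forall x, `|f x - g x| <= h x & Z h <= e]) ->
  mean_cvg f.
Proof.
move=> pf H; split => //; apply/cvgrPdist_lt => e e0.
have e4 : 0 < e / 4 by rewrite divr_gt0.
have [g [h [[pg cg] [ph ch] fgh Zh]]] := H _ e4.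
move/cvgrPdist_lt/(_ _ e4) : ch; move/cvgrPdist_lt/(_ _ e4) : cg => cg ch.
apply: filterS2 ch cg => i h1 h2.
have A := mean_dist mZ pf pg ph fgh; have B := mean_dist (mE i) pf pg ph fgh.
have -> : Z f - E i f = (Z f - Z g) + ((Z g - E i g) + (E i g - E i f)) by ring.
apply: le_lt_trans (ler_normD _ _) _; rewrite [ltRHS](_ : e = e/4 + (e/4 + (e/4 + e/4))); last by field.
apply: ler_ltD; first exact: le_trans A Zh.
apply: le_lt_trans (ler_normD _ _) _.
apply: ltr_leD => //; rewrite distrC; apply: le_trans B _.
have -> : E i h = Z h - (Z h - E i h) by ring.
by apply: lerD => //; rewrite lerNl; apply: ltW; move: h1; rewrite ltr_norml => /andP[].
Qed.

Lemma pow_fact_small (a e : R) : 0 < e -> exists n, (0 < n)%N /\ a ^+ n / n`!%:R < e.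
Proof.
move=> e0; have /cvgrPdist_lt/(_ _ e0) := cvg_series_cvg_0 (@is_cvg_series_exp_coeff R a).
move=> [N _ /(_ N.+1 (leqnSn _))]; rewrite sub0r normrN /exp_coeff => H.
by exists N.+1; split => //; apply: le_lt_trans H; exact: ler_norm.
Qed.

(** The normal moment $(2n)!/(2^n n!)$ cancels the factorial of the Taylor remainder, whose mean
    becomes $(w^2/2)^n/n!$ and tends to [0] for every [w]. *)
Lemma mean_cvg_cos w : mean_cvg (fun x => cos (w * x)).
Proof.
apply: mean_cvg_approx; first exact: poly_growth_cos.
move=> e e0; have [n [n0 ne]] := pow_fact_small (w ^+ 2 / 2) e0.
exists (fun x => cos_taylor n (w * x)), (fun x => w ^+ n.*2 / (n.*2)`!%:R * x ^+ n.*2); split.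
- apply: mean_cvg_sum => i.
  rewrite [X in mean_cvg X](_ : _ = fun x => ((-1) ^+ i * w ^+ i.*2 / (i.*2)`!%:R) * x ^+ i.*2).
    exact: mean_cvgZ.
  by apply/funext => x; rewrite exprMn; ring.
- exact: mean_cvgZ.
- by move=> x; apply: le_trans (cos_taylor_bound _ n0) _; rewrite exprMn mulrAC.
rewrite meanZ ?Z_even//; last exact: poly_growth_pow.
apply: le_trans (ltW ne); rewrite expr_div_n -exprM mul2n.
have f0 : (n.*2)`!%:R != 0 :> R by rewrite pnatr_eq0 -lt0n fact_gt0.
have f1 : n`!%:R != 0 :> R by rewrite pnatr_eq0 -lt0n fact_gt0.
rewrite le_eqVlt; apply/orP; left; apply/eqP; field.
by rewrite f0 f1 expf_neq0.
Qed.

Lemma mean_cvg_sin w : mean_cvg (fun x => sin (w * x)).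
Proof.
apply: mean_cvg_approx; first exact: poly_growth_sin.
move=> e e0.
have w1 : 0 < 1 + w ^+ 2 by rewrite ltr_pwDl// sqr_ge0.
(* The two even powers of the remainder contribute at most $1$ and $w^2$ times $(w^2/2)^n/n!$,
   whence the division by $1 + w^2$. *)
have [n [n0 ne]] := pow_fact_small (w ^+ 2 / 2) (divr_gt0 e0 w1).
exists (fun x => sin_taylor n (w * x)), (fun x => w ^+ n.*2 / (n.*2.+1)`!%:R * x ^+ n.*2 + w ^+ n.*2.+2 / (n.*2.+1)`!%:R * x ^+ n.*2.+2).
have g1 : mean_cvg (fun x => w ^+ n.*2 / (n.*2.+1)`!%:R * x ^+ n.*2) by exact: mean_cvgZ.
have g2 : mean_cvg (fun x => w ^+ n.*2.+2 / (n.*2.+1)`!%:R * x ^+ n.*2.+2) by exact: mean_cvgZ.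
split.
- apply: mean_cvg_sum => i.
  rewrite [X in mean_cvg X](_ : _ = fun x => ((-1) ^+ i * w ^+ i.*2.+1 / (i.*2.+1)`!%:R) * x ^+ i.*2.+1).
    exact: mean_cvgZ.
  by apply/funext => x; rewrite exprMn; ring.
- exact: mean_cvgD.
- move=> x; apply: le_trans (sin_taylor_bound _ n0) _.
  by rewrite !exprMn mulrDl mulrAC lerD2l mulrAC.
rewrite (meanD mZ g1.1 g2.1) !(meanZ mZ _ (poly_growth_pow _)).
rewrite (Z_even n) (Z_even n.+1).
have f0 : (n.*2)`!%:R != 0 :> R by rewrite pnatr_eq0 -lt0n fact_gt0.
have f1 : n`!%:R != 0 :> R by rewrite pnatr_eq0 -lt0n fact_gt0.
have f2 : n%:R + 1 != 0 :> R by rewrite natr1 pnatr_eq0.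
have f3 : 1 + 2 * n%:R != 0 :> R by rewrite -natrM nat1r pnatr_eq0.
apply: (@le_trans _ _ ((1 + w ^+ 2) * ((w ^+ 2 / 2) ^+ n / n`!%:R))); last first.
  by rewrite mulrC -ler_pdivlMr// ltW.
rewrite expr_div_n -exprM mul2n.
have e1 : n.*2.+1%:R = 1 + 2 * n%:R :> R by rewrite -nat1r -mul2n natrM.
have e2 : n.*2.+2%:R = 2 * (n%:R + 1) :> R by rewrite -nat1r e1; ring.
have p0 : 2 ^+ n != 0 :> R by rewrite expf_neq0.
have -> : w ^+ n.*2 / (n.*2.+1)`!%:R * ((n.*2)`!%:R / (2 ^+ n * n`!%:R)) = w ^+ n.*2 / 2 ^+ n / n`!%:R / (1 + 2 * n%:R).
  rewrite factS natrM e1; move: f0 f1 f3 p0.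
  move: (n.*2)`!%:R n`!%:R (1 + _) (2 ^+ n) (w ^+ _) => a b c d z a0 b0 c0 d0.
  by field; rewrite ?a0 ?b0 ?c0 ?d0.
have -> : w ^+ n.*2.+2 / (n.*2.+1)`!%:R * ((n.+1.*2)`!%:R / (2 ^+ n.+1 * n.+1`!%:R)) = w ^+ 2 * (w ^+ n.*2 / 2 ^+ n / n`!%:R).
  rewrite doubleS (factS n.*2.+1) (factS n.*2) (factS n) !natrM e2 e1 -[n.+1%:R]natr1 !exprS expr0 mulr1.
  move: f0 f1 f2 f3 p0.
  move: (n.*2)`!%:R n`!%:R (1 + _) (n%:R + 1) (2 ^+ n) (w ^+ n.*2) => a b c d x z a0 b0 d0 c0 x0.
  by field; rewrite ?a0 ?b0 ?c0 ?d0 ?x0.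
rewrite [leRHS]mulrDl mul1r; apply: lerD => //.
have n1 : 1 <= 1 + 2 * n%:R :> R by rewrite lerDl mulr_ge0.
apply: ler_piMr; last by rewrite invf_le1//; exact: lt_le_trans n1.
rewrite -mul2n exprM; apply: divr_ge0 => //; apply: divr_ge0; apply: exprn_ge0 => //.
exact: sqr_ge0.
Qed.

Lemma mean_cvg_ext f g : f =1 g -> mean_cvg f -> mean_cvg g.
Proof. by move=> /funext ->. Qed.

(** By the product formulas a factor $\sin(wx)$ moves the frequency [c] to $c \pm w$ and exchanges
    sine and cosine; hence both statements are proved together, for all [c]. *)
Lemma mean_cvg_trig w n c : mean_cvg (fun x => cos (c * x) * sin (w * x) ^+ n) /\
  mean_cvg (fun x => sin (c * x) * sin (w * x) ^+ n).
Proof.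
elim: n c => [|n IH] c.
  split; [apply: mean_cvg_ext (mean_cvg_cos c) => x|apply: mean_cvg_ext (mean_cvg_sin c) => x];
  by rewrite expr0 mulr1.
have [c1 s1] := IH (c + w); have [c2 s2] := IH (c - w); split.
  apply: mean_cvg_ext (mean_cvgD (mean_cvgZ (2^-1) s1) (mean_cvgZ (- 2^-1) s2)) => x.
  rewrite exprS; move: (sin (w * x) ^+ n) => z.
  by rewrite !mulrDl !mulNr sinD sinB; field.
apply: mean_cvg_ext (mean_cvgD (mean_cvgZ (2^-1) c2) (mean_cvgZ (- 2^-1) c1)) => x.
rewrite exprS; move: (sin (w * x) ^+ n) => z.
by rewrite !mulrDl !mulNr cosB cosD; field.
Qed.

Lemma mean_cvg_poly_sin w (p : {poly R}) : mean_cvg (fun x => p.[sin (w * x)]).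
Proof.
apply: (@mean_cvg_ext (fun x => \sum_(i < size p) p`_i * sin (w * x) ^+ i)).
  by move=> x; rewrite horner_coef.
apply: mean_cvg_sum => i; apply: mean_cvgZ.
apply: mean_cvg_ext (mean_cvg_trig w i 0).1 => x.
by rewrite mul0r cos0 mul1r.
Qed.

End Limit.
End MethodOfMoments.

(** * Approximation of a step by polynomials in a sine *)

Section Bernstein.
Context {R : realType}.
Implicit Types (f g : nat -> R) (u : R).

(* Expectation of [f] under the binomial law of parameters [n] and [u]. *)
Fixpoint bernstein n f u : R :=
  if n is m.+1 then u * bernstein m (f \o S) u + (1 - u) * bernstein m f u
  else f 0%N.

Fixpoint bernstein_poly n f : {poly R} :=
  if n is m.+1 then
    'X * bernstein_poly m (f \o S) + (1 - 'X) * bernstein_poly m f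
  else (f 0%N)%:P.

Lemma horner_bernstein_poly n f u : (bernstein_poly n f).[u] = bernstein n f u.
Proof.
by elim: n f => [|n IH] f /=; rewrite ?hornerC// !hornerE IH IH.
Qed.

Lemma le_bernstein n f g u : 0 <= u <= 1 -> (forall k, f k <= g k) ->
  bernstein n f u <= bernstein n g u.
Proof.
move=> /andP[u0 u1]; elim: n f g => [|n IH] f g fg /=; first exact: fg.
apply: lerD; apply: ler_wpM2l => //; rewrite ?subr_ge0//; apply: IH => k //.
exact: fg.
Qed.

Lemma bernsteinZ n c f u : bernstein n (fun k => c * f k) u = c * bernstein n f u.
Proof.
elim: n f => [//|n IH] f /=.
by rewrite IH [X in _ * X](IH (f \o S)); ring.
Qed.

Lemma bernsteinD n f g u :
  bernstein n (fun k => f k + g k) u = bernstein n f u + bernstein n g u.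
Proof.
elim: n f g => [//|n IH] f g /=.
by rewrite IH [X in _ * X](IH (f \o S) (g \o S)); ring.
Qed.

Lemma bernstein_cst n c u : bernstein n (fun=> c) u = c.
Proof. by elim: n => [//|n IH] /=; rewrite [X in u * X]IH IH; ring. Qed.

(** The centre [c] is arbitrary because a success in the first trial moves it to [c - 1] in the
    induction. *)
Lemma bernstein_variance n c u :
  bernstein n (fun k => (k%:R - c) ^+ 2) u = n%:R * u * (1 - u) + (n%:R * u - c) ^+ 2.
Proof.
elim: n c => [|n IH] c /=; first by rewrite mulr0n; ring.
rewrite IH.
have -> : bernstein n ((fun k => (k%:R - c) ^+ 2) \o S) u =
  bernstein n (fun k => (k%:R - (c - 1)) ^+ 2) u.
  by congr bernstein; apply/funext => k /=; rewrite -natr1; ring.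
by rewrite IH -natr1; ring.
Qed.

(** Bernstein polynomial of the indicator of $[0, x_0]$, with $x_0$ the midpoint of [a] and [b]. For
    [u] outside $]a, b[$ a wrong value forces a deviation of at least [n * d] from the mean [n * u],
    which Chebyshev's inequality makes improbable. *)
Lemma bernstein_step (a b e : R) : a < b -> 0 < e ->
  exists p : {poly R}, forall u, 0 <= u <= 1 ->
    [/\ 0 <= p.[u] <= 1, u <= a -> 1 - e <= p.[u] & b <= u -> p.[u] <= e].
Proof.
move=> ab e0; have [d dE] : exists d, d = (b - a) / 2 by eexists.
have d0 : 0 < d by rewrite dE divr_gt0// subr_gt0.
pose n := (Num.truncn ((e * d ^+ 2)^-1)).+1.
have n0 : 0 < n%:R :> R by rewrite ltr0n.
have ne : (n%:R * d ^+ 2)^-1 <= e.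
  have d2 : 0 < d ^+ 2 by exact: exprn_gt0.
  rewrite -[leRHS]invrK lef_pV2 ?posrE ?(mulr_gt0 n0 d2) ?invr_gt0//.
  rewrite -ler_pdivrMr// -invfM; apply/ltW; exact: truncnS_gt.
pose x0 := (a + b) / 2.
pose f (k : nat) : R := ((k%:R <= n%:R * x0 :> R)%R : nat)%:R.
exists (bernstein_poly n f) => u u01; rewrite horner_bernstein_poly.
have f01 k : 0 <= f k <= 1 by rewrite /f ler0n lern1 leq_b1.
(* Chebyshev's majorant: at least [1] as soon as [k] is at distance [n * d] from [n * u], and of
   mean at most $1/(n d^2) \le e$. *)
pose q (k : nat) := (n%:R * d) ^- 2 * (k%:R - n%:R * u) ^+ 2.
have Bq : bernstein n q u <= e.
  rewrite bernsteinZ bernstein_variance subrr expr0n/= addr0; apply: le_trans ne.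
  have uu : u * (1 - u) <= 1.
    move: u01 => /andP[u0 u1]; nra.
  rewrite (_ : (n%:R * d) ^- 2 * _ = (n%:R * d ^+ 2)^-1 * (u * (1 - u))); last first.
    by field; rewrite !gt_eqF.
  by rewrite ler_piMr// invr_ge0 mulr_ge0// ltW// exprn_gt0.
have key (k : nat) (y : R) : n%:R * d <= `|k%:R - n%:R * u| -> y <= 1 -> y <= q k.
  move=> H y1; apply: le_trans y1 _; rewrite /q mulrC ler_pdivlMr ?exprn_gt0 ?mulr_gt0//.
  by rewrite mul1r -[leRHS]real_normK ?num_real// ler_pXn2r// ?nnegrE ?mulr_ge0// ltW.
have q0 k : 0 <= q k by rewrite mulr_ge0 ?sqr_ge0// invr_ge0 sqr_ge0.
split.
- have := @le_bernstein n (fun=> 0) f u u01; rewrite bernstein_cst => -> /=; last by move=> k; case/andP: (f01 k).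
  by have := @le_bernstein n f (fun=> 1) u u01; rewrite bernstein_cst => -> //= k; case/andP: (f01 k).
- move=> ua; rewrite lerBlDr -[leLHS](bernstein_cst n _ u).
  apply: (@le_trans _ _ (bernstein n (fun k => f k + q k) u)); last by rewrite bernsteinD lerD2l.
  apply: le_bernstein => // k; rewrite /f; case: (leP (k%:R : R) (n%:R * x0)) => h /=; first by rewrite lerDl.
  rewrite add0r; apply: key => //; rewrite ger0_norm; last first.
    rewrite subr_ge0; apply: le_trans (ltW h); rewrite ler_wpM2l//.
    by apply: le_trans ua _; rewrite /x0; lra.
  rewrite lerBrDr; apply: le_trans (ltW h); rewrite -mulrDr ler_wpM2l//.
  by rewrite /x0 dE; lra.
- move=> bu; apply: le_trans Bq; apply: le_bernstein => // k.
  rewrite /f; case: (leP (k%:R : R) (n%:R * x0)) => h //=; apply: key => //; rewrite ler0_norm ?opprB; last first.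
    rewrite subr_le0; apply: le_trans h _; rewrite ler_wpM2l//.
    by apply: le_trans bu; rewrite /x0; lra.
  rewrite lerBrDr addrC -lerBrDr; apply: le_trans h _; rewrite -mulrBr ler_wpM2l//.
  by rewrite /x0 dE; lra.
Qed.

(** The frequency is so low that $\sin(wy)$ is increasing on $[-T, T]$, where a step in [y] is a
    step in the sine. Beyond $T$ the approximation is worthless, but there the error term $e y^2$ is
    at least [1]. *)
Lemma sin_poly_step (a b e : R) : a < b -> 0 < e ->
  exists (w : R) (p : {poly R}), forall y,
   [/\ (y <= a)%R%:R <= p.[sin (w * y)] + (e + e * y ^+ 2) &
       p.[sin (w * y)] <= (y <= b)%R%:R + (e + e * y ^+ 2)].
Proof.
move=> ab e0.
(* [T] exceeds $|a|$, $|b|$, [1] and $1/e$, so that $e T^2 \ge e T \ge 1$. *)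
pose T : R := `|a| + `|b| + 1 + e^-1.
have ei : 0 < e^-1 by rewrite invr_gt0.
have T1 : 1 <= T by rewrite /T -addrA addrC -!addrA lerDl !addr_ge0// ltW.
have T0 : 0 < T by exact: lt_le_trans T1.
pose w := pi / 2 / T.
have wT : w * T = pi / 2 by rewrite /w divfK// gt_eqF.
have w0 : 0 < w by rewrite divr_gt0// divr_gt0// pi_gt0.
have win y : `|y| <= T -> w * y \in `[ - (pi / 2), pi / 2].
  by rewrite in_itv/= -wT -mulrN !ler_pM2l// ler_norml.
have aT : `|a| <= T by rewrite /T -!addrA lerDl !addr_ge0// ltW.
have bT : `|b| <= T by rewrite /T -!addrA addrCA lerDl !addr_ge0// ltW.
have mono x y : `|x| <= T -> `|y| <= T -> x <= y -> sin (w * x) <= sin (w * y).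
  by move=> xT yT xy; rewrite leNgt ltr_sin ?win// ltr_pM2l// -leNgt.
have sab : (1 + sin (w * a)) / 2 < (1 + sin (w * b)) / 2.
  by rewrite ltr_pM2r// ltrD2l ltr_sin ?win// ltr_pM2l.
have [p Hp] := bernstein_step sab e0.
exists w, (p \Po ((1 + 'X) / 2%:P)) => y.
have -> : (p \Po ((1 + 'X) / 2%:P)).[sin (w * y)] = p.[(1 + sin (w * y)) / 2].
  rewrite horner_comp hornerM hornerD hornerX hornerC; congr (p.[_ * _]).
  by rewrite polyCV hornerC.
have u01 : 0 <= (1 + sin (w * y)) / 2 <= 1.
  have := sin_geN1 (w * y); have := sin_le1 (w * y) => *; lra.
have [/andP[p0 p1] pa pb] := Hp _ u01.
have ey : 0 <= e * y ^+ 2 by rewrite mulr_ge0 ?sqr_ge0// ltW.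
have [yT|yT] := leP `|y| T.
  split.
    have [ya|ya] := leP y a; last by rewrite !addr_ge0// ltW.
    have /pa : (1 + sin (w * y)) / 2 <= (1 + sin (w * a)) / 2.
      by rewrite ler_pM2r// lerD2l mono.
    by move=> h; rewrite /=; lra.
  have [yb|/ltW yb] := leP y b; first by apply: le_trans p1 _; rewrite lerDl addr_ge0// ltW.
  have /pb : (1 + sin (w * b)) / 2 <= (1 + sin (w * y)) / 2.
    by rewrite ler_pM2r// lerD2l mono.
  by move=> h; rewrite /=; lra.
have e1 : 1 <= e * y ^+ 2.
  rewrite -[y ^+ 2]real_normK ?num_real// mulrC -ler_pdivrMr// mul1r.
  apply: (@le_trans _ _ (T * T)); last first.
    by rewrite expr2; apply: ler_pM => //; exact: ltW.
  apply: (@le_trans _ _ T); last by rewrite ler_peMr// ltW.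
  by rewrite /T lerDr !addr_ge0.
split; first by case: (y <= a) => /=; lra.
by case: (y <= b) => /=; lra.
Qed.

End Bernstein.

Section MomentsCdf.
Context {R : realType} {I : Type} (F : set_system I) {FF : Filter F}.
Variables (E : I -> (R -> R) -> R) (Z : (R -> R) -> R).
Hypothesis mE : forall i, mean_functional (E i).
Hypothesis mZ : mean_functional Z.
Hypothesis cvg_pow : forall n : nat, E i (fun x => x ^+ n) @[i --> F] --> Z (fun x => x ^+ n).
Hypothesis Z_even : forall n,
  Z (fun x => x ^+ n.*2) = (n.*2)`!%:R / (2 ^+ n * n`!%:R).

(** The indicator is squeezed between polynomials in a sine, whose means converge, at the cost of
    the shift [d]. The quadratic error $e + e x^2$ is controlled by the second moments. Continuity
    of the limit law does not enter at this stage. *)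
Lemma moments_cdf (t d : R) : 0 < d -> \forall i \near F,
  Z (fun x => (x <= t - d)%R%:R) - d <= E i (fun x => (x <= t)%R%:R)
    <= Z (fun x => (x <= t + d)%R%:R) + d.
Proof.
(* Sixth part: [2 * e] is lost under [Z], whose second moment is [1], [e] in the convergence, and
   [3 * e] under [E i], whose second moment is eventually at most [2]. *)
move=> d0; pose e := d / 6; have e0 : 0 < e by rewrite divr_gt0.
have cp n : mean_cvg F E Z (fun x => x ^+ n) by split; first exact: poly_growth_pow.
have Z2 : Z (fun x => x ^+ 2) = 1.
  by rewrite (Z_even 1) (_ : (1.*2)`! = 2)%N// (_ : 1`! = 1)%N// expr1 mulr1 divff.
have [|w1 [p1 H1]] := @sin_poly_step R t (t + d) e _ e0; first by rewrite ltrDl.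
have [|w2 [p2 H2]] := @sin_poly_step R (t - d) t e _ e0; first by rewrite ltrBlDr ltrDl.
have [g1 c1] := mean_cvg_poly_sin mE mZ cp Z_even w1 p1.
have [g2 c2] := mean_cvg_poly_sin mE mZ cp Z_even w2 p2.
have err : poly_growth (fun x : R => e + e * x ^+ 2).
  by apply: poly_growthD; [exact: poly_growth_cst|apply/poly_growthZ/poly_growth_pow].
have Eerr (G : (R -> R) -> R) : mean_functional G ->
    G (fun x : R => e + e * x ^+ 2) = e + e * G (fun x => x ^+ 2).
  move=> mG; rewrite (meanD mG) ?mean_cst ?(meanZ mG)//.
  - exact: poly_growth_pow.
  - exact: poly_growth_cst.
  - exact/poly_growthZ/poly_growth_pow.
have ind := @poly_growth_le_indic R.
have step (G : (R -> R) -> R) (f g : R -> R) : mean_functional G -> poly_growth f -> poly_growth g ->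
    (forall x, f x <= g x + (e + e * x ^+ 2)) -> G f <= G g + (e + e * G (fun x => x ^+ 2)).
  move=> mG pf pg fg; rewrite -Eerr// -(meanD mG)//; apply: (mean_le mG) => //.
  exact: poly_growthD.
move/cvgrPdist_lt/(_ _ e0) : c1 => c1; move/cvgrPdist_lt/(_ _ e0) : c2 => c2.
have := @cvg_pow 2; rewrite Z2 => /cvgrPdist_lt/(_ _ ltr01) c3.
have A1 := step Z _ _ mZ g1 (ind (t + d)) (fun y => (H1 y).2).
have A2 := step Z _ _ mZ (ind (t - d)) g2 (fun y => (H2 y).1).
move: A1 A2; rewrite Z2 mulr1 => A1 A2.
apply: filterS3 c1 c2 c3 => i; rewrite !ltr_norml => /andP[B1 _] /andP[_ B2] /andP[B3 B4].
have C1 := step (E i) _ _ (mE i) (ind t) g1 (fun y => (H1 y).1).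
have C2 := step (E i) _ _ (mE i) g2 (ind t) (fun y => (H2 y).2).
have Eb : e * E i (fun x => x ^+ 2) <= e * 2 by rewrite ler_pM2l//; lra.
have de : d = 6 * e by rewrite /e; field.
by apply/andP; split; lra.
Qed.
End MomentsCdf.

(** * Moments of the standard normal law *)

Section NormalMoments.
Context {R : realType}.
Local Notation mu := (@lebesgue_measure R).
Implicit Types (f g : R -> R).

Let p : R -> R := normal_pdf 0 1.

Definition normal_mean f : R := \int[mu]_(x in setT) (f x * p x).

Lemma std_normal_pdfE x : p x = normal_peak 1 * expR (- x ^+ 2 / 2).
Proof.
by rewrite /p normal_pdfE ?oner_neq0// /normal_fun subr0 expr1n.
Qed.

(** Half of the Gaussian exponent absorbs the polynomial; the other half is a normal density of
    variance [2], which is integrable and bounded. *)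
Lemma oneDsqr_pow_normal_pdf k : exists C : R, 0 <= C /\
  forall x, (1 + x ^+ 2) ^+ k * p x <= C * normal_pdf 0 (Num.sqrt 2) x.
Proof.
have s2 : Num.sqrt 2 != 0 :> R by rewrite sqrtr_eq0 -ltNge.
(* From $y^{k+1}/(k+1)! \le e^y$ at $y = (1 + x^2)/4$; the last factor undoes the added $1/4$. *)
pose K : R := 4 ^+ k.+1 * (k.+1)`!%:R * expR (4^-1).
have K0 : 0 <= K by rewrite !mulr_ge0 ?exprn_ge0// expR_ge0.
have pk0 : 0 < normal_peak (Num.sqrt 2) :> R by exact: normal_peak_gt0.
have p1 : 0 < normal_peak 1 :> R by exact: normal_peak_gt0 (oner_neq0 _).
exists (K * normal_peak 1 / normal_peak (Num.sqrt 2)); split.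
  by rewrite divr_ge0 ?mulr_ge0// ltW.
move=> x; rewrite std_normal_pdfE normal_pdfE// /normal_fun subr0 sqr_sqrtr//.
rewrite -[X in _ <= X]mulrA mulKf ?gt_eqF//.
rewrite mulrCA [leRHS]mulrAC [leRHS]mulrC (ler_wpM2l (ltW p1))//.
have -> : expR (- x ^+ 2 / 2) = expR (- x ^+ 2 / (2 *+ 2)) * expR (- x ^+ 2 / (2 *+ 2)).
  by rewrite -expRD; congr expR; field.
rewrite mulrA ler_wpM2r ?expR_ge0//.
rewrite -ler_pdivlMr ?expR_gt0// -expRN.
have -> : - (- x ^+ 2 / (2 *+ 2)) = (1 + x ^+ 2) / 4 - 4^-1 by field.
rewrite expRD expRN /K [expR _ / _]mulrC mulrA mulfK ?gt_eqF ?expR_gt0//.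
apply: (@le_trans _ _ ((1 + x ^+ 2) ^+ k.+1)).
  by rewrite [leRHS]exprSr ler_peMr ?exprn_ge0 ?lerDl ?sqr_ge0// addr_ge0 ?sqr_ge0.
have y0 : 0 <= (1 + x ^+ 2) / 4 by rewrite divr_ge0// addr_ge0// sqr_ge0.
have := expR_ge1Dxn k y0; rewrite expr_div_n => H.
rewrite mulrC -ler_pdivrMr; last by rewrite mulr_gt0 ?exprn_gt0// ltr0n fact_gt0.
by apply: le_trans H; rewrite invfM mulrA lerDr.
Qed.

Lemma integrable_normal_mean f : poly_growth f ->
  mu.-integrable setT (EFin \o (fun x => f x * p x)).
Proof.
move=> [mf [C [k fC]]]; have [D [D0 HD]] := oneDsqr_pow_normal_pdf k.
have C0 : 0 <= C.
  have := fC 0; rewrite expr0n addr0 expr1n mulr1; exact: le_trans.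
have := integrableZl measurableT (C * D) (@integrable_normal_pdf R 0 (Num.sqrt 2)).
apply: le_integrable => //.
  by apply/measurable_EFinP/measurable_funM => //; exact: measurable_normal_pdf.
move=> x _; rewrite /= lee_fin normrM [leRHS]ger0_norm; last first.
  by rewrite !mulr_ge0// normal_pdf_ge0.
rewrite [X in _ * X <= _]ger0_norm ?normal_pdf_ge0//.
apply: (@le_trans _ _ (C * (1 + x ^+ 2) ^+ k * p x)).
  by rewrite ler_wpM2r// normal_pdf_ge0.
by rewrite -!mulrA ler_wpM2l.
Qed.

Lemma mean_functional_normal : mean_functional normal_mean.
Proof.
split.
- move=> f g pf pg; rewrite /normal_mean -RintegralD//; [|exact: integrable_normal_mean..].
  by apply: eq_Rintegral => x _; rewrite mulrDl.
- move=> c f pf; rewrite /normal_mean -RintegralZl//; last exact: integrable_normal_mean.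
  by apply: eq_Rintegral => x _; rewrite mulrA.
- move=> f g pf pg fg; apply: le_Rintegral => //; [exact: integrable_normal_mean..|].
  by move=> x _; rewrite ler_wpM2r// normal_pdf_ge0.
- rewrite /normal_mean /Rintegral; under eq_integral => x _ do rewrite mul1r.
  by rewrite integral_normal_pdf.
Qed.

Lemma normal_mean_le_indic (t : R) :
  (normal_mean (fun x => (x <= t)%R%:R))%:E = normal_prob 0 1 `]-oo, t]%classic.
Proof.
rewrite /normal_mean /Rintegral fineK; last first.
  by apply: integrable_fin_num => //; exact/integrable_normal_mean/poly_growth_le_indic.
rewrite /normal_prob [RHS]integral_mkcond; apply: eq_integral => x _.
rewrite patchE; case: ifPn.
  by rewrite inE /= in_itv /= => ->; rewrite mul1r.
by rewrite notin_setE /= in_itv /= => /negP/negbTE ->; rewrite mul0r.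
Qed.

Lemma is_derive_std_normal_pdf x : is_derive x (1 : R) p (- x * p x).
Proof.
have -> : p = (fun x => normal_peak 1 * expR (- 2^-1 * x ^+ 2)).
  by apply/funext => y; rewrite std_normal_pdfE; congr (_ * expR _); ring.
have D1 : is_derive x (1 : R) (fun y : R => - 2^-1 * y ^+ 2) (- x).
  by apply: is_derive_monomial; rewrite /= expr1; field.
have D2 := @is_derive1_comp R expR (fun y : R => - 2^-1 * y ^+ 2) x _ _ (is_derive_expR (- 2^-1 * x ^+ 2)) D1.
have := is_deriveZ (normal_peak 1) D2; rewrite /GRing.scale/= => D3.
by congr (is_derive _ _ _ _): D3; ring.
Qed.

Lemma is_derive_pow_normal n x :
  is_derive x (1 : R) (fun y => y ^+ n * p y) ((n%:R * x ^+ n.-1 - x ^+ n.+1) * p x).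
Proof.
have D1 : is_derive x (1 : R) (fun y : R => y ^+ n) (n%:R * x ^+ n.-1).
  have := @is_derive_monomial R 1 n x _ erefl; rewrite mul1r.
  by under eq_fun do rewrite mul1r.
have := is_deriveM D1 (is_derive_std_normal_pdf x); rewrite /GRing.scale/= => D.
by congr (is_derive _ _ _ _): D; rewrite exprS; ring.
Qed.

Lemma normal_pow_cvg0 n : exists2 C : R, 0 <= C &
  forall x, 0 < x -> `|x ^+ n * p x| <= C / x /\ `|(- x) ^+ n * p (- x)| <= C / x.
Proof.
have [C [C0 HC]] := oneDsqr_pow_normal_pdf n.+1.
pose C1 := C * normal_peak (Num.sqrt 2).
have C10 : 0 <= C1 by rewrite mulr_ge0// normal_peak_ge0.
have s2 : Num.sqrt 2 != 0 :> R by rewrite sqrtr_eq0 -ltNge.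
have key x : 0 < x -> `|x ^+ n * p x| <= C1 / x.
  move=> x0; rewrite ler_pdivlMr//; apply: le_trans (_ : (1 + x ^+ 2) ^+ n.+1 * p x <= _); last first.
    by apply: le_trans (HC x) _; rewrite ler_wpM2l// normal_pdf_ub.
  rewrite ger0_norm ?mulr_ge0 ?normal_pdf_ge0 ?exprn_ge0 ?(ltW x0)// mulrAC -exprSr.
  rewrite ler_wpM2r ?normal_pdf_ge0// lerXn2r ?nnegrE ?(ltW x0) ?addr_ge0 ?sqr_ge0//.
  by nra.
exists C1 => // x x0; split; first exact: key.
have -> : p (- x) = p x by rewrite !std_normal_pdfE sqrrN.
by rewrite normrM normrX normrN -normrX -normrM; exact: key.
Qed.

(** Integration by parts: the integrand against the density is the derivative of $x^n$ times the
    density. The integral over $[-k-1, k+1]$ equals the boundary terms, which vanish in the limit,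
    and dominated convergence identifies the limit of the integrals. *)
Lemma normal_mean_recurrence n :
  normal_mean (fun x => n%:R * x ^+ n.-1 - x ^+ n.+1) = 0.
Proof.
set f := (fun x : R => _); pose F x := x ^+ n * p x.
have pf : poly_growth f.
  have -> : f = (fun x => n%:R * x ^+ n.-1 + (- 1) * x ^+ n.+1).
    by apply/funext => x; rewrite mulN1r.
  by apply: poly_growthD; exact/poly_growthZ/poly_growth_pow.
have ifp := integrable_normal_mean pf.
pose g (k : nat) := (EFin \o (fun x => f x * p x)) \_ `[- k.+1%:R, k.+1%:R].
have mfp : measurable_fun setT (EFin \o (fun x => f x * p x)) by case/integrableP : ifp.
have cp : continuous p by apply: continuous_normal_pdf; exact: oner_neq0.
have cf : continuous f.
  move=> x; apply: cvgB; last exact: exprn_continuous.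
  by apply: cvgM; [exact: cvg_cst|exact: exprn_continuous].
have FTC (k : nat) : (\int[mu]_x g k x = (F k.+1%:R)%:E - (F (- k.+1%:R))%:E)%E.
  rewrite -integral_mkcond; apply: continuous_FTC2.
  - by rewrite gtrN// ltr0n.
  - by apply: continuous_subspaceT => x; apply: cvgM; [exact: cf|exact: cp].
  - have cF : continuous F.
      by move=> x; apply: cvgM; [exact: exprn_continuous|exact: cp].
    split; [by move=> x _; have [] := is_derive_pow_normal n x|exact/cvg_at_right_filter/cF|exact/cvg_at_left_filter/cF].
  - by move=> x _; rewrite derive1E; have [_ ->] := is_derive_pow_normal n x.
have H : [sequence (\int[mu]_x g k x)%E]_k @ \oo --> 0%E.
  under eq_fun => k do rewrite /= FTC -EFinB.
  apply: cvg_EFin; first by apply: nearW.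
  have [C C0 HC] := normal_pow_cvg0 n.
  apply/cvgrPdist_le => e e0; exists (Num.truncn (2 * C / e)) => // k /= kN.
  rewrite sub0r normrN /=; have k0 : 0 < k.+1%:R :> R by [].
  have [h1 h2] := HC _ k0; apply: le_trans (ler_normB _ _) _; apply: le_trans (lerD h1 h2) _.
  rewrite -mulrDl ler_pdivrMr// -ler_pdivrMl// -mulr2n mulrC -[C *+ 2]mulr_natl.
  apply: ltW; apply: lt_le_trans (truncnS_gt _) _; by rewrite ler_nat.
have ae1 : {ae mu, forall x, [set: R] x -> g ^~ x @ \oo --> (EFin \o (fun x => f x * p x)) x}.
  apply: aeW => x _; apply: cvg_near_cst; exists (Num.truncn `|x|) => // k /= kN.
  apply/eqP; rewrite /g patchE ifT// inE /= in_itv/= -ler_norml.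
  apply: ltW; apply: lt_le_trans (truncnS_gt _) _; by rewrite ler_nat.
have ae2 : {ae mu, forall x k, [set: R] x ->
    (`|g k x| <= (abse \o (EFin \o (fun x : R => (f x * p x)%R))) x)%E}.
  apply: aeW => x k _; rewrite /g patchE; case: ifP => // _.
  by rewrite /= normr0 lee_fin.
have mg k : measurable_fun setT (g k).
  by apply/(measurable_restrictT _ _).1 => //; exact: measurable_funTS.
have [_ _ L] := @dominated_convergence _ _ R mu setT measurableT g
   (EFin \o (fun x => f x * p x)) (abse \o (EFin \o (fun x => f x * p x)))
   mg mfp ae1 (integrable_abse ifp) ae2.
by rewrite /normal_mean /Rintegral -(cvg_unique _ H L).
Qed.

Lemma normal_mean_step n : normal_mean (fun x => x ^+ n.+2) = n.+1%:R * normal_mean (fun x => x ^+ n).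
Proof.
have := normal_mean_recurrence n.+1; have mN := mean_functional_normal.
have -> : (fun x : R => n.+1%:R * x ^+ n.+1.-1 - x ^+ n.+2) = (fun x => n.+1%:R * x ^+ n + (- 1) * x ^+ n.+2).
  by apply/funext => x; rewrite mulN1r.
rewrite (meanD mN) ?(meanZ mN); try exact: poly_growth_pow; try exact/poly_growthZ/poly_growth_pow.
by rewrite mulN1r => /eqP; rewrite subr_eq0 => /eqP.
Qed.

Lemma normal_mean_pow0 : normal_mean (fun x => x ^+ 0) = 1.
Proof. by under eq_fun do rewrite expr0; exact: mean1 mean_functional_normal. Qed.

Lemma normal_mean_pow1 : normal_mean (fun x => x ^+ 1) = 0.
Proof.
have := normal_mean_recurrence 0; have mN := mean_functional_normal.
have -> : (fun x : R => 0%:R * x ^+ 0.-1 - x ^+ 1) = (fun x => (- 1) * x ^+ 1).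
  by apply/funext => x; rewrite mul0r mulN1r add0r.
rewrite (meanZ mN); last exact: poly_growth_pow.
by rewrite mulN1r => /eqP; rewrite oppr_eq0 => /eqP.
Qed.

Lemma normal_mean_even n :
  normal_mean (fun x => x ^+ n.*2) = (n.*2)`!%:R / (2 ^+ n * n`!%:R).
Proof.
elim: n => [|n IH].
  by rewrite double0 normal_mean_pow0 fact0 expr0 mul1r divr1.
rewrite doubleS normal_mean_step IH (factS n.*2.+1) (factS n.*2) (factS n) exprS !natrM.
have -> : n.*2.+2%:R = 2 * n.+1%:R :> R by rewrite -natrM mul2n doubleS.
have f0 : n`!%:R != 0 :> R by rewrite pnatr_eq0 -lt0n fact_gt0.
have n0 : n.+1%:R != 0 :> R by rewrite pnatr_eq0.
have p0 : 2 ^+ n != 0 :> R by rewrite expf_neq0.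
move: f0 n0 p0; move: (n.*2.+1%:R) (n.*2`!%:R) n`!%:R n.+1%:R (2 ^+ n) => a b c d z c0 d0 z0.
by field; rewrite ?c0 ?d0 ?z0.
Qed.

End NormalMoments.

(** * Exponential sums *)

Section ComplexModulus.
Local Open Scope complex_scope.
Context {R : realType}.
Implicit Types (z w : R[i]) (x y : R).

(** The modulus as an element of [R]; the norm of [R[i]] takes its values in [R[i]], where the
    estimates with real quantities would need embeddings. *)
Definition cnorm z : R := Num.sqrt (complex.Re z ^+ 2 + complex.Im z ^+ 2).

Lemma norm_cnorm z : `|z| = (cnorm z)%:C.
Proof. by rewrite normc_def. Qed.

Lemma cnorm_ge0 z : 0 <= cnorm z.
Proof. exact: sqrtr_ge0. Qed.

Lemma cnormM z w : cnorm (z * w) = cnorm z * cnorm w.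
Proof. by apply: (@complexI R); rewrite rmorphM /= -!norm_cnorm normrM. Qed.

Lemma cnormD z w : cnorm (z + w) <= cnorm z + cnorm w.
Proof. by rewrite -lecR rmorphD /= -!norm_cnorm ler_normD. Qed.

Lemma cnormN z : cnorm (- z) = cnorm z.
Proof. by apply: (@complexI R); rewrite -!norm_cnorm normrN. Qed.

Lemma cnorm0 : cnorm 0 = 0.
Proof. by apply: (@complexI R); rewrite -norm_cnorm normr0. Qed.

Lemma cnorm1 : cnorm 1 = 1.
Proof. by apply: (@complexI R); rewrite -norm_cnorm normr1. Qed.

Lemma cnormX z n : cnorm (z ^+ n) = cnorm z ^+ n.
Proof. by elim: n => [|n IH]; rewrite ?expr0 ?cnorm1// !exprS cnormM IH. Qed.

Lemma cnorm_real x : cnorm x%:C = `|x|.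
Proof. by rewrite /cnorm /= expr0n addr0 sqrtr_sqr. Qed.

Lemma cnormJ z : cnorm z^*%C = cnorm z.
Proof. by case: z => a b; rewrite /cnorm /= sqrrN. Qed.

Lemma sqr_cnorm z : (cnorm z ^+ 2)%:C = z * z^*%C.
Proof. by rewrite -sqr_normc norm_cnorm -rmorphXn. Qed.

Lemma sqr_cnormE z : cnorm z ^+ 2 = complex.Re z ^+ 2 + complex.Im z ^+ 2.
Proof. by rewrite sqr_sqrtr// addr_ge0 ?sqr_ge0. Qed.

Lemma normr_Re_le z : `|complex.Re z| <= cnorm z.
Proof. by rewrite -lecR -norm_cnorm normc_ge_Re. Qed.

Lemma cnorm_sum (I : Type) (s : seq I) (P : pred I) (F : I -> R[i]) :
  cnorm (\sum_(i <- s | P i) F i) <= \sum_(i <- s | P i) cnorm (F i).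
Proof.
elim/big_rec2: _ => [|i x y Pi h]; first by rewrite cnorm0.
by apply: le_trans (cnormD _ _) _; rewrite lerD2l.
Qed.

Lemma cnorm_prod (I : Type) (s : seq I) (P : pred I) (F : I -> R[i]) :
  cnorm (\prod_(i <- s | P i) F i) = \prod_(i <- s | P i) cnorm (F i).
Proof.
by elim/big_rec2: _ => [|i x y Pi <-]; rewrite ?cnorm1// cnormM.
Qed.

End ComplexModulus.

Section Exponential.
Local Open Scope complex_scope.
Context {R : realType}.
Implicit Types (x y t : R) (n N Q : nat) (m : int).

Lemma e_D x y : e_ (x + y) = e_ x * e_ y.
Proof.
rewrite /e_ mulrDr cosD sinD; apply/eqP; rewrite eq_complex /=.
by rewrite eqxx /= addrC [cos _ * _]mulrC [X in X + _]mulrC addrC mulrC eqxx.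
Qed.

Lemma e_0 : e_ (0 : R) = 1.
Proof. by rewrite /e_ mulr0 cos0 sin0. Qed.

Lemma e_N x : e_ (- x) = (e_ x)^*%C.
Proof. by rewrite /e_ mulrN cosN sinN. Qed.

Lemma cnorm_e x : cnorm (e_ x) = 1.
Proof. by rewrite /cnorm /= cos2Dsin2 sqrtr1. Qed.

Lemma e_1 : e_ (1 : R) = 1.
Proof. by rewrite /e_ mulr1 mulrC mulr_natr cos2pi sin2pi. Qed.

Lemma e_natM n x : e_ (n%:R * x) = e_ x ^+ n.
Proof.
by elim: n => [|n IH]; rewrite ?mul0r ?e_0 ?expr0// -natr1 mulrDl mul1r e_D IH exprSr.
Qed.

Lemma e_int m : e_ (m%:~R : R) = 1.
Proof.
case: m => n; first by rewrite -pmulrn -[n%:R]mulr1 e_natM e_1 expr1n.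
rewrite NegzE mulrNz e_N -pmulrn -[_%:R]mulr1 e_natM e_1 expr1n.
by rewrite /conjc /= oppr0.
Qed.

Lemma e_Dint x m : e_ (x + m%:~R) = e_ x.
Proof. by rewrite e_D e_int mulr1. Qed.

Lemma cnorm_1Be_sqr x : cnorm (1 - e_ x) ^+ 2 = 2 - 2 * cos (2 * pi * x).
Proof.
rewrite sqr_cnormE /e_ /= sub0r sqrrN sqrrB expr1n mul1r.
by rewrite -addrA cos2Dsin2 mulr_natl; ring.
Qed.

Lemma cnorm_1Be_pow x j : cnorm (1 - e_ (j%:R * x)) <= j%:R * cnorm (1 - e_ x).
Proof.
elim: j => [|j IH]; first by rewrite !mul0r e_0 subrr cnorm0.
have -> : 1 - e_ (j.+1%:R * x) = (1 - e_ (j%:R * x)) + e_ (j%:R * x) * (1 - e_ x).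
  by rewrite -natr1 mulrDl mul1r e_D; ring.
apply: le_trans (cnormD _ _) _; rewrite cnormM cnorm_e mul1r -natr1 mulrDl mul1r.
by rewrite lerD2r.
Qed.

(** Some multiple satisfies $1/4 < jx \le 3/4$; there the cosine is nonpositive, so $|1 - e(jx)| \ge
    1$. Since $|1 - e(jx)| \le j |1 - e(x)|$, this gives $x \le jx\,|1 - e(x)| \le \frac34 |1 -
    e(x)|$. *)
Lemma cnorm_1Be_ge_small x : 0 < x <= 2^-1 -> x <= cnorm (1 - e_ x).
Proof.
move=> /andP[x0 x2]; pose j := (Num.truncn ((4 * x)^-1)).+1.
have x4 : 0 < 4 * x by rewrite mulr_gt0.
have j1 : 4^-1 < j%:R * x.
  rewrite -ltr_pdivrMr// -invfM; exact: truncnS_gt.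
have j2 : j%:R * x <= 3 / 4.
  rewrite /j -natr1 mulrDl mul1r.
  have : (Num.truncn (4 * x)^-1)%:R * x <= 4^-1.
    rewrite -ler_pdivlMr// -invfM truncn_le invr_ge0; exact: ltW.
  move=> h; lra.
have c0 : cos (2 * pi * (j%:R * x)) <= 0.
  have -> : 2 * pi * (j%:R * x) = (2 * pi * (j%:R * x) - pi) + pi by ring.
  rewrite cosDpi oppr_le0; apply: cos_ge0_pihalf; have := @pi_gt0 R => p0.
  by apply/andP; split; nra.
have n1 : 1 <= cnorm (1 - e_ (j%:R * x)).
  rewrite -(ler_pXn2r (ltn0Sn 1)) ?nnegrE ?cnorm_ge0// expr1n cnorm_1Be_sqr; lra.
have := le_trans n1 (cnorm_1Be_pow x j) => h.
have := cnorm_ge0 (1 - e_ x) => g0.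
have h2 : x <= (j%:R * x) * cnorm (1 - e_ x).
  by rewrite mulrAC -[leLHS]mul1r ler_wpM2r// ltW.
by nra.
Qed.

Lemma cnorm_1Be_ge x : `|x| <= 2^-1 -> `|x| <= cnorm (1 - e_ x).
Proof.
move=> x2; have [x0|x0|->] := ltgtP x 0; last by rewrite normr0 cnorm_ge0.
  have -> : cnorm (1 - e_ x) = cnorm (1 - e_ (- x)).
    by rewrite e_N; case: (e_ x) => a b; rewrite /cnorm /= !sub0r !sqrrN.
  rewrite ltr0_norm//; apply: cnorm_1Be_ge_small.
  by rewrite oppr_gt0 x0 -ltr0_norm.
by rewrite gtr0_norm//; apply: cnorm_1Be_ge_small; rewrite x0 -(gtr0_norm x0).
Qed.

(** The difference of [t] and its nearest integer [m] is a nonzero multiple of $1/Q$. *)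
Lemma cnorm_1Be_frac t Q : (0 < Q)%N -> Q%:R * t \is a Num.int ->
  t \isn't a Num.int -> Q%:R^-1 <= cnorm (1 - e_ t).
Proof.
move=> Q0 /intrP[k kE] tN; pose m := Num.floor (t + 2^-1); pose y := t - m%:~R.
have -> : e_ t = e_ y by rewrite /y -mulrNz e_Dint.
have ym : `|y| <= 2^-1.
  have := floor_le_tmp (t + 2^-1); have := floorD1_gt (t + 2^-1); rewrite -/m intrD => h1 h2.
  by rewrite ler_norml /y; apply/andP; split; lra.
apply: le_trans (cnorm_1Be_ge ym).
have Q0' : 0 < Q%:R :> R by rewrite ltr0n.
rewrite -[leLHS]mul1r ler_pdivrMr// -[Q%:R](gtr0_norm Q0') -normrM.
have -> : y * Q%:R = (k - m * Q%:Z)%:~R.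
  by rewrite /y mulrBl mulrC kE intrB intrM.
rewrite -intr_norm -[1]/(1%:~R) ler_int -gtz0_ge1 normr_gt0.
apply: contra tN; rewrite subr_eq0 => /eqP kmE; apply/intrP; exists m.
apply: (mulfI (lt0r_neq0 Q0')); rewrite kE kmE intrM mulrC//.
Qed.

(** A geometric sum: numerator at most [2], denominator at least $1/Q$. The bound is uniform in [N],
    so it is negligible once [N] exceeds the denominators. *)
Lemma cnorm_exp_sum t N Q : (0 < Q)%N -> Q%:R * t \is a Num.int ->
  t \isn't a Num.int -> cnorm (\sum_(i < N) e_ (i.+1%:R * t)) <= 2 * Q%:R.
Proof.
move=> Q0 Qt tN; have h := cnorm_1Be_frac Q0 Qt tN.
have Q0' : 0 < Q%:R :> R by rewrite ltr0n.
have -> : \sum_(i < N) e_ (i.+1%:R * t) = e_ t * \sum_(i < N) e_ t ^+ i.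
  by rewrite mulr_sumr; apply: eq_bigr => i _; rewrite e_natM exprS.
rewrite cnormM cnorm_e mul1r.
have := subrX1 (e_ t) N => /(congr1 cnorm); rewrite cnormM => E.
have h2 : cnorm (e_ t - 1) = cnorm (1 - e_ t) by rewrite -cnormN opprB.
have le2 : cnorm (e_ t ^+ N - 1) <= 2.
  apply: le_trans (cnormD _ _) _; rewrite cnormN cnorm1 cnormX cnorm_e expr1n.
  by rewrite -[2]/(1 + 1).
move: le2; rewrite E h2 => le2.
rewrite -ler_pdivrMr// mulrC; apply: le_trans le2; rewrite ler_wpM2r ?cnorm_ge0//.
Qed.

Lemma sum_e_residues (r : nat) m : (0 < r)%N ->
  \sum_(a < r) e_ (a.+1%:R * (m%:~R / r%:R)) =
  if (r%:Z %| m)%Z then r%:R else 0 :> R[i].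
Proof.
move=> r0; have r0' : r%:R != 0 :> R by rewrite pnatr_eq0 -lt0n.
case: ifPn => [/dvdzP[k ->]|rm].
  rewrite (eq_bigr (fun=> 1)) ?sumr_const ?card_ord// => i _.
  by rewrite intrM -pmulrn mulfK// -[k%:~R]mulr1 mulrC mulr1 -[i.+1%:R]/((i.+1%:Z)%:~R) -intrM e_int.
pose z := e_ (m%:~R / r%:R : R).
have z1 : z != 1.
  apply: contra rm => /eqP z1.
  have [//|tN] := boolP ((m%:~R / r%:R : R) \is a Num.int).
    move=> /intrP[k kE]; apply/dvdzP; exists k; apply: (@intr_inj R).
    by rewrite intrM -pmulrn -kE divfK.
  have : r%:R * (m%:~R / r%:R) \is a @Num.int R by rewrite mulrC divfK// intr_int.
  move=> /(cnorm_1Be_frac r0)/(_ tN); rewrite -/z z1 subrr cnorm0 invr_le0 lern0.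
  by rewrite -leqn0 leqNgt r0.
have E := subrX1 z r.
have zr : z ^+ r = 1.
  by rewrite -e_natM mulrC divfK// e_int.
rewrite (eq_bigr (fun i : 'I_r => z * z ^+ i)); last by move=> i _; rewrite e_natM exprS.
rewrite -mulr_sumr; move/eqP: E; rewrite zr subrr eq_sym mulf_eq0 subr_eq0 (negbTE z1) /=.
by move=> /eqP ->; rewrite mulr0.
Qed.

End Exponential.

(** * Tuples of fractions with integral sum *)

Section DivisorBound.
Local Open Scope nat_scope.

(** $(e+1)^k \le (e+k)\cdots(e+1) = k!\binom{e+k}{k} \le k!\,2^{e+k}$. *)
Lemma expn_succ_le k e : e.+1 ^ k <= k`! * 2 ^ k * 2 ^ e.
Proof.
have h1 : e.+1 ^ k <= (e + k) ^_ k.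
  elim: k => [//|k IH]; rewrite addnS ffactSS expnS leq_mul// ltnS leq_addr//.
have h2 : 'C(e + k, k) <= 2 ^ (e + k).
  have -> : 2 ^ (e + k) = \sum_(i < (e + k).+1) 'C(e + k, i).
    rewrite -[2]/(1 + 1) expnDn; apply: eq_bigr => i _; by rewrite !exp1n !muln1.
  have kek : k < (e + k).+1 by rewrite ltnS leq_addl.
  by rewrite (bigD1 (Ordinal kek)) //= leq_addr.
apply: leq_trans h1 _; rewrite -bin_ffact mulnC -mulnA leq_mul//.
by rewrite -expnD [(k + e)%N]addnC.
Qed.

Lemma size_divisors_pfactor p e m : prime p -> 0 < m -> ~~ (p %| m) ->
  size (divisors (p ^ e * m)) <= e.+1 * size (divisors m).
Proof.
move=> pp m0 pm.
have pe0 : 0 < p ^ e by rewrite expn_gt0 prime_gt0.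
have -> : e.+1 * size (divisors m) =
    size [seq p ^ i * d | i <- iota 0 e.+1, d <- divisors m].
  by rewrite size_allpairs size_iota.
apply: uniq_leq_size; first exact: divisors_uniq.
move=> d; rewrite -dvdn_divisors ?muln_gt0 ?pe0// => dn.
have d0 : 0 < d by apply: dvdn_gt0 dn; rewrite muln_gt0 pe0.
rewrite -(partnC p d0) p_part; apply: allpairs_f.
  rewrite mem_iota add0n ltnS /=.
  have := dvdn_leq_log p _ dn; rewrite muln_gt0 pe0 m0 => /(_ isT).
  by rewrite lognM// pfactorK// (lognE p m) pp m0 (negbTE pm) addn0.
rewrite -dvdn_divisors// -(@Gauss_dvdr _ (p ^ e)).
  exact: dvdn_trans (dvdn_part _ _) dn.
rewrite coprime_sym; apply: (@pnat_coprime p); last exact: part_pnat.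
by rewrite pnatX pnat_id.
Qed.

Lemma prime_part_split p n : prime p -> 0 < n ->
  exists e m, [/\ n = p ^ e * m, 0 < m, ~~ (p %| m) & m %| n].
Proof.
move=> pp n0; have [m pm nE] := pfactor_coprime pp n0.
exists (logn p n), m; split; first by rewrite mulnC.
- by move: n0; rewrite nE muln_gt0 => /andP[].
- by rewrite -prime_coprime.
- by rewrite [X in _ %| X]nE dvdn_mulr.
Qed.

(** A prime power $p^e$ dividing [n] exactly contributes the factor $e + 1$ to the number of
    divisors, and $(e+1)^k \le 2^{ke} \le p^e$ when $p \ge 2^k$. *)
Lemma size_divisors_large_primes k n : 0 < n ->
  (forall p, prime p -> p %| n -> 2 ^ k <= p) -> size (divisors n) ^ k <= n.
Proof.
case: k => [|k]; first by rewrite expn0.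
elim/ltn_ind: n => n IH n0 np; have [->|n1] := eqVneq n 1.
  by rewrite (_ : size (divisors 1) = 1)// exp1n.
have n2 : 1 < n by rewrite ltn_neqAle eq_sym n1.
have pp := pdiv_prime n2; set p := pdiv n in pp.
have [e [m [nE m0 pm mn]]] := prime_part_split pp n0.
have e0 : 0 < e.
  rewrite lt0n; apply: contraNneq pm => e0; move: nE; rewrite e0 mul1n => <-; exact: pdiv_dvd.
have mltn : m < n.
  rewrite nE -{1}[m]mul1n ltn_pmul2r// -(exp1n e) ltn_exp2r// prime_gt1//.
have mk : size (divisors m) ^ k.+1 <= m.
  by apply: IH => // q qp qm; apply: np => //; exact: dvdn_trans mn.
apply: (@leq_trans ((e.+1 * size (divisors m)) ^ k.+1)).
  by rewrite leq_exp2r// {1}nE; exact: size_divisors_pfactor.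
rewrite expnMn [leqRHS]nE leq_mul//.
apply: (@leq_trans ((2 ^ k.+1) ^ e)); last by rewrite leq_exp2r// np// pdiv_dvd.
rewrite -expnM mulnC expnM.
by rewrite leq_exp2r// ltn_expl.
Qed.

(** Downward induction on [P] from $2^k$: allowing one more small prime costs at most the factor
    $k!\,2^k$. The case [P = 0] is the divisor bound $\tau(n) \ll n^{1/k}$, written without real
    powers. *)
Lemma size_divisors_bound_from k P : exists C, forall n, 0 < n ->
  (forall p, prime p -> p %| n -> P <= p) -> size (divisors n) ^ k <= C * n.
Proof.
have [d] : exists d, 2 ^ k - P <= d by exists (2 ^ k - P).
elim: d P => [|d IH] P hd.
  exists 1 => n n0 np; rewrite mul1n; apply: size_divisors_large_primes => // p pp pn.
  by apply: leq_trans (np _ pp pn); rewrite -subn_eq0 -leqn0.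
have [C HC] := IH P.+1 ltac:(by rewrite subnS; lia).
have [pP|nP] := boolP (prime P); last first.
  exists C => n n0 np; apply: HC => // p pp pn; rewrite ltn_neqAle np// andbT.
  by apply: contraNneq nP => ->.
exists (k`! * 2 ^ k * C) => n n0 np.
have [e [m [nE m0 pm mn]]] := prime_part_split pP n0.
have mk : size (divisors m) ^ k <= C * m.
  apply: HC => // q qp qm; rewrite ltn_neqAle np ?andbT//; last exact: dvdn_trans mn.
  by apply: contraNneq pm => ->.
case: k hd IH HC mk => [|k] hd IH HC mk.
  rewrite expn0 /= !mul1n; apply: leq_trans mk _; rewrite leq_mul2l; apply/orP; right.
  exact: dvdn_leq.
apply: (@leq_trans ((e.+1 * size (divisors m)) ^ k.+1)).
  by rewrite leq_exp2r// {1}nE; exact: size_divisors_pfactor.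
rewrite expnMn [in leqRHS]nE.
have -> : k.+1`! * 2 ^ k.+1 * C * (P ^ e * m) = (k.+1`! * 2 ^ k.+1 * P ^ e) * (C * m) by ring.
apply: leq_mul => //; apply: leq_trans (expn_succ_le _ _) _; rewrite leq_mul2l; apply/orP; right.
by case: e {nE} => [//|e]; rewrite leq_exp2r// prime_gt1.
Qed.

Lemma size_divisors_bound k : exists C, forall n, 0 < n ->
  size (divisors n) ^ k <= C * n.
Proof. by have [C HC] := size_divisors_bound_from k 0; exists C => n n0; exact: HC. Qed.

End DivisorBound.

(** * Squarefree products over a pairwise coprime set *)

Section PairwiseCoprimeProducts.
Variable B : pred nat.
Hypothesis B_gt1 : forall b, B b -> (1 < b)%N.
Hypothesis B_coprime : forall b c, B b -> B c -> b != c -> coprime b c.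
Local Open Scope nat_scope.
Implicit Types (b c d r D : nat) (Q : pred nat).

(** Squarefree products over [B] are encoded by predicates on [B]: by pairwise coprimality,
    factorizations and divisibilities between them become Boolean identities. *)
Definition bprod D Q := \prod_(b < D | B b && Q b) (b : nat).

Lemma bprod_gt0 D Q : 0 < bprod D Q.
Proof. by apply: prodn_cond_gt0 => b /andP[/B_gt1/ltnW]. Qed.

Lemma eq_bprod D D' Q Q' :
  (forall b, B b -> (b < D) && Q b = (b < D') && Q' b) -> bprod D Q = bprod D' Q'.
Proof.
move=> E; rewrite /bprod.
rewrite (big_ord_widen_cond (maxn D D') (fun b => B b && Q b) (fun b => b)) ?leq_maxl//.
rewrite [RHS](big_ord_widen_cond (maxn D D') (fun b => B b && Q' b) (fun b => b)) ?leq_maxr//.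
apply: eq_bigl => b; have [Bb|] := boolP (B b) => //=.
by rewrite andbC E// andbC.
Qed.

Lemma coprime_bprod b D Q : B b -> ~~ ((b < D) && Q b) -> coprime b (bprod D Q).
Proof.
move=> Bb Nb; rewrite /bprod; elim/big_ind: _ => [|x y hx hy|[c /= cD] /andP[Bc Qc]].
- exact: coprimen1.
- by rewrite coprimeMr hx hy.
by apply: B_coprime => //; apply: contraNneq Nb => ->; rewrite cD.
Qed.

Lemma dvdn_bprod b D Q : B b -> (b %| bprod D Q) = (b < D) && Q b.
Proof.
move=> Bb; apply/idP/idP => [bd|/andP[bD Qb]].
  apply: contraLR bd => /(coprime_bprod Bb); rewrite /coprime => cop.
  apply/negP => /gcdn_idPl bE; have := B_gt1 Bb.
  by rewrite -bE (eqP cop).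
by rewrite /bprod (bigD1 (Ordinal bD)) /= ?Bb// dvdn_mulr.
Qed.

Lemma bprodID D Q Q' : bprod D Q =
  bprod D (fun b => Q b && Q' b) * bprod D (fun b => Q b && ~~ Q' b).
Proof.
rewrite /bprod (bigID (fun b : 'I_D => Q' b)) /=.
by congr (_ * _); apply: eq_bigl => b; rewrite andbA.
Qed.

Lemma dvdn_bprod_sub D Q Q' : (forall b, B b -> b < D -> Q b -> Q' b) ->
  bprod D Q %| bprod D Q'.
Proof.
move=> QQ; rewrite (bprodID D Q' Q) dvdn_mulr//.
rewrite (@eq_bprod D D Q (fun b => Q' b && Q b))// => b Bb.
have [bD|//] := ltnP b D; rewrite /=.
by case Qb : (Q b); rewrite ?andbF// QQ.
Qed.

(* [bsqf r]: [r] is a product of distinct elements of [B]. *)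
Definition bsqf r := r == bprod r.+1 (fun b => b %| r).

Lemma bsqf_gt0 r : bsqf r -> 0 < r.
Proof. by move=> /eqP ->; exact: bprod_gt0. Qed.

Lemma bsqfE r D : bsqf r -> r < D -> bprod D (fun b => b %| r) = r.
Proof.
move=> sr rD; rewrite [RHS](eqP sr); apply: eq_bprod => b Bb.
have [br|] := boolP (b %| r); last by rewrite !andbF.
by have := dvdn_leq (bsqf_gt0 sr) br => h; rewrite !andbT ltnS h (leq_ltn_trans h).
Qed.

Lemma bsqf_bprod D Q : bsqf (bprod D Q).
Proof.
apply/eqP/eq_bprod => b Bb; rewrite dvdn_bprod//.
have [/andP[bD Qb]|] := boolP ((b < D) && Q b); last by rewrite andbF.
rewrite andbT ltnS; symmetry; apply: dvdn_leq; first exact: bprod_gt0.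
by rewrite dvdn_bprod// bD.
Qed.

Lemma bsqf1 : bsqf 1.
Proof.
apply/eqP; rewrite /bprod big1// => b /andP[/B_gt1 b1].
by rewrite dvdn1 => /eqP ->.
Qed.

End PairwiseCoprimeProducts.

Lemma expn_split_square p m t k :
  (((p * m) ^ 2 * t) ^ k = m ^ (2 * k) * (p ^ (2 * k) * t ^ k))%N.
Proof. by rewrite expnMn -expnM expnMn [(p ^ _ * m ^ _)%N]mulnC mulnA. Qed.

(** * Tuples without opposite pairs *)

Section IrreducibleTuples.
Variable B : pred nat.
Hypothesis B_gt1 : forall b, B b -> (1 < b)%N.
Hypothesis B_coprime : forall b c, B b -> B c -> b != c -> coprime b c.
Variables (R : realType) (k : nat) (a : 'I_k -> int) (r : 'I_k -> nat) (z Z : nat).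
Hypothesis k_gt1 : (1 < k)%N.
Hypothesis r_sqf : forall l, bsqf B (r l).
Hypothesis r_le : forall l, (r l <= Z)%N.
Hypothesis r_ge : forall l, (z <= r l)%N.
Hypothesis ar_reduced : forall l b, B b -> (b %| r l)%N -> ~~ (b%:Z %| a l)%Z.
Hypothesis sum_int : \sum_l (a l)%:~R / (r l)%:R \is a @Num.int R.
Hypothesis no_cancel : forall l l', l != l' ->
  (a l)%:~R / (r l)%:R + (a l')%:~R / (r l')%:R \isn't a @Num.int R.

(** [L] is the least common denominator, [co l] its cofactor with respect to [r l], and [w b] the
    number of denominators divisible by [b]. [T] collects the [b] with [2 < w b], [p i j] those
    dividing [r i] and [r j] only; [m i j] is the cofactor of [p i j] in [L], and [s i j] in [r i]
    when [i] and [j] differ. *)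
Let D := Z.+1.
Let act b := [exists l, b %| r l]%N.
Let w b := (\sum_l (b %| r l))%N.
Let bp := bprod B D.
Let pr i j b := [&& b %| r i, b %| r j & [forall l, (l != i) ==> (l != j) ==> ~~ (b %| r l)]]%N.
Let L := bp act.
Let co l := bp (fun b => act b && ~~ (b %| r l))%N.
Let p i j := bp (pr i j).
Let m i j := bp (fun b => act b && ~~ pr i j b).
Let s i j := bp (fun b => (b %| r i)%N && ~~ pr i j b).
Let T := bp (fun b => act b && (2 < w b)%N).

Let rE l : bp (fun b => b %| r l)%N = r l.
Proof. by apply: bsqfE => //; rewrite ltnS. Qed.

Let r_gt0 l : (0 < r l)%N.
Proof. exact: (bsqf_gt0 B_gt1 (r_sqf l)). Qed.

Let actr l b : (b %| r l)%N -> act b.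
Proof. by move=> h; apply/existsP; exists l. Qed.

Let eq_bp Q Q' : Q =1 Q' -> bp Q = bp Q'.
Proof. by move=> E; apply: eq_bprod => b _; rewrite E. Qed.

Let bpID Q Q' : bp Q =
  (bp (fun b => Q b && Q' b) * bp (fun b => Q b && ~~ Q' b))%N.
Proof. exact: bprodID. Qed.

Let Lco l : L = (r l * co l)%N.
Proof.
rewrite /L (bpID act (fun b => b %| r l)%N) -[in RHS](rE l); congr (_ * _)%N.
by apply: eq_bp => b; case h : (b %| r l)%N; rewrite ?andbF// (actr h).
Qed.

Let R_L l : ((a l)%:~R / (r l)%:R) * L%:R = (a l * (co l)%:Z)%:~R :> R.
Proof.
rewrite (Lco l) natrM mulrA divfK ?pnatr_eq0 -?lt0n ?r_gt0//.
by rewrite intrM.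
Qed.

Let L_dvd : (L%:Z %| \sum_l a l * (co l)%:Z)%Z.
Proof.
have /intrP[q qE] := sum_int; apply/dvdzP; exists q; apply: (@intr_inj R).
rewrite raddf_sum /= intrM -qE mulr_suml.
by apply: eq_bigr => l _; rewrite -R_L.
Qed.

(** If [b] divided [r l] alone, it would divide [co l'] for every other [l'], hence by integrality
    also [a l * co l]. But [b] is coprime to [co l], and [a l] is reduced. *)
Let w_ge2 b : B b -> (b < D)%N -> act b -> (1 < w b)%N.
Proof.
move=> Bb bD ab; rewrite ltnNge; apply/negP => w1.
have /existsP[l bl] := ab.
have nl l' : l' != l -> ~~ (b %| r l')%N.
  move=> ll; apply/negP => bl'; move: w1; rewrite /w (bigD1 l)//= bl (bigD1 l')//= bl'.
  by rewrite /= !add1n.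
have : (b%:Z %| a l * (co l)%:Z)%Z.
  have bL : (b%:Z %| \sum_l a l * (co l)%:Z)%Z.
    apply: dvdz_trans L_dvd; rewrite dvdzE /= /L dvdn_bprod//; exact/andP.
  move: bL; rewrite (bigD1 l)//= rpredDr//.
  apply: rpred_sum => l' ll; apply: dvdz_mull.
  by rewrite dvdzE /= /co dvdn_bprod// bD ab nl.
rewrite Gauss_dvdzl; last first.
  rewrite coprimezE /= /co coprime_bprod// bl andbF andbF//.
exact/negP/ar_reduced.
Qed.

(** The exponent of [b] in the product of all [r l] is [w b], which is at least [2], and at least
    [3] for the factors of [T]. *)
Let prod_r : (L ^ 2 * T <= Z ^ k)%N.
Proof.
have -> : (L ^ 2 * T = \prod_(b < D | B b) b ^ (2 * act b + (act b && (2 < w b))))%N.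
  rewrite /L /T /bp /bprod; under [RHS]eq_bigr => b _ do rewrite expnD expnM.
  rewrite big_split /=; congr (_ * _)%N.
    rewrite (big_morph (expn^~ 2) (fun x y => expnMn x y 2) (exp1n 2)) big_mkcondr /=.
    by apply: eq_bigr => b _; case: (act b); rewrite ?expn1 ?expn0.
  by rewrite big_mkcondr /=; apply: eq_bigr => b _; case: (act b && _); rewrite ?expn1 ?expn0.
apply: (@leq_trans (\prod_(b < D | B b) b ^ w b)).
  apply: leq_prod => b Bb; apply: leq_pexp2l; first exact/ltnW/B_gt1.
  case ab : (act b) => //=; have := w_ge2 Bb (ltn_ord b) ab.
  by case: (ltnP 2 (w b)) => /=; lia.
have -> : (\prod_(b < D | B b) b ^ w b = \prod_l r l)%N.
  transitivity (\prod_(b < D | B b) \prod_(l < k) b ^ (b %| r l))%N.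
    by apply: eq_bigr => b _; rewrite /w expn_sum.
  rewrite exchange_big /=; apply: eq_bigr => l _.
  rewrite -[RHS]rE /bp /bprod big_mkcondr /=; apply: eq_bigr => b _.
  by case: ifP; rewrite ?expn1.
rewrite -[X in (Z ^ X)%N]card_ord -prod_nat_const; exact: leq_prod.
Qed.

Let p_gt0 i j : (0 < p i j)%N. Proof. exact: bprod_gt0. Qed.
Let T_gt0 : (0 < T)%N. Proof. exact: bprod_gt0. Qed.

(** An element [b] dividing [r i] either divides at least three denominators and is a factor of [T],
    or divides exactly one further [r j] and is a factor of [p i j]. *)
Let r_le_prod i : (r i <= T * \prod_(j | j != i) p i j)%N.
Proof.
rewrite -{1}(rE i) /T /p /bp /bprod.
have -> : (\prod_(j | j != i) \prod_(b < D | B b && pr i j b) b =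
   \prod_(b < D | B b) b ^ \sum_(j | j != i) pr i j b)%N.
  under [RHS]eq_bigr => b _ do rewrite expn_sum.
  rewrite [RHS]exchange_big /=; apply: eq_bigr => j _; rewrite big_mkcondr /=.
  by apply: eq_bigr => b _; case: ifP; rewrite ?expn1.
rewrite !(@big_mkcondr _ _ _ _ _ (fun b : 'I_D => B b)) /= -big_split /=.
apply: leq_prod => b Bb; have b0 := ltnW (B_gt1 Bb).
case: ifP => [bi|_]; last by rewrite muln_gt0; case: ifP => _; rewrite ?b0 expn_gt0 b0.
have ab := actr bi; rewrite ab /=; case: ltnP => w2; first by rewrite leq_pmulr// expn_gt0 b0.
rewrite mul1n -{1}[b : nat]expn1 leq_pexp2l//.
have := w_ge2 Bb (ltn_ord b) ab; rewrite /w (bigD1 i)//= bi.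
rewrite add1n ltnS => /(leq_trans)/(_ (leqnn _)).
rewrite lt0n sum_nat_eq0 negb_forall => /existsP[j]; rewrite negb_imply => /andP[ji].
rewrite eqb0 negbK => bj.
rewrite (bigD1 j)//= addn_gt0; apply/orP; left; rewrite lt0b /pr bi bj /=.
apply/forallP => l; apply/implyP => li; apply/implyP => lj; apply/negP => bl.
move: w2; rewrite /w (bigD1 i)//= bi (bigD1 j)//= bj (bigD1 l) /=; last by rewrite li lj.
by rewrite bl.
Qed.

(* Each [b] dividing one of the [r l] divides a second one, since the sum is an
   integer; [p] collects the [b] dividing exactly [r i] and [r j].  Averaging
   over the pairs yields one with [m] small, after which [p] is confined to the
   divisors of a nonzero integer. *)
Lemma irreducible_code : exists i j m p s s', [/\ i != j,
  [/\ bsqf B m, (m ^ (2 * k) * z <= Z ^ (k * k))%N, (s %| m)%N & (s' %| m)%N],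
  [/\ r i = (p * s)%N, r j = (p * s')%N & forall l, l != i -> l != j -> (r l %| m)%N] &
  (p%:Z %| a i * (m %/ s)%:Z + a j * (m %/ s')%:Z)%Z /\
  a i * (m %/ s)%:Z + a j * (m %/ s')%:Z != 0].
Proof.
have k0 : (0 < k)%N by exact: ltnW.
pose i := Ordinal k0; pose j0 := Ordinal k_gt1.
(* [j] maximises [p i j] for the fixed [i], so that [r_le_prod] yields $z \le T p^k$. *)
have [j ji jmax] : exists2 j, j != i & forall j', j' != i -> (p i j' <= p i j)%N.
  have j0i : j0 != i by [].
  by have [j ji jm] := @arg_maxnP _ j0 (fun j => j != i) (fun j => p i j) j0i; exists j.
have pr_sym b : pr j i b = pr i j b.
  rewrite /pr andbCA; congr [&& _, _ & _]; apply: eq_forallb => l.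
  by case: (l != i); case: (l != j).
have sE l : (l == i) || (l == j) -> r l = (p i j * bp (fun b => (b %| r l)%N && ~~ pr i j b))%N.
  move=> lij; rewrite -{1}(rE l) (bpID _ (pr i j)); congr (_ * _)%N; apply: eq_bp => b.
  case h : (pr i j b); rewrite ?andbF// andbT; case/and3P: h => bi bj _.
  by case/orP: lij => /eqP ->.
have mE l : (l == i) || (l == j) -> m i j = (bp (fun b => (b %| r l)%N && ~~ pr i j b) * co l)%N.
  move=> lij; rewrite /m (bpID _ (fun b => b %| r l)%N); congr (_ * _)%N; apply: eq_bp => b.
    case h : (b %| r l)%N; rewrite ?andbF// (actr h) !andbT//.
  case h : (b %| r l)%N; rewrite ?andbF//= !andbT.
  case h' : (pr i j b); rewrite ?andbT// andbF; case/and3P: h' => bi bj _.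
  by move: h; case/orP: lij => /eqP ->; rewrite ?bi ?bj.
have mco l : (l == i) || (l == j) -> (m i j %/ bp (fun b => (b %| r l)%N && ~~ pr i j b) = co l)%N.
  by move=> lij; rewrite (mE l)// mulKn// bprod_gt0.
have Lpm : L = (p i j * m i j)%N.
  rewrite /L (bpID act (pr i j)); congr (_ * _)%N; apply: eq_bp => b.
  case h : (pr i j b); rewrite ?andbF// andbT; case/and3P: h => bi _ _; exact: actr bi.
have ii : (i == i) || (i == j) by rewrite eqxx.
have jj : (j == i) || (j == j) by rewrite eqxx orbT.
exists i, j, (m i j), (p i j), (bp (fun b => (b %| r i)%N && ~~ pr i j b)),
  (bp (fun b => (b %| r j)%N && ~~ pr i j b)); split.
- by rewrite eq_sym.
- split.
  + exact: bsqf_bprod.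
  + have zT : (z <= T * p i j ^ k)%N.
      apply: leq_trans (r_ge i) _; apply: leq_trans (r_le_prod i) _.
      rewrite leq_mul2l; apply/orP; right.
      apply: (@leq_trans (\prod_(l < k) p i j)%N); last by rewrite prod_nat_const card_ord.
      rewrite [leqRHS](bigD1 i)//= -[leqLHS]mul1n leq_mul//.
      by apply: leq_prod => l li; apply: jmax.
    (* As $L = pm$, this reads $m^{2k} p^{2k} T^k \le Z^{k^2}$, and $p^{2k} T^k \ge T p^k \ge z$. *)
    have h1 : ((L ^ 2 * T) ^ k <= Z ^ (k * k))%N by rewrite expnM leq_exp2r//; exact: prod_r.
    apply: leq_trans h1; rewrite Lpm expn_split_square leq_mul2l; apply/orP; right.
    apply: leq_trans zT _; rewrite mulnC; apply: leq_mul.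
      by apply: leq_pexp2l => //; rewrite leq_pmull.
    by rewrite -{1}[T]expn1 leq_pexp2l.
  + by rewrite (mE i)// dvdn_mulr.
  + by rewrite (mE j)// dvdn_mulr.
- split; [exact: sE|exact: sE|] => l li lj.
  rewrite -(rE l); apply: dvdn_bprod_sub => // b Bb bD bl; rewrite (actr bl) /=.
  by apply/negP => /and3P[_ _ /forallP/(_ l)]; rewrite li lj bl.
rewrite !mco//; split.
  have : (p i j %| L)%N by rewrite Lpm dvdn_mulr.
  move=> pL; have pS : ((p i j)%:Z %| \sum_l a l * (co l)%:Z)%Z.
    by apply: dvdz_trans L_dvd; rewrite dvdzE.
  move: pS; rewrite (bigD1 i)//= (bigD1 j)//= addrA rpredDr//.
  apply: rpred_sum => l /andP[li lj]; apply: dvdz_mull; rewrite dvdzE /=.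
  apply: dvdn_bprod_sub => // b Bb bD /and3P[bi bj /forallP/(_ l)].
  by rewrite li lj /= => ->; rewrite (actr bi).
(* If the integer vanished, the [i]-th and [j]-th fractions would have sum [0], against
   [no_cancel]. *)
apply/negP => /eqP E0; have ij : i != j by rewrite eq_sym.
have := no_cancel ij; apply/negP; rewrite negbK.
suff -> : (a i)%:~R / (r i)%:R + (a j)%:~R / (r j)%:R = 0 :> R by exact: rpred0.
have L0 : L%:R != 0 :> R by rewrite pnatr_eq0 -lt0n bprod_gt0.
by apply: (mulIf L0); rewrite mul0r mulrDl !R_L -intrD E0.
Qed.

End IrreducibleTuples.

Lemma absz_add_le (u v : int) x y :
  (absz u <= x)%N -> (absz v <= y)%N -> (absz (u + v)%R <= x + y)%N.
Proof. lia. Qed.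

Lemma absz_shift_lt (u : int) x : (absz u <= x)%N -> (absz (u + x%:Z)%R < (2 * x).+1)%N.
Proof. lia. Qed.

Lemma absz_shiftK (u : int) x : (absz u <= x)%N -> (absz (u + x%:Z)%R)%:Z - x%:Z = u.
Proof. lia. Qed.

Section IrreducibleCount.
Variable B : pred nat.
Hypothesis B_gt1 : forall b, B b -> (1 < b)%N.
Hypothesis B_coprime : forall b c, B b -> B c -> b != c -> coprime b c.
Variables (R : realType) (J : finType) (num : J -> int) (den : J -> nat).
Variables (A z Z M tau : nat).
Hypothesis numden_inj : injective (fun x => (num x, den x)).
Hypothesis den_sqf : forall x, bsqf B (den x).
Hypothesis den_le : forall x, (den x <= Z)%N.
Hypothesis den_ge : forall x, (z <= den x)%N.
Hypothesis num_le : forall x, (`|num x| <= A)%N.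
Hypothesis reduced : forall x b, B b -> (b %| den x)%N -> ~~ (b%:Z %| num x)%Z.
Hypothesis tauP : forall n, (0 < n <= (2 * A).+1 * M)%N -> (size (divisors n) <= tau)%N.

Definition frac (x : J) : R := (num x)%:~R / (den x)%:R.

Definition irreducible_tuples k : {set {ffun 'I_k -> J}} :=
  [set f : {ffun 'I_k -> J} | (\sum_i frac (f i) \is a Num.int) &&
    [forall i, forall j, (i != j) ==> (frac (f i) + frac (f j) \isn't a Num.int)]].

Let ml := [seq m <- iota 0 M.+1 | bsqf B m].

(** The data of [irreducible_code] determine the tuple: the two indices, [m], all numerators, the
    divisors [s], [s'] and [r l] of [m], and finally [p] as a divisor of a nonzero integer
    computable from the preceding data. Divisors are recorded by their rank in the list of divisors,
    at most [tau] possibilities each. *)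
Lemma card_irreducible_tuples k : (1 < k)%N ->
  (forall m, (m ^ (2 * k) * z <= Z ^ (k * k))%N -> (m <= M)%N) ->
  (#|irreducible_tuples k| <=
    k * k * size ml * (2 * A).+1 ^ k * tau ^ k * tau)%N.
Proof.
move=> k1 HM.
pose T := ('I_k * 'I_k * 'I_(size ml) * {ffun 'I_k -> 'I_(2 * A).+1} *
  {ffun 'I_k -> 'I_tau} * 'I_tau)%type.
have -> : (k * k * size ml * (2 * A).+1 ^ k * tau ^ k * tau)%N = #|{: T}|.
  by rewrite !card_prod !card_ffun !card_ord.
pose data (f : {ffun 'I_k -> J}) := [ffun l => (num (f l), den (f l))].
pose aval (av : {ffun 'I_k -> 'I_(2 * A).+1}) l : int := (av l)%:Z - A%:Z.
pose tval m (tv : {ffun 'I_k -> 'I_tau}) l := nth 0%N (divisors m) (tv l).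
pose Eval m av tv (i j : 'I_k) : nat :=
  absz (aval av i * (m %/ tval m tv i)%:Z + aval av j * (m %/ tval m tv j)%:Z).
(* [p] is read last, since the integer that it divides depends on the other components of the
   code. *)
pose decode (q : T) : {ffun 'I_k -> int * nat} :=
  let: (i, j, mi, av, tv, pi) := q in
  let m := nth 0%N ml mi in
  let p := nth 0%N (divisors (Eval m av tv i j)) pi in
  [ffun l => (aval av l, if (l == i) || (l == j) then (p * tval m tv l)%N else tval m tv l)].
have data_inj : injective data.
  move=> f g fg; apply/ffunP => l; apply: numden_inj.
  by have /ffunP/(_ l) := fg; rewrite !ffunE.
rewrite cardE -(size_map data) -[leqRHS](_ : size [seq decode q | q <- enum {: T}] = _); last by rewrite size_map -cardE.
apply: uniq_leq_size; first by rewrite map_inj_uniq ?enum_uniq.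
move=> _ /mapP[f + ->]; rewrite mem_enum inE => /andP[fint /forallP fno].
have fno' i j : i != j -> frac (f i) + frac (f j) \isn't a Num.int.
  by move=> ij; have /forallP/(_ j)/implyP/(_ ij) := fno i.
have [i [j [m [p [s [s' [ij [sm mM sm1 sm2] [ri rj rl] [pE E0]]]]]]]] :=
  @irreducible_code B B_gt1 B_coprime R k (num \o f) (den \o f) z Z k1
    (fun l => den_sqf (f l)) (fun l => den_le (f l)) (fun l => den_ge (f l))
    (fun l => @reduced (f l)) fint fno'.
have m0 : (0 < m)%N := bsqf_gt0 B_gt1 sm.
have mleM : (m <= M)%N by exact: HM.
pose t0 l := if l == i then s else if l == j then s' else den (f l).
have t0m l : (t0 l %| m)%N.
  by rewrite /t0; case: eqP => // /eqP li; case: eqP => // /eqP lj; exact: rl.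
have mtau : (size (divisors m) <= tau)%N.
  by apply: tauP; rewrite m0 (leq_trans mleM)// leq_pmull.
have Ht l : (index (t0 l) (divisors m) < tau)%N.
  by apply: leq_trans mtau; rewrite index_mem -dvdn_divisors.
have Ha l : (absz (num (f l) + A%:Z)%R < (2 * A).+1)%N by exact: absz_shift_lt.
have Hm : (index m ml < size ml)%N.
  by rewrite index_mem mem_filter sm mem_iota.
pose E := absz (num (f i) * (m %/ s)%:Z + num (f j) * (m %/ s')%:Z).
have Egt0 : (0 < E)%N by rewrite absz_gt0.
have pdE : (p %| E)%N by rewrite dvdzE in pE.
(* [E] is at most [2 * A * M]; the hypothesis on [tau] reaches [(2 * A).+1 * M], which covers both
   [E] and [m]. *)
have Hp : (index p (divisors E) < tau)%N.
  apply: (@leq_trans (size (divisors E))); first by rewrite index_mem -dvdn_divisors.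
  apply: tauP; rewrite Egt0 /= /E.
  have := num_le (f i); have := num_le (f j).
  have : (m %/ s <= M)%N by apply: leq_trans mleM; exact: leq_div.
  have : (m %/ s' <= M)%N by apply: leq_trans mleM; exact: leq_div.
  move: (m %/ s)%N (m %/ s')%N (num (f i)) (num (f j)) => x y u v hy hx hv hu.
  have h1 : (absz (u * x%:Z)%R <= A * M)%N by rewrite abszM; apply: leq_mul.
  have h2 : (absz (v * y%:Z)%R <= A * M)%N by rewrite abszM; apply: leq_mul.
  move: (u * _) (v * _) h1 h2 => U V h1 h2.
  have e : ((2 * A).+1 * M = A * M + A * M + M)%N by ring.
  rewrite e; apply: leq_trans (leq_addr _ _); exact: absz_add_le.
apply/mapP; exists (i, j, Ordinal Hm, [ffun l => Ordinal (Ha l)], [ffun l => Ordinal (Ht l)], Ordinal Hp);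
  first by rewrite mem_enum.
have mE : nth 0%N ml (Ordinal Hm) = m by rewrite /= nth_index// mem_filter sm mem_iota.
have avE l : aval [ffun l => Ordinal (Ha l)] l = num (f l).
  by rewrite /aval ffunE /= absz_shiftK.
have tvE l : tval m [ffun l => Ordinal (Ht l)] l = t0 l.
  by rewrite /tval ffunE /= nth_index// -dvdn_divisors.
have EE : Eval m [ffun l => Ordinal (Ha l)] [ffun l => Ordinal (Ht l)] i j = E.
  by rewrite /Eval !avE !tvE /t0 eqxx [j == i]eq_sym (negbTE ij) eqxx.
apply/ffunP => l; rewrite /decode mE EE !ffunE /= avE tvE nth_index -?dvdn_divisors//.
congr (_, _); rewrite /t0; case: eqP => [->|/eqP li] /=; first exact: ri.
by case: eqP => [->|/eqP lj] //; exact: rj.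
Qed.

End IrreducibleCount.

(** * Moments of a trigonometric polynomial *)

Section FfunInsert.
Local Open Scope complex_scope.
Variable I : finType.

Definition ffun_ins n (i : 'I_n.+1) (x : I) (g : {ffun 'I_n -> I}) : {ffun 'I_n.+1 -> I} :=
  [ffun l => oapp g x (unlift i l)].

Lemma ffun_ins_at n (i : 'I_n.+1) x g : ffun_ins i x g i = x.
Proof. by rewrite ffunE unlift_none. Qed.

Lemma ffun_ins_lift n (i : 'I_n.+1) x g j : ffun_ins i x g (lift i j) = g j.
Proof. by rewrite ffunE liftK. Qed.

Lemma big_ffun_ins (V : Type) (idx : V) (op : Monoid.com_law idx) n (i : 'I_n.+1)
    (F : {ffun 'I_n.+1 -> I} -> V) :
  \big[op/idx]_f F f = \big[op/idx]_x \big[op/idx]_g F (ffun_ins i x g).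
Proof.
rewrite pair_big /= (reindex (fun q : I * {ffun 'I_n -> I} => ffun_ins i q.1 q.2)) //=.
exists (fun f => (f i, [ffun j => f (lift i j)])) => [[x g] _|f _] /=.
  by rewrite ffun_ins_at; congr (_, _); apply/ffunP => j; rewrite ffunE ffun_ins_lift.
apply/ffunP => l; rewrite ffunE; case: unliftP => [j ->|->] //=.
by rewrite ffunE.
Qed.

End FfunInsert.

Section TupleMoments.
Local Open Scope complex_scope.
Context {R : realType} (I : finType) (sg : I -> R) (c : I -> R[i]) (neg : I -> I).
Hypothesis sg_neg : forall x y, (sg x + sg y \is a Num.int) = (y == neg x).
Hypothesis c_neg : forall x, c (neg x) = (c x)^*%C.
Hypothesis sgN : forall x, sg x \isn't a Num.int.

Definition zero_sum k (f : {ffun 'I_k -> I}) := \sum_i sg (f i) \is a @Num.int R.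
(** Limiting average over [n] of the [k]-th power of $\sum_x c_x e(n\,\sigma_x)$: after expansion
    only the tuples with integral sum are not oscillating. *)
Definition tuple_moment k : R[i] := \sum_(f : {ffun 'I_k -> I} | zero_sum f) \prod_i c (f i).
Definition zero_sum_count k := (\sum_(f : {ffun 'I_k -> I}) zero_sum f)%N.
Definition head_uncancelled k (f : {ffun 'I_k.+1 -> I}) :=
  [forall j : 'I_k, f (lift ord0 j) != neg (f ord0)].
Definition uncancelled_count k :=
  (\sum_(f : {ffun 'I_k.+1 -> I}) (zero_sum f && head_uncancelled f))%N.
Definition irreducible_count k :=
  (\sum_(f : {ffun 'I_k -> I}) (zero_sum f && [forall i, forall j, (i != j) ==> (f j != neg (f i))]))%N.
Definition weight : R := \sum_x cnorm (c x) ^+ 2.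

(** Number of entries opposite to the first. Weighting by [n1] makes the recursion exact; only the
    tuples with [n1 f != 1] are then counted wrongly. *)
Let n1 k (f : {ffun 'I_k.+1 -> I}) := (\sum_(j < k) (f (lift ord0 j) == neg (f ord0)))%N.

Lemma neg_sym x y : (y == neg x) = (x == neg y).
Proof. by rewrite -!sg_neg addrC. Qed.

Lemma negK : involutive neg.
Proof. by move=> x; apply/eqP; rewrite eq_sym neg_sym. Qed.

Lemma zero_sum_ins k (i : 'I_k.+1) x (g : {ffun 'I_k -> I}) :
  zero_sum (ffun_ins i x g) = (sg x + \sum_j sg (g j) \is a Num.int).
Proof.
rewrite /zero_sum (bigD1_ord i)//= ffun_ins_at.
by congr (_ + _ \is a Num.int); apply: eq_bigr => j _; rewrite ffun_ins_lift.
Qed.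

Lemma zero_sum_ins2 k (i : 'I_k.+2) (j : 'I_k.+1) x y (h : {ffun 'I_k -> I}) : y = neg x ->
  zero_sum (ffun_ins i x (ffun_ins j y h)) = zero_sum h.
Proof.
move=> yx; rewrite zero_sum_ins (bigD1_ord j)//= ffun_ins_at addrA.
have -> : \sum_(l < k) sg (ffun_ins j y h (lift j l)) = \sum_l sg (h l).
  by apply: eq_bigr => l _; rewrite ffun_ins_lift.
by rewrite rpredDl//; rewrite sg_neg yx.
Qed.

Lemma sum_pair (V : nmodType) k (j : 'I_k.+1) (F : I -> I -> {ffun 'I_k -> I} -> V)
    (G : {ffun 'I_k.+2 -> I} -> V) :
  (forall x y h, G (ffun_ins ord0 x (ffun_ins j y h)) = F x y h) ->
  \sum_(f : {ffun 'I_k.+2 -> I}) (if f (lift ord0 j) == neg (f ord0) then G f else 0) =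
  \sum_x \sum_h F x (neg x) h.
Proof.
move=> GF; rewrite (big_ffun_ins _ ord0); apply: eq_bigr => x _.
rewrite (big_ffun_ins _ j) (bigD1 (neg x)) //= [X in _ + X]big1 ?addr0.
  by apply: eq_bigr => h _; rewrite ffun_ins_lift !ffun_ins_at eqxx GF.
move=> y ynx; rewrite big1// => h _.
by rewrite ffun_ins_lift !ffun_ins_at (negbTE ynx).
Qed.

(** The weight counts the positions of an entry opposite to the first one. Such a pair contributes
    $c_x \overline{c_x}$, and its removal leaves an arbitrary zero-sum tuple of length [k], so the
    sum factorizes. *)
Lemma tuple_moment_n1 k :
  \sum_(f : {ffun 'I_k.+2 -> I} | zero_sum f) (n1 f)%:R * \prod_i c (f i) =
  (k.+1%:R * weight)%:C * tuple_moment k.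
Proof.
have -> : \sum_(f : {ffun 'I_k.+2 -> I} | zero_sum f) (n1 f)%:R * \prod_i c (f i) =
  \sum_(j < k.+1) \sum_(f : {ffun 'I_k.+2 -> I})
     (if f (lift ord0 j) == neg (f ord0) then (zero_sum f)%:R * \prod_i c (f i) else 0).
  rewrite exchange_big big_mkcond /=; apply: eq_bigr => f _.
  rewrite /n1 natr_sum mulr_suml; case: (zero_sum f); last first.
    by rewrite big1// => j _; rewrite mul0r if_same.
  by apply: eq_bigr => j _; case: (_ == _); rewrite ?mul1r ?mul0r.
transitivity (\sum_(j < k.+1) (weight%:C * tuple_moment k)); last first.
  rewrite sumr_const card_ord rmorphM /= -mulrA -[LHS]mulr_natl; congr (_ * _).
  by rewrite rmorph_nat.
apply: eq_bigr => j _.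
rewrite (@sum_pair _ k j (fun x y h => (zero_sum (ffun_ins ord0 x (ffun_ins j y h)))%:R *
  (c x * (c y * \prod_i c (h i))))); last first.
  move=> x y h; congr (_ * _); rewrite (bigD1_ord ord0)//= ffun_ins_at; congr (_ * _).
  rewrite (eq_bigr (fun l => c (ffun_ins j y h l))); last by move=> l _; rewrite ffun_ins_lift.
  rewrite (bigD1_ord j)//= ffun_ins_at; congr (_ * _).
  by apply: eq_bigr => l _; rewrite ffun_ins_lift.
rewrite /weight rmorph_sum mulr_suml; apply: eq_bigr => x _.
rewrite /tuple_moment mulr_sumr [RHS]big_mkcond; apply: eq_bigr => h _.
rewrite zero_sum_ins2// c_neg [c x * (_ * _)]mulrA -sqr_cnorm.
by case: (zero_sum h); rewrite ?mul1r ?mul0r.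
Qed.

Lemma n1_0 k (f : {ffun 'I_k.+1 -> I}) : (n1 f == 0)%N = head_uncancelled f.
Proof. by rewrite /n1 sum_nat_eq0; apply: eq_forallb => j; rewrite eqb0. Qed.

Lemma n1_ge2 k (f : {ffun 'I_k.+2 -> I}) : (1 < n1 f)%N ->
  exists (j : 'I_k.+1) (l : 'I_k),
  (f (lift ord0 j) == neg (f ord0)) && (f (lift ord0 (lift j l)) == neg (f ord0)).
Proof.
move=> n12.
have : (n1 f != 0)%N by rewrite -lt0n; exact: ltnW.
rewrite sum_nat_eq0 negb_forall => /existsP[j]; rewrite eqb0 negbK => fj.
move: n12; rewrite /n1 (bigD1_ord j)//= fj add1n ltnS lt0n sum_nat_eq0 negb_forall.
by move=> /existsP[l]; rewrite eqb0 negbK => fl; exists j, l; rewrite fj.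
Qed.

Lemma sum_pair_count k (j : 'I_k.+1) :
  (\sum_(f : {ffun 'I_k.+2 -> I}) (zero_sum f && (f (lift ord0 j) == neg (f ord0))) =
   #|I| * zero_sum_count k)%N.
Proof.
transitivity (\sum_(x : I) zero_sum_count k)%N; last by rewrite sum_nat_const.
rewrite (eq_bigr (fun f : {ffun 'I_k.+2 -> I} =>
  if f (lift ord0 j) == neg (f ord0) then (zero_sum f : nat) else 0)).
  rewrite (@sum_pair _ k j (fun x y h => zero_sum (ffun_ins ord0 x (ffun_ins j y h)) : nat))//.
  by apply: eq_bigr => x _; apply: eq_bigr => h _; rewrite zero_sum_ins2.
by move=> f _; case: (_ == _); rewrite ?andbT ?andbF.
Qed.

(** When two entries are opposite to the first, one remains after removal of a pair and determines
    the value of that pair; so the factor [#|I|] of [sum_pair_count] disappears. *)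
Lemma sum_double_count k (j : 'I_k.+1) (l : 'I_k) :
  (\sum_(f : {ffun 'I_k.+2 -> I}) (zero_sum f && ((f (lift ord0 j) == neg (f ord0)) &&
       (f (lift ord0 (lift j l)) == neg (f ord0)))) = zero_sum_count k)%N.
Proof.
rewrite (eq_bigr (fun f : {ffun 'I_k.+2 -> I} =>
  if f (lift ord0 j) == neg (f ord0) then
    ((zero_sum f && (f (lift ord0 (lift j l)) == neg (f ord0))) : nat) else 0)); last first.
  by move=> f _; case: (f (lift ord0 j) == _); rewrite ?andbT ?andbF.
rewrite (@sum_pair _ k j (fun x y h =>
   (zero_sum (ffun_ins ord0 x (ffun_ins j y h)) && (h l == neg x)) : nat)); last first.
  by move=> x y h; rewrite !ffun_ins_lift ffun_ins_at.
rewrite exchange_big; apply: eq_bigr => h _.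
rewrite (bigD1 (neg (h l))) //= big1 ?addr0.
  by rewrite zero_sum_ins2// negK eqxx andbT.
by move=> x xh; rewrite neg_sym (negbTE xh) andbF.
Qed.

(** [n1 f = 0] means an uncancelled head; [n1 f >= 2] provides two positions, counted by
    [sum_double_count]. *)
Lemma bad_count k :
  (\sum_(f : {ffun 'I_k.+2 -> I}) (zero_sum f && (n1 f != 1)) <=
   uncancelled_count k.+1 + k.+1 * k.+1 * zero_sum_count k)%N.
Proof.
have -> : (k.+1 * k.+1 * zero_sum_count k = \sum_(j < k.+1) \sum_(l < k.+1) zero_sum_count k)%N.
  by rewrite !sum_nat_const !card_ord mulnA.
apply: (@leq_trans (uncancelled_count k.+1 + \sum_(j < k.+1) \sum_(l < k) zero_sum_count k)); last first.
  rewrite leq_add2l; apply: leq_sum => j _; rewrite big_ord_recr /=; exact: leq_addr.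
under [X in (_ <= _ + X)%N]eq_bigr => j _.
  under eq_bigr => l _ do rewrite -(sum_double_count j l); over.
under [X in (_ <= _ + X)%N]eq_bigr => j _ do rewrite exchange_big.
rewrite [X in (_ <= _ + X)%N]exchange_big /uncancelled_count -big_split /=.
apply: leq_sum => f _; case zf : (zero_sum f) => //=.
have [h0|h0] := boolP (n1 f == 0%N); first by rewrite -n1_0 h0 /= (eqP h0) leq_addr.
have [h1|h1] := eqVneq (n1 f) 1%N; first by [].
have : (1 < n1 f)%N by lia.
move=> /n1_ge2[j [l hjl]].
by rewrite (bigD1 j)//= (bigD1 l)//= hjl /=; lia.
Qed.

(* Gaussian recursion: almost all tuples contain exactly one index cancelling
   the first entry, and removing both leaves a tuple of length [k]. *)
Lemma tuple_moment_step (C : R) k : 1 <= C -> (forall x, cnorm (c x) <= C) ->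
  cnorm (tuple_moment k.+2 - (k.+1%:R * weight)%:C * tuple_moment k) <=
  C ^+ k.+2 * k.+1%:R * (uncancelled_count k.+1 + k.+1 * k.+1 * zero_sum_count k)%:R.
Proof.
move=> C1 cC; rewrite -tuple_moment_n1 /tuple_moment -sumrB.
apply: le_trans (cnorm_sum _ _ _) _.
apply: (@le_trans _ _ (C ^+ k.+2 * k.+1%:R * (\sum_(f : {ffun 'I_k.+2 -> I}) (zero_sum f && (n1 f != 1)%N))%:R)); last first.
  by rewrite ler_wpM2l ?ler_nat ?bad_count// mulr_ge0// exprn_ge0// (le_trans _ C1).
rewrite natr_sum mulr_sumr big_mkcond /=; apply: ler_sum => f _.
case: ifP => _ /=; last by rewrite mulr0.
have -> : \prod_i c (f i) - (n1 f)%:R * \prod_i c (f i) = (1 - (n1 f)%:R)%:C * \prod_i c (f i).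
  by rewrite rmorphB rmorph1 rmorph_nat mulrBl mul1r.
rewrite cnormM cnorm_real cnorm_prod mulrC.
have [->|h1] := eqVneq (n1 f) 1%N; first by rewrite subrr normr0 mulr0 mulr0.
rewrite mulr1 ler_pM ?prodr_ge0//; try by move=> *; exact: cnorm_ge0.
  rewrite -[X in _ <= _ ^+ X]card_ord -prodr_const; apply: ler_prod => i _.
  by rewrite cnorm_ge0 cC.
have n1k : (n1 f <= k.+1)%N.
  apply: (@leq_trans (\sum_(j < k.+1) 1)%N); last by rewrite sum_nat_const card_ord muln1.
  by apply: leq_sum => j _; exact: leq_b1.
have : (n1 f)%:R <= k.+1%:R :> R by rewrite ler_nat.
have : 0 <= (n1 f)%:R :> R by [].
have : 1 <= k.+1%:R :> R by rewrite ler1n.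
by move=> *; rewrite ler_norml; apply/andP; split; lra.
Qed.

Lemma tuple_moment0 : tuple_moment 0 = 1.
Proof.
rewrite /tuple_moment (eq_bigl xpredT); last by move=> f; rewrite /zero_sum big_ord0 rpred0.
under eq_bigr => f _ do rewrite big_ord0.
by rewrite sumr_const card_ffun card_ord expn0.
Qed.

Lemma zero_sum1 (f : {ffun 'I_1 -> I}) : zero_sum f = false.
Proof. by rewrite /zero_sum big_ord1; exact/negbTE/sgN. Qed.

Lemma tuple_moment1 : tuple_moment 1 = 0.
Proof. by rewrite /tuple_moment big1// => f; rewrite zero_sum1. Qed.

Lemma zero_sum_count_le0 : (zero_sum_count 0 <= 1)%N.
Proof.
rewrite /zero_sum_count; apply: (@leq_trans (\sum_(f : {ffun 'I_0 -> I}) 1)%N).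
  by apply: leq_sum => f _; exact: leq_b1.
by rewrite sum1_card card_ffun card_ord expn0.
Qed.

Lemma zero_sum_count1 : zero_sum_count 1 = 0%N.
Proof. by rewrite /zero_sum_count big1// => f _; rewrite zero_sum1. Qed.

Lemma uncancelled_count0 : uncancelled_count 0 = 0%N.
Proof. by rewrite /uncancelled_count big1// => f _; rewrite zero_sum1. Qed.

Lemma uncancelled_count1 : uncancelled_count 1 = 0%N.
Proof.
rewrite /uncancelled_count big1// => f _; apply/eqP; rewrite eqb0; apply/negP.
rewrite /zero_sum (bigD1_ord ord0)//= big_ord1 sg_neg => /andP[h /forallP/(_ ord0)].
by rewrite h.
Qed.

Lemma zero_sum_count_step k :
  (zero_sum_count k.+2 <= uncancelled_count k.+1 + k.+1 * #|I| * zero_sum_count k)%N.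
Proof.
have -> : (k.+1 * #|I| * zero_sum_count k = \sum_(j < k.+1) #|I| * zero_sum_count k)%N.
  by rewrite sum_nat_const card_ord mulnA.
under [X in (_ <= _ + X)%N]eq_bigr => j _ do rewrite -(sum_pair_count j).
rewrite exchange_big /uncancelled_count /zero_sum_count -big_split /=.
apply: leq_sum => f _; case zf : (zero_sum f) => //=.
have [//|] := boolP (head_uncancelled f).
rewrite negb_forall => /existsP[j]; rewrite negbK => fj.
by rewrite (bigD1 j)//= fj.
Qed.

(** If such a tuple is not irreducible, it has two opposite entries, neither being the head. Their
    removal leaves a shorter tuple of the same kind, and there are [#|I|] values for the pair. *)
Lemma uncancelled_count_step k :
  (uncancelled_count k.+2 <= k.+3 * k.+3 * #|I| * uncancelled_count k + irreducible_count k.+3)%N.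
Proof.
have pairE (i : 'I_k.+3) (j : 'I_k.+2) : i != ord0 -> lift i j != ord0 ->
  (\sum_(f : {ffun 'I_k.+3 -> I}) ((zero_sum f && head_uncancelled f) && (f (lift i j) == neg (f i)))
    <= #|I| * uncancelled_count k)%N.
  move=> i0 ij0; rewrite (big_ffun_ins _ i) -sum_nat_const; apply: leq_sum => x _.
  rewrite (big_ffun_ins _ j) (bigD1 (neg x)) //= [X in (_ + X <= _)%N]big1 ?addn0; last first.
    move=> y ynx; rewrite big1// => h _.
    by rewrite ffun_ins_lift !ffun_ins_at (negbTE ynx) andbF.
  apply: leq_sum => h _; rewrite zero_sum_ins2//.
  case zh : (zero_sum h) => //=.
  case hu : (head_uncancelled _) => //=.
  suff -> : head_uncancelled h by case: (_ == _).
  apply/forallP => l.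
  (* Neither removed position is [0], so the head keeps its place in the shorter tuple. *)
  have j0 : lift j ord0 = ord0.
    apply/val_inj; rewrite /= /bump leqn0; case: eqP => // jv; exfalso.
    move/eqP: ij0; apply; apply/val_inj; rewrite /= /bump jv leqn0.
    by case: eqP => // iv; move/eqP: i0; case; exact/val_inj.
  have i0' : lift i ord0 = ord0.
    apply/val_inj; rewrite /= /bump leqn0; case: eqP => // iv; exfalso.
    by move/eqP: i0; apply; exact/val_inj.
  have h0 : ffun_ins i x (ffun_ins j (neg x) h) ord0 = h ord0.
    by rewrite -{1}i0' ffun_ins_lift -{1}j0 ffun_ins_lift.
  have hl : ffun_ins i x (ffun_ins j (neg x) h) (lift i (lift j (lift ord0 l))) = h (lift ord0 l).
    by rewrite !ffun_ins_lift.
  have nz : lift i (lift j (lift ord0 l)) != ord0.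
    by rewrite -[X in _ != X]i0' (inj_eq lift_inj) -[X in _ != X]j0 (inj_eq lift_inj) eq_sym neq_lift.
  have [q qE|qE] := unliftP ord0 (lift i (lift j (lift ord0 l))); last by rewrite qE eqxx in nz.
  by move/forallP: hu => /(_ q); rewrite -qE hl h0.
have -> : (k.+3 * k.+3 * #|I| * uncancelled_count k =
    \sum_(i < k.+3) \sum_(j < k.+3) #|I| * uncancelled_count k)%N.
  by rewrite !sum_nat_const !card_ord !mulnA.
apply: (@leq_trans ((\sum_(i < k.+3) \sum_(j < k.+2)
   \sum_(f : {ffun 'I_k.+3 -> I}) [&& i != ord0, lift i j != ord0 &
       ((zero_sum f && head_uncancelled f) && (f (lift i j) == neg (f i)))])
   + irreducible_count k.+3)%N); last first.
  rewrite leq_add2r; apply: leq_sum => i _; rewrite [leqRHS]big_ord_recr /=.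
  apply: leq_trans (leq_addr _ _); apply: leq_sum => j _.
  case: (boolP (i != ord0)) => [i0|_]; last by rewrite big1.
  case: (boolP (lift i j != ord0)) => [ij0|_]; last by rewrite big1.
  exact: pairE.
under [X in (_ <= X + _)%N]eq_bigr => i _ do rewrite exchange_big.
rewrite [X in (_ <= X + _)%N]exchange_big /uncancelled_count /irreducible_count -big_split /=.
apply: leq_sum => f _; case zf : (zero_sum f) => //=.
case hu : (head_uncancelled f) => //=.
have [_|] := boolP [forall i, forall j, (i != j) ==> (f j != neg (f i))]; first by rewrite addn1.
move=> /forallPn[i /forallPn[j]]; rewrite negb_imply negbK => /andP[ij fij].
have nz l l' : l != l' -> f l' == neg (f l) -> l != ord0.
  move=> ll fl; apply/negP => /eqP l0; move: ll fl; rewrite l0 => ll fl.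
  have [q qE|qE] := unliftP ord0 l'; last by rewrite qE eqxx in ll.
  by move/forallP: hu => /(_ q); rewrite -qE fl.
have i0 := nz _ _ ij fij.
have j0 : j != ord0 by apply: (nz j i); [rewrite eq_sym|rewrite neg_sym].
have [q qE|qE] := unliftP i j; last by rewrite qE eqxx in ij.
by rewrite (bigD1 i)//= (bigD1 q)//= i0 -qE j0 fij.
Qed.

End TupleMoments.

Section MomentLimit.
Context {R : realType} {T : Type} (F : set_system T) {FF : Filter F}.
Variables (I : T -> finType) (sg : forall x, I x -> R) (c : forall x, I x -> R[i]).
Variables (neg : forall x, I x -> I x) (s : T -> R) (C a : R).
Hypothesis sg_neg : forall x (u w : I x), (sg u + sg w \is a Num.int) = (w == neg u).
Hypothesis sgN : forall x (u : I x), sg u \isn't a Num.int.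
Hypothesis c_neg : forall x (u : I x), c (neg u) = (c u)^*%C.
Hypothesis C1 : 1 <= C.
Hypothesis a0 : 0 < a.
Hypothesis s_gt0 : \forall x \near F, 0 < s x.
Hypothesis s_infty : (s x)^-1 @[x --> F] --> (0 : R).
Hypothesis cC : forall x (u : I x), cnorm (c u) <= C.
Hypothesis card_le : \forall x \near F, #|I x|%:R <= C * s x ^+ 2.
Hypothesis irreducible_small : forall k, (2 < k)%N ->
  (irreducible_count (@sg x) (@neg x) k)%:R / s x ^+ k @[x --> F] --> (0 : R).
Hypothesis weight_ge : \forall x \near F, a * s x <= Num.sqrt (weight (@c x)).

Let cvg0_le (f g : T -> R) : (\forall x \near F, 0 <= f x <= g x) ->
  g x @[x --> F] --> (0 : R) -> f x @[x --> F] --> (0 : R).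
Proof. by move=> fg g0; apply: (squeeze_cvgr fg) => //; exact: cvg_cst. Qed.

(** Induction in steps of two, hence the pair of statements: the first two counts are [0], removing
    an opposite pair costs [#|I|], of order $s^2$, and the irreducible tuples are negligible by
    hypothesis. *)
Lemma scaled_uncancelled_count k :
  (uncancelled_count (@sg x) (@neg x) k)%:R / s x ^+ k.+1 @[x --> F] --> (0 : R).
Proof.
suff: (uncancelled_count (@sg x) (@neg x) k)%:R / s x ^+ k.+1 @[x --> F] --> (0 : R) /\
  (uncancelled_count (@sg x) (@neg x) k.+1)%:R / s x ^+ k.+2 @[x --> F] --> (0 : R) by case.
elim: k => [|k [IH1 IH2]].
  split; apply: (cvg0_le _ (cvg_cst (0 : R))); apply: nearW => x.
    by rewrite (uncancelled_count0 _ (@sgN x)) mul0r lexx.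
  by rewrite (uncancelled_count1 (@sg_neg x)) mul0r lexx.
split => //.
have h : (k.+3 * k.+3)%:R * C * ((uncancelled_count (@sg x) (@neg x) k)%:R / s x ^+ k.+1)
  + (irreducible_count (@sg x) (@neg x) k.+3)%:R / s x ^+ k.+3 @[x --> F] --> (0 : R).
  rewrite -[X in _ --> X](addr0 0); apply: cvgD; last exact: irreducible_small.
  rewrite -[X in _ --> X](mulr0 ((k.+3 * k.+3)%:R * C)); apply: cvgM => //; exact: cvg_cst.
apply: cvg0_le h; near=> x.
have s0 : 0 < s x by near: x.
have cl : #|I x|%:R <= C * s x ^+ 2 by near: x.
rewrite divr_ge0 ?exprn_ge0 ?(ltW s0)//=.
rewrite ler_pdivrMr ?exprn_gt0// mulrDl divfK ?gt_eqF ?exprn_gt0//.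
have := uncancelled_count_step (@sg_neg x) k; rewrite -(ler_nat R) natrD => h2.
apply: le_trans h2 _; rewrite lerD2r natrM natrM.
have -> : (k.+3 * k.+3)%:R * C * ((uncancelled_count (@sg x) (@neg x) k)%:R / s x ^+ k.+1) * s x ^+ k.+3 =
  (k.+3 * k.+3)%:R * (C * s x ^+ 2) * (uncancelled_count (@sg x) (@neg x) k)%:R.
  by rewrite (exprD _ 2 k.+1); field; rewrite ?expf_neq0 ?gt_eqF.
by rewrite ler_wpM2r// ler_wpM2l.
Unshelve. all: by end_near. Qed.

(** Same induction in steps of two: the head is either uncancelled, which is negligible, or belongs
    to an opposite pair with $O(s^2)$ values. *)
Lemma scaled_zero_sum_count k : exists C', 0 < C' /\
  \forall x \near F, (zero_sum_count (@sg x) k)%:R <= C' * s x ^+ k.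
Proof.
suff: (exists C', 0 < C' /\ \forall x \near F, (zero_sum_count (@sg x) k)%:R <= C' * s x ^+ k) /\
  (exists C', 0 < C' /\ \forall x \near F, (zero_sum_count (@sg x) k.+1)%:R <= C' * s x ^+ k.+1).
  by case.
elim: k => [|k [[C' [C'0 IH1]] IH2]].
  split; exists 1; split => //.
    by apply: nearW => x; rewrite expr0 mulr1 (ler_nat R _ 1) zero_sum_count_le0.
  by apply: filterS s_gt0 => x s0; rewrite zero_sum_count1 ?mul1r ?exprn_ge0 ?(ltW s0)//; exact: sgN.
split => //; exists (1 + k.+1%:R * C * C'); have C0 : 0 < C by exact: lt_le_trans C1.
split; first by rewrite addr_gt0 ?mulr_gt0.
have := scaled_uncancelled_count k.+1 => /cvgrPdist_lt/(_ _ ltr01) h.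
near=> x.
have s0 : 0 < s x by near: x.
have cl : #|I x|%:R <= C * s x ^+ 2 by near: x.
have z : (zero_sum_count (@sg x) k)%:R <= C' * s x ^+ k by near: x.
have u1 : (uncancelled_count (@sg x) (@neg x) k.+1)%:R <= s x ^+ k.+2.
  have : `|0 - (uncancelled_count (@sg x) (@neg x) k.+1)%:R / s x ^+ k.+2| < 1 by near: x.
  rewrite sub0r normrN ger0_norm ?divr_ge0 ?exprn_ge0 ?(ltW s0)//.
  by rewrite ltr_pdivrMr ?exprn_gt0// mul1r => /ltW.
have := zero_sum_count_step (@sg_neg x) k; rewrite -(ler_nat R) natrD => h2.
apply: le_trans h2 _; rewrite mulrDl mul1r; apply: lerD => //.
have -> : k.+1%:R * C * C' * s x ^+ k.+2 = k.+1%:R * (C * s x ^+ 2) * (C' * s x ^+ k).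
  by rewrite (exprD _ 2 k); ring.
by rewrite !natrM ler_pM// ?mulr_ge0// ler_wpM2l.
Unshelve. all: by end_near. Qed.

(** After division by the power of the standard deviation, [tuple_moment_step] becomes the
    recurrence $m_{k+2} = (k+1) m_k$ of the normal moments. Its error is the scaled uncancelled
    count plus $O(s^k/s^{k+2})$ from the doubly cancelled tuples. *)
Lemma tuple_moment_cvg k :
  complex.Re (tuple_moment (@sg x) (@c x) k) / Num.sqrt (weight (@c x)) ^+ k @[x --> F] -->
  normal_mean (fun y : R => y ^+ k).
Proof.
have C0 : 0 < C by exact: lt_le_trans C1.
suff: (complex.Re (tuple_moment (@sg x) (@c x) k) / Num.sqrt (weight (@c x)) ^+ k @[x --> F] -->
  normal_mean (fun y : R => y ^+ k)) /\
 (complex.Re (tuple_moment (@sg x) (@c x) k.+1) / Num.sqrt (weight (@c x)) ^+ k.+1 @[x --> F] -->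
  normal_mean (fun y : R => y ^+ k.+1)) by case.
elim: k => [|k [IH1 IH2]].
  rewrite normal_mean_pow0 normal_mean_pow1; split.
    by under eq_fun do rewrite tuple_moment0 expr0 divr1; exact: cvg_cst.
  by under eq_fun => x do rewrite (tuple_moment1 _ (@sgN x)) mul0r; exact: cvg_cst.
split => //; rewrite normal_mean_step.
have [C' [C'0 zC]] := scaled_zero_sum_count k.
pose u x : R := (uncancelled_count (@sg x) (@neg x) k.+1)%:R / s x ^+ k.+2.
pose K : R := C ^+ k.+2 * k.+1%:R / a ^+ k.+2.
have h0 : K * (u x + (k.+1 * k.+1)%:R * C' * ((s x)^-1 * (s x)^-1)) @[x --> F] --> (0 : R).
  rewrite -[X in _ --> X](mulr0 K); apply: cvgM; first exact: cvg_cst.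
  rewrite -[X in _ --> X](addr0 0); apply: cvgD; first exact: scaled_uncancelled_count.
  rewrite -[X in _ --> X](mulr0 ((k.+1 * k.+1)%:R * C')); apply: cvgM; first exact: cvg_cst.
  by rewrite -[X in _ --> X](mulr0 0); exact: cvgM.
pose m j x := complex.Re (tuple_moment (@sg x) (@c x) j) / Num.sqrt (weight (@c x)) ^+ j.
have d0 : m k.+2 x - k.+1%:R * m k x @[x --> F] --> (0 : R).
  apply/norm_cvg0P; apply: cvg0_le h0; near=> x.
  have s0 : 0 < s x by near: x.
  have wg : a * s x <= Num.sqrt (weight (@c x)) by near: x.
  have z : (zero_sum_count (@sg x) k)%:R <= C' * s x ^+ k by near: x.
  have w0 : 0 < Num.sqrt (weight (@c x)) by apply: lt_le_trans wg; exact: mulr_gt0.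
  have w20 : 0 < weight (@c x) by rewrite -sqrtr_gt0.
  have := tuple_moment_step (@sg_neg x) (@c_neg x) k C1 (@cC x).
  move/(le_trans (normr_Re_le _)) => h.
  rewrite normr_ge0 /=.
  have -> : m k.+2 x - k.+1%:R * m k x =
     complex.Re (tuple_moment (@sg x) (@c x) k.+2 - (k.+1%:R * weight (@c x))%:C%C * tuple_moment (@sg x) (@c x) k)
       / Num.sqrt (weight (@c x)) ^+ k.+2.
    rewrite /m raddfB /= [complex.Re (_%:C%C * _)](_ : _ = k.+1%:R * weight (@c x) * complex.Re (tuple_moment (@sg x) (@c x) k)); last first.
      by case: (tuple_moment _ _ k) => ? ? /=; rewrite mul0r subr0.
    have := sqr_sqrtr (ltW w20); move: w0; set w := Num.sqrt _ => w0 <-.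
    by rewrite (exprD w 2 k); field; rewrite ?expf_neq0 ?gt_eqF.
  rewrite normrM normfV (ger0_norm (exprn_ge0 _ (ltW w0))) ler_pdivrMr ?exprn_gt0//.
  apply: le_trans h _.
  apply: (@le_trans _ _ (K * (u x + (k.+1 * k.+1)%:R * C' * ((s x)^-1 * (s x)^-1)) * (a * s x) ^+ k.+2)); last first.
    have K0 : 0 <= K by apply: divr_ge0; [apply: mulr_ge0 => //; exact/exprn_ge0/ltW|exact/exprn_ge0/ltW].
    rewrite ler_wpM2l//; last by rewrite ler_pXn2r ?nnegrE ?(ltW w0) ?mulr_ge0 ?(ltW a0) ?(ltW s0).
    by rewrite mulr_ge0// addr_ge0 ?divr_ge0 ?exprn_ge0 ?mulr_ge0 ?invr_ge0 ?(ltW s0) ?(ltW C'0).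
  rewrite /K /u.
  have -> : C ^+ k.+2 * k.+1%:R / a ^+ k.+2 *
     ((uncancelled_count (@sg x) (@neg x) k.+1)%:R / s x ^+ k.+2 +
       (k.+1 * k.+1)%:R * C' * ((s x)^-1 * (s x)^-1)) * (a * s x) ^+ k.+2 =
     C ^+ k.+2 * k.+1%:R * ((uncancelled_count (@sg x) (@neg x) k.+1)%:R + (k.+1 * k.+1)%:R * (C' * s x ^+ k)).
    rewrite exprMn (exprD (s x) 2 k); field; rewrite ?expf_neq0 ?gt_eqF//.
  apply: ler_wpM2l; first by apply: mulr_ge0 => //; exact/exprn_ge0/ltW.
  by rewrite natrD lerD2l [X in X <= _]natrM ler_wpM2l.
have -> : (fun x => complex.Re (tuple_moment (@sg x) (@c x) k.+2) / Num.sqrt (weight (@c x)) ^+ k.+2) =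
   (fun x => (m k.+2 x - k.+1%:R * m k x) + k.+1%:R * m k x).
  by apply/funext => x; rewrite subrK.
rewrite -[X in _ --> X]add0r; apply: cvgD => //; apply: cvgM => //; exact: cvg_cst.
Unshelve. all: by end_near. Qed.

End MomentLimit.

(** * Regular variation and squarefree divisors *)

Section RegularVariation.
Context {R : realType}.
Implicit Types (J : set nat) (x y t s eta : R).

Lemma counting_functionE J x : 0 <= x ->
  counting_function J x = \sum_(n < (Num.truncn x).+1 | (n : nat) \in J) 1.
Proof.
move=> x0; rewrite /counting_function.
set A := [set n | _]; set sq := [seq n <- iota 0 (Num.truncn x).+1 | n \in J].
have -> : fset_set A = [fset n | n in sq]%fset.
  apply/fsetP => n; rewrite in_fset_set; last first.
    apply: (@sub_finite_set _ _ `I_(Num.truncn x).+1); last exact: finite_II.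
    by move=> m [_ mx] /=; rewrite ltnS truncn_ge_nat.
  rewrite !inE /= mem_filter mem_iota add0n ltnS leq0n /= truncn_ge_nat//.
  by apply/idP/andP => [/set_mem[Jn nx]|[/set_mem Jn nx]]; [split => //; exact: mem_set|apply: mem_set].
rewrite card_fseq undup_id ?filter_uniq ?iota_uniq//.
rewrite size_filter -sum1_count natr_sum -(big_mkord (fun n => n \in J) (fun=> 1 : R)) /index_iota subn0.
by [].
Qed.

Lemma counting_function_ge0 J x : 0 <= counting_function J x.
Proof. by rewrite /counting_function. Qed.

Lemma finite_counting J x : finite_set [set n | J n /\ n%:R <= x].
Proof.
apply: (@sub_finite_set _ _ `I_(Num.truncn x).+1); last exact: finite_II.
move=> m [_ mx] /=; rewrite ltnS truncn_ge_nat//; exact: le_trans mx.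
Qed.

Lemma le_counting_function J J' x y : J `<=` J' -> x <= y ->
  counting_function J x <= counting_function J' y.
Proof.
move=> JJ xy; rewrite /counting_function ler_nat; apply: fsubset_leq_card.
rewrite -fset_set_sub; [|exact: finite_counting..].
by move=> n [Jn nx]; split; [exact: JJ|exact: le_trans xy].
Qed.

Lemma powR2_lt (x y : R) : (2 `^ x < 2 `^ y :> R) = (x < y).
Proof. by rewrite /powR gt_eqF// ltr_expR ltr_pM2r// ln_gt0// ltr1n. Qed.

Lemma pow2_between t : 1 <= t -> exists n, 2 ^+ n <= t < 2 ^+ n.+1.
Proof.
move=> t1; have t0 : 0 <= t by exact: le_trans t1.
exists (trunc_log 2 (Num.truncn t)).
have N0 : (0 < Num.truncn t)%N by rewrite truncn_gt0.
have := trunc_logP (isT : 1 < 2)%N N0; have := trunc_log_ltn (Num.truncn t) (isT : 1 < 2)%N.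
rewrite -!natrX -truncn_ge_nat// => h1 h2; rewrite h2 /=.
by rewrite -truncn_lt_nat.
Qed.

Section Fixed.
Variables (J : set nat) (alpha : R).
Hypothesis alpha01 : 0 < alpha < 1.
Hypothesis J_regular : regularly_varying J alpha.
Local Notation N := (counting_function J : R -> R).

(** The slowly varying factor is eliminated here; everything later uses [N] itself, which is
    monotone. *)
Lemma counting_ratio (l : R) : 0 < l -> N (l * x) / N x @[x --> +oo] --> l `^ alpha.
Proof.
move=> l0; have [L [[K [_ Lpos]] Lsv] NL] := J_regular.
pose A x := N x / (x `^ alpha * L x).
have Al : A (l * x) @[x --> +oo] --> (1 : R).
  have h : l * x @[x --> +oo] --> +oo.
    apply/cvgryPge => M; apply: filterS (nbhs_pinfty_ge (num_real (M / l))) => x.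
    by rewrite ler_pdivrMr// mulrC.
  exact: (cvg_comp _ _ h NL).
have cv : A (l * x) * (l `^ alpha * (L (l * x) / L x)) * (A x)^-1 @[x --> +oo] --> l `^ alpha.
  have : A (l * x) * (l `^ alpha * (L (l * x) / L x)) * (A x)^-1 @[x --> +oo] -->
      (1 * (l `^ alpha * 1) * 1^-1 : R).
    apply: cvgM; last by apply: cvgV => //; exact: oner_neq0.
    apply: cvgM => //; apply: cvgM; [exact: cvg_cst|exact: Lsv].
  by rewrite invr1 !mulr1 mul1r.
apply: cvg_trans cv; apply: near_eq_cvg; near=> x.
have x0 : 0 < x by near: x; exact: nbhs_pinfty_gt.
have Lx : L x != 0 by rewrite gt_eqF// Lpos//; near: x; exact: nbhs_pinfty_ge.
have Llx : L (l * x) != 0.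
  rewrite gt_eqF// Lpos// mulrC -ler_pdivrMr//; near: x; exact: nbhs_pinfty_ge.
have xa : x `^ alpha != 0 by rewrite gt_eqF// powR_gt0.
have la : l `^ alpha != 0 by rewrite gt_eqF// powR_gt0.
rewrite /A powRM ?ltW// invf_div.
(* Division by [0] gives [0], so the identity also holds at the [x] where [N x] vanishes. *)
have [N0|N0] := eqVneq (N x) 0; first by rewrite N0 invr0 !mulr0.
by field; rewrite N0 Lx Llx xa la.
Unshelve. all: by end_near. Qed.

Lemma counting_doubling eta : 0 < eta -> exists x0, 1 <= x0 /\ forall x, x0 <= x ->
  [/\ 0 < N x, 2 `^ (alpha - eta) * N x <= N (2 * x) & N (2 * x) <= 2 `^ (alpha + eta) * N x].
Proof.
move=> eta0; have cv := counting_ratio (ltr0Sn R 1).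
have lo : 2 `^ (alpha - eta) < 2 `^ alpha by rewrite powR2_lt gtrBl.
have hi : 2 `^ alpha < 2 `^ (alpha + eta) by rewrite powR2_lt ltrDl.
have e1 : \forall x \near +oo, 2 `^ (alpha - eta) < N (2 * x) / N x by exact: (cvgr_gt _ cv).
have e2 : \forall x \near +oo, N (2 * x) / N x < 2 `^ (alpha + eta) by exact: (cvgr_lt _ cv).
have [M [_ HM]] : \forall x \near +oo, 2 `^ (alpha - eta) < N (2 * x) / N x < 2 `^ (alpha + eta).
  by apply: filterS2 e1 e2 => x -> ->.
exists (Num.max 1 (M + 1)); split; first by rewrite le_max lexx.
move=> x; rewrite ge_max => /andP[_ Mx].
have Mx' : M < x by apply: lt_le_trans Mx; rewrite ltrDl.
have /andP[h1 h2] := HM x Mx'.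
have Nx : 0 < N x.
  rewrite lt_neqAle counting_function_ge0 andbT eq_sym; apply/eqP => N0.
  by move: h1; rewrite N0 invr0 mulr0 ltNge powR_ge0.
by split => //; [rewrite -ler_pdivlMr|rewrite -ler_pdivrMr]; rewrite // ltW.
Qed.

Lemma powR2_exp (b : R) n : (2 `^ b) ^+ n = (2 ^+ n) `^ b.
Proof. by rewrite -powR_mulrn ?powR_ge0// powRAC powR_mulrn. Qed.

Lemma counting_doubling_iter eta : 0 < eta -> exists x0, 1 <= x0 /\ forall y n, x0 <= y ->
  [/\ 0 < N y, (2 `^ (alpha - eta)) ^+ n * N y <= N (2 ^+ n * y) &
    N (2 ^+ n * y) <= (2 `^ (alpha + eta)) ^+ n * N y].
Proof.
move=> /counting_doubling[x0 [x01 H]]; exists x0; split => // y n yx.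
have y0 : 0 < y by apply: lt_le_trans yx; apply: lt_le_trans x01.
elim: n => [|n [Ny IH1 IH2]].
  by rewrite !expr0 !mul1r; split => //; case: (H y yx).
have ny : x0 <= 2 ^+ n * y.
  by apply: le_trans yx _; rewrite ler_peMl ?exprn_ege1 ?ler1n// ltW.
have [_ h1 h2] := H _ ny; rewrite !(exprS 2) -!mulrA; split => //.
  rewrite exprS -mulrA; apply: le_trans h1; rewrite ler_wpM2l// powR_ge0//.
by apply: le_trans h2 _; rewrite exprS -mulrA ler_wpM2l// powR_ge0.
Qed.

(** Potter's bounds: doubling iterated over dyadic scales, with monotonicity of [N] between two of
    them. The rounding to a power of [2] costs the constant $2^{\alpha+\eta}$. *)
Lemma counting_potter eta : 0 < eta < alpha -> exists C x0, [/\ 1 <= x0, 0 < C &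
  forall y x, x0 <= y -> y <= x ->
   [/\ 0 < N y, N x <= C * (x / y) `^ (alpha + eta) * N y &
       N y <= C * (y / x) `^ (alpha - eta) * N x]].
Proof.
move=> /andP[eta0 etaa]; have [x0 [x01 H]] := counting_doubling_iter eta0.
have r0 : 0 < 2 `^ (alpha + eta) :> R by rewrite powR_gt0.
have s0 : 0 < 2 `^ (alpha - eta) :> R by rewrite powR_gt0.
exists (2 `^ (alpha + eta)), x0; split => // y x x0y yx.
have y0 : 0 < y by apply: lt_le_trans x0y; apply: lt_le_trans x01.
have x_gt0 : 0 < x by exact: lt_le_trans yx.
have [|n /andP[n1 n2]] := @pow2_between (x / y); first by rewrite ler_pdivlMr// mul1r.
have [Ny h1 _] := H y n x0y; have [_ _ h2] := H y n.+1 x0y.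
have ae : 0 <= alpha + eta by rewrite addr_ge0 ?ltW// (lt_trans eta0).
have as0 : 0 <= alpha - eta by rewrite subr_ge0 ltW.
split => //.
  apply: (@le_trans _ _ (N (2 ^+ n.+1 * y))).
    by apply: le_counting_function => //; rewrite -ler_pdivrMr// ltW.
  apply: le_trans h2 _; rewrite (ler_wpM2r (ltW Ny))// exprS (ler_wpM2l (ltW r0))// powR2_exp.
  by rewrite ge0_ler_powR ?nnegrE ?exprn_ge0 ?divr_ge0 ?(ltW y0) ?(ltW x_gt0).
have Nn : N (2 ^+ n * y) <= N x.
  by apply: le_counting_function => //; rewrite -ler_pdivlMr.
have h3 := le_trans h1 Nn.
have -> : y / x = (x / y)^-1 by rewrite invf_div.
have xy0 : 0 < x / y by rewrite divr_gt0.
have -> : (x / y)^-1 `^ (alpha - eta) = ((x / y) `^ (alpha - eta))^-1.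
  by rewrite -powRN -powR_inv1 ?ltW// -powRrM mulN1r.
rewrite mulrAC ler_pdivlMr ?powR_gt0// mulrC.
apply: (@le_trans _ _ ((2 `^ (alpha - eta)) ^+ n.+1 * N y)).
  by rewrite (ler_wpM2r (ltW Ny))// powR2_exp ge0_ler_powR ?nnegrE ?exprn_ge0 ?(ltW xy0) ?(ltW n2).
rewrite exprS -mulrA; apply: ler_pM h3; first exact: ltW.
  by rewrite mulr_ge0 ?exprn_ge0 ?(ltW s0) ?(ltW Ny).
by rewrite ler_powR ?ler1n// lerD2l; lra.
Qed.

(** The lower bound for arguments [y] down to [1]: below [x0] one compares with [N x0], and the
    constant grows by $x_0^{\alpha-\eta}$. *)
Lemma counting_potter_low eta : 0 < eta < alpha -> exists C x0, [/\ 1 <= x0, 0 < C &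
  forall y x, x0 <= x -> 1 <= y -> y <= x -> N y <= C * (y / x) `^ (alpha - eta) * N x].
Proof.
move=> eta01; have [C [x0 [x01 C0 H]]] := counting_potter eta01.
have /andP[eta0 etaa] := eta01.
have as0 : 0 <= alpha - eta by rewrite subr_ge0 ltW.
have x_0 : 0 < x0 by exact: lt_le_trans x01.
exists (C * x0 `^ (alpha - eta)), x0; split => //; first by rewrite mulr_gt0// powR_gt0.
move=> y x x0x y1 yx.
have y0 : 0 < y by exact: lt_le_trans y1.
have xp : 0 < x by exact: lt_le_trans yx.
have x1 : 1 <= x0 `^ (alpha - eta) by rewrite -(powRr0 x0) ler_powR.
have [x0y|/ltW yx0] := leP x0 y.
  have [_ _ h] := H y x x0y yx; apply: le_trans h _.
  by rewrite ler_wpM2r ?counting_function_ge0// ler_wpM2r ?powR_ge0// ler_peMr// (ltW C0).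
have [_ _ h] := H x0 x (lexx _) x0x.
apply: (@le_trans _ _ (N x0)); first exact: le_counting_function.
apply: le_trans h _; rewrite ler_wpM2r ?counting_function_ge0// -!mulrA ler_wpM2l ?(ltW C0)//.
have yx_0 : 0 <= y / x by rewrite divr_ge0 ?(ltW y0) ?(ltW xp).
rewrite -powRM ?(ltW x_0)//.
rewrite ge0_ler_powR ?nnegrE ?(mulr_ge0 (ltW x_0) yx_0) ?(divr_ge0 (ltW x_0) (ltW xp))//.
by rewrite mulrA ler_wpM2r ?invr_ge0 ?(ltW xp)// ler_peMr// (ltW x_0).
Qed.

Lemma counting_ge_sum t M : 0 <= t ->
  \sum_(d < M | ((d : nat) \in J) && (d%:R <= t)) 1 <= N t.
Proof.
move=> t0; rewrite counting_functionE//.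
rewrite (big_ord_widen_cond (maxn M (Num.truncn t).+1) (fun d => (d \in J) && (d%:R <= t)) (fun=> 1))
  ?leq_maxl//.
rewrite [leRHS](big_ord_widen_cond (maxn M (Num.truncn t).+1) (fun d => d \in J) (fun=> 1))
  ?leq_maxr//.
rewrite big_mkcond [leRHS]big_mkcond; apply: ler_sum => d _.
case: ifP => [/andP[/andP[dJ dt] _]|_]; last by case: ifP.
by rewrite dJ /= ltnS truncn_ge_nat// dt.
Qed.

Lemma geometric_le (th : R) n : 0 <= th < 1 -> \sum_(j < n) th ^+ j <= (1 - th)^-1.
Proof.
move=> /andP[t0 t1]; have u0 : 0 < 1 - th by rewrite subr_gt0.
rewrite -[leRHS]mul1r ler_pdivlMr// mulrC -opprB mulNr -subrX1 opprB gerBl exprn_ge0//.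
Qed.

Lemma counting_tail s : alpha < s -> exists C x0, [/\ 1 <= x0, 0 < C &
  forall y M, x0 <= y ->
   \sum_(d < M | ((d : nat) \in J) && (y < d%:R)) d%:R `^ (- s) <= C * y `^ (- s) * N y].
Proof.
move=> as_; pose eta := (s - alpha) / 2.
have eta0 : 0 < eta by rewrite divr_gt0// subr_gt0.
have [x0 [x01 H]] := counting_doubling_iter eta0.
set rho := 2 `^ (alpha + eta) in H.
have rho0 : 0 < rho by rewrite powR_gt0.
pose th := rho / 2 `^ s.
have s0 : 0 < s by apply: lt_trans as_; case/andP: alpha01.
have p0 : 0 < 2 `^ s :> R by rewrite powR_gt0.
have th01 : 0 <= th < 1.
  rewrite divr_ge0 ?ltW//= ltr_pdivrMr// mul1r powR2_lt /eta; lra.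
exists (rho / (1 - th)), x0; split => //.
  by rewrite divr_gt0// subr_gt0; case/andP: th01.
move=> y M x0y.
have y1 : 1 <= y by exact: le_trans x0y.
have y0 : 0 < y by exact: lt_le_trans y1.
have step n : \sum_(d < M | ((d : nat) \in J) && (y < d%:R <= 2 ^+ n * y)) d%:R `^ (- s) <=
    rho * y `^ (- s) * N y * \sum_(j < n) th ^+ j.
  elim: n => [|n IH].
    rewrite expr0 mul1r big_ord0 mulr0 big_pred0// => d.
    by apply/negbTE; rewrite negb_and; case: (ltP y) => //= h; rewrite ?andbF ?orbT// -ltNge h orbT.
  rewrite (bigID (fun d : 'I_M => d%:R <= 2 ^+ n * y)) /= big_ord_recr /= mulrDr lerD//.
    apply: le_trans IH; rewrite big_mkcond [leRHS]big_mkcond; apply: ler_sum => d _.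
    case: ifP => [/andP[/andP[dJ /andP[yd _]] dn]|_]; first by rewrite dJ yd dn.
    by case: ifP => // _; exact: powR_ge0.
  have n0 : 0 < 2 ^+ n * y by rewrite mulr_gt0 ?exprn_gt0.
  apply: (@le_trans _ _ ((2 ^+ n * y) `^ (- s) * N (2 ^+ n.+1 * y))); last first.
    have [_ _ h] := H y n.+1 x0y; rewrite -/rho in h.
    apply: le_trans (ler_wpM2l (powR_ge0 _ _) h) _.
    rewrite powRM ?exprn_ge0 ?(ltW y0)// -powR2_exp powRN exprVn exprS /th expr_div_n.
    rewrite le_eqVlt; apply/orP; left; apply/eqP; field.
    by rewrite expf_neq0 ?gt_eqF.
  apply: (@le_trans _ _ (\sum_(d < M | ((d : nat) \in J) && (d%:R <= 2 ^+ n.+1 * y)) (2 ^+ n * y) `^ (- s))).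
    rewrite big_mkcond [leRHS]big_mkcond; apply: ler_sum => d _.
    case: ifP => [/andP[/andP[dJ /andP[yd d2]] dn]|_]; last by case: ifP => // _; exact: powR_ge0.
    rewrite dJ d2 /= !powRN lef_pV2 ?posrE ?powR_gt0//; last exact: lt_trans yd.
    by move: dn; rewrite -ltNge => dn; rewrite ge0_ler_powR ?nnegrE ?(ltW s0) ?(ltW n0) ?(ltW dn).
  rewrite -[X in \sum_(_ | _) X]mulr1 -mulr_sumr ler_wpM2l ?powR_ge0//.
  by apply: counting_ge_sum; rewrite mulr_ge0 ?exprn_ge0// ltW.
have [n nM] : exists n, M%:R <= 2 ^+ n * y.
  exists M; apply: (@le_trans _ _ (2 ^+ M)); last by rewrite ler_peMr// exprn_ge0.
  by rewrite -natrX ler_nat ltnW// ltn_expl.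
apply: (@le_trans _ _ (\sum_(d < M | ((d : nat) \in J) && (y < d%:R <= 2 ^+ n * y)) d%:R `^ (- s))).
  rewrite big_mkcond [leRHS]big_mkcond; apply: ler_sum => d _.
  case: ifP => [/andP[dJ yd]|_]; last by case: ifP => // _; exact: powR_ge0.
  by rewrite dJ yd /= (le_trans _ nM)// ler_nat ltnW.
apply: le_trans (step n) _.
rewrite [leRHS](_ : _ = rho * y `^ (- s) * N y * (1 - th)^-1); last by ring.
by rewrite ler_wpM2l ?geometric_le// !mulr_ge0 ?powR_ge0 ?counting_function_ge0// ltW.
Qed.

End Fixed.
End RegularVariation.

(** * Squarefree elements and the Möbius function of the sieving set *)

Section SquarefreeSemigroup.
Variable B : set nat.
Hypothesis B_ge2 : B `<=` [set b | 2 <= b]%N.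
Hypothesis B_cop : {in B &, forall b c, b != c -> coprime b c}.
Local Open Scope nat_scope.
Implicit Types (b d n r u D N : nat) (Q : pred nat).

Definition inB : pred nat := fun b => b \in B.
Local Notation sqf := (bsqf inB).
Local Notation bpr := (bprod inB).

Lemma inB_gt1 b : inB b -> 1 < b.
Proof. by move=> /set_mem/B_ge2. Qed.

Lemma inB_coprime b c : inB b -> inB c -> b != c -> coprime b c.
Proof. by move=> Bb Bc; apply: B_cop. Qed.

Let gt1 := inB_gt1.
Let cop := inB_coprime.

Lemma sqf_gt0 d : sqf d -> 0 < d.
Proof. exact: bsqf_gt0. Qed.

Lemma bprod_dvd D Q a : (forall b, inB b -> b < D -> Q b -> b %| a) -> bpr D Q %| a.
Proof.
rewrite /bprod; elim: D => [|D IH] H; first by rewrite big_ord0 dvd1n.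
rewrite big_mkcond big_ord_recr -big_mkcond /=; case: ifP => [/andP[BD QD]|_]; last first.
  by rewrite muln1 IH// => b Bb bD; apply: H => //; exact: ltnW.
have cD : coprime (\prod_(i < D | inB i && Q i) i) D.
  by rewrite coprime_sym; apply: (coprime_bprod cop) => //; rewrite ltnn.
rewrite Gauss_dvd//; apply/andP; split; last exact: H.
by apply: IH => b Bb bD; apply: H => //; exact: ltnW.
Qed.

Lemma eq_sqf d e : sqf d -> sqf e -> (forall b, inB b -> (b %| d) = (b %| e)) -> d = e.
Proof.
move=> sd se H; rewrite -(bsqfE gt1 sd (_ : d < (maxn d e).+1)) ?ltnS ?leq_maxl//.
rewrite -[RHS](bsqfE gt1 se (_ : e < (maxn d e).+1)) ?ltnS ?leq_maxr//.
by apply: eq_bprod => b Bb; rewrite H.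
Qed.

Lemma sqf_dvd d e : sqf d -> (forall b, inB b -> b %| d -> b %| e) -> d %| e.
Proof.
move=> sd H; rewrite -(bsqfE gt1 sd (ltnSn d)).
by apply: bprod_dvd => b Bb _; exact: H.
Qed.

Lemma sqf_div d r : sqf d -> sqf r -> r %| d ->
  sqf (d %/ r) /\ forall b, inB b -> (b %| d %/ r) = (b %| d) && ~~ (b %| r).
Proof.
move=> sd sr rd.
have E : d %/ r = bpr d.+1 (fun b => (b %| d) && ~~ (b %| r)).
  have dE := bsqfE gt1 sd (ltnSn d).
  rewrite (bprodID _ _ _ (fun b => b %| r)) in dE.
  have rE : bpr d.+1 (fun b => (b %| d) && (b %| r)) = r.
    rewrite -[RHS](bsqfE gt1 sr (_ : r < d.+1)); last by rewrite ltnS dvdn_leq// sqf_gt0.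
    apply: eq_bprod => b Bb; case h : (b %| r); rewrite ?andbF// andbT.
    by rewrite (dvdn_trans h rd).
  by rewrite rE in dE; rewrite -{1}dE mulKn// sqf_gt0.
split; first by rewrite E; exact: bsqf_bprod.
move=> b Bb; rewrite E (dvdn_bprod gt1 cop)//.
case h : (b %| d); rewrite ?andbF//=.
by rewrite ltnS dvdn_leq// sqf_gt0.
Qed.

Lemma sqf_mul r e : sqf r -> sqf e -> (forall b, inB b -> b %| r -> ~~ (b %| e)) ->
  sqf (r * e) /\ forall b, inB b -> (b %| r * e) = (b %| r) || (b %| e).
Proof.
move=> sr se H; pose D := (r * e).+1.
have rD : r < D by rewrite ltnS leq_pmulr// sqf_gt0.
have eD : e < D by rewrite ltnS leq_pmull// sqf_gt0.
have E : r * e = bpr D (fun b => (b %| r) || (b %| e)).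
  rewrite (bprodID _ _ _ (fun b => b %| r)) -{1}(bsqfE gt1 sr rD) -{1}(bsqfE gt1 se eD).
  congr (_ * _); apply: eq_bprod => b Bb.
    by case: (b %| r); rewrite ?andbF ?andbT.
  by have [h|h] := boolP (b %| r); rewrite ?andbF ?andbT ?(negbTE (H _ Bb h)) ?andbF.
split; first by rewrite E; exact: bsqf_bprod.
move=> b Bb; rewrite E (dvdn_bprod gt1 cop)//; case h : (_ || _); rewrite ?andbF// andbT.
case/orP: h => h; [apply: leq_ltn_trans rD|apply: leq_ltn_trans eD]; by rewrite dvdn_leq// sqf_gt0.
Qed.

Lemma sqf_b b : inB b -> sqf b.
Proof.
move=> Bb; have E : b = bpr b.+1 (fun c => c == b).
  rewrite /bprod (bigD1 (Ordinal (ltnSn b))) /=; last by rewrite Bb eqxx.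
  by rewrite big1 ?muln1// => c /andP[/andP[_ /eqP cb] /eqP []]; exact/val_inj.
by rewrite E; exact: bsqf_bprod.
Qed.

Lemma coprime_sqf b d : inB b -> sqf d -> ~~ (b %| d) -> coprime b d.
Proof.
move=> Bb sd bd; rewrite -(bsqfE gt1 sd (ltnSn d)); apply: (coprime_bprod cop) => //.
by rewrite (negbTE bd) andbF.
Qed.

Lemma dvd_b_b b c : inB b -> inB c -> (b %| c) = (b == c).
Proof.
move=> Bb Bc; apply/idP/eqP => [bc|->//]; apply/eqP; apply: contraT => bnc.
have := cop Bb Bc bnc; rewrite /coprime (gcdn_idPl bc) => /eqP b1.
by have := gt1 Bb; rewrite b1.
Qed.

Definition Bfactors n := [seq b <- iota 0 n.+1 | inB b && (b %| n)].

Lemma Bfactors_prod n : sqf n -> \prod_(b <- Bfactors n) b = n.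
Proof.
move=> sn; rewrite big_filter -[RHS](bsqfE gt1 sn (ltnSn n)) /bprod.
by rewrite -(big_mkord (fun b => inB b && (b %| n)) (fun b => b)) /index_iota subn0.
Qed.

Lemma mem_Bfactors n b : 0 < n -> (b \in Bfactors n) = inB b && (b %| n).
Proof.
move=> n0; rewrite mem_filter mem_iota add0n ltnS leq0n /=.
by case h : (b %| n); rewrite ?andbF// (dvdn_leq n0 h) andbT.
Qed.

Lemma prod_uniq_sqf (s : seq nat) : uniq s -> {in s, forall b, inB b} ->
  sqf (\prod_(b <- s) b) /\ forall b, inB b -> (b %| \prod_(b <- s) b) = (b \in s).
Proof.
elim: s => [_ _|c s IH /= /andP[cs us] sB].
  rewrite big_nil; split; first exact: bsqf1.
  by move=> b Bb; rewrite dvdn1 in_nil; apply/negbTE; have := gt1 Bb; case: (ltngtP b 1).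
have Bc : inB c by apply: sB; rewrite mem_head.
have [|ss sd] := IH us; first by move=> b bs; apply: sB; rewrite in_cons bs orbT.
have := @sqf_mul c (\prod_(b <- s) b) (sqf_b Bc) ss; rewrite big_cons => -[].
  by move=> b Bb; rewrite dvd_b_b// sd// => /eqP ->.
by move=> h1 h2; split => // b Bb; rewrite h2// in_cons dvd_b_b// sd.
Qed.

Lemma uniq_of_no_square (s : seq nat) :
  {in s, forall b, ~~ (b ^ 2 %| \prod_(c <- s) c)} -> uniq s.
Proof.
elim: s => //= c s IH H; apply/andP; split.
  apply/negP => cs; have := H c (mem_head _ _).
  by rewrite big_cons -mulnn dvdn_pmul2l ?(big_rem c cs) /= ?dvdn_mulr//;
     case: c cs H => // cs /(_ 0 (mem_head _ _)); rewrite big_cons mul0n.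
apply: IH => b bs; apply: contra (H b _); last by rewrite in_cons bs orbT.
by rewrite big_cons => h; rewrite dvdn_mull.
Qed.

Lemma sqf_no_square n b : sqf n -> inB b -> ~~ (b ^ 2 %| n).
Proof.
move=> sn Bb; apply/negP => bbn.
have bn : b %| n by apply: dvdn_trans bbn; rewrite -mulnn dvdn_mulr.
have [_ /(_ b Bb)] := sqf_div sn (sqf_b Bb) bn; rewrite dvdnn andbF.
by rewrite dvdn_divRL// -?mulnn; move: bbn; rewrite -mulnn => ->.
Qed.

Lemma sqf_generated n : sqf n -> generated_semigroup B n.
Proof.
move=> sn; exists (Bfactors n); last by rewrite Bfactors_prod.
by move=> b; rewrite mem_Bfactors ?sqf_gt0// => /andP[/set_mem].
Qed.

Lemma generated_no_square_sqf n : generated_semigroup B n ->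
  (forall b, B b -> ~~ (b ^ 2 %| n)) -> sqf n.
Proof.
move=> [s sB nE] nsq; have {}nE : n = \prod_(b <- s) b := nE.
have us : uniq s by apply: uniq_of_no_square => b /sB Bb; rewrite -nE; exact: nsq.
by rewrite nE; have [] := prod_uniq_sqf us (fun b bs => mem_set (sB b bs)).
Qed.

(** Any factorization into distinct elements is a permutation of the list of elements of [B]
    dividing [n], so the choice made by [xget] is immaterial. *)
Lemma mu_sqf n : sqf n -> mu_B B n = ((-1) ^+ size (Bfactors n))%R.
Proof.
move=> sn; rewrite /mu_B; case: asboolP => [[|[b Bb]]|_].
- by move=> h; exfalso; apply: h; exact: sqf_generated.
- by move/negP: (sqf_no_square sn (mem_set Bb)).
congr (_ ^+ _)%R.
case: xgetP => [s _ [us sB nE]|/(_ (Bfactors n)) h].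
  apply/perm_size/uniq_perm => //; first by rewrite filter_uniq ?iota_uniq.
  have [ss sd] := prod_uniq_sqf us (fun b bs => mem_set (sB b bs)).
  move=> b; rewrite mem_Bfactors ?sqf_gt0//.
  apply/idP/andP => [bs|[Bb bn]].
    by have Bb := mem_set (sB b bs); split => //; rewrite nE sd.
  by rewrite -sd// -nE.
exfalso; apply: h; split; first by rewrite filter_uniq ?iota_uniq.
  by move=> b; rewrite mem_Bfactors ?sqf_gt0// => /andP[/set_mem].
by rewrite Bfactors_prod.
Qed.

Lemma B_squarefreeE n : (n \in B_squarefree B) = sqf n.
Proof.
apply/idP/idP => [/set_mem|sn]; last first.
  by apply: mem_set; rewrite /B_squarefree /= mu_sqf// sqrr_sign.
rewrite /B_squarefree /mu_B /=; case: asboolP => [_|/not_orP[/contrapT gn nsq _]].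
  by rewrite expr0n.
apply: generated_no_square_sqf => // b Bb; apply/negP => bn.
by apply: nsq; exists b.
Qed.

Lemma mu_1 : mu_B B 1 = 1%R.
Proof.
rewrite mu_sqf; last exact: bsqf1.
rewrite /Bfactors (_ : [seq b <- iota 0 2 | _] = [::])//.
apply/eqP; rewrite -(negbK (_ == _)) -has_filter; apply/hasPn => b _.
by rewrite negb_and dvdn1; case Bb : (inB b) => //=; have := gt1 Bb; case: (ltngtP b 1).
Qed.

Lemma mu_mul r e : sqf r -> sqf e -> (forall b, inB b -> b %| r -> ~~ (b %| e)) ->
  mu_B B (r * e) = (mu_B B r * mu_B B e)%R.
Proof.
move=> sr se H; have [sre dre] := sqf_mul sr se H.
rewrite !mu_sqf// -exprD; congr (_ ^+ _)%R; rewrite -size_cat.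
apply/perm_size/uniq_perm; first by rewrite filter_uniq ?iota_uniq.
  rewrite cat_uniq !filter_uniq ?iota_uniq// andbT /=; apply/hasPn => b.
  rewrite !mem_Bfactors ?sqf_gt0// => /andP[Bb be]; rewrite Bb /=.
  by apply/negP => /(H _ Bb); rewrite be.
move=> b; rewrite mem_cat !mem_Bfactors ?sqf_gt0//.
by case Bb : (inB b) => //=; rewrite dre.
Qed.

Lemma mu_b b : inB b -> mu_B B b = (-1)%R.
Proof.
move=> Bb; rewrite (mu_sqf (sqf_b Bb)) -[RHS]expr1; congr (_ ^+ _)%R.
rewrite -[1]/(size [:: b]); apply/perm_size/uniq_perm => //; first by rewrite filter_uniq ?iota_uniq.
move=> c; rewrite mem_Bfactors ?(ltnW (gt1 Bb))// inE.
apply/andP/eqP => [[Bc]|->]; first by rewrite dvd_b_b// => /eqP.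
by rewrite dvdnn.
Qed.

(** Splits off one element [b], the multiples of [b] being written [b * d]. Both the Möbius identity
    and the expansion of the Euler products rest on it. *)
Lemma sum_sqf_split (V : nmodType) b D (P : pred nat) (F : nat -> V) : inB b ->
  (\sum_(d < D | sqf d && P d) F d = \sum_(d < D | [&& sqf d, P d & ~~ (b %| d)%N]) F d +
   \sum_(d < D | [&& sqf d, ~~ (b %| d)%N, (b * d < D)%N & P (b * d)%N]) F (b * d)%N)%R.
Proof.
move=> Bb; have b0 := ltnW (gt1 Bb).
rewrite (bigID (fun d : 'I_D => ~~ (b %| d))) /=; congr (_ + _)%R.
  by apply: eq_bigl => d; rewrite andbA.
rewrite -(big_mkord (fun d => (sqf d && P d) && ~~ ~~ (b %| d)) F).
rewrite -(big_mkord (fun d => [&& sqf d, ~~ (b %| d), (b * d < D) & P (b * d)]) (fun d => F (b * d))).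
rewrite -!(big_filter _ (fun d => [&& sqf d, _, _ & _])) -big_filter.
rewrite -(big_map (muln b) xpredT F); apply: perm_big; apply: uniq_perm.
- by rewrite filter_uniq// iota_uniq.
- by rewrite map_inj_uniq ?filter_uniq ?iota_uniq// => x y /eqP; rewrite eqn_pmul2l// => /eqP.
move=> x; rewrite mem_filter mem_index_iota negbK.
apply/andP/mapP => [[/andP[/andP[sx Px] bx] /andP[_ xD]]|[d]].
  have [sd dd] := sqf_div sx (sqf_b Bb) bx.
  have xE : x = b * (x %/ b) by rewrite mulnC divnK.
  exists (x %/ b) => //; rewrite mem_filter mem_index_iota sd dd// dvdnn andbF -xE xD Px /=.
  by apply: leq_ltn_trans xD; exact: leq_div.
rewrite mem_filter mem_index_iota => /andP[/and4P[sd nbd bdD PbD] _] ->.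
rewrite PbD bdD dvdn_mulr// !andbT; split => //.
have [] // := @sqf_mul b d (sqf_b Bb) sd.
by move=> c Bc; rewrite dvd_b_b// => /eqP ->.
Qed.

(** If some [b] divides [u], the divisors [d] and [b * d] with [d] prime to [b] cancel in pairs;
    otherwise [d = 1] is the only term. *)
Lemma mu_sum_Bfree (V : pzRingType) u D : 0 < u -> u < D ->
  (\sum_(d < D | sqf d && (d %| u)%N) (mu_B B d)%:~R = (`[< B_free B u >])%:R :> V)%R.
Proof.
move=> u0 uD; case: asboolP => [[_ ufree]|nfree].
  rewrite (bigD1 (Ordinal (leq_ltn_trans u0 uD : 1 < D)))%N /=; last first.
    by rewrite dvd1n (bsqf1 gt1).
  rewrite mu_1 big1 ?addr0// => d /andP[/andP[sd du] d1]; exfalso.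
  move/eqP: d1; apply; apply/val_inj => /=; apply: eq_sqf => //; first exact: bsqf1.
  move=> b Bb; rewrite dvdn1; apply/idP/eqP => [bd|->]; last exact: dvd1n.
  by have := ufree b (set_mem Bb); rewrite (dvdn_trans bd du).
have [b Bb bu] : exists2 b, inB b & b %| u.
  apply: contrapT => h; apply: nfree; split => // b Bb; apply/negP => bu.
  by apply: h; exists b => //; exact: mem_set.
rewrite (@sum_sqf_split V b D (fun d => d %| u) (fun d => (mu_B B d)%:~R)%R Bb) [X in (_ + X)%R](_ : _ = (- \sum_(d < D | [&& sqf d, (d %| u)%N & ~~ (b %| d)%N]) (mu_B B d)%:~R)%R) ?subrr//.
rewrite -sumrN; apply: eq_big => [d|d /and4P[sd nbd _ _]]; last first.
  rewrite (mu_mul (sqf_b Bb) sd) ?(mu_b Bb) ?mulN1r ?mulrNz// => c Bc; rewrite dvd_b_b// => /eqP ->//.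
case sd : (sqf d) => //=; case bd : (b %| d); rewrite ?andbF//= andbT.
have cbd : coprime b d by apply: coprime_sqf; rewrite ?bd.
rewrite Gauss_dvd// bu /=; case du : (d %| u); rewrite ?andbF// andbT.
apply: leq_ltn_trans uD; apply: dvdn_leq => //.
by rewrite Gauss_dvd// bu.
Qed.

Lemma generated_mul m n : generated_semigroup B m -> generated_semigroup B n ->
  generated_semigroup B (m * n).
Proof.
move=> [s sB ->] [t tB ->]; exists (s ++ t); last by rewrite big_cat.
by move=> b; rewrite mem_cat => /orP[/sB|/tB].
Qed.

Lemma generated_gt0 n : generated_semigroup B n -> 0 < n.
Proof.
move=> [s sB ->]; rewrite big_seq prodn_cond_gt0// => b /sB/B_ge2 /=; exact: ltnW.
Qed.

Lemma generated_sqf_square n : generated_semigroup B n ->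
  exists r q, [/\ sqf r, generated_semigroup B q & n = r * q ^ 2].
Proof.
move=> [s sB ->]; elim: s sB => [|b s IH] sB.
  exists 1, 1; split; [exact: bsqf1|by exists [::] => //; rewrite big_nil|by rewrite big_nil].
have Bb : B b by apply: sB; rewrite mem_head.
have bB : inB b := mem_set Bb.
have [|r [q [sr gq E]]] := IH; first by move=> c cs; apply: sB; rewrite in_cons cs orbT.
rewrite big_cons E; have [br|nbr] := boolP (b %| r).
  have [sd _] := sqf_div sr (sqf_b bB) br.
  exists (r %/ b), (b * q); split => //.
    apply: generated_mul => //; exists [:: b]; last by rewrite big_seq1.
    by move=> c; rewrite inE => /eqP ->.
  by rewrite -{1}(divnK br) expnMn -mulnn; ring.
exists (b * r), q; split => //; last exact: mulnA.
have [] // := @sqf_mul b r (sqf_b bB) sr.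
by move=> c Bc; rewrite dvd_b_b// => /eqP ->.
Qed.

(** Decidable form of the condition that $\gcd(a, r)$ be $B$-free. Such fractions need not be in
    lowest terms: only common factors from [B] are excluded. *)
Definition breduced a r := [forall b : 'I_r.+1, (inB b && (b %| r)) ==> ~~ (b %| a)].

Lemma breducedP a r : 0 < r ->
  reflect (forall b, inB b -> b %| r -> ~~ (b %| a)) (breduced a r).
Proof.
move=> r0; apply: (iffP forallP) => [H b Bb br|H b]; last first.
  by apply/implyP => /andP[Bb br]; exact: H.
have bl : b < r.+1 by rewrite ltnS dvdn_leq.
by have /implyP := H (Ordinal bl); rewrite /= Bb br; exact.
Qed.

Lemma breduced_free a r : 0 < r -> breduced a r = `[< B_free B (gcdn a r) >].
Proof.
move=> r0; apply/(breducedP _ r0)/asboolP => [H|[_ H] b Bb br].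
  split; first by rewrite gcdn_gt0 r0 orbT.
  by move=> b Bb; rewrite dvdn_gcd negb_and; case: (boolP (b %| r)) => [/(H _ (mem_set Bb))->|]; rewrite ?orbT.
by have := H b (set_mem Bb); rewrite dvdn_gcd br andbT.
Qed.

(** The reduced denominator of $a/d$ is the product [ra a] of the elements of [B] dividing [d] but
    not [a]; its cofactor in [d] divides [a] and is cancelled. *)
Lemma sum_residues_reduced (R : realType) (V : nmodType) (F : R -> V) d : sqf d ->
  (\sum_(1 <= a < d.+1) F (a%:R / d%:R)%R =
   \sum_(r < d.+1 | sqf r && (r %| d)%N) \sum_(1 <= a < r.+1 | breduced a r) F (a%:R / r%:R))%R.
Proof.
move=> sd; have d0 := sqf_gt0 sd.
pose ra a := bpr d.+1 (fun b => (b %| d) && ~~ (b %| a)).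
have ra_dvd a b : inB b -> (b %| ra a) = (b %| d) && ~~ (b %| a).
  move=> Bb; rewrite /ra (dvdn_bprod gt1 cop)//; case h : (b %| d); rewrite ?andbF//=.
  by rewrite ltnS dvdn_leq.
have ra_sqf a : sqf (ra a) by exact: bsqf_bprod.
have ra_d a : ra a %| d by apply: sqf_dvd => // b Bb; rewrite ra_dvd// => /andP[].
have ra_lt a : ra a < d.+1 by rewrite ltnS dvdn_leq.
rewrite big_nat_cond (eq_bigl (fun a => (1 <= a < d.+1))); last by move=> a; rewrite andbT.
rewrite (partition_big (fun a => Ordinal (ra_lt a)) (fun r : 'I_d.+1 => sqf r && (r %| d))) /=; last first.
  by move=> a _; rewrite ra_sqf ra_d.
apply: eq_bigr => r /andP[sr rd]; have r0 := sqf_gt0 sr.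
pose e := d %/ r; have [se de] := sqf_div sd sr rd.
have dE : d = e * r by rewrite divnK.
have e0 : 0 < e by rewrite sqf_gt0.
rewrite -big_filter.
transitivity (\sum_(a <- [seq (e * a')%N | a' <- [seq a <- index_iota 1 r.+1 | breduced a r]]) F (a%:R / d%:R))%R.
  apply: perm_big; apply: uniq_perm.
  - by rewrite filter_uniq// iota_uniq.
  - by rewrite map_inj_uniq ?filter_uniq ?iota_uniq// => x y /eqP; rewrite eqn_pmul2l// => /eqP.
  move=> a; rewrite mem_filter mem_index_iota.
  apply/andP/mapP => [[/andP[/andP[a1 ad] /eqP/(congr1 val)/= rE] _]|[a']].
    have ea : e %| a.
      apply: sqf_dvd => // b Bb; rewrite de// -rE ra_dvd//.
      by case: (b %| d) => //=; rewrite negbK.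
    exists (a %/ e); last by rewrite mulnC divnK.
    rewrite mem_filter mem_index_iota; apply/and3P; split.
    - apply/breducedP => // b Bb br; have : b %| ra a by rewrite rE.
      rewrite ra_dvd// => /andP[_]; apply: contra => /dvdn_mulr -/(_ e).
      by rewrite divnK.
    - by rewrite divn_gt0// dvdn_leq.
    - by rewrite ltnS -(leq_pmul2r e0) divnK// mulnC -dE -ltnS.
  rewrite mem_filter mem_index_iota => /and3P[/(breducedP _ r0) red a1 ar] ->.
  have red' : 1 <= e * a' < d.+1 by rewrite muln_gt0 e0 a1 /= ltnS dE leq_pmul2l.
  rewrite !red'; split => //; rewrite andTb; apply/eqP/val_inj => /=.
  apply: eq_sqf => // b Bb; rewrite ra_dvd//.
  case bd : (b %| d) => /=; last by apply/esym/negbTE; apply: contraFN bd => /dvdn_trans; exact.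
  case br : (b %| r).
    have : b %| e = false by rewrite de// br andbF.
    move=> be; have cbe : coprime b e by apply: coprime_sqf; rewrite ?be.
    by rewrite Gauss_dvdr// red.
  by apply/negbTE; rewrite negbK dvdn_mulr// de// bd br.
rewrite big_map big_filter; apply: eq_bigr => a _; congr F.
have e0' : e%:R != 0%R :> R by rewrite pnatr_eq0 -lt0n.
by rewrite [in LHS]dE !natrM -mulf_div divff// mul1r.
Qed.

End SquarefreeSemigroup.

(** * Euler products, the coefficients g, and squarefree counting *)

Section Density.
Context {R : realType}.
Variables (B : set nat) (alpha : R).
Hypothesis B_ge2 : B `<=` [set b | 2 <= b]%N.
Hypothesis B_cop : {in B &, forall b c, b != c -> coprime b c}.
Hypothesis alpha01 : 0 < alpha < 1.
Hypothesis B_regular : regularly_varying (generated_semigroup B) alpha.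
Implicit Types (b d n r D K M : nat) (x y e t : R).

Local Notation J := (generated_semigroup B).
Local Notation sqf := (bsqf (inB B)).
Local Notation N := (counting_function (generated_semigroup B) : R -> R).
Local Notation N1 := (counting_function (B_squarefree B) : R -> R).
Local Notation mu d := ((mu_B B d)%:~R : R).

Let gt1 := @inB_gt1 B B_ge2.
Let cop := @inB_coprime B B_cop.
Let sqfJ d : sqf d -> d \in J.
Proof. by move=> sd; exact/mem_set/(sqf_generated B_ge2 sd). Qed.

Lemma counting_poly_upper beta : alpha < beta -> exists C x0, [/\ 1 <= x0, 0 < C &
  forall x, x0 <= x -> N x <= C * x `^ beta].
Proof.
move=> ab; have /andP[a0 a1] := alpha01.
pose eta := Num.min (beta - alpha) (alpha / 2).
have eta0 : 0 < eta by rewrite lt_min subr_gt0 ab divr_gt0.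
have etaa : 0 < eta < alpha by rewrite eta0 /= gt_min ltr_pdivrMr// mulr_natr mulr2n ltrDl a0 orbT.
have [C [x0 [x01 C0 H]]] := counting_potter B_regular etaa.
have x00 : 0 < x0 by exact: lt_le_trans x01.
exists (C * (x0 `^ beta)^-1 * N x0 + C * N x0), x0; split => //.
  have [Nx0 _ _] := H x0 x0 (lexx _) (lexx _).
  by rewrite addr_gt0// !mulr_gt0// invr_gt0 powR_gt0.
move=> x xx0; have [Nx0 h _] := H x0 x (lexx _) xx0; apply: le_trans h _.
have xp : 0 < x by exact: lt_le_trans xx0.
rewrite mulrAC [leRHS](_ : _ = C * N x0 * ((x0 `^ beta)^-1 * x `^ beta) + C * N x0 * x `^ beta); last by ring.
apply: (@le_trans _ _ (C * N x0 * ((x0 `^ beta)^-1 * x `^ beta))); last first.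
  by rewrite lerDl !mulr_ge0 ?powR_ge0 ?(ltW C0) ?(ltW Nx0).
rewrite ler_wpM2l ?mulr_ge0 ?(ltW C0) ?(ltW Nx0)//.
have -> : (x0 `^ beta)^-1 * x `^ beta = (x / x0) `^ beta.
  rewrite powRM ?invr_ge0 ?(ltW x00) ?(ltW xp)// mulrC; congr (_ * _).
  by rewrite -[x0^-1]powR_inv1 ?(ltW x00)// -powRrM mulN1r powRN.
rewrite ler_powR ?ler_pdivlMr ?mul1r//.
by rewrite -lerBrDl /eta ge_min lexx.
Qed.

Lemma recip_tail beta : alpha < beta < 1 -> exists C x0, [/\ 1 <= x0, 0 < C &
  forall y M, x0 <= y ->
   \sum_(d < M | ((d : nat) \in J) && (y < d%:R)) (d%:R)^-1 <= C * y `^ (beta - 1)].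
Proof.
move=> /andP[ab b1]; have /andP[a0 a1] := alpha01.
have [C [x0 [x01 C0 H]]] := counting_tail alpha01 B_regular a1.
have [C' [x0' [x01' C0' H']]] := counting_poly_upper ab.
exists (C * C'), (Num.max x0 x0'); split; [by rewrite le_max x01|exact: mulr_gt0|].
move=> y M; rewrite ge_max => /andP[y1 y2].
have y0 : 0 < y by apply: lt_le_trans y1; apply: lt_le_trans x01.
rewrite (eq_bigr (fun d : 'I_M => d%:R `^ (-1))); last first.
  by move=> d _; rewrite powR_inv1.
apply: le_trans (H y M y1) _.
have -> : y `^ (beta - 1) = y `^ beta * y^-1.
  by rewrite -[y^-1]powR_inv1 ?(ltW y0)// -powRD ?(gt_eqF y0) ?implybT.
rewrite powR_inv1 ?(ltW y0)//.
rewrite -mulrA [leRHS](_ : _ = C * (y^-1 * (C' * y `^ beta))); last by ring.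
by rewrite !ler_wpM2l ?(ltW C0) ?invr_ge0 ?(ltW y0)// H'.
Qed.

Lemma recip_tail_small e : 0 < e -> exists y0, 1 <= y0 /\ forall M,
  \sum_(d < M | ((d : nat) \in J) && (y0 < d%:R)) (d%:R)^-1 <= e.
Proof.
move=> e0; have /andP[a0 a1] := alpha01.
have [|C [x0 [x01 C0 H]]] := @recip_tail ((alpha + 1) / 2); first by apply/andP; split; lra.
pose g : R := 1 - (alpha + 1) / 2; have g0 : 0 < g by rewrite /g; lra.
have C1 : 0 < (C / e) `^ g^-1 by rewrite powR_gt0// divr_gt0.
exists (Num.max x0 ((C / e) `^ g^-1)); split; first by rewrite le_max x01.
move=> M; set y := Num.max _ _; have yx : x0 <= y by rewrite le_max lexx.
apply: le_trans (H y M yx) _.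
have -> : (alpha + 1) / 2 - 1 = - g by rewrite /g; ring.
have yy : (C / e) `^ g^-1 <= y by rewrite le_max lexx orbT.
have y0 : 0 < y by exact: lt_le_trans yy.
rewrite powRN ler_pdivrMr ?powR_gt0// mulrC -ler_pdivrMr//.
apply: (@le_trans _ _ (((C / e) `^ g^-1) `^ g)).
  by rewrite -powRrM mulVf ?gt_eqF// powRr1// divr_ge0// ltW.
by rewrite ge0_ler_powR ?nnegrE ?(ltW g0) ?(ltW C1) ?(ltW y0).
Qed.

Lemma recip_sum_bounded : exists C : R, 0 < C /\ forall M,
  \sum_(d < M | (d : nat) \in J) (d%:R)^-1 <= C.
Proof.
have [y0 [y1 H]] := recip_tail_small ltr01.
exists (N y0 + 1); split; first by rewrite ltr_wpDl// counting_function_ge0.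
move=> M; rewrite (bigID (fun d : 'I_M => d%:R <= y0)) /=; apply: lerD; last first.
  apply: le_trans (H M); rewrite le_eqVlt; apply/orP; left; apply/eqP.
  by apply: eq_bigl => d; rewrite ltNge.
have y00 : 0 <= y0 by exact: le_trans y1.
apply: le_trans (counting_ge_sum J M y00).
apply: ler_sum => d /andP[dJ _]; rewrite invf_le1 ?ler1n ?ltr0n.
  exact: (generated_gt0 B_ge2 (set_mem dJ)).
exact: (generated_gt0 B_ge2 (set_mem dJ)).
Qed.

Definition euler_partial r M : R := \prod_(b < M | inB B b && ~~ (b %| r)%N) (1 - b%:R^-1).

Lemma euler_factor b : inB B b -> 2^-1 <= 1 - b%:R^-1 :> R /\ 1 - b%:R^-1 <= 1 :> R.
Proof.
move=> /gt1 b1; have b2 : 2 <= b%:R :> R by rewrite (ler_nat R 2 b).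
have b0 : 0 < b%:R :> R by exact: lt_le_trans b2.
have : b%:R^-1 <= 2^-1 :> R by rewrite lef_pV2 ?posrE.
have : 0 <= b%:R^-1 :> R by rewrite invr_ge0 ltW.
by move=> *; split; lra.
Qed.

Lemma euler_partial_ge0 r M : 0 <= euler_partial r M.
Proof.
apply: prodr_ge0 => b /andP[/euler_factor[h _] _]; apply: le_trans h; by rewrite invr_ge0.
Qed.

Lemma euler_partial_gt0 r M : 0 < euler_partial r M.
Proof.
apply: prodr_gt0 => b /andP[/euler_factor[h _] _]; apply: lt_le_trans h; by rewrite invr_gt0.
Qed.

Lemma euler_partialS r M : euler_partial r M.+1 =
  euler_partial r M * (if inB B M && ~~ (M %| r)%N then 1 - M%:R^-1 else 1).
Proof. by rewrite /euler_partial big_mkcond big_ord_recr -big_mkcond. Qed.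

Lemma euler_partial_noninc r : nonincreasing_seq (euler_partial r).
Proof.
apply/nonincreasing_seqP => M; rewrite euler_partialS ler_piMr ?euler_partial_ge0//.
by case: ifP => // /andP[/euler_factor[_ h] _].
Qed.

Lemma euler_partial_le1 r M : euler_partial r M <= 1.
Proof.
have : euler_partial r M <= euler_partial r 0 by apply: euler_partial_noninc.
by rewrite {2}/euler_partial big_ord0.
Qed.

Lemma euler_partial_cvg r : cvgn (euler_partial r).
Proof.
apply: nonincreasing_is_cvgn; first exact: euler_partial_noninc.
by exists 0 => _ [M _ <-]; exact: euler_partial_ge0.
Qed.

Lemma euler_prodE r : euler_prod (B `&` [set b | ~~ (b %| r)%N]) = limn (euler_partial r).
Proof.
rewrite /euler_prod; congr (limn _); apply/funext => M; rewrite big_mkord.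
apply: eq_bigl => b; rewrite /inB in_setI; congr (_ && _).
by apply/idP/idP => [/set_mem|h]//; exact: mem_set.
Qed.

Lemma sieve_densityE : sieve_density B = limn (euler_partial 1).
Proof.
rewrite /sieve_density /euler_prod; congr (limn _); apply/funext => M; rewrite big_mkord.
apply: eq_bigl => b; rewrite /inB dvdn1; case Bb : (_ \in _) => //=.
by have := gt1 Bb; case: (ltngtP b 1%N).
Qed.

Lemma mu_abs d : sqf d -> `|mu d| = 1.
Proof. by move=> sd; rewrite mu_sqf// rmorphXn /= normrX rmorphN1 normrN1 expr1n. Qed.

(** Expansion of the finite product, one factor at a time. [K] is any bound beyond all divisors, so
    that sums for different [M] can be compared on a common range. *)
Lemma euler_divisor_sum r M K : (bprod (inB B) M (fun b => ~~ (b %| r)%N) < K)%N ->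
  euler_partial r M =
  \sum_(d < K | sqf d && (d %| bprod (inB B) M (fun b => ~~ (b %| r)))%N) mu d / d%:R.
Proof.
elim: M K => [|M IH] K.
  rewrite /bprod /euler_partial !big_ord0 => K1.
  rewrite (bigD1 (Ordinal K1)) /= ?(bsqf1 gt1)// mu_1// divr1 big1 ?addr0// => d.
  rewrite dvdn1 => /andP[/andP[_ /eqP d1]] /eqP; case; exact/val_inj.
have bS : bprod (inB B) M.+1 (fun b => ~~ (b %| r)%N) =
   (bprod (inB B) M (fun b => ~~ (b %| r)%N) * (if inB B M && ~~ (M %| r)%N then M else 1))%N.
  by rewrite /bprod big_mkcond big_ord_recr -big_mkcond.
rewrite euler_partialS bS; set X := bprod _ M _ in IH *.
have X0 : (0 < X)%N by exact: bprod_gt0.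
case: ifP => [/andP[BM Mr]|_]; last by rewrite muln1 mulr1; exact: IH.
move=> XK; have M1 := gt1 BM.
have XltK : (X < K)%N by apply: leq_ltn_trans XK; rewrite leq_pmulr// ltnW.
have MX : ~~ (M %| X)%N by rewrite (dvdn_bprod gt1 cop)// ltnn.
have cMX : coprime M X by apply: (coprime_bprod cop) => //; rewrite ltnn.
rewrite (@sum_sqf_split B B_ge2 B_cop _ M K (fun d => d %| X * M)%N (fun d => mu d / d%:R) BM).
have E1 : \sum_(d < K | [&& sqf d, (d %| X * M)%N & ~~ (M %| d)%N]) mu d / d%:R =
    \sum_(d < K | sqf d && (d %| X)%N) mu d / d%:R.
  apply: eq_bigl => d; case sd : (sqf d) => //=.
  apply/andP/idP => [[dXM Md]|dX].
    apply: (sqf_dvd B_ge2 B_cop sd) => b Bb bd.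
    have := dvdn_trans bd dXM; rewrite Gauss_dvdl//.
    by apply: cop => //; apply: contraNneq Md => <-.
  by rewrite dvdn_mulr//; split => //; apply: contra MX => /dvdn_trans; exact.
have E2 : \sum_(d < K | [&& sqf d, ~~ (M %| d)%N, (M * d < K)%N & (M * d %| X * M)%N])
     mu (M * d)%N / (M * d)%:R = - M%:R^-1 * \sum_(d < K | sqf d && (d %| X)%N) mu d / d%:R.
  rewrite mulr_sumr; apply: eq_big => [d|d /and4P[sd Md _ _]]; last first.
    rewrite (mu_mul B_ge2 B_cop (sqf_b B_ge2 B_cop BM) sd); last first.
      by move=> c Bc; rewrite (dvd_b_b B_ge2 B_cop Bc BM) => /eqP ->.
    rewrite mu_b// mulN1r mulrNz natrM invfM; ring.
  case sd : (sqf d) => //=; rewrite [(X * M)%N]mulnC dvdn_pmul2l ?(ltnW M1)//.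
  case dX : (d %| X)%N; rewrite ?andbF// andbT; apply/andP; split.
    by apply: contra MX => /dvdn_trans; exact.
  by apply: leq_ltn_trans XK; rewrite mulnC leq_mul2r dvdn_leq ?orbT.
by rewrite E1 E2 (IH K)//; ring.
Qed.

(** For [D <= M] a squarefree [d < D] divides the product of the admissible [b < M] exactly when it
    has no factor from [B] in common with [r]. The remaining terms of the expansion have [d >= D]
    and total at most [t], uniformly in [M]. *)
Lemma density_approx r D t :
  (forall M, \sum_(d < M | sqf d && (D <= d)%N) (d%:R)^-1 <= t) ->
  `|limn (euler_partial r) - \sum_(d < D | sqf d && breduced B r d) mu d / d%:R| <= t.
Proof.
move=> Ht; set S := \sum_(d < D | _) _.
have key M : (D <= M)%N -> `|euler_partial r M - S| <= t.
  move=> DM; set X := bprod (inB B) M (fun b => ~~ (b %| r)%N).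
  pose K := (maxn D X.+1).
  have XK : (X < K)%N by rewrite leq_max ltnSn orbT.
  rewrite (euler_divisor_sum XK) -/X.
  have -> : S = \sum_(d < K | sqf d && (d %| X)%N && (d < D)%N) mu d / d%:R.
    rewrite /S (big_ord_widen_cond K (fun d => sqf d && breduced B r d) (fun d => mu d / d%:R)) ?leq_maxl//.
    apply: eq_bigl => d; case sd : (sqf d) => //=; case dD : (d < D)%N; rewrite ?andbF// !andbT.
    apply/(breducedP _ _ (sqf_gt0 B_ge2 sd))/idP => [H|dX b Bb bd].
      apply: (sqf_dvd B_ge2 B_cop sd) => b Bb bd; rewrite (dvdn_bprod gt1 cop)// H// andbT.
      by apply: leq_trans DM; apply: leq_ltn_trans dD; rewrite dvdn_leq// (sqf_gt0 B_ge2 sd).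
    by have := dvdn_trans bd dX; rewrite (dvdn_bprod gt1 cop)// => /andP[].
  rewrite (bigID (fun d : 'I_K => (d < D)%N)) /= addrC addrK.
  apply: le_trans (ler_norm_sum _ _ _) _; apply: le_trans (Ht K).
  rewrite big_mkcond [leRHS]big_mkcond; apply: ler_sum => d _.
  case: ifP => [/andP[/andP[sd _] dD]|_]; last by case: ifP => // _; rewrite invr_ge0.
  by rewrite sd leqNgt dD /= normrM mu_abs// mul1r normfV normr_nat.
have cv : euler_partial r M - S @[M --> \oo] --> limn (euler_partial r) - S.
  by apply: cvgB; [exact: euler_partial_cvg|exact: cvg_cst].
have cvn : `|euler_partial r M - S| @[M --> \oo] --> `|limn (euler_partial r) - S| by exact: cvg_norm.
rewrite -(cvg_lim _ cvn)//; apply: limr_le; first by apply/cvg_ex; eexists; exact: cvn.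
by exists D => // M /= DM; exact: key.
Qed.

Lemma sqf_tail_le y D M : y < D%:R ->
  \sum_(d < M | sqf d && (D <= d)%N) (d%:R)^-1 <=
  \sum_(d < M | ((d : nat) \in J) && (y < d%:R)) (d%:R)^-1 :> R.
Proof.
move=> yD; rewrite big_mkcond [leRHS]big_mkcond; apply: ler_sum => d _.
case: ifP => [/andP[sd Dd]|_]; last by case: ifP => // _; rewrite invr_ge0.
by rewrite sqfJ// (lt_le_trans yD) ?ler_nat.
Qed.

(** Beyond a suitable [D] the reciprocals sum to at most $1/2$, and $\prod(1 - 1/b) \ge 1 - \sum
    1/b$ shows that the later factors at most halve the product. *)
Lemma sieve_density_gt0 : 0 < limn (euler_partial 1).
Proof.
have [y0 [y1 H]] := @recip_tail_small 2^-1 ltac:(by rewrite invr_gt0).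
pose D := (Num.truncn y0).+1.
have yD : y0 < D%:R by exact: truncnS_gt.
have key M : euler_partial 1 D / 2 <= euler_partial 1 (D + M).
  have [u [P1 P2]] : exists u : R, u <= \sum_(d < D + M | sqf d && (D <= d)%N) (d%:R)^-1 /\
     euler_partial 1 D * (1 - u) <= euler_partial 1 (D + M).
    exists (\sum_(b < D + M | inB B b && (D <= b)%N) b%:R^-1); split.
      rewrite big_mkcond [leRHS]big_mkcond; apply: ler_sum => d _.
      case: ifP => [/andP[Bd Dd]|_]; last by case: ifP => // _; rewrite invr_ge0.
      by rewrite Dd (sqf_b B_ge2 B_cop Bd).
    elim: M => [|M IH].
      rewrite addn0 big_pred0 ?subr0 ?mulr1// => d; by rewrite leqNgt ltn_ord andbF.
    rewrite addnS euler_partialS big_mkcond big_ord_recr -big_mkcond /= leq_addr andbT dvdn1.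
    set u := \sum_(_ < _ | _) _ in IH *.
    case: (boolP (inB B (D + M))) => [Bb|_] /=; last by rewrite addr0 mulr1.
    have [f1 f2] := euler_factor Bb.
    have -> /= : (D + M != 1)%N by have := gt1 Bb; case: (ltngtP (D + M) 1)%N.
    have u0 : 0 <= u by apply: sumr_ge0 => ? _; rewrite invr_ge0.
    have e0 := euler_partial_ge0 1 D.
    apply: le_trans (ler_wpM2r _ IH); last by apply: le_trans f1; rewrite invr_ge0.
    set z := (D + M)%:R^-1 : R in f1 f2 *.
    have z0 : 0 <= z by rewrite /z invr_ge0.
    rewrite -mulrA ler_wpM2l//; nra.
  apply: le_trans P2; rewrite ler_wpM2l ?euler_partial_ge0//.
  have := le_trans P1 (le_trans (sqf_tail_le (D + M) yD) (H _)); lra.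
apply: (@lt_le_trans _ _ (euler_partial 1 D / 2)); first by rewrite divr_gt0 ?euler_partial_gt0.
apply: limr_ge; first exact: euler_partial_cvg.
exists D => // M /= DM; by rewrite -(subnKC DM).
Qed.

Lemma euler_lim_ge r : limn (euler_partial 1) <= limn (euler_partial r).
Proof.
apply: ler_lim; [exact: euler_partial_cvg|exact: euler_partial_cvg|].
apply: nearW => M; rewrite /euler_partial big_mkcond [leRHS]big_mkcond.
apply: ler_prod => b _; rewrite dvdn1.
case Bb : (inB B b) => /=; last by rewrite ler01 lexx.
have [f1 f2] := euler_factor Bb.
have f0 : 0 <= 1 - b%:R^-1 :> R by apply: le_trans f1; rewrite invr_ge0.
have b1 := gt1 Bb; rewrite (gtn_eqF b1) /=.
by case: ifP => _; rewrite f0 ?f2 ?lexx.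
Qed.

Lemma euler_lim_le1 r : limn (euler_partial r) <= 1.
Proof.
by apply: limr_le; [exact: euler_partial_cvg|apply: nearW => M; exact: euler_partial_le1].
Qed.

Lemma gB_E r : g_B B r = mu r / r%:R * limn (euler_partial r).
Proof. by rewrite /g_B euler_prodE. Qed.

(* Weight of a fraction of reduced denominator [r] in [sum_(d < D) mu d / d],
   each [d] being expanded into the fractions of denominator [d]. *)
Definition gD D r : R := \sum_(d < D | sqf d && (r %| d)%N) mu d / d%:R.

(** Write [d = r * e] with [e] free of the factors of [r]; then [d < D] means that [e] is at most
    [(D.-1) %/ r]. The condition [0 < D] covers the empty sum. *)
Lemma gD_E D r : sqf r -> gD D r = mu r / r%:R *
  \sum_(e < ((D.-1) %/ r).+1 | sqf e && breduced B r e && (0 < D)%N) mu e / e%:R.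
Proof.
move=> sr; have r0 := sqf_gt0 B_ge2 sr.
case: D => [|D] /=; first by rewrite /gD big_ord0 big_pred0 ?mulr0// => e; rewrite andbF.
rewrite mulr_sumr /gD.
rewrite -(big_mkord (fun d => sqf d && (r %| d)%N) (fun d => mu d / d%:R)).
rewrite -(big_mkord (fun e : nat => sqf e && breduced B r e && (0 < D.+1)%N) (fun e : nat => mu r / r%:R * (mu e / e%:R))).
rewrite -big_filter -[RHS]big_filter.
transitivity (\sum_(d <- [seq (r * (e : nat))%N | e : nat <- [seq e : nat <- index_iota 0 (D %/ r).+1 | sqf e && breduced B r e && (0 < D.+1)%N]]) mu d / d%:R).
  apply: perm_big; apply: uniq_perm; first by rewrite filter_uniq// iota_uniq.
    by rewrite map_inj_uniq ?filter_uniq ?iota_uniq// => x y /eqP; rewrite eqn_pmul2l// => /eqP.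
  move=> d; rewrite mem_filter mem_index_iota leq0n andTb ltnS.
  apply/andP/mapP => [[/andP[sd rd] dD]|[e]].
    have [se de] := sqf_div B_ge2 B_cop sd sr rd.
    exists (d %/ r)%N; last by rewrite mulnC divnK.
    rewrite mem_filter mem_index_iota se !ltnS leq_div2r//= !andbT.
    by apply/breducedP; [exact: (sqf_gt0 B_ge2 se)|move=> b Bb; rewrite de// => /andP[]].
  rewrite mem_filter mem_index_iota ltnS => /andP[/andP[/andP[se bre] _] eD] ->.
  have [|sre _] := sqf_mul B_ge2 B_cop sr se.
    move=> b Bb br; apply/negP => be.
    by have /(breducedP _ _ (sqf_gt0 B_ge2 se))/(_ b Bb be) := bre; rewrite br.
  by rewrite sre dvdn_mulr//; split => //; rewrite mulnC -leq_divRL.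
rewrite big_map !big_filter; apply: eq_bigr => e /andP[/andP[se bre] _].
rewrite mu_mul//; last first.
  move=> b Bb br; apply/negP => be.
  by have /(breducedP _ _ (sqf_gt0 B_ge2 se))/(_ b Bb be) := bre; rewrite br.
by rewrite intrM natrM invfM; ring.
Qed.

Lemma gD_abs_le D r C : sqf r -> (forall M, \sum_(d < M | (d : nat) \in J) (d%:R)^-1 <= C) ->
  `|gD D r| <= C / r%:R.
Proof.
move=> sr HC; rewrite gD_E// !normrM mu_abs// mul1r normfV normr_nat mulrC.
rewrite ler_wpM2r ?invr_ge0//; apply: le_trans (ler_norm_sum _ _ _) _.
apply: le_trans (HC _); rewrite big_mkcond [leRHS]big_mkcond; apply: ler_sum => e _.
case: ifP => [/andP[/andP[se _] _]|_]; last by case: ifP => // _; rewrite invr_ge0.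
by rewrite sqfJ// normrM mu_abs// mul1r normfV normr_nat.
Qed.

(** [g_B B r] is the limit of [gD D r] as [D] grows, the cofactor sum of [gD_E] tending to the Euler
    product; the quality depends on $D/r$. *)
Lemma gD_gB D r t : sqf r -> (0 < D)%N ->
  (forall M, \sum_(d < M | sqf d && (((D.-1) %/ r).+1 <= d)%N) (d%:R)^-1 <= t) ->
  `|g_B B r - gD D r| <= t / r%:R.
Proof.
move=> sr D0 Ht; rewrite gD_E// gB_E -mulrBr !normrM mu_abs// mul1r normfV normr_nat mulrC.
rewrite ler_wpM2r ?invr_ge0//.
rewrite (eq_bigl (fun e : 'I_((D.-1) %/ r).+1 => sqf e && breduced B r e)); last first.
  by move=> e; rewrite D0 andbT.
exact: density_approx.
Qed.

Lemma gB_abs_le r : sqf r -> `|g_B B r : R| <= r%:R^-1.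
Proof.
move=> sr; rewrite gB_E !normrM mu_abs// mul1r normfV normr_nat.
have h := euler_lim_le1 r.
have h0 : 0 <= limn (euler_partial r).
  by apply: le_trans (euler_lim_ge r); exact/ltW/sieve_density_gt0.
by rewrite ger0_norm// ler_piMr// invr_ge0.
Qed.

Lemma gB_abs_ge r : sqf r -> limn (euler_partial 1) / r%:R <= `|g_B B r : R|.
Proof.
move=> sr; rewrite gB_E !normrM mu_abs// mul1r normfV normr_nat mulrC.
rewrite ler_wpM2l ?invr_ge0//; apply: le_trans (ler_norm _); exact: euler_lim_ge.
Qed.

(** Writing $n = r q^2$ with [r] squarefree gives $N(x) \le \sum_q N_1(x/q^2)$. By Potter's bounds
    $N(x/q^2) \ll q^{-s} N(x)$ with $s = 3\alpha/2 > \alpha$, so the large [q] contribute at most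
    $N(x)/2$; the finitely many others contribute at most $N_1(x)$ each. *)
Lemma sqf_count_lower : exists c x0, [/\ 1 <= x0, 0 < c & forall x, x0 <= x -> c * N x <= N1 x].
Proof.
have /andP[a0 a1] := alpha01.
have etaa : 0 < alpha / 4 < alpha by apply/andP; split; lra.
have [C [x0 [x01 C0 H]]] := counting_potter_low B_regular etaa.
pose s := 2 * (alpha - alpha / 4).
have sa : alpha < s by rewrite /s; lra.
have [C2 [x2 [x21 C20 H2]]] := counting_tail alpha01 B_regular sa.
pose bt := (alpha + s) / 2.
have abt : alpha < bt by rewrite /bt; lra.
have [C3 [x3 [x31 C30 H3]]] := counting_poly_upper abt.
pose g := s - bt; have g0 : 0 < g by rewrite /g /bt; lra.
pose K := 2 * C * C2 * C3.
have K0 : 0 < K by rewrite !mulr_gt0.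
(* The tail over $q > y$ is at most $\frac{K}{2}\, y^{-g}$, hence at most $1/2$ once $y^g \ge K$. *)
pose y := Num.max (Num.max x2 x3) (K `^ g^-1).
have y2 : x2 <= y by rewrite !le_max lexx.
have y3 : x3 <= y by rewrite !le_max lexx orbT.
have y1 : 1 <= y by exact: le_trans y2.
have y0 : 0 < y by exact: lt_le_trans y1.
have tail M : C * \sum_(d < M | ((d : nat) \in J) && (y < d%:R)) d%:R `^ (- s) <= 2^-1.
  apply: (@le_trans _ _ (C * (C2 * y `^ (- s) * (C3 * y `^ bt)))).
    rewrite ler_wpM2l ?(ltW C0)//; apply: le_trans (H2 y M y2) _.
    by rewrite ler_wpM2l ?H3// mulr_ge0 ?powR_ge0// ltW.
  have -> : C * (C2 * y `^ (- s) * (C3 * y `^ bt)) = K / 2 * (y `^ (- s) * y `^ bt).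
    by rewrite /K; field.
  rewrite -powRD ?(gt_eqF y0) ?implybT//; have -> : - s + bt = - g by rewrite /g; ring.
  rewrite powRN ler_pdivrMr ?powR_gt0// mulrC ler_pM2l//.
  apply: (@le_trans _ _ ((K `^ g^-1) `^ g)).
    by rewrite -powRrM mulVf ?gt_eqF// powRr1// ltW.
  by rewrite ge0_ler_powR ?nnegrE ?(ltW g0) ?powR_ge0 ?(ltW y0)// le_max lexx orbT.
pose Q := (Num.truncn y).+1.
exists (2 * Q%:R)^-1, (Num.max x0 1); split; [by rewrite le_max lexx orbT|by rewrite invr_gt0 mulr_gt0|].
move=> x; rewrite ge_max => /andP[xx0 x1].
have xp : 0 < x by exact: lt_le_trans x1.
have x0' : 0 <= x by exact: ltW.
pose X := (Num.truncn x).+1.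
have NX : N x <= \sum_(q < X | ((q : nat) \in J) && ((q%:R : R) ^+ 2 <= x)) N1 (x / q%:R ^+ 2).
  rewrite counting_functionE// -/X.
  apply: (@le_trans _ _ (\sum_(q < X | ((q : nat) \in J) && ((q%:R : R) ^+ 2 <= x))
      \sum_(r < X | sqf r && (r%:R <= x / q%:R ^+ 2)) 1)); last first.
    apply: ler_sum => q /andP[qJ qx].
    have q0 : (0 < q)%N := generated_gt0 B_ge2 (set_mem qJ).
    have xq : 0 <= x / q%:R ^+ 2 by rewrite divr_ge0// sqr_ge0.
    apply: le_trans (counting_ge_sum (B_squarefree B) X xq).
    by rewrite le_eqVlt; apply/orP; left; apply/eqP/eq_bigl => r; rewrite (B_squarefreeE B_ge2 B_cop).
  apply: (@le_trans _ _ (\sum_(n < X) \sum_(q < X | ((q : nat) \in J) && ((q%:R : R) ^+ 2 <= x))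
      \sum_(r < X | sqf r && (r%:R <= x / q%:R ^+ 2)) ((n : nat) == r * q ^ 2)%N%:R)).
    rewrite big_mkcond; apply: ler_sum => n _; case: ifP => [nJ|_]; last first.
      by do 2!(apply: sumr_ge0 => ? _).
    have [r [q [sr qJ nE]]] := generated_sqf_square B_ge2 B_cop (set_mem nJ).
    have q0 := generated_gt0 B_ge2 qJ; have r0 := sqf_gt0 B_ge2 sr.
    have nX : (n%:R : R) <= x by rewrite -truncn_ge_nat//; have := ltn_ord n; rewrite ltnS.
    have qn : (q ^ 2 <= n)%N by rewrite nE leq_pmull.
    have qX : (q < X)%N.
      apply: leq_ltn_trans (ltn_ord n); apply: leq_trans qn; rewrite -mulnn leq_pmull//.
    have rX : (r < X)%N.
      apply: leq_ltn_trans (ltn_ord n); by rewrite nE leq_pmulr// expn_gt0 q0.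
    have qx : (q%:R : R) ^+ 2 <= x by apply: le_trans nX; rewrite -natrX ler_nat.
    rewrite (bigD1 (Ordinal qX)) /=; last by rewrite (mem_set qJ) qx.
    rewrite (bigD1 (Ordinal rX)) /=; last first.
      rewrite sr /= ler_pdivlMr ?exprn_gt0 ?ltr0n//; apply: le_trans nX.
      by rewrite -natrX -natrM ler_nat nE.
    by rewrite -nE eqxx -addrA lerDl addr_ge0// !sumr_ge0// => ? _; rewrite sumr_ge0.
  rewrite exchange_big /=; apply: ler_sum => q _; rewrite exchange_big /=; apply: ler_sum => r _.
  have [h|h] := ltnP (r * q ^ 2) X.
    rewrite (bigD1 (Ordinal h)) //= eqxx big1 ?addr0// => n nh.
    by case: eqP => // nE; move/eqP: nh; case; exact/val_inj.
  by rewrite big1 // => n _; case: eqP => // nE; have := ltn_ord n; rewrite nE ltnNge h.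
have part1 : \sum_(q < X | (((q : nat) \in J) && ((q%:R : R) ^+ 2 <= x)) && (q%:R <= y)) N1 (x / q%:R ^+ 2) <= Q%:R * N1 x.
  apply: (@le_trans _ _ (\sum_(q < Q) N1 x)); last by rewrite sumr_const card_ord mulr_natl.
  pose Z := maxn X Q.
  rewrite (big_ord_widen_cond Z (fun q => ((q \in J) && ((q%:R : R) ^+ 2 <= x)) && (q%:R <= y)) (fun q => N1 (x / q%:R ^+ 2))) ?leq_maxl//.
  rewrite [leRHS](big_ord_widen Z (fun=> N1 x)) ?leq_maxr//.
  rewrite big_mkcond [leRHS]big_mkcond; apply: ler_sum => q _.
  case: ifP => [/andP[/andP[/andP[qJ qx] qy] _]|_]; last by case: ifP => // _; exact: counting_function_ge0.
  rewrite /Q ltnS truncn_ge_nat ?(ltW y0)// qy; apply: le_counting_function => //.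
  have q0 : (0 < q)%N := generated_gt0 B_ge2 (set_mem qJ).
  by rewrite ler_pdivrMr ?exprn_gt0 ?ltr0n// ler_peMr// exprn_ege1// ler1n.
have part2 : \sum_(q < X | (((q : nat) \in J) && ((q%:R : R) ^+ 2 <= x)) && ~~ (q%:R <= y)) N1 (x / q%:R ^+ 2) <= 2^-1 * N x.
  apply: le_trans (_ : (C * \sum_(d < X | ((d : nat) \in J) && (y < d%:R)) d%:R `^ (- s)) * N x <= _); last first.
    by rewrite ler_wpM2r ?counting_function_ge0.
  rewrite mulr_sumr mulr_suml big_mkcond [leRHS]big_mkcond; apply: ler_sum => q _.
  case: ifP => [/andP[/andP[qJ qx] qy]|_]; last first.
    by case: ifP => // _; rewrite !mulr_ge0 ?powR_ge0 ?counting_function_ge0// ltW.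
  rewrite -ltNge in qy; rewrite qJ qy /=.
  have q0 : (0 < q)%N := generated_gt0 B_ge2 (set_mem qJ).
  have qp : 0 < (q%:R : R) by rewrite ltr0n.
  have q2 : 0 < (q%:R : R) ^+ 2 by exact: exprn_gt0.
  apply: (@le_trans _ _ (N (x / q%:R ^+ 2))).
    by apply: le_counting_function => // n /mem_set; rewrite (B_squarefreeE B_ge2 B_cop) => /sqfJ/set_mem.
  apply: le_trans (H (x / q%:R ^+ 2) x xx0 _ _) _.
  - by rewrite ler_pdivlMr// mul1r.
  - by rewrite ler_pdivrMr// ler_peMr// exprn_ege1// ler1n.
  rewrite le_eqVlt; apply/orP; left; apply/eqP; congr (_ * _ * _).
  rewrite mulrAC divff ?gt_eqF// mul1r -powR_inv1 ?(ltW q2)// -powR_mulrn ?(ltW qp)// -!powRrM.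
  by congr (_ `^ _); rewrite /s; ring.
rewrite mulrC ler_pdivrMr ?mulr_gt0//.
have : N x <= Q%:R * N1 x + 2^-1 * N x.
  apply: le_trans NX _; rewrite (bigID (fun q : 'I_X => q%:R <= y)) /=; exact: lerD.
move=> h; lra.
Qed.

End Density.

(** * The kernel and the variance *)

Section Window.
Context {R : realType}.
Variables (phi : R -> R) (c V : R).
Hypothesis supp : forall x, phi x != 0 -> 0 <= x <= c.
Hypothesis varV : forall K (x : nat -> R), (forall i, (i < K)%N -> x i < x i.+1) ->
  \sum_(i < K) `|phi (x i.+1) - phi (x i)| <= V.
Implicit Types (h t x : R) (K m r a : nat).

Lemma window_eq0 x : c < x -> phi x = 0.
Proof. by move=> cx; apply/eqP; apply: contraT => /supp/andP[_]; rewrite leNgt cx. Qed.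

(** Compare with a point to the right of [x] and of the support, where [phi] vanishes. *)
Lemma window_bound x : `|phi x| <= V.
Proof.
pose y i := if i is 0%N then x else Num.max x c + 1.
have := @varV 1 y; rewrite big_ord1 /= window_eq0; last by rewrite ltr_pwDr// le_max lexx orbT.
by rewrite sub0r normrN; apply => -[|]//= _; rewrite ltr_pwDr// le_max lexx.
Qed.

Lemma window_V_ge0 : 0 <= V.
Proof. exact: le_trans (normr_ge0 _) (window_bound 0). Qed.

Lemma sum_window (W : nmodType) (F : int -> W) h K : 0 < h -> c * h < K%:R ->
  (forall m : int, phi (m%:~R / h) = 0 -> F m = 0) ->
  \sum_(m \in [set: int]) F m = \sum_(m < K) F m%:Z.
Proof.
move=> h0 cK F0.
rewrite (fsbigE [seq m%:Z | m <- iota 0 K]) //=; last first.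
- move=> m _ mN; apply: F0; apply: contraNeq mN => /supp/andP[].
  rewrite ler_pdivlMr// mul0r ler0z ler_pdivrMr// => m0 mc.
  apply/mapP; exists (absz m); last by rewrite gez0_abs.
  by rewrite mem_iota /= add0n -(ltr_nat R) natr_absz ger0_norm// (le_lt_trans mc).
- by rewrite map_inj_uniq ?iota_uniq// => i j [].
rewrite big_map (eq_bigl xpredT); last by move=> m; rewrite in_setT.
by rewrite -[in LHS](subn0 K) -/(index_iota 0 K) big_mkord.
Qed.

Lemma Phi_E h K t : 0 < h -> c * h < K%:R ->
  Phi_ phi h t = \sum_(m < K) e_ (m%:R * t) * (phi (m%:R / h))%:C%C.
Proof.
move=> h0 cK; rewrite /Phi_ (sum_window h0 cK)// => m ->.
by rewrite mulr0.
Qed.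

Section Fixed.
Variables (h : R) (K : nat).
Hypothesis h0 : 0 < h.
Hypothesis cK : c * h < K%:R.
Local Notation Phi := (Phi_ phi h).

Lemma Phi_int t (m : int) : Phi (t + m%:~R) = Phi t.
Proof.
rewrite !(Phi_E _ h0 cK); apply: eq_bigr => i _; congr (_ * _).
by rewrite mulrDr -[(i : nat)%:R]/((i : nat)%:Z%:~R) -intrM e_Dint.
Qed.

Lemma Phi_conj t : Phi (- t) = (Phi t)^*%C.
Proof.
rewrite !(Phi_E _ h0 cK) rmorph_sum; apply: eq_bigr => i _.
rewrite mulrN e_N rmorphM; congr (_ * _).
by rewrite /= oppr0.
Qed.

Lemma cnorm_Phi_le t : cnorm (Phi t) <= V * K%:R.
Proof.
rewrite (Phi_E _ h0 cK); apply: le_trans (cnorm_sum _ _ _) _.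
rewrite mulr_natr -[K in leRHS]card_ord -sumr_const; apply: ler_sum => i _.
by rewrite cnormM cnorm_e mul1r cnorm_real window_bound.
Qed.

(** Summation by parts: multiplication by $1 - e(t)$ leaves the boundary term [phi 0] and the
    increments of [phi] along the points $m/h$, each of which bounded variation controls by [V]. The
    other boundary term lies beyond the support. *)
Lemma Phi_abel t : cnorm (Phi t) * cnorm (1 - e_ t) <= 2 * V.
Proof.
have E : Phi t * (1 - e_ t) = (phi 0)%:C%C +
    \sum_(m < K) (phi (m.+1%:R / h) - phi (m%:R / h))%:C%C * e_ (m.+1%:R * t).
  rewrite (Phi_E _ h0 cK) mulrBr mulr1 mulr_suml.
  have -> : \sum_(m < K) e_ (m%:R * t) * (phi (m%:R / h))%:C%C =
     (phi 0)%:C%C + \sum_(m < K) e_ (m.+1%:R * t) * (phi (m.+1%:R / h))%:C%C.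
    transitivity (\sum_(m < K.+1) e_ (m%:R * t) * (phi (m%:R / h))%:C%C).
      rewrite big_ord_recr /= [phi (K%:R / h)]window_eq0 ?ltr_pdivlMr//.
      by rewrite mulr0 addr0.
    by rewrite big_ord_recl /= !mul0r e_0 mul1r.
  rewrite -addrA -sumrB; congr (_ + _); apply: eq_bigr => m _.
  by rewrite -natr1 mulrDl mul1r e_D rmorphB /=; ring.
rewrite -cnormM E; apply: le_trans (cnormD _ _) _.
rewrite cnorm_real mulrDl mul1r; apply: lerD; first exact: window_bound.
apply: le_trans (cnorm_sum _ _ _) _.
apply: le_trans (varV (K := K) (x := fun i => i%:R / h) _); last first.
  by move=> i _; rewrite ltr_pM2r ?invr_gt0// ltr_nat.
by apply: ler_sum => m _; rewrite cnormM cnorm_e mulr1 cnorm_real.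
Qed.

Lemma cnorm_Phi_frac r a : (0 < a < r)%N ->
  cnorm (Phi (a%:R / r%:R)) <= 2 * V * r%:R / (minn a (r - a))%:R.
Proof.
move=> /andP[a0 ar]; have r0 : 0 < r%:R :> R by rewrite ltr0n (ltn_trans a0).
set q := minn _ _; have q0 : (0 < q)%N by rewrite /q leq_min a0 subn_gt0.
suff h1 : q%:R / r%:R <= cnorm (1 - e_ (a%:R / r%:R : R)).
  rewrite ler_pdivlMr ?ltr0n//.
  have := Phi_abel (a%:R / r%:R); set z := cnorm (Phi _) => h2.
  have z0 : 0 <= z by exact: cnorm_ge0.
  have := le_trans (ler_wpM2l z0 h1) h2.
  by rewrite mulrA ler_pdivrMr.
have [ra|ra] := leqP (2 * a) r.
  have -> : q = a by rewrite /q; apply/minn_idPl; lia.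
  rewrite -[leLHS]ger0_norm ?divr_ge0//; apply: cnorm_1Be_ge.
  rewrite ger0_norm ?divr_ge0// ler_pdivrMr// -[_ * r%:R]mulrC ler_pdivlMr//.
  by rewrite -natrM ler_nat mulnC.
have -> : q = (r - a)%N by rewrite /q; apply/minn_idPr; lia.
have e1 : e_ (a%:R / r%:R : R) = e_ (- ((r - a)%N%:R / r%:R)).
  rewrite natrB ?(ltnW ar)// mulrBl divff ?gt_eqF// opprB.
  by rewrite -(e_Dint _ (- 1)) mulrN1z.
rewrite e1 -[leLHS]ger0_norm ?divr_ge0// -normrN; apply: cnorm_1Be_ge.
rewrite normrN ger0_norm ?divr_ge0// ler_pdivrMr// -[_ * r%:R]mulrC ler_pdivlMr//.
by rewrite -natrM ler_nat; lia.
Qed.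

Lemma Phi_parseval r : (0 < r)%N ->
  \sum_(a < r) cnorm (Phi (a.+1%:R / r%:R)) ^+ 2 =
  r%:R * \sum_(m < K) \sum_(l < K) (r%:Z %| m%:Z - l%:Z)%Z%:R * (phi (m%:R / h) * phi (l%:R / h)).
Proof.
move=> r0; apply: (@complexI R); rewrite rmorph_sum /=.
transitivity (\sum_(m < K) \sum_(l < K) (phi (m%:R / h) * phi (l%:R / h))%:C%C *
   (\sum_(a < r) e_ (a.+1%:R * ((m%:Z - l%:Z)%:~R / r%:R))) : R[i]).
  rewrite (eq_bigr (fun a : 'I_r => \sum_(m < K) \sum_(l < K) (phi (m%:R / h) * phi (l%:R / h))%:C%C *
    e_ (a.+1%:R * ((m%:Z - l%:Z)%:~R / r%:R)))) => [|a _].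
    rewrite exchange_big; apply: eq_bigr => m _; rewrite exchange_big; apply: eq_bigr => l _.
    by rewrite mulr_sumr.
  rewrite sqr_cnorm -Phi_conj !(Phi_E _ h0 cK) mulr_suml; apply: eq_bigr => m _.
  rewrite mulr_sumr; apply: eq_bigr => l _.
  rewrite rmorphM /= mulrACA -e_D mulrC; congr (_ * e_ _).
  by rewrite intrB -!pmulrn; ring.
rewrite rmorphM /= rmorph_sum mulr_sumr; apply: eq_bigr => m _.
rewrite rmorph_sum mulr_sumr; apply: eq_bigr => l _ /=.
rewrite sum_e_residues// rmorphM /= rmorph_nat; case: (_ %| _)%Z; last by rewrite mul0r !mulr0.
by rewrite mul1r rmorphM /= mulrC.
Qed.

(** Two indices below [K] are congruent modulo such an [r] only if they are equal. *)
Lemma Phi_parseval_ge r : (0 < r)%N -> (K <= r)%N ->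
  \sum_(a < r) cnorm (Phi (a.+1%:R / r%:R)) ^+ 2 = r%:R * \sum_(m < K) phi (m%:R / h) ^+ 2.
Proof.
move=> r0 Kr; rewrite Phi_parseval//; congr (_ * _); apply: eq_bigr => m _.
rewrite (bigD1 m) //= subrr dvdz0 mul1r -expr2 big1 ?addr0// => l lm.
case: (boolP (r%:Z %| _)%Z) => [|_]; last by rewrite mul0r.
rewrite dvdzE /= => d; exfalso; move/negP: lm; apply; apply/eqP/val_inj => /=.
have := ltn_ord m; have := ltn_ord l; move: d; set x := (m : nat); set y := (l : nat).
move=> d yK xK; have := dvdn_leq _ d; lia.
Qed.

End Fixed.
End Window.

Section WindowLower.
Context {R : realType}.
Variables (phi : R -> R) (c V : R).
Hypothesis supp : forall x, phi x != 0 -> 0 <= x <= c.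
Hypothesis varV : forall K (x : nat -> R), (forall i, (i < K)%N -> x i < x i.+1) ->
  \sum_(i < K) `|phi (x i.+1) - phi (x i)| <= V.

(* If small values of [phi] were dense in ]a, b[, then interlacing them with points where
   [phi] exceeds [2 e] shows that there are finitely many such points for each [e]; hence
   [phi] would vanish off a countable set. *)
Lemma window_large_values : (exists a b : R, a < b /\ forall x, a < x < b -> phi x != 0) ->
  exists a b d : R, [/\ a < b, 0 < d & forall x, a < x < b -> d <= `|phi x|].
Proof.
move=> [a [b [ab phi0]]]; apply: contrapT => noE.
have dense u w d : a <= u -> u < w -> w <= b -> 0 < d ->
    exists x, u < x < w /\ `|phi x| < d.
  move=> au uw wb d0; apply: contrapT => no; apply: noE; exists u, w, d; split => // x xuw.
  by rewrite leNgt; apply/negP => xd; apply: no; exists x.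
pose E n := [set x | a < x < b /\ n.+1%:R^-1 < `|phi x|].
have finE n : finite_set (E n).
  apply: contrapT => inf.
  (* Half of the threshold of [E n]: passing from a point of [E n] to one with $|\varphi| < d$ costs
     variation at least [d], and more than $V/d$ such passages are impossible. *)
  pose d : R := (2 * n.+1%:R)^-1; have d0 : 0 < d by rewrite invr_gt0 mulr_gt0.
  pose m := (Num.truncn (V / d)).+1.
  have [X XE Xm] := infinite_set_fset m.+1 inf.
  pose s := sort <=%R (enum_fset X).
  have ss : size s = #|` X| by rewrite size_sort.
  have slt : sorted <%R s by rewrite lt_sorted_uniq_le sort_uniq fset_uniq sort_le_sorted.
  pose p i := nth 0 s i.
  have pE i : (i < m.+1)%N -> E n (p i).
    move=> im; apply: XE => /=; rewrite /p; have : nth 0 s i \in s by rewrite mem_nth// ss (leq_trans im).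
    by rewrite mem_sort.
  have plt i : (i < m)%N -> p i < p i.+1.
    move=> im; rewrite /p (lt_sorted_ltn_nth 0 slt) ?inE ?ss//; apply: leq_trans Xm; rewrite ltnS//.
    exact: ltnW.
  pose q i := xget 0 [set x | p i < x < p i.+1 /\ `|phi x| < d].
  have qP i : (i < m)%N -> p i < q i < p i.+1 /\ `|phi (q i)| < d.
    move=> im; have [[/andP[h1 h2] _] [/andP[h3 h4] _]] := (pE i (ltnW im), pE i.+1 im).
    apply: (@xgetPex _ 0 [set x | p i < x < p i.+1 /\ `|phi x| < d]).
    by apply: dense => //; [exact: ltW|exact: plt|exact: ltW].
  pose x j := if odd j then q j./2 else p j./2.
  have xe i : x i.*2 = p i by rewrite /x odd_double doubleK.
  have xo i : x i.*2.+1 = q i by rewrite /x /= odd_double /= uphalf_double.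
  have := varV (K := m.*2) (x := x).
  have key M : (M <= m)%N -> M%:R * d <= \sum_(i < M.*2) `|phi (x i.+1) - phi (x i)|.
    elim: M => [|M IH] Mm; first by rewrite mul0r big_ord0.
    rewrite doubleS !big_ord_recr /= xo xe -natr1 mulrDl mul1r -addrA.
    apply: lerD; first exact: IH (ltnW Mm).
    rewrite -[leLHS]addr0; apply: lerD => //.
    have [_ h1] := pE M (leqW Mm); have [_ h2] := qP M Mm.
    rewrite distrC; apply: le_trans (lerB_dist _ _).
    have : n.+1%:R^-1 = d + d by rewrite /d invfM; field; rewrite nat1r.
    move=> E1; rewrite lerBrDr; apply/ltW/(lt_le_trans _ (ltW h1)); rewrite E1 ltrD2l.
    exact: h2.
  move=> h; have {h} : \sum_(i < m.*2) `|phi (x i.+1) - phi (x i)| <= V.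
    apply: h => j jm; rewrite -(odd_double_half j).
    have hm : (j./2 < m)%N by rewrite -ltn_double; apply: leq_ltn_trans jm; rewrite -{2}(odd_double_half j) leq_addl.
    have [/andP[h1 h2] _] := qP _ hm.
    case: (odd j); rewrite ?add0n ?add1n ?xo ?xe //.
    by rewrite -doubleS xe.
  move/(le_trans (key m (leqnn m))); rewrite -ler_pdivlMr// leNgt.
  by rewrite truncnS_gt.
have sub : `]a, b[%classic `<=` \bigcup_n E n.
  move=> x /=; rewrite in_itv /= => xab; have x0 := phi0 x xab.
  exists (Num.truncn (`|phi x|^-1)) => //; split => //.
  by rewrite -[ltRHS]invrK ltf_pV2 ?posrE ?invr_gt0 ?normr_gt0// truncnS_gt.
have cnt : countable (`]a, b[%classic : set R).
  apply: sub_countable (subset_card_le sub) _; apply: bigcup_countable => // n _.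
  exact: finite_set_countable.
have := countable_lebesgue_measure0 cnt.
rewrite lebesgue_measure_itv /= lte_fin ab -EFinD => -[] /eqP.
by rewrite subr_eq0 gt_eqF.
Qed.

(** On an interval where $|\varphi| \ge d$ there are at least $(b-a)h/2$ sampling points $m/h$, each
    contributing $d^2$. *)
Lemma sum_sqr_window_ge : (exists a b : R, a < b /\ forall x, a < x < b -> phi x != 0) ->
  exists c0 h1 : R, [/\ 0 < c0, 0 < h1 & forall h K, h1 <= h -> c * h < K%:R ->
    c0 * h <= \sum_(m < K) phi (m%:R / h) ^+ 2].
Proof.
move=> /window_large_values[a [b [d [ab d0 D]]]].
have ba0 : 0 < b - a by rewrite subr_gt0.
have a0 : 0 <= a.
  rewrite leNgt; apply/negP => a0; pose x := Num.min b 0.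
  have : a < (a + x) / 2 < b.
    have : a < x by rewrite lt_min ab.
    have : x <= b by rewrite ge_min lexx.
    by move=> *; apply/andP; split; lra.
  move=> /[dup] h /D dx.
  have /supp/andP[] : phi ((a + x) / 2) != 0 by rewrite -normr_gt0 (lt_le_trans d0).
  have : x <= 0 by rewrite ge_min lexx orbT.
  by move=> *; lra.
exists (d ^+ 2 * ((b - a) / 2)), (3 / (b - a)); split; rewrite ?mulr_gt0 ?exprn_gt0 ?invr_gt0//.
move=> h K hh cK.
have h0 : 0 < h by apply: lt_le_trans hh; rewrite divr_gt0.
have h3 : 3 <= h * (b - a) by rewrite -ler_pdivrMr.
(* [n0] consecutive integers starting just above $ha$; they stay below $hb$ because $h(b-a) \ge
   3$. *)
pose m0 := (Num.truncn (h * a)).+1; pose n0 := (Num.truncn (h * (b - a) / 2)).+1.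
have hba : 0 <= h * (b - a) / 2 by rewrite divr_ge0// mulr_ge0 ?(ltW h0) ?(ltW ba0).
have m01 : h * a < m0%:R by exact: truncnS_gt.
have m02 : m0%:R <= h * a + 1.
  by rewrite /m0 -natr1 lerD2r truncn_le// mulr_ge0 ?(ltW h0).
have nn1 : h * (b - a) / 2 < n0%:R by exact: truncnS_gt.
have inI j : (j < n0)%N -> a < (m0 + j)%N%:R / h < b.
  rewrite /n0 ltnS truncn_ge_nat// => jn; rewrite natrD ltr_pdivlMr// ltr_pdivrMr//.
  have : 0 <= j%:R :> R by [].
  by move=> *; apply/andP; split; nra.
have phid j : (j < n0)%N -> d <= `|phi ((m0 + j)%N%:R / h)| by move=> /inI/D.
have mK : (m0 + n0 <= K)%N.
  have dp := phid n0.-1 (leqnn n0).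
  have /supp/andP[_] : phi ((m0 + n0.-1)%N%:R / h) != 0.
    by rewrite -normr_gt0 (lt_le_trans d0).
  rewrite ler_pdivrMr// => /le_lt_trans/(_ cK); rewrite ltr_nat.
  by move=> mk; apply: leq_trans mk; rewrite -addnS.
rewrite -(big_mkord xpredT (fun m => phi (m%:R / h) ^+ 2)).
rewrite (big_cat_nat (leq0n m0) (leq_trans (leq_addr _ _) mK)) /=.
rewrite -[leLHS]add0r; apply: lerD; first by apply: sumr_ge0 => ? _; exact: sqr_ge0.
rewrite (big_cat_nat (leq_addr n0 m0) mK) /= -[leLHS]addr0; apply: lerD; last first.
  by apply: sumr_ge0 => ? _; exact: sqr_ge0.
rewrite -{1}[m0]add0n big_addn addKn big_mkord.
apply: (@le_trans _ _ (\sum_(j < n0) d ^+ 2)).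
  rewrite sumr_const card_ord -[X in _ <= X]mulr_natr -mulrA ler_pM2l ?exprn_gt0//.
  by apply: le_trans (ltW nn1); rewrite le_eqVlt; apply/orP; left; apply/eqP; ring.
apply: ler_sum => j _; rewrite -[X in _ <= X]real_normK ?num_real//.
rewrite addnC; have := phid _ (ltn_ord j) => dd.
by rewrite ler_pXn2r ?nnegrE ?(ltW d0).
Qed.

(** Proved with the subtracted term $1/(M+A+1)$, which makes the induction telescope. *)
Lemma sum_inv_sqr_tail A r : \sum_(a < r | (A < a)%N) (a%:R ^+ 2)^-1 <= 2 / A.+1%:R :> R.
Proof.
suff key M : \sum_(a < M + A.+2 | (A < a)%N) (a%:R ^+ 2)^-1 <= 2 / A.+1%:R - (M + A).+1%:R^-1 :> R.
  apply: le_trans (_ : \sum_(a < r + A.+2 | (A < a)%N) (a%:R ^+ 2)^-1 <= _); last first.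
    by apply: le_trans (key r) _; rewrite gerBl invr_ge0.
  rewrite (big_ord_widen_cond (r + A.+2) (fun a => (A < a)%N) (fun a => (a%:R ^+ 2)^-1 : R)) ?leq_addr//.
  rewrite big_mkcondr /=; apply: ler_sum => a _; case: ifP => // _.
elim: M => [|M IH].
  rewrite !add0n big_mkcond big_ord_recr -big_mkcond /= ltnSn big_pred0 ?add0r; last first.
    by move=> a; rewrite ltnNge -ltnS ltn_ord.
  set x : R := A.+1%:R; have x1 : 1 <= x by rewrite ler1n.
  have x0 : 0 < x by exact: lt_le_trans x1.
  have -> : 2 / x - x^-1 = x^-1 by field; rewrite gt_eqF.
  by rewrite lef_pV2 ?posrE ?exprn_gt0// ler_eXnr.
rewrite addSn big_mkcond big_ord_recr -big_mkcond /= [(A < _)%N](_ : _ = true); last by lia.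
apply: le_trans (lerD IH (lexx _)) _.
rewrite addSn !addnS; set x : R := (M + A).+1%:R; have x0 : 0 < x by rewrite ltr0n.
have -> : (M + A).+2%:R = x + 1 :> R by rewrite -natr1.
have x10 : 0 < x + 1 by rewrite addr_gt0.
rewrite -addrA lerD2l -lerBrDl opprK [leRHS]addrC.
rewrite -(ler_pM2r (mulr_gt0 (exprn_gt0 2 x10) x0)).
have -> : ((x + 1) ^+ 2)^-1 * ((x + 1) ^+ 2 * x) = x by field; rewrite gt_eqF.
have -> : (x^-1 - (x + 1)^-1) * ((x + 1) ^+ 2 * x) = x + 1 by field; rewrite !gt_eqF.
by rewrite lerDl.
Qed.

End WindowLower.

Section ReducedFractions.
Context {R : realType}.
Variable (B : set nat).
Hypothesis B_ge2 : B `<=` [set b | 2 <= b]%N.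
Hypothesis B_cop : {in B &, forall b c, b != c -> coprime b c}.
Implicit Types (a b d r : nat).
Local Notation sqf := (bsqf (inB B)).
Let gt1 := @inB_gt1 B B_ge2.
Let cop := @inB_coprime B B_cop.

Lemma frac_sum_intE a b r1 r2 : (0 < r1)%N -> (0 < r2)%N ->
  (a%:R / r1%:R + b%:R / r2%:R \is a @Num.int R) = (r1 * r2 %| a * r2 + b * r1)%N.
Proof.
move=> r10 r20; have r1' : r1%:R != 0 :> R by rewrite pnatr_eq0 -lt0n.
have r2' : r2%:R != 0 :> R by rewrite pnatr_eq0 -lt0n.
have -> : a%:R / r1%:R + b%:R / r2%:R = (a * r2 + b * r1)%N%:R / (r1 * r2)%N%:R :> R.
  by rewrite natrD !natrM; field; rewrite r1' r2'.
set x := (a * _ + _)%N; set y := (r1 * r2)%N.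
have y0 : y%:R != 0 :> R by rewrite pnatr_eq0 -lt0n muln_gt0 r10.
apply/intrP/dvdnP => [[k kE]|[k ->]]; last by exists k%:Z; rewrite natrM mulfK.
have xk : x%:Z = k * y%:Z.
  apply: (@intr_inj R); rewrite intrM -kE /= -!pmulrn.
  by rewrite divfK.
exists (absz k); have := congr1 absz xk; by rewrite abszM.
Qed.

(** An element of [B] dividing [r1] but not [r2] would divide [a * r2], hence [a], since it is
    coprime to [r2]. By symmetry two reduced fractions with integral sum have equal denominators. *)
Lemma breduced_frac_dvd a b r1 r2 : sqf r1 -> sqf r2 -> breduced B a r1 ->
  (r1 * r2 %| a * r2 + b * r1)%N -> (r1 %| r2)%N.
Proof.
move=> s1 s2 ra h; have r10 := sqf_gt0 B_ge2 s1.
apply: (sqf_dvd B_ge2 B_cop s1) => p Bp pr1.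
apply: contraT => pr2.
have /(breducedP _ _ r10)/(_ p Bp pr1)/negP := ra; case.
have : (p %| a * r2 + b * r1)%N by apply: dvdn_trans h; rewrite dvdn_mulr.
rewrite dvdn_addl; last by rewrite dvdn_mull.
by rewrite Gauss_dvdl//; exact: (coprime_sqf B_ge2 B_cop Bp s2 pr2).
Qed.

Lemma breduced_frac_sum a b r1 r2 : sqf r1 -> sqf r2 -> breduced B a r1 -> breduced B b r2 ->
  (a%:R / r1%:R + b%:R / r2%:R \is a @Num.int R) = (r1 == r2) && (r1 %| a + b)%N.
Proof.
move=> s1 s2 ra rb; have r10 := sqf_gt0 B_ge2 s1; have r20 := sqf_gt0 B_ge2 s2.
rewrite frac_sum_intE//; apply/idP/andP => [h|[/eqP <- h]]; last first.
  by rewrite -mulnDl mulnC dvdn_pmul2l.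
have d1 := breduced_frac_dvd s1 s2 ra h.
have d2 : (r2 %| r1)%N by apply: (breduced_frac_dvd s2 s1 rb (b := a)); rewrite mulnC addnC.
have e : r1 = r2 by apply/eqP; rewrite eqn_dvd d1 d2.
by split; [rewrite e|move: h; rewrite -e -mulnDl mulnC dvdn_pmul2l].
Qed.

Lemma breduced_lt a r : sqf r -> (1 < r)%N -> breduced B a r -> ~~ (r %| a)%N.
Proof.
move=> sr r1 ra; apply/negP => dra; have r0 := ltnW r1.
suff : (r %| 1)%N by rewrite dvdn1 => /eqP e; move: r1; rewrite e.
apply: (sqf_dvd B_ge2 B_cop sr) => p Bp pr.
by have /(breducedP _ _ r0)/(_ p Bp pr)/negP := ra; case; exact: dvdn_trans dra.
Qed.

Lemma breduced_sub a r : (a <= r)%N -> (0 < r)%N -> breduced B (r - a) r = breduced B a r.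
Proof.
move=> ar r0; apply/(breducedP _ _ r0)/(breducedP _ _ r0) => H b Bb br; have := H b Bb br.
  by rewrite dvdn_subr.
by rewrite dvdn_subr.
Qed.

(** Representatives in $]0, 1]$ and in $[0, 1[$ agree, neither endpoint being reduced when
    [1 < r]. *)
Lemma big_breduced (W : nmodType) (F : nat -> W) r : sqf r -> (1 < r)%N ->
  \sum_(1 <= a < r.+1 | breduced B a r) F a = \sum_(a < r | breduced B a r) F a.
Proof.
move=> sr r1; have r0 := ltnW r1.
have nr0 : breduced B 0 r = false.
  by apply/negbTE/negP => /(breduced_lt sr r1); rewrite dvdn0.
have nrr : breduced B r r = false by apply/negbTE/negP => /(breduced_lt sr r1); rewrite dvdnn.
rewrite -(big_mkord (fun a => breduced B a r) F) [RHS]big_mkcond (big_ltn r0) nr0 /= add0r.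
by rewrite [LHS]big_mkcond (big_nat_recr _ _ _ r0) /= nrr addr0 -big_mkcond.
Qed.

Lemma sum_reduced_fractions (W : nmodType) (F : R -> W) r : sqf r -> (1 < r)%N ->
  \sum_(s \in reduced_fractions B r) F s = \sum_(a < r | breduced B a r) F (a%:R / r%:R).
Proof.
move=> sr r1; have r0 := ltnW r1; have r0' : r%:R != 0 :> R by rewrite pnatr_eq0 -lt0n.
rewrite -(big_breduced (fun a => F (a%:R / r%:R)) sr r1) /reduced_fractions.
rewrite fsbig_image; last first.
  by move=> a b _ _ /(mulIf (invr_neq0 r0')) /eqP; rewrite eqr_nat => /eqP.
have PE a : (1 <= a < r.+1)%N -> ((1 <= a <= r)%N /\ B_free B (gcdn a r)) <-> breduced B a r.
  move=> ar; rewrite breduced_free//; split => [[_ h]|/asboolP h]; first exact/asboolP.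
  by split.
rewrite (fsbigE [seq a <- index_iota 1 r.+1 | breduced B a r]) //=.
- rewrite big_filter_cond big_nat_cond [RHS]big_nat_cond; apply: eq_bigl => a.
  have [ar|//] := boolP (1 <= a < r.+1)%N; rewrite !andTb.
  have [ra|//] := boolP (breduced B a r); rewrite andTb; apply/mem_set/PE => //.
- by rewrite filter_uniq// iota_uniq.
- by move=> a /=; rewrite mem_filter mem_index_iota => /andP[ra ar]; apply/(PE a ar).
- move=> a aP; rewrite mem_filter mem_index_iota; have [/andP[a1 a2] _] := aP.
  have ar : (1 <= a < r.+1)%N by rewrite a1.
  by have /(PE a ar) -> := aP; rewrite ar.
Qed.

End ReducedFractions.

(** * The constant C_2 as a sum of squares *)

Section PairCorrelation.
Context {R : realType}.
Variable B : set nat.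
Hypothesis B_ge2 : B `<=` [set b | 2 <= b]%N.
Hypothesis B_cop : {in B &, forall b c, b != c -> coprime b c}.
Variables (phi : R -> R) (c V : R).
Hypothesis supp : forall x, phi x != 0 -> 0 <= x <= c.
Hypothesis varV : forall K (x : nat -> R), (forall i, (i < K)%N -> x i < x i.+1) ->
  \sum_(i < K) `|phi (x i.+1) - phi (x i)| <= V.
Variables (h : R) (K : nat).
Hypothesis h0 : 0 < h.
Hypothesis cK : c * h < K%:R.
Local Notation Phi := (Phi_ phi h).
Local Notation sqf := (bsqf (inB B)).
Implicit Types (a b d r : nat).

Definition reduced_energy r : R := \sum_(a < r | breduced B a r) cnorm (Phi (a%:R / r%:R)) ^+ 2.

Definition C2_diagonal r : R := (g_B B r) ^+ 2 * reduced_energy r.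

Lemma reduced_energy_ge0 r : 0 <= reduced_energy r.
Proof. by apply: sumr_ge0 => *; exact: sqr_ge0. Qed.

Lemma C2_diagonal_ge0 r : 0 <= C2_diagonal r.
Proof. by rewrite mulr_ge0 ?sqr_ge0 ?reduced_energy_ge0. Qed.

(** Integrality of the sum forces equal denominators and opposite residues, and $\Phi_H(-t) =
    \overline{\Phi_H(t)}$; so off-diagonal terms vanish and diagonal ones are nonnegative. *)
Lemma C2_termE r1 r2 : sqf r1 -> (1 < r1)%N -> sqf r2 -> (1 < r2)%N ->
  C2_term B phi h r1 r2 = (if r1 == r2 then C2_diagonal r1 else 0)%:C%C.
Proof.
move=> s1 r11 s2 r21; rewrite /C2_term.
pose G s1 s2 : R[i] := if s1 + s2 \is a @Num.int R then Phi s1 * Phi s2 else 0.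
have E s : \sum_(s2 \in reduced_fractions B r2 `&` [set s2 | s + s2 \is a Num.int]) Phi s * Phi s2 =
    \sum_(b < r2 | breduced B b r2) G s (b%:R / r2%:R).
  rewrite -(sum_reduced_fractions B_ge2 B_cop (G s) s2 r21) fsbig_mkcondr.
  by apply: eq_fsbigr => s' _; rewrite /G; congr (if _ then _ else _); apply/idP/idP => [/set_mem|/mem_set].
under eq_fsbigr => s _ do rewrite E.
rewrite (sum_reduced_fractions B_ge2 B_cop _ s1 r11).
have [e|ne] := eqVneq r1 r2; last first.
  rewrite big1 ?mulr0// => a ra; rewrite big1// => b rb.
  by rewrite /G (breduced_frac_sum B_ge2 B_cop)// (negbTE ne).
subst r2; rewrite /C2_diagonal [RHS]rmorphM -expr2; congr (_ * _).
rewrite /reduced_energy rmorph_sum; apply: eq_bigr => a ra.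
have a0 : (0 < a)%N by rewrite lt0n; apply/eqP => a0; have := breduced_lt B_ge2 B_cop s1 r11 ra; rewrite a0 dvdn0.
have ar := ltn_ord a; have bl : (r1 - a < r1)%N by rewrite ltn_subrL a0 (ltnW r11).
rewrite (bigD1 (Ordinal bl)) /=; last by rewrite breduced_sub ?(ltnW ar) ?(ltnW r11).
rewrite big1 ?addr0 => [|b /andP[rb ba]].
  rewrite /G (breduced_frac_sum B_ge2 B_cop) ?breduced_sub ?(ltnW ar) ?(ltnW r11)//.
  rewrite eqxx subnKC ?(ltnW ar)// dvdnn /= sqr_cnorm; congr (_ * _).
  rewrite -(Phi_conj supp h0 cK) natrB ?(ltnW ar)// mulrBl divff ?pnatr_eq0 -?lt0n ?(ltnW r11)//.
  by rewrite addrC; exact: (Phi_int supp h0 cK _ 1).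
rewrite /G (breduced_frac_sum B_ge2 B_cop)// eqxx /=; case: ifP => // /dvdnP[k kE].
move/negP: ba; case; apply/eqP/val_inj => /=; have := ltn_ord b.
have k1 : k = 1%N by have := ltn_ord b; have := a0; nia.
by move: kE; rewrite k1 mul1n; lia.
Qed.

(** The terms being nonnegative and supported on the diagonal, every finite partial sum is at most
    [L], and one containing all pairs [(r, r)] with [r < M] is at least the [M]-th partial sum. The
    unordered sum over pairs thus reduces to an ordinary limit. *)
Lemma C2_complexE L : L = limn (fun M => \sum_(r < M | sqf r && (1 < r)%N) C2_diagonal r) ->
  (exists C, forall M, \sum_(r < M | sqf r && (1 < r)%N) C2_diagonal r <= C) ->
  C2_complex B phi h = L%:C%C.
Proof.
move=> LE [C HC]; pose S M := \sum_(r < M | sqf r && (1 < r)%N) C2_diagonal r.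
have ndS : nondecreasing_seq S.
  apply/nondecreasing_seqP => M; rewrite /S [leRHS]big_mkcond big_ord_recr -big_mkcond /=.
  by rewrite lerDl; case: ifP => // _; exact: C2_diagonal_ge0.
have cvS : cvgn S by apply: nondecreasing_is_cvgn => //; exists C => _ [M _ <-]; exact: HC.
have SL M : S M <= L by rewrite LE; exact: nondecreasing_cvgn_le.
rewrite /C2_complex /summability.sum.
set x := (X in summability.partial_sum X).
pose P r := sqf r && (1 < r)%N.
have xE p : x p = (if (p.1 == p.2) && P p.1 then C2_diagonal p.1 else 0)%:C%C.
  rewrite /x !in_setI !(B_squarefreeE B_ge2 B_cop).
  have mE r : (r \in [set r | (1 < r)%N]) = (1 < r)%N by apply/idP/idP => [/set_mem|/mem_set].
  rewrite !mE -/(P p.1) -/(P p.2).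
  have [p1|] := boolP (P p.1); last by rewrite andbF.
  have [p2|p2] := boolP (P p.2); last first.
    by rewrite andbF /=; case: eqP => [e|//]; move: p2; rewrite -e p1.
  by move/andP: p1 => [? ?]; move/andP: p2 => [? ?]; rewrite /= C2_termE// andbT.
have parE (A : {fset (nat * nat)%type}) : summability.partial_sum x A =
    (\sum_(p <- enum_fset A) (if (p.1 == p.2) && P p.1 then C2_diagonal p.1 else 0))%:C%C.
  rewrite /summability.partial_sum rmorph_sum /=.
  rewrite -(big_seq_fsetE _ A predT x) /=.
  by apply: eq_bigr => p _; rewrite xE.
have parle (A : {fset (nat * nat)%type}) : (\sum_(p <- enum_fset A) (if (p.1 == p.2) && P p.1 then C2_diagonal p.1 else 0)) <= L.
  pose M := (\max_(p <- enum_fset A) p.1).+1.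
  apply: le_trans (SL M); rewrite /S.
  rewrite -big_mkcond /=.
  rewrite -(big_mkord P C2_diagonal) -big_filter -[leRHS]big_filter.
  rewrite -(big_map fst xpredT C2_diagonal).
  set s := [seq _ | _ <- _]; set t := [seq _ <- _ | _].
  have us : uniq s.
    rewrite map_inj_in_uniq ?filter_uniq ?fset_uniq// => -[p q] [p' q'].
    rewrite !mem_filter /= => /andP[/andP[/eqP <- _] _] /andP[/andP[/eqP <- _] _] -> //.
  have st r : r \in s -> r \in t.
    move=> /mapP[[p q]]; rewrite mem_filter /= => /andP[/andP[/eqP <- Pp] pA ->].
    rewrite mem_filter mem_index_iota leq0n andTb ltnS; apply/andP; split; first exact: Pp.
    by rewrite (big_rem _ pA) /= leq_maxl.
  have -> : \sum_(i <- s) C2_diagonal i = \sum_(i <- t | i \in s) C2_diagonal i.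
    rewrite -[RHS]big_filter; apply: perm_big; apply: uniq_perm => //.
      by rewrite !filter_uniq// iota_uniq.
    by move=> r; rewrite mem_filter; case: (boolP (r \in s)) => //= /st ->.
  by rewrite big_mkcond /=; apply: ler_sum => r _; case: ifP => // _; exact: C2_diagonal_ge0.
have cvL : S M @[M --> \oo] --> L by rewrite LE.
have hd : hausdorff_space (R[i]^o) by exact: norm_hausdorff.
have FT : ProperFilter (@summability.totally (nat * nat)%type) := summability.totally_filter.
apply: (cvg_lim hd).
apply/cvgrPdist_lt => e e0.
have e0' : 0 < complex.Re e by case: e e0 => a b; rewrite ltcE /= => /andP[].
have eE : e = (complex.Re e)%:C%C by case: e e0 {e0'} => a b; rewrite ltcE /= => /andP[/eqP ->].
move/cvgrPdist_lt/(_ _ e0') : (cvL) => [M _ /(_ M (leqnn M))] /= SM.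
pose A0 : {fset (nat * nat)%type} := [fset p in [seq (r, r) | r <- index_iota 0 M]]%fset.
exists A0 => // A /= /fsubsetP A0A.
rewrite parE -rmorphB norm_cnorm cnorm_real eE ltcR; apply: le_lt_trans SM.
rewrite ger0_norm ?subr_ge0 ?parle// ger0_norm ?subr_ge0 ?SL// lerD2l lerN2.
rewrite /S -(big_mkord P C2_diagonal) -big_filter -big_mkcond /= -[leRHS]big_filter.
rewrite -[leRHS](big_map fst xpredT C2_diagonal).
set t := [seq _ | _ <- _]; set s := [seq _ <- _ | _].
have ut : uniq t.
  rewrite map_inj_in_uniq ?filter_uniq ?fset_uniq// => -[p q] [p' q'].
  rewrite !mem_filter /= => /andP[/andP[/eqP <- _] _] /andP[/andP[/eqP <- _] _] -> //.
have st r : r \in s -> r \in t.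
  rewrite mem_filter => /andP[Pr rM]; apply/mapP; exists (r, r) => //.
  rewrite mem_filter; apply/andP; split; first by apply/andP; split; [exact: eqxx|exact: Pr].
  apply: A0A; rewrite !inE /=.
  by apply/mapP; exists r.
have -> : \sum_(i <- s) C2_diagonal i = \sum_(i <- t | i \in s) C2_diagonal i.
  rewrite -[RHS]big_filter; apply: perm_big; apply: uniq_perm => //; rewrite ?filter_uniq ?iota_uniq//.
  by move=> r; rewrite [in RHS]mem_filter; apply/idP/andP => [rs|[]//]; split => //; exact: st.
by rewrite big_mkcond /=; apply: ler_sum => r _; case: ifP => // _; exact: C2_diagonal_ge0.
Qed.

End PairCorrelation.

Lemma sum_ord_shift (W : nmodType) (F : nat -> W) r :
  \sum_(a < r) F a.+1 = \sum_(a < r.+1 | (0 < a)%N) F a.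
Proof.
by rewrite [RHS]big_mkcond big_ord_recl /= add0r; apply: eq_bigr.
Qed.

Section Energy.
Context {R : realType}.
Variables (B : set nat) (alpha : R).
Hypothesis B_ge2 : B `<=` [set b | 2 <= b]%N.
Hypothesis B_cop : {in B &, forall b c, b != c -> coprime b c}.
Hypothesis alpha01 : 0 < alpha < 1.
Hypothesis B_regular : regularly_varying (generated_semigroup B) alpha.
Variables (phi : R -> R) (c V : R).
Hypothesis supp : forall x, phi x != 0 -> 0 <= x <= c.
Hypothesis varV : forall K (x : nat -> R), (forall i, (i < K)%N -> x i < x i.+1) ->
  \sum_(i < K) `|phi (x i.+1) - phi (x i)| <= V.
Variables (h : R) (K : nat).
Hypothesis h0 : 0 < h.
Hypothesis cK : c * h < K%:R.
Local Notation Phi := (Phi_ phi h).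
Local Notation sqf := (bsqf (inB B)).
Local Notation J := (generated_semigroup B).
Local Notation N := (counting_function (generated_semigroup B) : R -> R).
Implicit Types (a b d r A M : nat).
Let V0 := window_V_ge0 supp varV.

Definition energy_gt A r : R := \sum_(a < r | (A < minn a (r - a))%N) cnorm (Phi (a%:R / r%:R)) ^+ 2.

Lemma energy_gt_ge0 A r : 0 <= energy_gt A r.
Proof. by apply: sumr_ge0 => *; exact: sqr_ge0. Qed.

Lemma energy_gt_le A r : energy_gt A r <= 16 * V ^+ 2 * r%:R ^+ 2 / A.+1%:R.
Proof.
have -> : 16 * V ^+ 2 * r%:R ^+ 2 / A.+1%:R = 4 * V ^+ 2 * r%:R ^+ 2 * (2 / A.+1%:R + 2 / A.+1%:R).
  by ring.
have s1 := @sum_inv_sqr_tail R A r.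
have s2 : \sum_(a < r | (A < r - a)%N) ((r - a)%N%:R ^+ 2)^-1 <= 2 / A.+1%:R :> R.
  apply: le_trans (@sum_inv_sqr_tail R A r.+1); rewrite [leRHS]big_mkcond big_ord_recl /= add0r -[leRHS]big_mkcond.
  rewrite (reindex_inj rev_ord_inj) /= le_eqVlt; apply/orP; left; apply/eqP.
  by apply: eq_big => [a|a _]; rewrite subKn.
apply: le_trans (ler_wpM2l _ (lerD s1 s2)); last by rewrite !mulr_ge0 ?sqr_ge0.
rewrite mulrDr !mulr_sumr /energy_gt big_mkcond [X in _ <= X + _]big_mkcond [X in _ <= _ + X]big_mkcond -big_split /=.
apply: ler_sum => a _; rewrite leq_min.
have p0 x : 0 <= 4 * V ^+ 2 * r%:R ^+ 2 * (x ^+ 2)^-1 :> R by rewrite !mulr_ge0 ?invr_ge0 ?sqr_ge0.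
case: ifP => [/andP[a1 a2]|_]; last by apply: addr_ge0; case: ifP => // _; rewrite p0.
rewrite a1 a2; have ar : (0 < a < r)%N by rewrite ltn_ord (leq_ltn_trans _ a1).
have := cnorm_Phi_frac supp varV h0 cK ar; set z := cnorm _ => hz.
apply: (@le_trans _ _ (4 * V ^+ 2 * r%:R ^+ 2 * ((minn a (r - a))%:R ^+ 2)^-1)).
  have -> : 4 * V ^+ 2 * r%:R ^+ 2 * ((minn a (r - a))%:R ^+ 2)^-1 = (2 * V * r%:R / (minn a (r - a))%:R) ^+ 2.
    by rewrite exprMn exprVn; ring.
  by rewrite ler_pXn2r ?nnegrE ?cnorm_ge0// divr_ge0 ?mulr_ge0.
by case: (leqP a (r - a)%N) => _; rewrite ?lerDl ?lerDr p0.
Qed.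

Lemma energy_gt0_le r : (K <= r)%N -> energy_gt 0 r <= r%:R * (K%:R * V ^+ 2).
Proof.
move=> Kr; case: r Kr => [|r] Kr; first by rewrite /energy_gt big_ord0 mul0r.
apply: (@le_trans _ _ (\sum_(a < r.+1) cnorm (Phi (a.+1%:R / r.+1%:R)) ^+ 2)).
  rewrite (sum_ord_shift (fun a => cnorm (Phi (a%:R / r.+1%:R)) ^+ 2)) /energy_gt.
  rewrite big_mkcond [leRHS]big_mkcond [leRHS]big_ord_recr /= -[leLHS]addr0; apply: lerD; last exact: sqr_ge0.
  apply: ler_sum => a _; rewrite leq_min; case: ifP => [/andP[-> _]//|_].
  by case: ifP => // _; exact: sqr_ge0.
rewrite (Phi_parseval_ge supp h0 cK)// ler_wpM2l// mulr_natl -[X in _ *+ X]card_ord -sumr_const.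
by apply: ler_sum => m _; rewrite -real_normK ?num_real// ler_pXn2r ?nnegrE// (window_bound supp varV).
Qed.

Lemma reduced_energy_le r : sqf r -> (1 < r)%N -> reduced_energy B phi h r <= energy_gt 0 r.
Proof.
move=> sr r1; rewrite /reduced_energy big_mkcond [leRHS]big_mkcond; apply: ler_sum => a _.
case: ifP => [ra|_]; last by case: ifP => // _; exact: sqr_ge0.
rewrite leq_min subn_gt0 ltn_ord andbT lt0n ifT//.
by apply: contra (breduced_lt B_ge2 B_cop sr r1 ra) => /eqP ->; rewrite dvdn0.
Qed.

(** Three ranges: below [lo] each [r] costs at most $16V^2$ by the decay of $\Phi_H$; between [lo]
    and [hi] the condition $|a| > A$ gains the factor $1/(A+1)$; above [hi] Parseval's identity
    bounds the energy divided by $r^2$ by $K V^2/r$. *)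
Lemma outside_energy_le (lo hi : R) A M : K%:R <= hi -> lo <= hi ->
  \sum_(r < M | sqf r && (1 < r)%N) (r%:R ^+ 2)^-1 *
     energy_gt (if lo <= r%:R <= hi then A else 0) r <=
  V ^+ 2 * (16 * N lo + 16 * N hi / A.+1%:R +
    K%:R * \sum_(r < M | ((r : nat) \in J) && (hi < r%:R)) (r%:R)^-1) :> R.
Proof.
move=> Khi lohi; have hi0 : 0 <= hi by exact: le_trans Khi.
have V20 : 0 <= V ^+ 2 := sqr_ge0 V.
have sJ r : sqf r -> r \in J by move=> sr; exact/mem_set/(sqf_generated B_ge2 sr).
have cnt x : \sum_(r < M | sqf r && (1 < r)%N) (r%:R <= x)%R%:R <= N x :> R.
  have [x0|x0] := ltP x 0.
    rewrite big1; first exact: counting_function_ge0.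
    by move=> r _; rewrite leNgt (lt_le_trans x0).
  apply: le_trans (counting_ge_sum J M x0).
  rewrite big_mkcond [leRHS]big_mkcond; apply: ler_sum => r _.
  case: ifP => [/andP[sr _]|_]; last by case: ifP.
  by rewrite (sJ _ sr) /=; case: (r%:R <= x)%R.
apply: (@le_trans _ _ (\sum_(r < M | sqf r && (1 < r)%N) (16 * V ^+ 2 * (r%:R <= lo)%R%:R +
   16 * V ^+ 2 / A.+1%:R * (r%:R <= hi)%R%:R + V ^+ 2 * K%:R * ((hi < r%:R)%R%:R * (r%:R)^-1)))).
  apply: ler_sum => r /andP[sr r1]; have r0 : 0 < r%:R :> R by rewrite ltr0n (ltnW r1).
  have t1 : 0 <= 16 * V ^+ 2 * (r%:R <= lo)%R%:R :> R by rewrite !mulr_ge0.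
  have t2 : 0 <= 16 * V ^+ 2 / A.+1%:R * (r%:R <= hi)%R%:R :> R by rewrite !mulr_ge0.
  have t3 : 0 <= V ^+ 2 * K%:R * ((hi < r%:R)%R%:R * (r%:R)^-1) :> R by rewrite !mulr_ge0 ?invr_ge0.
  have [rhi|rhi] := leP (r%:R : R) hi; last first.
    rewrite andbF; apply: le_trans (_ : V ^+ 2 * K%:R * (1 * r%:R^-1) <= _).
      rewrite mul1r mulrC ler_pdivrMr ?exprn_gt0//.
      have Kr : (K <= r)%N by rewrite -(ler_nat R); exact: le_trans (ltW rhi).
      apply: le_trans (energy_gt0_le Kr) _; rewrite le_eqVlt; apply/orP; left; apply/eqP.
      by field; rewrite gt_eqF.
    by rewrite lerDr; move: t1 t2; rewrite mulr0 addr0.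
  have e A' : (r%:R ^+ 2)^-1 * energy_gt A' r <= 16 * V ^+ 2 / A'.+1%:R :> R.
    rewrite mulrC ler_pdivrMr ?exprn_gt0//; apply: le_trans (energy_gt_le A' r) _.
    by rewrite mulrAC.
  have [lor|lor] := leP lo (r%:R : R).
    rewrite andTb; apply: le_trans (e A) _; rewrite !mulr1 mul0r mulr0 addr0 lerDr//.
  rewrite andFb; apply: le_trans (e 0%N) _; rewrite divr1 (ltW lor) mulr1 -addrA lerDl mul0r mulr0 addr0.
  by rewrite !mulr_ge0 ?invr_ge0.
rewrite !big_split /= -!mulr_sumr.
rewrite [leRHS](_ : _ = 16 * V ^+ 2 * N lo + 16 * V ^+ 2 / A.+1%:R * N hi +
   V ^+ 2 * K%:R * \sum_(r < M | ((r : nat) \in J) && (hi < r%:R)) (r%:R)^-1); last by ring.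
apply: lerD; [apply: lerD|]; rewrite ler_wpM2l ?mulr_ge0 ?invr_ge0//.
rewrite big_mkcond [leRHS]big_mkcond; apply: ler_sum => r _.
case: ifP => [/andP[sr _]|_]; last by case: ifP => // _; rewrite invr_ge0.
by rewrite sJ//=; case: ifP => _; rewrite ?mul1r ?mul0r.
Qed.

Lemma C2_diagonal_le r : sqf r -> (1 < r)%N ->
  C2_diagonal B phi h r <= (r%:R ^+ 2)^-1 * energy_gt 0 r.
Proof.
move=> sr r1; apply: ler_pM; rewrite ?sqr_ge0 ?reduced_energy_ge0// ?reduced_energy_le//.
rewrite -exprVn -real_normK ?num_real// ler_pXn2r ?nnegrE ?invr_ge0//.
exact: (gB_abs_le B_ge2 B_cop alpha01 B_regular sr).
Qed.

Lemma C2_diagonal_sum_bounded :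
  exists C, forall M, \sum_(r < M | sqf r && (1 < r)%N) C2_diagonal B phi h r <= C.
Proof.
have [C [C0 HC]] := recip_sum_bounded B_ge2 alpha01 B_regular.
exists (V ^+ 2 * (16 * N K%:R + 16 * N K%:R / 1 + K%:R * C)) => M.
apply: (@le_trans _ _ (\sum_(r < M | sqf r && (1 < r)%N) (r%:R ^+ 2)^-1 *
     energy_gt (if (K%:R : R) <= r%:R <= K%:R then 0 else 0) r)).
  by apply: ler_sum => r /andP[sr r1]; rewrite if_same; exact: C2_diagonal_le.
apply: le_trans (outside_energy_le 0 M (lexx _) (lexx _)) _.
rewrite ler_wpM2l ?sqr_ge0// lerD2l ler_wpM2l//; apply: le_trans (HC M).
rewrite big_mkcond [leRHS]big_mkcond; apply: ler_sum => r _.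
by case: (_ \in _) => //=; case: ifP => // _; rewrite invr_ge0.
Qed.

Lemma C2E : C2 B phi h = limn (fun M => \sum_(r < M | sqf r && (1 < r)%N) C2_diagonal B phi h r).
Proof.
by rewrite /C2 (C2_complexE B_ge2 B_cop supp h0 cK (erefl _) C2_diagonal_sum_bounded).
Qed.

Let S_nd : nondecreasing_seq (fun M => \sum_(r < M | sqf r && (1 < r)%N) C2_diagonal B phi h r).
Proof.
apply/nondecreasing_seqP => M; rewrite [leRHS]big_mkcond big_ord_recr -big_mkcond /=.
by rewrite lerDl; case: ifP => // _; exact: C2_diagonal_ge0.
Qed.

Let S_cvg : cvgn (fun M => \sum_(r < M | sqf r && (1 < r)%N) C2_diagonal B phi h r).
Proof.
have [C HC] := C2_diagonal_sum_bounded.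
by apply: nondecreasing_is_cvgn; [exact: S_nd|exists C => _ [M _ <-]; exact: HC].
Qed.

Lemma C2_partial_le M : \sum_(r < M | sqf r && (1 < r)%N) C2_diagonal B phi h r <= C2 B phi h.
Proof.
by rewrite C2E; exact: (nondecreasing_cvgn_le S_nd S_cvg M).
Qed.

Lemma C2_le x : (forall M, \sum_(r < M | sqf r && (1 < r)%N) C2_diagonal B phi h r <= x) ->
  C2 B phi h <= x.
Proof. by move=> H; rewrite C2E; apply: limr_le; [exact: S_cvg|exact: nearW]. Qed.

End Energy.

Lemma sum_inv_sqr_multiples (R : realType) r M : (0 < r)%N ->
  \sum_(d < M | (r %| d)%N && (0 < d)%N) (d%:R ^+ 2)^-1 <= 2 / r%:R ^+ 2 :> R.
Proof.
move=> r0.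
apply: (@le_trans _ _ (\sum_(d < M) \sum_(m < M | (0 < m)%N) ((d : nat) == r * m)%N%:R * ((r * m)%N%:R ^+ 2)^-1)).
  rewrite big_mkcond; apply: ler_sum => d _; case: ifP => [/andP[rd d0]|_]; last first.
    by apply: sumr_ge0 => m _; rewrite mulr_ge0 ?invr_ge0 ?sqr_ge0.
  have hm : (d %/ r < M)%N by apply: leq_ltn_trans (ltn_ord d); exact: leq_div.
  rewrite (bigD1 (Ordinal hm)) /=; last by rewrite divn_gt0// dvdn_leq.
  rewrite mulnC divnK// eqxx mul1r lerDl; apply: sumr_ge0 => m _.
  by rewrite mulr_ge0 ?invr_ge0 ?sqr_ge0.
rewrite exchange_big /=.
apply: (@le_trans _ _ (\sum_(m < M | (0 < m)%N) (r%:R ^+ 2)^-1 * (m%:R ^+ 2)^-1)).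
  apply: ler_sum => m m0; rewrite natrM exprMn invfM.
  have [hm|hm] := ltnP (r * m) M.
    rewrite (bigD1 (Ordinal hm)) //= eqxx mul1r big1 ?addr0// => d dm.
    by case: eqP => [e|_]; [move/negP: dm; case; apply/eqP/val_inj|rewrite mul0r].
  rewrite big1 => [|d _]; first by rewrite mulr_ge0 ?invr_ge0 ?sqr_ge0.
  by case: eqP => [e|_]; [have := ltn_ord d; rewrite e ltnNge hm|rewrite mul0r].
rewrite -mulr_sumr mulrC ler_wpM2r ?invr_ge0 ?sqr_ge0//.
by apply: le_trans (@sum_inv_sqr_tail R 0 M) _; rewrite divr1.
Qed.

(** * Lower bound for the variance *)

Section EnergyLower.
Context {R : realType}.
Variables (B : set nat) (alpha : R).
Hypothesis B_ge2 : B `<=` [set b | 2 <= b]%N.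
Hypothesis B_cop : {in B &, forall b c, b != c -> coprime b c}.
Hypothesis alpha01 : 0 < alpha < 1.
Hypothesis B_regular : regularly_varying (generated_semigroup B) alpha.
Local Notation sqf := (bsqf (inB B)).
Local Notation J := (generated_semigroup B).
Local Notation N := (counting_function (generated_semigroup B) : R -> R).
Local Notation N1 := (counting_function (B_squarefree B) : R -> R).

(** [sum_residues_reduced] without the residue [0]: the term [a = d] on the left and the denominator
    [1] on the right are both [F 1]. *)
Lemma sum_residues_gt1 (W : zmodType) (F : R -> W) d : sqf d -> (1 < d)%N ->
  \sum_(a < d | (0 < a)%N) F (a%:R / d%:R) =
  \sum_(r < d.+1 | sqf r && (1 < r)%N && (r %| d)%N) \sum_(a < r | breduced B a r) F (a%:R / r%:R).
Proof.
move=> sd d1; have := sum_residues_reduced B_ge2 B_cop F sd.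
have -> : \sum_(1 <= a < d.+1) F (a%:R / d%:R) = \sum_(a < d | (0 < a)%N) F (a%:R / d%:R) + F 1.
  rewrite big_nat_recr ?(ltnW d1)//= divff ?pnatr_eq0 -?lt0n ?(ltnW d1)//; congr (_ + _).
  rewrite -(big_mkord (fun a => (0 < a)%N) (fun a => F (a%:R / d%:R))).
  rewrite [RHS]big_mkcond (big_ltn (ltnW d1)) /= add0r [RHS]big_nat [LHS]big_nat.
  by apply: eq_bigr => a /andP[-> _].
have o1 : (1 < d.+1)%N by rewrite ltnS ltnW.
rewrite (bigD1 (Ordinal o1)) /=; last by rewrite (bsqf1 (@inB_gt1 B B_ge2)) dvd1n.
have -> : \sum_(1 <= a < 2 | breduced B a 1) F (a%:R / 1%:R) = F 1.
  rewrite big_mkcond big_nat1 divr1 ifT//; apply/breducedP => // b Bb.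
  by rewrite dvdn1 => /eqP b1; have := inB_gt1 B_ge2 Bb; rewrite b1.
rewrite [X in X = _ -> _]addrC => /(congr1 (fun z => - F 1 + z)); rewrite !addKr => ->.
apply: eq_big => [r|r /andP[/andP[sr rd] r1]].
  rewrite -andbA [X in _ && X]andbC andbA; case sr : (sqf r) => //=; congr (_ && _).
  have r0 := sqf_gt0 B_ge2 sr; rewrite -(inj_eq val_inj) /=.
  by case: (ltngtP r 1%N) => //; rewrite ltnS leqNgt r0.
have r0 := sqf_gt0 B_ge2 sr; apply: (big_breduced B_ge2 B_cop (fun a => F (a%:R / r%:R))) => //.
by move: r1; rewrite -(inj_eq val_inj) /=; case: (ltngtP r 1%N) => //; rewrite ltnS leqNgt r0.
Qed.

Variables (phi : R -> R) (c V : R).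
Hypothesis supp : forall x, phi x != 0 -> 0 <= x <= c.
Hypothesis varV : forall K (x : nat -> R), (forall i, (i < K)%N -> x i < x i.+1) ->
  \sum_(i < K) `|phi (x i.+1) - phi (x i)| <= V.
Hypothesis phi_neq0 : exists a b : R, a < b /\ forall x, a < x < b -> phi x != 0.
Hypothesis c0 : 0 <= c.
Let V0 := window_V_ge0 supp varV.

(** Regrouping by reduced denominators [r] gives the weight $\sum_{r \mid d} d^{-2} \le 2/r^2$, and
    $|g(r)| \ge \mathcal{M}_B/r$ turns it into $2 g(r)^2/\mathcal{M}_B^2$. *)
Lemma divisor_energy_le h K M : 0 < h -> c * h < K%:R ->
  \sum_(d < M | sqf d && (1 < d)%N) (d%:R ^+ 2)^-1 *
     \sum_(a < d | (0 < a)%N) cnorm (Phi_ phi h (a%:R / d%:R)) ^+ 2 <=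
  2 / limn (euler_partial (R := R) B 1) ^+ 2 * C2 B phi h.
Proof.
move=> h0 cK; set m0 := limn _.
have m00 : 0 < m0 := sieve_density_gt0 B_ge2 B_cop alpha01 B_regular.
pose U r := reduced_energy B phi h r.
have U0 r : 0 <= U r by exact: reduced_energy_ge0.
apply: (@le_trans _ _ (\sum_(d < M | sqf d && (1 < d)%N) \sum_(r < M | sqf r && (1 < r)%N)
    ((r %| d)%N && (0 < d)%N)%:R * (d%:R ^+ 2)^-1 * U r)).
  apply: ler_sum => d /andP[sd d1].
  rewrite (sum_residues_gt1 (fun t => cnorm (Phi_ phi h t) ^+ 2) sd d1) mulr_sumr.
  rewrite (big_ord_widen_cond M (fun r => sqf r && (1 < r)%N && (r %| d)%N) (fun r => (d%:R ^+ 2)^-1 * U r)) ?ltn_ord//.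
  rewrite big_mkcond [leRHS]big_mkcond; apply: ler_sum => r _.
  have p : 0 <= (d%:R ^+ 2)^-1 * U r by rewrite mulr_ge0 ?invr_ge0 ?sqr_ge0.
  case sr : (sqf r && (1 < r)%N) => //=; rewrite (ltnW d1) andbT -mulrA.
  by case: (r %| d)%N => /=; rewrite ?mul1r ?mul0r//; case: ifP => // _; rewrite p.
rewrite exchange_big /=.
apply: (@le_trans _ _ (\sum_(r < M | sqf r && (1 < r)%N) 2 / m0 ^+ 2 * C2_diagonal B phi h r)); last first.
  rewrite -mulr_sumr ler_wpM2l ?divr_ge0 ?sqr_ge0//.
  exact: (C2_partial_le B_ge2 B_cop alpha01 B_regular supp varV h0 cK).
apply: ler_sum => r /andP[sr r1]; have r0 := ltnW r1; have rp : 0 < r%:R :> R by rewrite ltr0n.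
rewrite -mulr_suml /C2_diagonal mulrA ler_wpM2r//.
apply: (@le_trans _ _ (2 / r%:R ^+ 2)).
  apply: le_trans (sum_inv_sqr_multiples R M r0); rewrite big_mkcond [leRHS]big_mkcond.
  apply: ler_sum => d _; have p : 0 <= (d%:R ^+ 2)^-1 :> R by rewrite invr_ge0 sqr_ge0.
  by case: (_ && (0 < d)%N); case: ifP => _; rewrite ?mul1r ?mul0r.
have g2 : m0 ^+ 2 / r%:R ^+ 2 <= g_B B r ^+ 2 :> R.
  have := gB_abs_ge B_ge2 B_cop sr; rewrite -/m0 => g.
  rewrite -exprVn -exprMn -[leRHS]real_normK ?num_real// ler_pXn2r ?nnegrE ?mulr_ge0 ?invr_ge0 ?(ltW m00)//.
  exact: g.
have -> : 2 / r%:R ^+ 2 = 2 / m0 ^+ 2 * (m0 ^+ 2 / r%:R ^+ 2) :> R by field; rewrite !gt_eqF.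
by rewrite ler_wpM2l// divr_ge0 ?sqr_ge0.
Qed.

(* Parseval bounds the sum over all nonzero [a] modulo [d] from below, for [d]
   in a window above [h]; regrouping the [a / d] by reduced fractions returns to
   the terms of [C2]. *)
Lemma C2_lower : exists c1 h1 : R, [/\ 0 < c1, 1 <= h1 & forall h, h1 <= h ->
  c1 * N h <= C2 B phi h].
Proof.
have [e0 [h2 [e00 h20 He]]] := sum_sqr_window_ge supp varV phi_neq0.
have [cs [xs [xs1 cs0 Hs]]] := sqf_count_lower B_ge2 B_cop alpha01 B_regular.
have /andP[a0 a1] := alpha01.
have etaa : 0 < alpha / 2 < alpha by apply/andP; split; lra.
have [C [x0 [x01 C0 HC]]] := counting_potter_low B_regular etaa.
pose kap := c + 1; have kap0 : 0 < kap by rewrite ltr_wpDl.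
(* For $d > \lambda h$ the modulus exceeds the window size, so Parseval's identity is diagonal, and
   the residue [0], worth at most $(VK)^2$, takes no more than half of the lower bound $d\,e_0
   h$. *)
pose lam := kap + 1 + 2 * V ^+ 2 * kap ^+ 2 / e0.
have q0 : 0 <= 2 * V ^+ 2 * kap ^+ 2 / e0 by rewrite !mulr_ge0 ?sqr_ge0 ?invr_ge0// ltW.
have lam1 : 1 <= lam by rewrite /lam; lra.
have lamk : kap <= lam by rewrite /lam; lra.
have lam0 : 0 < lam by exact: lt_le_trans lam1.
have lamV : V ^+ 2 * kap ^+ 2 <= lam * e0 / 2.
  have : 2 * V ^+ 2 * kap ^+ 2 / e0 * e0 <= lam * e0.
    by rewrite ler_wpM2r ?(ltW e00)// /lam lerDr; lra.
  rewrite divfK ?gt_eqF//; lra.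
pose g := alpha - alpha / 2; have g0 : 0 < g by rewrite /g; lra.
(* Chosen so that the squarefree count up to $\Lambda x$ is at least $2N(x)$; then at least $N(x)$
   squarefree [d] lie between [x] and $\Lambda x$. *)
pose Lam := Num.max 1 ((2 * C / cs) `^ g^-1).
have Lam1 : 1 <= Lam by rewrite le_max lexx.
have Lam0 : 0 < Lam by exact: lt_le_trans Lam1.
have LamC : 2 * C / cs <= Lam `^ g.
  apply: (@le_trans _ _ (((2 * C / cs) `^ g^-1) `^ g)).
    by rewrite -powRrM mulVf ?gt_eqF// powRr1// divr_ge0 ?mulr_ge0// ltW.
  by rewrite ge0_ler_powR ?nnegrE ?(ltW g0) ?powR_ge0 ?(ltW Lam0)// le_max lexx orbT.
pose m0 : R := limn (euler_partial (R := R) B 1).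
have m00 : 0 < m0 := sieve_density_gt0 B_ge2 B_cop alpha01 B_regular.
exists (e0 / 2 / (Lam * lam) / (2 / m0 ^+ 2)), (Num.max (Num.max h2 x0) (Num.max xs 1)).
split; [by rewrite !divr_gt0 ?mulr_gt0 ?exprn_gt0|by rewrite !le_max lexx !orbT|].
move=> h; rewrite !ge_max => /andP[/andP[hh2 hx0] /andP[hxs h1]].
have h0 : 0 < h by exact: lt_le_trans h1.
pose K := (Num.truncn (c * h)).+1.
have cK : c * h < K%:R by exact: truncnS_gt.
have Kk : K%:R <= kap * h.
  by rewrite /K -natr1 /kap mulrDl mul1r lerD// truncn_le// mulr_ge0// ltW.
rewrite mulrAC ler_pdivrMr ?divr_gt0 ?exprn_gt0// [leRHS]mulrC.
pose x := lam * h; pose y := Lam * x.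
have hx : h <= x by rewrite ler_peMl// ltW.
have xy : x <= y by rewrite ler_peMl// (le_trans (ltW h0) hx).
have x00 : 0 < x by exact: lt_le_trans hx.
have y00 : 0 < y by exact: lt_le_trans xy.
pose M := (Num.truncn y).+1.
apply: le_trans (divisor_energy_le M h0 cK).
have NyM : N1 y <= \sum_(d < M | sqf d && (x < d%:R <= y)) 1 + N1 x.
  rewrite (counting_functionE _ (ltW y00)) -/M (bigID (fun d : 'I_M => d%:R <= x)) /= addrC; apply: lerD.
    rewrite big_mkcond [leRHS]big_mkcond; apply: ler_sum => d _.
    rewrite (B_squarefreeE B_ge2 B_cop) -ltNge.
    have dy : d%:R <= y by rewrite -truncn_ge_nat ?(ltW y00)//; have := ltn_ord d; rewrite ltnS.
    by rewrite dy andbT.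
  exact: counting_ge_sum (ltW x00).
have Nd : N h <= \sum_(d < M | sqf d && (x < d%:R <= y)) 1.
  have n1 : N1 x <= N x.
    by apply: le_counting_function => // n /mem_set; rewrite (B_squarefreeE B_ge2 B_cop) => /(sqf_generated B_ge2).
  have n2 : N h <= N x by exact: le_counting_function.
  have n3 : 2 * N x <= N1 y.
    apply: le_trans (Hs y _); last by apply: le_trans hxs _; exact: le_trans xy.
    have := HC x y _ _ xy; rewrite -/g => hc.
    have {hc} : N x <= C * (x / y) `^ g * N y.
      by apply: hc; [apply: le_trans hx0 _; exact: le_trans xy|exact: le_trans hx].
    have -> : x / y = Lam^-1 by rewrite /y; field; rewrite !gt_eqF.
    rewrite -powR_inv1 ?(ltW Lam0)// -powRrM mulN1r powRN => hc.
    have Lg : 0 < Lam `^ g by exact: powR_gt0.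
    have Ny0 : 0 <= N y by exact: counting_function_ge0.
    have h3 : N x * Lam `^ g <= C * N y.
      have := ler_wpM2r (ltW Lg) hc.
      by rewrite [leRHS]mulrAC divfK ?gt_eqF.
    have h4 : N x * (2 * C / cs) <= C * N y.
      by apply: le_trans h3; rewrite ler_wpM2l// counting_function_ge0.
    rewrite -(ler_pM2l C0); have := ler_wpM2r (ltW cs0) h4.
    rewrite -!mulrA mulVf ?gt_eqF// mulr1 => h5.
    by rewrite [X in X <= _](_ : _ = N x * (2 * C)) ?[X in _ <= X](_ : _ = C * (N y * cs))//; ring.
  lra.
have w0 : 0 <= e0 / 2 / (Lam * lam) by rewrite !divr_ge0 ?mulr_ge0 ?ltW.
apply: le_trans (ler_wpM2l w0 Nd) _; rewrite mulr_sumr big_mkcond [leRHS]big_mkcond.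
apply: ler_sum => d _; rewrite mulr1.
case: ifP => [/andP[sd /andP[xd dy]]|_]; last first.
  by case: ifP => // _; rewrite mulr_ge0 ?invr_ge0 ?sqr_ge0// sumr_ge0// => *; exact: sqr_ge0.
have d1 : (1 < d)%N.
  by rewrite -(ltr_nat R); apply: le_lt_trans xd; exact: le_trans hx.
rewrite sd d1 /=; have d0 : 0 < d%:R :> R by rewrite ltr0n ltnW.
have Kd : (K <= d)%N.
  rewrite -(ler_nat R); apply/ltW/(le_lt_trans _ xd)/(le_trans Kk).
  by rewrite ler_wpM2r// ltW.
have P := Phi_parseval_ge supp h0 cK (ltnW d1) Kd.
rewrite (sum_ord_shift (fun a => cnorm (Phi_ phi h (a%:R / d%:R)) ^+ 2)) in P.
rewrite big_mkcond big_ord_recr /= (ltnW d1) -big_mkcond /= in P.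
have P2 := He h K hh2 cK.
have P3 : cnorm (Phi_ phi h (d%:R / d%:R)) ^+ 2 <= d%:R * e0 * h / 2.
  apply: (@le_trans _ _ ((V * K%:R) ^+ 2)).
    by rewrite ler_pXn2r ?nnegrE ?cnorm_ge0 ?mulr_ge0// (cnorm_Phi_le supp varV h0 cK).
  apply: (@le_trans _ _ (V ^+ 2 * (kap * h) ^+ 2)).
    by rewrite exprMn ler_wpM2l ?sqr_ge0// ler_pXn2r ?nnegrE ?mulr_ge0 ?(ltW kap0) ?(ltW h0).
  rewrite exprMn mulrA; apply: (@le_trans _ _ (lam * e0 / 2 * h ^+ 2)).
    by rewrite ler_wpM2r ?sqr_ge0.
  have -> : lam * e0 / 2 * h ^+ 2 = x * (e0 * h / 2) by rewrite /x; ring.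
  have -> : d%:R * e0 * h / 2 = d%:R * (e0 * h / 2) by ring.
  by rewrite ler_wpM2r ?(ltW xd)// !mulr_ge0 ?invr_ge0// ltW.
have P4 : d%:R * (e0 * h) <= d%:R * \sum_(m < K) phi (m%:R / h) ^+ 2 by rewrite ler_wpM2l.
set E := \sum_(a < d | _) _ in P *.
have P5 : d%:R * e0 * h / 2 <= E.
  have {P2} : d%:R * (e0 * h) <= E + cnorm (Phi_ phi h (d%:R / d%:R)) ^+ 2 by rewrite P.
  lra.
rewrite [leRHS]mulrC ler_pdivlMr ?exprn_gt0//; apply: le_trans P5.
have -> : e0 / 2 / (Lam * lam) * d%:R ^+ 2 = e0 / 2 * h * d%:R * (d%:R / y).
  by rewrite /y /x; field; rewrite !gt_eqF.
have -> : d%:R * e0 * h / 2 = e0 / 2 * h * d%:R * 1 by ring.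
rewrite ler_wpM2l ?ler_pdivrMr ?mul1r//.
by rewrite !mulr_ge0 ?invr_ge0// ltW.
Qed.

End EnergyLower.

(** Expand the square: the diagonal gives the first term, and the frequency differences are
    nonintegral with denominator at most [Q], so each off-diagonal geometric sum is at most
    [2 * Q]. *)
Lemma mean_square_trig (R : realType) (I : finType) (P : pred I) (z : I -> R[i]) (sg : I -> R) Q M :
  (forall i j, P i -> P j -> i != j -> sg i - sg j \isn't a Num.int) ->
  (forall i j, P i -> P j -> exists q, [/\ (0 < q)%N, (q <= Q)%N & q%:R * (sg i - sg j) \is a Num.int]) ->
  \sum_(n < M) cnorm (\sum_(i | P i) z i * e_ (n.+1%:R * sg i)) ^+ 2 <=
  M%:R * \sum_(i | P i) cnorm (z i) ^+ 2 + 2 * Q%:R * (\sum_(i | P i) cnorm (z i)) ^+ 2.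
Proof.
move=> sgN sgQ; set A := \sum_(n < M) _; set D := \sum_(i | P i) cnorm (z i) ^+ 2.
rewrite -lerBlDl; apply: le_trans (ler_norm _) _; rewrite -cnorm_real.
have -> : (A - M%:R * D)%:C%C = \sum_(i | P i) \sum_(j | P j && (j != i))
    z i * (z j)^*%C * \sum_(n < M) e_ (n.+1%:R * (sg i - sg j)).
  rewrite rmorphB /=.
  have -> : A%:C%C = \sum_(i | P i) \sum_(j | P j) z i * (z j)^*%C * \sum_(n < M) e_ (n.+1%:R * (sg i - sg j)).
    rewrite /A rmorph_sum /=.
    rewrite (eq_bigr (fun n : 'I_M => \sum_(i | P i) \sum_(j | P j) z i * (z j)^*%C * e_ (n.+1%:R * (sg i - sg j)))).
      rewrite exchange_big /=; apply: eq_bigr => i _; rewrite exchange_big /=; apply: eq_bigr => j _.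
      by rewrite mulr_sumr.
    move=> n _; rewrite sqr_cnorm rmorph_sum mulr_suml; apply: eq_bigr => i _.
    rewrite mulr_sumr; apply: eq_bigr => j _; rewrite rmorphM mulrACA; congr (_ * _).
    by rewrite -[X in _ * X]/((e_ _)^*%C) -e_N -e_D; congr e_; ring.
  rewrite rmorphM /= /D rmorph_sum mulr_sumr -sumrB; apply: eq_bigr => i Pi.
  rewrite (bigD1 i) //= addrC sqr_cnorm [X in _ * _ * X](eq_bigr (fun=> 1)); last first.
    by move=> n _; rewrite subrr mulr0 e_0.
  by rewrite sumr_const card_ord rmorph_nat [M%:R * _]mulrC addrK.
apply: le_trans (cnorm_sum _ _ _) _.
rewrite expr2 mulr_suml mulr_sumr; apply: ler_sum => i Pi.
apply: le_trans (cnorm_sum _ _ _) _.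
rewrite mulr_sumr mulr_sumr big_mkcondr /=; apply: ler_sum => j Pj.
case: ifP => [ji|_]; last by rewrite !mulr_ge0 ?cnorm_ge0.
rewrite !cnormM cnormJ mulrC ler_wpM2r ?mulr_ge0 ?cnorm_ge0//.
have [q [q0 qQ qi]] := sgQ i j Pi Pj.
apply: le_trans (cnorm_exp_sum M q0 qi _) _; first by apply: sgN => //; rewrite eq_sym.
by rewrite ler_wpM2l// ler_nat.
Qed.

(** * Truncation of the deviation *)

Section Decomposition.
Context {R : realType}.
Variables (B : set nat) (alpha : R).
Hypothesis B_ge2 : B `<=` [set b | 2 <= b]%N.
Hypothesis B_cop : {in B &, forall b c, b != c -> coprime b c}.
Hypothesis alpha01 : 0 < alpha < 1.
Hypothesis B_regular : regularly_varying (generated_semigroup B) alpha.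
Local Notation sqf := (bsqf (inB B)).
Local Notation mu d := ((mu_B B d)%:~R : R).
Variables (phi : R -> R) (c V : R).
Hypothesis supp : forall x, phi x != 0 -> 0 <= x <= c.
Hypothesis varV : forall K (x : nat -> R), (forall i, (i < K)%N -> x i < x i.+1) ->
  \sum_(i < K) `|phi (x i.+1) - phi (x i)| <= V.
Variables (h : R) (K : nat).
Hypothesis h0 : 0 < h.
Hypothesis cK : c * h < K%:R.
Local Notation Phi := (Phi_ phi h).
Implicit Types (a d r D M n : nat) (w : nat -> nat -> R).
Let V0 := window_V_ge0 supp varV.

Definition reduced_pair D (p : 'I_D * 'I_D) :=
  [&& sqf p.1, (1 < p.1)%N, (p.2 < p.1)%N & breduced B p.2 p.1].

Lemma sum_reduced_pair (W : nmodType) (F : nat -> nat -> W) D :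
  \sum_(p : 'I_D * 'I_D | reduced_pair p) F p.1 p.2 =
  \sum_(r < D | sqf r && (1 < r)%N) \sum_(a < r | breduced B a r) F r a.
Proof.
rewrite (eq_bigr (fun r : 'I_D => \sum_(a < D | breduced B a r && (a < r)%N) F r a)); last first.
  move=> r _; apply: (big_ord_widen_cond D (fun a => breduced B a r) (F r)); exact: ltnW.
rewrite pair_big_dep /=; apply: eq_bigl => -[r a] /=.
by rewrite /reduced_pair /= -!andbA [breduced _ _ _ && _]andbC.
Qed.

(** The weight is a parameter so that one mean-square estimate serves the coefficients [gD], their
    truncations and the differences of the two. *)
Definition trig D w n : R[i] := \sum_(p : 'I_D * 'I_D | reduced_pair p)
  ((w p.1 p.2)%:C%C * Phi (p.2%:R / p.1%:R)) * e_ (n%:R * (p.2%:R / p.1%:R)).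

Lemma reduced_pair_frac D (p q : 'I_D * 'I_D) : reduced_pair p -> reduced_pair q ->
  ((p.2%:R / p.1%:R - q.2%:R / q.1%:R : R) \is a Num.int) = (p == q).
Proof.
case: p q => [r a] [r' a'] /and4P[/= s1 r1 ar ra] /and4P[/= s2 r2 ar' ra'].
have -> : (a%:R / r%:R - a'%:R / r'%:R : R) \is a Num.int =
  ((a%:R / r%:R + (r' - a')%N%:R / r'%:R : R) \is a Num.int).
  have -> : a%:R / r%:R + (r' - a')%N%:R / r'%:R = (a%:R / r%:R - a'%:R / r'%:R) + 1 :> R.
    by rewrite natrB ?(ltnW ar')// mulrBl divff ?pnatr_eq0 -?lt0n ?(ltnW r2)//; ring.
  have i1 : (1 : R) \is a Num.int by exact: rpred1.
  by apply/idP/idP => hx; [exact: rpredD hx i1|have := rpredB hx i1; rewrite addrK].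
rewrite (breduced_frac_sum B_ge2 B_cop)// ?breduced_sub ?(ltnW ar') ?(ltnW r2)//.
rewrite xpair_eqE; case: eqP => [e|ne]; last by apply/esym/negbTE/negP => /andP[/eqP e]; case: ne; rewrite e.
have er : r = r' by exact/val_inj.
subst r'; rewrite eqxx /= -(inj_eq val_inj) /=; apply/idP/eqP => [/dvdnP[k kE]|->].
  have k1 : k = 1%N by nia.
  by move: kE; rewrite k1 mul1n; lia.
by rewrite subnKC// ltnW.
Qed.

Lemma trig_mean_square D w M :
  \sum_(n < M) cnorm (trig D w n.+1) ^+ 2 <=
  M%:R * \sum_(p : 'I_D * 'I_D | reduced_pair p) (w p.1 p.2 ^+ 2 * cnorm (Phi (p.2%:R / p.1%:R)) ^+ 2) +
  2 * (D * D)%N%:R * (\sum_(p : 'I_D * 'I_D | reduced_pair p) `|w p.1 p.2| * cnorm (Phi (p.2%:R / p.1%:R))) ^+ 2.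
Proof.
have E (p : 'I_D * 'I_D) : cnorm ((w p.1 p.2)%:C%C * Phi (p.2%:R / p.1%:R)) = `|w p.1 p.2| * cnorm (Phi (p.2%:R / p.1%:R)).
  by rewrite cnormM cnorm_real.
have E2 (p : 'I_D * 'I_D) : cnorm ((w p.1 p.2)%:C%C * Phi (p.2%:R / p.1%:R)) ^+ 2 = w p.1 p.2 ^+ 2 * cnorm (Phi (p.2%:R / p.1%:R)) ^+ 2.
  by rewrite E exprMn; congr (_ * _); apply: real_normK; exact: num_real.
rewrite -(eq_bigr _ (fun p _ => E2 p)) -(eq_bigr _ (fun p _ => E p)).
apply: (@mean_square_trig R _ (@reduced_pair D) _ (fun p : 'I_D * 'I_D => p.2%:R / p.1%:R) (D * D) M) => [p q Pp Pq|[r a] [r' a'] /and4P[/= s1 r1 _ _] /and4P[/= s2 r2 _ _]].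
  by rewrite reduced_pair_frac.
have r0 : (r : nat)%:R != 0 :> R by rewrite pnatr_eq0 -lt0n ltnW.
have r0' : (r' : nat)%:R != 0 :> R by rewrite pnatr_eq0 -lt0n ltnW.
exists (r * r')%N; split; first by rewrite muln_gt0 (ltnW r1) (ltnW r2).
  by apply: leq_mul; exact/ltnW/ltn_ord.
have -> : (r * r')%:R * (a%:R / r%:R - a'%:R / r'%:R) = (a * r')%N%:Z%:~R - (a' * r)%N%:Z%:~R :> R.
  by rewrite /= -!pmulrn !natrM; field; rewrite r0 r0'.
by rewrite rpredB// intr_int.
Qed.

(** Linearity in the first argument makes the summand vanish with [phi], which leaves the finite
    window [n, ..., n + K - 1]. *)
Lemma sum_window_shift (F : R -> int -> R) n : (forall x u, F x u = x * F 1 u) ->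
  \sum_(u \in [set: int]) F (phi ((u%:~R - n%:R) / h)) u =
  \sum_(m < K) F (phi (m%:R / h)) (n + m)%N%:Z.
Proof.
move=> FE.
rewrite (fsbigE [seq (n + m)%N%:Z | m <- iota 0 K]) //=; last first.
- move=> u _ uN; rewrite FE; suff -> : phi ((u%:~R - n%:R) / h) = 0 by rewrite mul0r.
  apply: contraNeq uN => /supp/andP[].
  have -> : u%:~R - n%:R = (u - n%:Z)%:~R :> R by rewrite intrB.
  rewrite ler_pdivlMr// mul0r ler0z ler_pdivrMr// => m0 mc.
  apply/mapP; exists (absz (u - n%:Z)); last first.
    by rewrite PoszD gez0_abs// addrCA subrr addr0.
  by rewrite mem_iota /= add0n -(ltr_nat R) natr_absz ger0_norm// (le_lt_trans mc).
- by rewrite map_inj_uniq ?iota_uniq// => i j [] /addnI.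
rewrite big_map (eq_bigl xpredT); last by move=> m; rewrite in_setT.
rewrite -[in LHS](subn0 K) -/(index_iota 0 K) big_mkord; apply: eq_bigr => m _.
by rewrite -pmulrn natrD addrAC subrr add0r.
Qed.

(** Orthogonality of additive characters modulo [d]; subtracting $1/d$ removes the residue [0]. *)
Lemma residue_window d n : (0 < d)%N ->
  (\sum_(m < K) phi (m%:R / h) * ((d %| n + m)%N%:R - d%:R^-1))%:C%C =
  (d%:R^-1)%:C%C * \sum_(a < d | (0 < a)%N) Phi (a%:R / d%:R) * e_ (n%:R * (a%:R / d%:R)).
Proof.
move=> d0; have d0' : d%:R != 0 :> R by rewrite pnatr_eq0 -lt0n.
have E m : \sum_(a < d | (0 < a)%N) e_ ((n + m)%N%:R * (a%:R / d%:R)) = (d%:R * (d %| n + m)%N%:R - 1)%:C%C :> R[i].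
  have := @sum_e_residues R d (n + m)%N%:Z d0.
  rewrite (sum_ord_shift (fun a => e_ (a%:R * ((n + m)%N%:Z%:~R / d%:R)))).
  rewrite big_mkcond big_ord_recr /= d0 -big_mkcond /= [d%:R * _]mulrC divfK// => H.
  transitivity (\sum_(a < d | (0 < a)%N) e_ (a%:R * ((n + m)%N%:R / d%:R)) : R[i]).
    by apply: eq_bigr => a _; congr e_; ring.
  apply: (addIr (e_ (n + m)%N%:R)); rewrite [LHS]H -[(n + m)%N%:R]/((n + m)%N%:Z%:~R : R) e_int.
  rewrite rmorphB /= subrK rmorphM /= rmorph_nat dvdzE /=.
  by case: (_ %| _)%N; rewrite ?mulr1 ?mulr0.
rewrite rmorph_sum mulr_sumr /=.
transitivity (\sum_(m < K) (d%:R^-1)%:C%C * ((phi (m%:R / h))%:C%C *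
    \sum_(a < d | (0 < a)%N) e_ ((n + m)%N%:R * (a%:R / d%:R)))).
  apply: eq_bigr => m _; rewrite E -!rmorphM /=; congr (_%:C%C).
  by field.
under [LHS]eq_bigr => m _ do rewrite mulr_sumr mulr_sumr.
rewrite exchange_big /=; apply: eq_bigr => a _; rewrite (Phi_E supp _ h0 cK) mulr_suml mulr_sumr.
apply: eq_bigr => m _; rewrite natrD mulrDl e_D; ring.
Qed.

Lemma weighted_deviationE n : (0 < n)%N -> weighted_deviation B phi h n =
  \sum_(m < K) phi (m%:R / h) * (`[< B_free B (n + m)%N >])%:R -
  limn (euler_partial B 1) * \sum_(m < K) phi (m%:R / h).
Proof.
move=> n0; rewrite /weighted_deviation (sieve_densityE B_ge2); congr (_ - _ * _); last first.
  by rewrite (sum_window supp h0 cK).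
rewrite (@sum_window_shift (fun x u => x * \1_([set k%:Z | k in B_free B]) u)); last by move=> x u; rewrite mul1r.
apply: eq_bigr => m _; congr (_ * _); rewrite indicE; congr (nat_of_bool _)%:R.
apply/idP/asboolP => [/set_mem[k Bk [<-]]//|Bk]; apply: mem_set; by exists (n + m)%N.
Qed.

(** Each modulus [d] contributes all its nonzero residues. After reduction the frequency $a/r$
    collects the moduli [d < D] divisible by [r], and the total coefficient is [gD B D r]. *)
Lemma trig_gDE D n : trig D (fun r _ => gD B D r) n =
  (\sum_(d < D | sqf d) mu d * \sum_(m < K) phi (m%:R / h) * ((d %| n + m)%N%:R - d%:R^-1))%:C%C.
Proof.
rewrite /trig (sum_reduced_pair (fun r a => ((gD B D r)%:C%C * Phi (a%:R / r%:R)) * e_ (n%:R * (a%:R / r%:R)))).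
pose S r := \sum_(a < r | breduced B a r) Phi (a%:R / r%:R) * e_ (n%:R * (a%:R / r%:R)).
transitivity (\sum_(r < D | sqf r && (1 < r)%N) \sum_(d < D | sqf d)
    ((r %| d)%N%:R * (mu d / d%:R))%:C%C * S r).
  apply: eq_bigr => r _; rewrite -mulr_suml.
  rewrite (eq_bigr (fun a : 'I_r => (gD B D r)%:C%C * (Phi (a%:R / r%:R) * e_ (n%:R * (a%:R / r%:R))))); last first.
    by move=> a _; rewrite -mulrA.
  rewrite -mulr_sumr -/(S r) -rmorph_sum; congr (_%:C%C * _).
  rewrite /gD big_mkcondr /=; apply: eq_bigr => d _.
  by case: (r %| d)%N; rewrite ?mul1r ?mul0r.
rewrite exchange_big rmorph_sum /=; apply: eq_bigr => d sd.
have d0 := sqf_gt0 B_ge2 sd.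
rewrite rmorphM /= residue_window// mulrA -rmorphM.
transitivity ((mu d / d%:R)%:C%C * \sum_(r < D | sqf r && (1 < r)%N && (r %| d)%N) S r).
  rewrite mulr_sumr [RHS]big_mkcondr /=; apply: eq_bigr => r _.
  by case: (r %| d)%N; rewrite ?mul1r// mul0r rmorph0 mul0r.
congr (_ * _).
have [d1|d1] := ltnP 1 d.
  rewrite (sum_residues_gt1 B_ge2 B_cop (fun t => Phi t * e_ (n%:R * t)) sd d1).
  rewrite [RHS](big_ord_widen_cond D (fun r => sqf r && (1 < r)%N && (r %| d)%N) S) ?ltn_ord//.
  apply: eq_bigl => r; case: (boolP (r %| d)%N); rewrite ?andbF//= andbT => rd.
  by rewrite ltnS (dvdn_leq d0 rd) andbT.
have {d1} d1 : (d : nat) = 1%N by apply/eqP; rewrite eqn_leq d1.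
rewrite big1 => [|r /andP[/andP[_ r1]]]; last by rewrite d1 dvdn1 => /eqP e; rewrite e in r1.
by rewrite big1// => a a0; exfalso; have := leq_trans (ltn_ord a) (eq_leq d1); rewrite ltnNge a0.
Qed.

Lemma count_shifted_multiples d m M : (0 < d)%N ->
  \sum_(n < M) (d %| n.+1 + m)%N%:R <= (M + m)%N%:R / d%:R :> R.
Proof.
move=> d0; rewrite ler_pdivlMr ?ltr0n//.
apply: (@le_trans _ _ (((M + m) %/ d)%N%:R * d%:R)); last by rewrite -natrM ler_nat leq_divM.
rewrite ler_wpM2r// divn_count_dvd -natr_sum ler_nat.
rewrite (big_addn 0 (M + m).+1 1) subn1 /= big_mkord.
rewrite -(big_mkord xpredT (fun i => (d %| i + 1 : nat))) addnC (big_cat_nat (leq0n m) (leq_addr M m)) /=.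
apply: leq_trans (leq_addl _ _); rewrite -{2}[m]add0n big_addn addKn big_mkord leq_eqVlt.
by apply/orP; left; apply/eqP/eq_bigr => i _; rewrite addn1 addSn.
Qed.

(** Expand the $B$-free indicator and the density by Möbius. The moduli below [D] form the
    polynomial exactly; the others are small only on average over [n], because [d] divides [n + m]
    for at most $(M+m)/d$ of the [n]. In [3 * M + K] the part [2 * M + K] comes from these moduli
    and [M] from the error in the density. *)
Lemma deviation_decomposition D M t :
  (forall L, \sum_(d < L | sqf d && (D <= d)%N) (d%:R)^-1 <= t) ->
  exists T : nat -> R, (forall n, (0 < n <= M)%N ->
    (weighted_deviation B phi h n)%:C%C = trig D (fun r _ => gD B D r) n + (T n)%:C%C) /\
  \sum_(n < M) `|T n.+1| <= K%:R * V * t * (3 * M + K)%N%:R.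
Proof.
(* Beyond both the level [D] and every integer of the windows, so that all divisors occurring are
   below [U]. *)
move=> Ht; pose U := maxn D (M + K).+1.
have DU : (D <= U)%N by rewrite leq_maxl.
pose err : R := limn (euler_partial B 1) - \sum_(d < U | sqf d) mu d / d%:R.
have err_le : `|err| <= t.
  rewrite /err.
  have -> : \sum_(d < U | sqf d) mu d / d%:R = \sum_(d < U | sqf d && breduced B 1 d) mu d / d%:R.
    apply: eq_bigl => d; case sd : (sqf d) => //=; apply/esym/(breducedP _ _ (sqf_gt0 B_ge2 sd)) => b Bb _.
    by rewrite dvdn1; have := inB_gt1 B_ge2 Bb; case: eqP => // ->.
  apply: (density_approx B_ge2 B_cop) => L; apply: le_trans (Ht L).
  rewrite big_mkcond [leRHS]big_mkcond; apply: ler_sum => d _; case sd : (sqf d) => //=.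
  case: ifP => [Ud|_]; last by case: ifP => // _; rewrite invr_ge0.
  by rewrite (leq_trans DU Ud).
pose rho d n : R := (d %| n)%N%:R - d%:R^-1.
pose T n := \sum_(m < K) phi (m%:R / h) * (\sum_(d < U | sqf d && (D <= d)%N) mu d * rho d (n + m)%N) -
  err * \sum_(m < K) phi (m%:R / h).
exists T; split.
  move=> n /andP[n0 nM]; rewrite trig_gDE -rmorphD weighted_deviationE//; congr (_%:C%C).
  have -> : \sum_(d < D | sqf d) mu d * \sum_(m < K) phi (m%:R / h) * rho d (n + m)%N =
      \sum_(m < K) phi (m%:R / h) * \sum_(d < U | sqf d && (d < D)%N) mu d * rho d (n + m)%N.
    under eq_bigr => d _ do rewrite mulr_sumr.
    rewrite exchange_big /=; apply: eq_bigr => m _.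
    rewrite mulr_sumr (big_ord_widen_cond U sqf (fun d => mu d * (phi (m%:R / h) * rho d (n + m)%N)))//.
    by apply: eq_bigr => d _; ring.
  rewrite /T addrA -big_split /=.
  rewrite [X in _ = X - _](eq_bigr (fun m : 'I_K => phi (m%:R / h) * (`[< B_free B (n + m) >]%:R - \sum_(d < U | sqf d) mu d / d%:R))).
    under [X in _ = X - _]eq_bigr => m _ do rewrite mulrBr.
    by rewrite sumrB -mulr_suml /err; ring.
  move=> m _; rewrite -mulrDr; congr (_ * _).
  have -> : \sum_(d < U | sqf d && (d < D)%N) mu d * rho d (n + m)%N + \sum_(d < U | sqf d && (D <= d)%N) mu d * rho d (n + m)%N =
     \sum_(d < U | sqf d) mu d * rho d (n + m)%N.
    rewrite [RHS](bigID (fun d : 'I_U => (d < D)%N)) /=; congr (_ + _).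
    by apply: eq_bigl => d; rewrite -leqNgt.
  rewrite -(@mu_sum_Bfree B B_ge2 B_cop R (n + m)%N U); last 2 first.
  - by rewrite addn_gt0 n0.
  - by rewrite leq_max ltnS leq_add ?orbT// ltnW.
  rewrite big_mkcondr /= -sumrB; apply: eq_bigr => d _; rewrite /rho mulrBr.
  by case: (d %| n + m)%N; rewrite ?mulr1 ?mulr0.
have t0 : 0 <= t by exact: le_trans err_le.
have phiV m : `|phi (m%:R / h)| <= V by exact: (window_bound supp varV).
have S1 : \sum_(m < K) `|phi (m%:R / h)| <= K%:R * V.
  by rewrite mulr_natl -[X in _ *+ X]card_ord -sumr_const; apply: ler_sum.
apply: (@le_trans _ _ (\sum_(n < M) (\sum_(m < K) V * (\sum_(d < U | sqf d && (D <= d)%N) ((d %| n.+1 + m)%N%:R + d%:R^-1)) + t * (K%:R * V)))).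
  apply: ler_sum => n _; apply: le_trans (ler_normB _ _) _; apply: lerD; last first.
    rewrite normrM ler_pM//; apply: le_trans (ler_norm_sum _ _ _) S1.
  apply: le_trans (ler_norm_sum _ _ _) _; apply: ler_sum => m _; rewrite normrM ler_pM//.
  apply: le_trans (ler_norm_sum _ _ _) _; apply: ler_sum => d /andP[sd _].
  rewrite normrM (mu_abs B_ge2 B_cop sd) mul1r; apply: le_trans (ler_normB _ _) _.
  by rewrite !ger0_norm ?invr_ge0.
rewrite big_split /= sumr_const card_ord exchange_big /=.
have -> : K%:R * V * t * (3 * M + K)%N%:R = K%:R * V * t * (2 * M + K)%N%:R + t * (K%:R * V) *+ M.
  by rewrite -[_ *+ M]mulr_natr (natrD _ (3 * M)) (natrD _ (2 * M)) !natrM; ring.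
apply: lerD => //.
have -> : K%:R * V * t * (2 * M + K)%N%:R = \sum_(m < K) V * (t * (2 * M + K)%N%:R).
  by rewrite sumr_const card_ord -mulr_natl; ring.
apply: ler_sum => m _; rewrite -mulr_sumr ler_wpM2l// exchange_big /=.
apply: le_trans (ler_wpM2r (ler0n R _) (Ht U)); rewrite mulr_suml.
apply: ler_sum => d /andP[sd _]; have d0 := sqf_gt0 B_ge2 sd.
rewrite big_split /= sumr_const card_ord -[d%:R^-1 *+ M]mulr_natr.
apply: le_trans (lerD (count_shifted_multiples m M d0) (lexx _)) _.
rewrite [leLHS](_ : _ = d%:R^-1 * (2 * M + m)%N%:R); last by rewrite (natrD _ M m) (natrD _ (2 * M) m) (natrM _ 2 M); ring.
by rewrite ler_wpM2l ?invr_ge0// ler_nat leq_add2l ltnW.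
Qed.

End Decomposition.

(** * Restriction to the fractions that carry the variance *)

Section Truncation.
Context {R : realType}.
Variables (B : set nat) (alpha : R).
Hypothesis B_ge2 : B `<=` [set b | 2 <= b]%N.
Hypothesis B_cop : {in B &, forall b c, b != c -> coprime b c}.
Hypothesis alpha01 : 0 < alpha < 1.
Hypothesis B_regular : regularly_varying (generated_semigroup B) alpha.
Local Notation sqf := (bsqf (inB B)).
Local Notation J := (generated_semigroup B).
Local Notation N := (counting_function (generated_semigroup B) : R -> R).
Variables (phi : R -> R) (c V : R).
Hypothesis supp : forall x, phi x != 0 -> 0 <= x <= c.
Hypothesis varV : forall K (x : nat -> R), (forall i, (i < K)%N -> x i < x i.+1) ->
  \sum_(i < K) `|phi (x i.+1) - phi (x i)| <= V.
Hypothesis c0 : 0 <= c.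
Let V0 := window_V_ge0 supp varV.
Implicit Types (q a r D M K : nat) (h : R).

Definition window_size h := (Num.truncn (c * h)).+1.

Lemma window_sizeP h : c * h < (window_size h)%:R.
Proof. exact: truncnS_gt. Qed.

Lemma window_size_le h : 1 <= h -> (window_size h)%:R <= (c + 1) * h.
Proof.
by move=> h1; rewrite -natr1 mulrDl mul1r lerD// truncn_le// mulr_ge0// (le_trans ler01).
Qed.

(** The bound of [outside_energy_le] for denominators between $h/q$ and $qh$ and numerators up to
    $q^3$. *)
Definition outside_bound q h M : R := V ^+ 2 * (16 * N (h / q%:R) + 16 * N (q%:R * h) / (q ^ 3).+1%:R +
    (window_size h)%:R * \sum_(r < M | ((r : nat) \in J) && (q%:R * h < r%:R)) (r%:R)^-1).

(** Each of the three terms is $O(q^{-g} N(h))$: the first because $\alpha - g \ge g$, the others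
    because $N(qh) \ll q^{\alpha+g} N(h)$ with $\alpha + g \le 1 - g$, and the factor $1/q^3$ or the
    tail factor $1/q$ remains. Both inequalities hold by the choice of [g]. *)
Lemma outside_small eta : 0 < eta -> exists q, [/\ (0 < q)%N, c + 1 <= q%:R & exists h1, 1 <= h1 /\
  forall h M, h1 <= h -> outside_bound q h M <= eta * N h].
Proof.
move=> eta0; have /andP[a0 a1] := alpha01.
pose g := Num.min (alpha / 2) ((1 - alpha) / 2).
have g0 : 0 < g by rewrite lt_min !divr_gt0// subr_gt0.
have ga : g <= alpha / 2 by rewrite ge_min lexx.
have g1 : g <= (1 - alpha) / 2 by rewrite ge_min lexx orbT.
have etaa : 0 < g < alpha by rewrite g0/=; lra.
have [C1 [x1 [x11 C10 H1]]] := counting_potter B_regular etaa.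
have [C2 [x2 [x21 C20 H2]]] := counting_potter_low B_regular etaa.
have [C3 [x3 [x31 C30 H3]]] := counting_tail alpha01 B_regular a1.
pose C := V ^+ 2 * (16 * C2 + 16 * C1 + (c + 1) * C3 * C1) + 1.
have C0 : 0 < C by rewrite ltr_wpDl// mulr_ge0 ?sqr_ge0// !addr_ge0 ?mulr_ge0 ?addr_ge0// ltW.
pose q := (Num.truncn (Num.max (c + 1) ((C / eta) `^ g^-1))).+1.
have qlb : Num.max (c + 1) ((C / eta) `^ g^-1) < q%:R by exact: truncnS_gt.
move: (ltW qlb); rewrite ge_max => /andP[qc qlb2].
have qp : 0 < q%:R :> R by rewrite ltr0n.
have q1 : 1 <= q%:R :> R by rewrite ler1n.
have qC : C <= eta * q%:R `^ g.
  rewrite mulrC -ler_pdivrMr//; apply: (@le_trans _ _ (((C / eta) `^ g^-1) `^ g)).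
    by rewrite -powRrM mulVf ?gt_eqF// powRr1// divr_ge0 ?(ltW C0)// ltW.
  by rewrite ge0_ler_powR ?nnegrE ?(ltW g0) ?powR_ge0.
have qg0 : 0 < q%:R `^ (- g) by exact: powR_gt0.
exists q; split => //; exists (q%:R * Num.max x1 (Num.max x2 x3)); split.
  by rewrite mulr_ege1// le_max x11.
move=> h M hh.
have hx : Num.max x1 (Num.max x2 x3) <= h / q%:R by rewrite ler_pdivlMr// mulrC.
have h0q : h / q%:R <= h.
  rewrite ler_pdivrMr// ler_peMr//; apply: le_trans hh; rewrite mulr_ge0 ?(ltW qp)//.
  by rewrite le_max (le_trans ler01 x11).
have hxx : Num.max x1 (Num.max x2 x3) <= h by exact: le_trans h0q.
move: (hx) (hxx); rewrite !ge_max => /and3P[p1 p2 p3] /and3P[r1 r2 r3].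
have h1 : 1 <= h by exact: le_trans r1.
have h0 : 0 < h by exact: lt_le_trans h1.
have hqh : h <= q%:R * h by rewrite ler_peMl// ltW.
have Nh0 : 0 <= N h by exact: counting_function_ge0.
have qh0 : 0 < q%:R * h by exact: mulr_gt0.
have b1 : N (h / q%:R) <= C2 * q%:R `^ (- g) * N h.
  have := H2 (h / q%:R) h r2 (le_trans x11 p1) h0q.
  have -> : h / q%:R / h = q%:R^-1 :> R by field; rewrite !gt_eqF.
  move/le_trans; apply; rewrite ler_wpM2r// ler_wpM2l ?(ltW C20)//.
  rewrite -powR_inv1 ?(ltW qp)// -powRrM mulN1r ler_powR//; lra.
have b2 : N (q%:R * h) <= C1 * q%:R `^ (1 - g) * N h.
  have [_ + _] := H1 h (q%:R * h) r1 hqh.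
  have -> : q%:R * h / h = q%:R :> R by field; rewrite !gt_eqF.
  by move/le_trans; apply; rewrite ler_wpM2r// ler_wpM2l ?(ltW C10)// ler_powR//; lra.
have q1g : q%:R `^ (1 - g) = q%:R * q%:R `^ (- g) :> R.
  by rewrite powRD ?(gt_eqF qp) ?implybT// powRr1 ?ltW.
have b3 : N (q%:R * h) / (q ^ 3).+1%:R <= C1 * q%:R `^ (- g) * N h.
  rewrite ler_pdivrMr ?ltr0n//; apply: le_trans b2 _; rewrite q1g.
  rewrite [leLHS](_ : _ = C1 * q%:R `^ (- g) * N h * q%:R); last by ring.
  rewrite ler_wpM2l ?mulr_ge0 ?(ltW C10) ?(ltW qg0)// ler_nat.
  by apply: leqW; rewrite -{1}[q]expn1 leq_pexp2l.
have b4 : (window_size h)%:R * \sum_(r < M | ((r : nat) \in J) && (q%:R * h < r%:R)) (r%:R)^-1 <=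
    (c + 1) * C3 * C1 * q%:R `^ (- g) * N h.
  have t := H3 (q%:R * h) M (le_trans r3 hqh).
  apply: (@le_trans _ _ ((c + 1) * h * (C3 * (q%:R * h) `^ (-1) * N (q%:R * h)))).
    apply: ler_pM => //; [by apply: sumr_ge0 => *; rewrite invr_ge0|exact: window_size_le|].
    apply: le_trans t; rewrite le_eqVlt; apply/orP; left; apply/eqP.
    by apply: eq_bigr => r _; rewrite powR_inv1.
  rewrite powR_inv1 ?(ltW qh0)// invfM.
  rewrite [leLHS](_ : _ = (c + 1) * C3 * (N (q%:R * h) / q%:R)); last by field; rewrite !gt_eqF.
  rewrite -!mulrA ler_wpM2l ?addr_ge0// ler_wpM2l ?(ltW C30)// ler_pdivrMr//.
  by apply: le_trans b2 _; rewrite q1g le_eqVlt; apply/orP; left; apply/eqP; ring.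
apply: (@le_trans _ _ (C * (q%:R `^ (- g) * N h))).
  apply: (@le_trans _ _ (V ^+ 2 * (16 * C2 + 16 * C1 + (c + 1) * C3 * C1) * (q%:R `^ (- g) * N h))).
    rewrite /outside_bound -[leRHS]mulrA ler_wpM2l ?sqr_ge0//.
    have -> : (16 * C2 + 16 * C1 + (c + 1) * C3 * C1) * (q%:R `^ (- g) * N h) =
      16 * (C2 * q%:R `^ (- g) * N h) + 16 * (C1 * q%:R `^ (- g) * N h) + (c + 1) * C3 * C1 * q%:R `^ (- g) * N h by ring.
    by apply: lerD => //; apply: lerD; [rewrite ler_pM2l|rewrite -mulrA ler_pM2l].
  by rewrite ler_wpM2r ?mulr_ge0 ?(ltW qg0)// /C lerDl.
rewrite mulrA ler_wpM2r// powRN ler_pdivrMr ?powR_gt0//.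
Qed.

Definition in_window q h r a : bool := (h / q%:R <= r%:R <= q%:R * h) && (minn a (r - a) <= q ^ 3)%N.

Definition trunc_weight q h r a : R := g_B B r * (in_window q h r a)%:R.

Definition trunc_variance q h D : R := \sum_(p : 'I_D * 'I_D | reduced_pair B p)
  trunc_weight q h p.1 p.2 ^+ 2 * cnorm (Phi_ phi h (p.2%:R / p.1%:R)) ^+ 2.

Lemma trunc_varianceE q h D : trunc_variance q h D =
  \sum_(r < D | sqf r && (1 < r)%N) g_B B r ^+ 2 * \sum_(a < r | breduced B a r)
    (in_window q h r a)%:R * cnorm (Phi_ phi h (a%:R / r%:R)) ^+ 2.
Proof.
rewrite /trunc_variance (sum_reduced_pair B (fun r a => trunc_weight q h r a ^+ 2 * cnorm (Phi_ phi h (a%:R / r%:R)) ^+ 2)).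
apply: eq_bigr => r _; rewrite mulr_sumr; apply: eq_bigr => a _.
by rewrite /trunc_weight exprMn mulrA; congr (_ * _ * _); case: in_window; rewrite ?expr1n ?expr0n.
Qed.

Lemma trunc_variance_le q h D : 0 < h -> trunc_variance q h D <= C2 B phi h.
Proof.
move=> h0; apply: le_trans (C2_partial_le B_ge2 B_cop alpha01 B_regular supp varV h0 (window_sizeP h) D).
rewrite trunc_varianceE; apply: ler_sum => r _; rewrite /C2_diagonal ler_wpM2l ?sqr_ge0//.
by apply: ler_sum => a _; case: in_window; rewrite ?mul1r// mul0r sqr_ge0.
Qed.

(** Common form of two estimates: with $C = 1$, $t = 0$ it bounds the variance lost by truncation,
    and with general constants the mean square of the difference between the full and the truncated
    polynomial. *)
Lemma weighted_energy_le q h r (w : nat -> R) (C t : R) : sqf r -> (1 < r)%N ->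
  (forall a, `|w a| <= C / r%:R) -> (forall a, in_window q h r a -> `|w a| <= t / r%:R) ->
  \sum_(a < r | breduced B a r) w a ^+ 2 * cnorm (Phi_ phi h (a%:R / r%:R)) ^+ 2 <=
  C ^+ 2 * ((r%:R ^+ 2)^-1 * energy_gt phi h (if h / q%:R <= r%:R <= q%:R * h then (q ^ 3)%N else 0%N) r) +
  t ^+ 2 * ((r%:R ^+ 2)^-1 * (r%:R <= q%:R * h)%R%:R * energy_gt phi h 0 r).
Proof.
move=> sr r1 wC wt.
have sq (x y : R) : `|x| <= y / r%:R -> x ^+ 2 <= y ^+ 2 * (r%:R ^+ 2)^-1.
  move=> xy; rewrite -exprVn -exprMn -real_normK ?num_real// ler_pXn2r ?nnegrE//.
  exact: le_trans xy.
have a0 (a : 'I_r) : breduced B a r -> (0 < minn a (r - a))%N.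
  move=> ra; rewrite leq_min subn_gt0 ltn_ord andbT lt0n.
  by apply: contra (breduced_lt B_ge2 B_cop sr r1 ra) => /eqP ->; rewrite dvdn0.
have ri : 0 <= (r%:R ^+ 2)^-1 :> R by rewrite invr_ge0 sqr_ge0.
have rb : 0 <= (r%:R ^+ 2)^-1 * (r%:R <= q%:R * h)%R%:R :> R by apply: mulr_ge0.
have pz (x y z : R) : 0 <= y -> 0 <= z -> 0 <= x ^+ 2 * (y * z).
  by move=> y0 z0; apply: mulr_ge0; [exact: sqr_ge0|exact: mulr_ge0].
rewrite /in_window in wt; set S := (_ <= _ <= _) in wt *.
rewrite /energy_gt !mulr_sumr big_mkcond [X in _ <= X + _]big_mkcond [X in _ <= _ + X]big_mkcond -big_split /=.
apply: ler_sum => a _; case: ifP => [ra|_]; last first.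
  by apply: addr_ge0; case: ifP => // _; apply: pz; rewrite ?cnorm_ge0 ?sqr_ge0.
rewrite (a0 _ ra).
have t0 : 0 <= t ^+ 2 * ((r%:R ^+ 2)^-1 * (r%:R <= q%:R * h)%R%:R * cnorm (Phi_ phi h (a%:R / r%:R)) ^+ 2).
  by apply: pz; rewrite ?sqr_ge0.
have [s|ns] := boolP S; last first.
  rewrite a0//; apply: le_trans (_ : C ^+ 2 * ((r%:R ^+ 2)^-1 * cnorm (Phi_ phi h (a%:R / r%:R)) ^+ 2) <= _); last by rewrite lerDl.
  by rewrite [leRHS]mulrA ler_wpM2r ?sqr_ge0 ?sq.
have [aA|aA] := leqP (minn a (r - a)) (q ^ 3); last first.
  apply: le_trans (_ : C ^+ 2 * ((r%:R ^+ 2)^-1 * cnorm (Phi_ phi h (a%:R / r%:R)) ^+ 2) <= _); last by rewrite lerDl.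
  by rewrite [leRHS]mulrA ler_wpM2r ?sqr_ge0 ?sq.
rewrite add0r [leRHS]mulrA; apply: ler_wpM2r; first exact: sqr_ge0.
have -> : (r%:R <= q%:R * h) = true by move: s; rewrite /S => /andP[].
by rewrite mulr1; apply: sq; apply: wt; rewrite s aA.
Qed.

Lemma near_energy_le (x : R) h M : 0 < h -> 0 <= x ->
  \sum_(r < M | sqf r && (1 < r)%N) (r%:R ^+ 2)^-1 * (r%:R <= x)%R%:R * energy_gt phi h 0 r <=
  16 * V ^+ 2 * N x.
Proof.
move=> h0 x0; apply: le_trans (_ : 16 * V ^+ 2 * \sum_(r < M | ((r : nat) \in J) && (r%:R <= x)) 1 <= _); last first.
  by rewrite ler_wpM2l ?mulr_ge0 ?sqr_ge0//; exact: counting_ge_sum.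
rewrite mulr_sumr big_mkcond [leRHS]big_mkcond; apply: ler_sum => r _.
have p16 : 0 <= 16 * V ^+ 2 * 1 by rewrite !mulr_ge0 ?sqr_ge0.
case: ifP => [/andP[sr r1]|_]; last by case: ifP.
rewrite (mem_set (sqf_generated B_ge2 sr)) /=; case: ifP => [_|_]; last by rewrite mulr0 mul0r.
rewrite !mulr1 [leLHS]mulrC ler_pdivrMr ?exprn_gt0 ?ltr0n ?(ltnW r1)//.
by apply: le_trans (energy_gt_le supp varV h0 (window_sizeP h) 0 r) _; rewrite divr1.
Qed.

(** The missing part of [C2] is supported outside the window, where $|g(r)| \le 1/r$ and the outside
    energy bound apply. *)
Lemma trunc_variance_ge q h D : 0 < h -> (0 < q)%N -> (window_size h)%:R <= q%:R * h -> q%:R * h < D%:R ->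
  forall x, (forall M, outside_bound q h M <= x) -> C2 B phi h - trunc_variance q h D <= x.
Proof.
move=> h0 q0 Kq qD x Hx; rewrite lerBlDl.
have qp : 0 < q%:R :> R by rewrite ltr0n.
have q1 : 1 <= q%:R :> R by rewrite ler1n.
apply: (C2_le B_ge2 B_cop alpha01 B_regular supp varV h0 (window_sizeP h)) => M.
have lohi : h / q%:R <= q%:R * h.
  rewrite ler_pdivrMr// mulrAC -expr2 ler_peMl ?(ltW h0)// exprn_ege1//.
apply: le_trans (lerD (lexx _) (Hx (maxn M D))).
apply: le_trans (lerD (lexx _) (outside_energy_le B_ge2 supp varV h0 (window_sizeP h) (q ^ 3) (maxn M D) Kq lohi)).
rewrite trunc_varianceE.
rewrite (big_ord_widen_cond (maxn M D) (fun r => sqf r && (1 < r)%N) (fun r => C2_diagonal B phi h r)) ?leq_maxl//.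
rewrite (big_ord_widen_cond (maxn M D) (fun r => sqf r && (1 < r)%N) (fun r => g_B B r ^+ 2 * \sum_(a < r | breduced B a r)
    (in_window q h r a)%:R * cnorm (Phi_ phi h (a%:R / r%:R)) ^+ 2)) ?leq_maxr//.
rewrite big_mkcondr [X in _ <= X + _]big_mkcondr /= -big_split /=; apply: ler_sum => r /andP[sr r1].
set v := g_B B r ^+ 2 * _; have v0 : 0 <= v.
  by rewrite mulr_ge0 ?sqr_ge0// sumr_ge0// => a _; rewrite mulr_ge0 ?sqr_ge0.
set o := _ * energy_gt _ _ _ _; have o0 : 0 <= o by rewrite mulr_ge0 ?invr_ge0 ?sqr_ge0 ?energy_gt_ge0.
have p0 : 0 <= (if (r < D)%N then v else 0) + o by apply: addr_ge0 => //; case: ifP.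
case: ifP => // _; rewrite {p0}.
suff H : C2_diagonal B phi h r <= (if r%:R <= q%:R * h then v else 0) + o.
  apply: le_trans H _; rewrite lerD2r; case: ifP => [rq|_]; last by case: ifP.
  by rewrite -(ltr_nat R) (le_lt_trans rq qD).
rewrite /C2_diagonal.
have -> : g_B B r ^+ 2 * reduced_energy B phi h r = v + \sum_(a < r | breduced B a r)
   (g_B B r * (~~ in_window q h r a)%:R) ^+ 2 * cnorm (Phi_ phi h (a%:R / r%:R)) ^+ 2.
  rewrite /v /reduced_energy !mulr_sumr -big_split /=; apply: eq_bigr => a _.
  by case: in_window => /=; rewrite ?mulr0 ?mulr1 ?expr0n /= ?mul0r ?mulr0 ?mul1r ?addr0 ?add0r.
have W := @weighted_energy_le q h r (fun a => g_B B r * (~~ in_window q h r a)%:R) 1 0 sr r1.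
have gle := gB_abs_le B_ge2 B_cop alpha01 B_regular sr.
have {}W : \sum_(a < r | breduced B a r)
   (g_B B r * (~~ in_window q h r a)%:R) ^+ 2 * cnorm (Phi_ phi h (a%:R / r%:R)) ^+ 2 <= o.
  apply: le_trans (W _ _) _ => [a|a aw|].
  - rewrite normrM mul1r normr_nat; case: (~~ _); rewrite ?mulr1// mulr0 invr_ge0//.
  - by rewrite aw mulr0 normr0 mul0r.
  - by rewrite expr1n mul1r expr0n mul0r addr0.
case: ifP => [_|rq]; first by rewrite lerD2l.
rewrite add0r; suff -> : v = 0 by rewrite add0r.
by rewrite /v big1 ?mulr0// => a _; rewrite /in_window rq andbF mul0r.
Qed.

Lemma trunc_diff_le q h D (C t x : R) : 0 < h -> (0 < q)%N -> (window_size h)%:R <= q%:R * h ->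
  (forall r, sqf r -> `|gD B D r| <= C / r%:R) ->
  (forall r, sqf r -> r%:R <= q%:R * h -> `|g_B B r - gD B D r| <= t / r%:R) ->
  (forall M, outside_bound q h M <= x) -> 1 <= C -> t <= 1 ->
  \sum_(p : 'I_D * 'I_D | reduced_pair B p)
    (gD B D p.1 - trunc_weight q h p.1 p.2) ^+ 2 * cnorm (Phi_ phi h (p.2%:R / p.1%:R)) ^+ 2 <=
  C ^+ 2 * x + t ^+ 2 * (16 * V ^+ 2 * N (q%:R * h)).
Proof.
move=> h0 q0 Kq gC gt Hx C1 t1.
have qp : 0 < q%:R :> R by rewrite ltr0n.
have q1 : 1 <= q%:R :> R by rewrite ler1n.
have lohi : h / q%:R <= q%:R * h.
  by rewrite ler_pdivrMr// mulrAC -expr2 ler_peMl ?(ltW h0)// exprn_ege1.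
rewrite (sum_reduced_pair B (fun r a => (gD B D r - trunc_weight q h r a) ^+ 2 * cnorm (Phi_ phi h (a%:R / r%:R)) ^+ 2)).
have O := outside_energy_le B_ge2 supp varV h0 (window_sizeP h) (q ^ 3) D Kq lohi.
have E := near_energy_le D h0 (le_trans (ler0n _ _) Kq).
apply: le_trans (lerD (ler_wpM2l (sqr_ge0 C) (le_trans O (Hx D))) (ler_wpM2l (sqr_ge0 t) E)).
rewrite !mulr_sumr -big_split /=; apply: ler_sum => r /andP[sr r1].
apply: (weighted_energy_le (w := fun a => gD B D r - trunc_weight q h r a)) => // a; last first.
  move=> aw; rewrite /trunc_weight aw mulr1 distrC; apply: gt => //.
  by move: aw; rewrite /in_window => /andP[/andP[]].
rewrite /trunc_weight; case aw : (in_window q h r a); last by rewrite mulr0 subr0; exact: gC.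
rewrite mulr1 distrC; apply: le_trans (gt r sr _) _.
  by move: aw; rewrite /in_window => /andP[/andP[]].
by rewrite ler_wpM2r ?invr_ge0// (le_trans t1).
Qed.

End Truncation.

Section PowerAverage.
Context {R : realType} (I : finType) (sg : I -> R) (z : I -> R[i]) (den : I -> nat).
Variables (C : R) (Z M k : nat).
Hypothesis den0 : forall x, (0 < den x)%N.
Hypothesis denZ : forall x, (den x <= Z)%N.
Hypothesis den_int : forall x, (den x)%:R * sg x \is a Num.int.
Hypothesis zC : forall x, cnorm (z x) <= C.

Lemma e_sum (J : finType) (f : J -> R) : e_ (\sum_j f j) = \prod_j e_ (f j).
Proof. by apply: (big_morph e_ (@e_D R) (@e_0 R)). Qed.

(** After expansion a tuple with integral sum contributes [M] times its coefficient; any other gives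
    a geometric sum whose frequency has a denominator at most $Z^k$. *)
Lemma power_average : cnorm (\sum_(n < M) (\sum_x z x * e_ (n.+1%:R * sg x)) ^+ k - M%:R * tuple_moment sg z k) <=
  #|I|%:R ^+ k * C ^+ k * (2 * Z%:R ^+ k).
Proof.
have E n : (\sum_x z x * e_ (n%:R * sg x)) ^+ k =
    \sum_(f : {ffun 'I_k -> I}) (\prod_i z (f i)) * e_ (n%:R * \sum_i sg (f i)).
  rewrite -[k in LHS]card_ord -prodr_const bigA_distr_bigA; apply: eq_bigr => f _.
  by rewrite big_split /= mulr_sumr e_sum.
have -> : \sum_(n < M) (\sum_x z x * e_ (n.+1%:R * sg x)) ^+ k - M%:R * tuple_moment sg z k =
  \sum_(f : {ffun 'I_k -> I} | ~~ zero_sum sg f) (\prod_i z (f i)) * \sum_(n < M) e_ (n.+1%:R * \sum_i sg (f i)).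
  under eq_bigr => n _ do rewrite E.
  rewrite exchange_big /= (bigID (@zero_sum R I sg k)) /= addrC.
  rewrite [X in _ + X - _](_ : _ = M%:R * tuple_moment sg z k).
    by rewrite addrK; apply: eq_bigr => f _; rewrite mulr_sumr.
  rewrite /tuple_moment mulr_sumr; apply: eq_bigr => f zf.
  transitivity (\sum_(n < M) \prod_i z (f i)); last first.
    by rewrite big_const_ord iter_addr_0 mulr_natl.
  apply: eq_bigr => n _; have /intrP[m mE] := zf.
  by rewrite mE -[n.+1%:R]/(n.+1%:Z%:~R) -intrM e_int mulr1.
apply: le_trans (cnorm_sum _ _ _) _.
apply: (@le_trans _ _ (\sum_(f : {ffun 'I_k -> I}) C ^+ k * (2 * Z%:R ^+ k))); last first.
  by rewrite sumr_const card_ffun card_ord -[X in X <= _]mulr_natl natrX mulrA.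
have C0 (f : {ffun 'I_k -> I}) : 0 <= C ^+ k.
  case: (k) f => [|k'] f; first by rewrite expr0.
  by rewrite exprn_ge0// (le_trans _ (zC (f ord0))) ?cnorm_ge0.
rewrite big_mkcond; apply: ler_sum => f _; case: ifP => [zf|_]; last first.
  by apply: mulr_ge0; [exact: C0 f|rewrite mulr_ge0 ?exprn_ge0].
rewrite cnormM; apply: ler_pM; rewrite ?cnorm_ge0//.
  rewrite cnorm_prod -[k in leRHS]card_ord -prodr_const; apply: ler_prod => i _.
  by rewrite cnorm_ge0 zC.
pose Q := (\prod_i den (f i))%N.
have Q0 : (0 < Q)%N by rewrite prodn_gt0.
have QZ : (Q <= Z ^ k)%N.
  by rewrite -[k in leqRHS]card_ord -prod_nat_const; apply: leq_prod.
apply: le_trans (cnorm_exp_sum M Q0 _ zf) _; last by rewrite ler_wpM2l// -natrX ler_nat.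
rewrite mulr_sumr; apply: rpred_sum => i _.
by rewrite /Q (bigD1 i) //= mulnC natrM -mulrA rpredM// natr_int.
Qed.

End PowerAverage.

(** * The finite family of truncated fractions *)

Section TruncatedFractions.
Context {R : realType}.
Variable B : set nat.
Hypothesis B_ge2 : B `<=` [set b | 2 <= b]%N.
Hypothesis B_cop : {in B &, forall b c, b != c -> coprime b c}.
Variables (alpha : R) (alpha01 : 0 < alpha < 1).
Hypothesis B_regular : regularly_varying (generated_semigroup B) alpha.
Local Notation sqf := (bsqf (inB B)).
Local Notation N := (counting_function (generated_semigroup B) : R -> R).
Variables (phi : R -> R) (c V : R).
Hypothesis supp : forall x, phi x != 0 -> 0 <= x <= c.
Hypothesis varV : forall K (x : nat -> R), (forall i, (i < K)%N -> x i < x i.+1) ->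
  \sum_(i < K) `|phi (x i.+1) - phi (x i)| <= V.
Variables (q : nat) (h : R).
Hypothesis q0 : (0 < q)%N.

Definition frac_bound := (Num.truncn (q%:R * h)).+1.
Local Notation D := frac_bound.
Local Notation A := (q ^ 3)%N.

Definition trunc_pair (p : 'I_D * 'I_D) := reduced_pair B p && in_window q h p.1 p.2.
Definition trunc_frac : Type := {p : 'I_D * 'I_D | trunc_pair p}.
HB.instance Definition _ := Finite.on trunc_frac.
HB.instance Definition _ := SubType.on trunc_frac.

Implicit Types x y : trunc_frac.

Definition tden x : nat := (val x).1.
Definition tres x : nat := (val x).2.
(* The representative of smallest absolute value, bounded by [q ^ 3]. *)
Definition tnum x : int := if (tres x <= A)%N then (tres x)%:Z else (tres x)%:Z - (tden x)%:Z.
(** The opposite fraction modulo [1]. The default of [insubd] and the overflow value of [inord] are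
    never reached, as [val_tneg] shows. *)
Definition tneg x : trunc_frac := insubd x ((val x).1, inord (tden x - tres x)).
Definition tsg x : R := frac R tnum tden x.
Definition tcoef x : R[i] := (g_B B (tden x))%:C%C * Phi_ phi h ((tres x)%:R / (tden x)%:R).

Lemma truncP x : [/\ sqf (tden x), (1 < tden x)%N, (0 < tres x < tden x)%N, breduced B (tres x) (tden x) &
   h / q%:R <= (tden x)%:R <= q%:R * h /\ (minn (tres x) (tden x - tres x) <= A)%N].
Proof.
case: x => [[r a] /= xP]; rewrite /tden /tres /=.
move/andP: (xP) => [/and4P[/= sr r1 ar ra] /andP[/= w m]]; split => //; rewrite ar andbT lt0n.
by apply: contra (breduced_lt B_ge2 B_cop sr r1 ra) => /eqP ->; rewrite dvdn0.
Qed.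

Lemma trunc_h_gt0 x : 0 < h.
Proof.
have [_ r1 _ _ [/andP[_ rq] _]] := truncP x.
have : 0 < q%:R * h by apply: lt_le_trans rq; rewrite ltr0n ltnW.
by rewrite pmulr_rgt0// ltr0n.
Qed.

Lemma tden_neq0 x : (tden x)%:R != 0 :> R.
Proof. by have [_ r1 _ _ _] := truncP x; rewrite pnatr_eq0 -lt0n ltnW. Qed.

Lemma tsgE x : tsg x = (tres x)%:R / (tden x)%:R - (~~ (tres x <= A)%N)%:R.
Proof.
rewrite /tsg /frac /tnum; case: ifP => _ /=; first by rewrite subr0.
by rewrite intrB mulrBl -!pmulrn divff// tden_neq0.
Qed.

Lemma val_tneg x : val (tneg x) = ((val x).1, inord (tden x - tres x)).
Proof.
rewrite /tneg val_insubd ifT//; have [sr r1 /andP[a0 ar] ra [w m]] := truncP x.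
have rD : (tden x < D)%N by exact: ltn_ord.
have e : (inord (tden x - tres x) : 'I_D) = (tden x - tres x)%N :> nat.
  by rewrite inordK//; apply: leq_ltn_trans (leq_subr _ _) rD.
rewrite /trunc_pair /reduced_pair /in_window /= e -/(tden x) sr r1 w /=.
rewrite breduced_sub ?(ltnW ar) ?(ltnW r1)// ra subKn ?(ltnW ar)// minnC m !andbT.
by rewrite ltn_subrL a0 (ltnW r1).
Qed.

Lemma tden_neg x : tden (tneg x) = tden x.
Proof. by rewrite /tden val_tneg. Qed.

Lemma tres_neg x : tres (tneg x) = (tden x - tres x)%N.
Proof.
rewrite /tres val_tneg /= inordK//; apply: leq_ltn_trans (leq_subr _ _) _; exact: ltn_ord.
Qed.

Lemma trunc_frac_inj x y : tden x = tden y -> tres x = tres y -> x = y.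
Proof.
move=> e1 e2; apply: val_inj; move: e1 e2; rewrite /tden /tres.
by case: (val x) (val y) => [r a] [r' a'] /= e1 e2; congr (_, _); apply: val_inj.
Qed.

Lemma tsg_neg x y : (tsg x + tsg y \is a Num.int) = (y == tneg x).
Proof.
rewrite !tsgE addrACA -opprD -natrD rpredBr ?natr_int//.
have [sx x1 /andP[ax0 ax] rx _] := truncP x; have [sy y1 /andP[ay0 ay] ry _] := truncP y.
rewrite (breduced_frac_sum B_ge2 B_cop)//; apply/andP/eqP => [[/eqP e d]|->].
  apply: trunc_frac_inj; rewrite ?tden_neg// tres_neg.
  rewrite -e in ay; move/dvdnP: d => [k kE].
  have k1 : k = 1%N by nia.
  by move: kE; rewrite k1 mul1n; lia.
by rewrite tden_neg tres_neg eqxx subnKC ?dvdnn// ltnW.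
Qed.

Lemma tsgN x : tsg x \isn't a Num.int.
Proof.
have [sx x1 /andP[ax0 ax] rx _] := truncP x.
rewrite tsgE rpredBr ?natr_int//; apply/negP.
rewrite -[_ / _]addr0 -[0 : R](mul0r 1%:R^-1) -[X in _ + X / _](mulr0n 1).
rewrite -/(0%:R) frac_sum_intE ?(ltnW x1)// muln1 mul0n addn0 muln1 => /(dvdn_leq ax0).
by rewrite leqNgt ax.
Qed.

Lemma tcoef_neg x : tcoef (tneg x) = (tcoef x)^*%C.
Proof.
have h0 := trunc_h_gt0 x; have [sx x1 /andP[ax0 ax] rx _] := truncP x.
rewrite /tcoef tden_neg tres_neg [RHS]rmorphM; congr (_ * _); first by rewrite /= oppr0.
rewrite natrB ?(ltnW ax)// mulrBl divff ?tden_neq0//.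
rewrite -[RHS]/((Phi_ phi h _)^*%C) -(Phi_conj supp h0 (window_sizeP c h)) addrC.
exact: (Phi_int supp h0 (window_sizeP c h) _ 1).
Qed.

(** The factor $1/r$ of [g] compensates the factor [r] in the bound for $\Phi_H(a/r)$, so the
    coefficients are bounded uniformly in [h]. *)
Lemma tcoef_le x : cnorm (tcoef x) <= 1 + 2 * V.
Proof.
have h0 := trunc_h_gt0 x; have [sx x1 ax rx _] := truncP x.
have r0 : 0 < (tden x)%:R :> R by rewrite ltr0n ltnW.
have V0 := window_V_ge0 supp varV.
rewrite /tcoef cnormM cnorm_real.
have g1 := gB_abs_le B_ge2 B_cop alpha01 B_regular sx.
have p1 := cnorm_Phi_frac supp varV h0 (window_sizeP c h) ax.
set m := minn _ _ in p1; have m0 : (0 < m)%N by rewrite /m leq_min subn_gt0.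
apply: le_trans (ler_pM (normr_ge0 _) (cnorm_ge0 _) g1 p1) _.
have -> : (tden x)%:R^-1 * (2 * V * (tden x)%:R / m%:R) = 2 * V / m%:R :> R.
  by field; rewrite pnatr_eq0 -lt0n m0 gt_eqF.
rewrite ler_pdivrMr ?ltr0n//; apply: (@le_trans _ _ ((1 + 2 * V) * 1)).
  by rewrite mulr1 lerDr.
by rewrite ler_wpM2l ?ler1n// addr_ge0// mulr_ge0.
Qed.

Lemma trunc_trigE n : trig B phi h D (trunc_weight B q h) n = \sum_x tcoef x * e_ (n%:R * tsg x).
Proof.
rewrite /trig (eq_bigr (fun x => (fun p : 'I_D * 'I_D => ((g_B B p.1)%:C%C * Phi_ phi h (p.2%:R / p.1%:R)) *
    e_ (n%:R * (p.2%:R / p.1%:R))) (val x))); last first.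
  move=> x _; rewrite tsgE mulrBr -natrM -[X in _ - X]/((n * ~~ (tres x <= A)%N)%N%:Z%:~R) -mulrNz.
  by rewrite e_Dint.
rewrite -(@big_sub _ _ _ _ [pred p | trunc_pair p]
   (fun p : 'I_D * 'I_D => ((g_B B p.1)%:C%C * Phi_ phi h (p.2%:R / p.1%:R)) * e_ (n%:R * (p.2%:R / p.1%:R)))).
rewrite [RHS](eq_bigl (fun p => reduced_pair B p && in_window q h p.1 p.2))// [RHS]big_mkcondr /=.
apply: eq_bigr => p _; rewrite /trunc_weight; case: in_window; first by rewrite mulr1.
by rewrite mulr0 rmorph0 !mul0r.
Qed.

Lemma trunc_weightE : weight tcoef = trunc_variance B phi q h D.
Proof.
rewrite /weight /trunc_variance.
rewrite (eq_bigr (fun x => (fun p : 'I_D * 'I_D => cnorm ((g_B B p.1)%:C%C * Phi_ phi h (p.2%:R / p.1%:R)) ^+ 2) (val x)))//.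
rewrite -(@big_sub _ _ _ _ [pred p | trunc_pair p]
   (fun p : 'I_D * 'I_D => cnorm ((g_B B p.1)%:C%C * Phi_ phi h (p.2%:R / p.1%:R)) ^+ 2)).
rewrite (eq_bigl (fun p => reduced_pair B p && in_window q h p.1 p.2))// big_mkcondr /=.
apply: eq_bigr => p _; rewrite /trunc_weight; case: in_window; last by rewrite mulr0 expr0n mul0r.
by rewrite mulr1 cnormM cnorm_real exprMn; congr (_ * _); apply: real_normK; exact: num_real.
Qed.

Lemma tnum_le x : (`|tnum x| <= A)%N.
Proof.
have [_ _ /andP[a0 ar] _ [_ m]] := truncP x; rewrite /tnum; case: ifPn => [//|].
rewrite -ltnNge => aA; rewrite distnC distnEl ?(ltnW ar)//.
by move: m; rewrite geq_min leqNgt aA.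
Qed.

Lemma tnum_tden_inj : injective (fun x => (tnum x, tden x)).
Proof.
move=> x y [e1 e2]; apply: trunc_frac_inj => //.
have [_ _ /andP[ax0 ax] _ _] := truncP x; have [_ _ /andP[ay0 ay] _ _] := truncP y.
move: e1 e2 ax0 ax ay0 ay; rewrite /tnum; move: (tres x) (tres y) (tden x) (tden y) => a b r s.
by case: ifP => _; case: ifP => _ e1 e2; lia.
Qed.

Lemma tnum_reduced x b : inB B b -> (b %| tden x)%N -> ~~ (b%:Z %| tnum x)%Z.
Proof.
move=> Bb bd; have [_ r1 _ ra _] := truncP x.
have /(breducedP _ _ (ltnW r1))/(_ b Bb bd) := ra.
rewrite /tnum; case: ifP => _; first by rewrite dvdzE.
by rewrite rpredBr dvdzE.
Qed.

(** Denominators are elements of the semigroup up to $qh$, and signed numerators are bounded by [A].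
    Together with the lower bound of the variance this makes the number of fractions comparable to
    the square of the scale. *)
Lemma card_trunc_frac : 0 < h -> #|{: trunc_frac}|%:R <= (2 * A).+1%:R * N (q%:R * h).
Proof.
move=> h0.
pose r_ok (r : 'I_D) := sqf r && ((r%:R : R) <= q%:R * h).
have rx x : r_ok (val x).1.
  by have [sr _ _ _ [/andP[_ w] _]] := truncP x; rewrite /r_ok sr w.
pose f x : {r : 'I_D | r_ok r} * 'I_(2 * A).+1 :=
  (Sub (val x).1 (rx x), inord (absz (tnum x + A%:Z))).
have fi : injective f.
  move=> x y [e1 /(congr1 val)] /=; rewrite !inordK ?absz_shift_lt ?tnum_le// => e2.
  apply: tnum_tden_inj; congr (_, _); last by rewrite /tden e1.
  by rewrite -(absz_shiftK (tnum_le x)) e2 absz_shiftK ?tnum_le.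
have := leq_card f fi; rewrite card_prod card_ord !card_sig => le.
rewrite mulrC; apply: le_trans (_ : (#|[pred r | r_ok r]| * (2 * A).+1)%N%:R <= _); first by rewrite ler_nat.
rewrite natrM ler_wpM2r// -sum1_card natr_sum.
have qh0 : 0 <= q%:R * h by rewrite mulr_ge0// ltW.
apply: le_trans (counting_ge_sum (generated_semigroup B) D qh0).
rewrite big_mkcond [leRHS]big_mkcond; apply: ler_sum => r _ /=.
rewrite inE /r_ok; case: ifP => [/andP[sr ->]|_]; last by case: ifP.
by rewrite (mem_set (sqf_generated B_ge2 sr)).
Qed.

Lemma irreducible_trunc_le k (z Z M tau : nat) : (1 < k)%N ->
  z%:R <= h / q%:R -> Z = Num.truncn (q%:R * h) ->
  (forall n, (0 < n <= (2 * A).+1 * M)%N -> (size (divisors n) <= tau)%N) ->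
  (forall m, (m ^ (2 * k) * z <= Z ^ (k * k))%N -> (m <= M)%N) ->
  (irreducible_count tsg tneg k)%:R <=
  (k * k)%N%:R * N M%:R * (2 * A).+1%:R ^+ k * tau%:R ^+ k * tau%:R :> R.
Proof.
move=> k1 zh ZE tauP HM.
have den_le x : (tden x <= Z)%N by rewrite ZE -ltnS; exact: ltn_ord.
have den_ge x : (z <= tden x)%N.
  by have [_ _ _ _ [/andP[w _] _]] := truncP x; rewrite -(ler_nat R); exact: le_trans w.
have den_sqf x : sqf (tden x) by have [] := truncP x.
have := card_irreducible_tuples (@inB_gt1 B B_ge2) (@inB_coprime B B_cop) R
  tnum_tden_inj den_sqf den_le den_ge tnum_le tnum_reduced tauP k1 HM.
have -> : #|irreducible_tuples R tnum tden k| = irreducible_count tsg tneg k.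
  rewrite /irreducible_count -sum1_card big_mkcond /=; apply: eq_bigr => f _.
  rewrite inE; congr (nat_of_bool (_ && _)); apply: eq_forallb => i; apply: eq_forallb => j.
  congr (_ ==> ~~ _); exact: tsg_neg.
rewrite -(ler_nat R) => /le_trans; apply.
rewrite !natrM !natrX; do 3 (rewrite ler_wpM2r ?exprn_ge0//).
rewrite ler_wpM2l//.
have M0 : 0 <= M%:R :> R by [].
rewrite (counting_functionE _ M0) natrK.
rewrite size_filter -sum1_count natr_sum.
rewrite -[iota _ _]/(index_iota 0 M.+1) big_mkord big_mkcond [leRHS]big_mkcond; apply: ler_sum => m _.
case: ifP => [sm|_]; last by case: ifP.
by rewrite (mem_set (sqf_generated B_ge2 sm)).
Qed.

End TruncatedFractions.

Lemma powRN_cvg0 (R : realType) (C g : R) : 0 <= C -> 0 < g -> C * x `^ (- g) @[x --> +oo] --> (0 : R).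
Proof.
move=> C0 g0; apply/cvgrPdist_lt => e e0.
have y0 : 0 < (C / e) `^ g^-1 + 1 by rewrite ltr_wpDl// powR_ge0.
exists ((C / e) `^ g^-1 + 1); split; first exact: num_real.
move=> x xx; have x0 : 0 < x by exact: lt_trans xx.
rewrite sub0r normrN ger0_norm ?mulr_ge0 ?powR_ge0// powRN ltr_pdivrMr ?powR_gt0// mulrC -ltr_pdivrMr//.
apply: (@le_lt_trans _ _ (((C / e) `^ g^-1) `^ g)).
  by rewrite -powRrM mulVf ?gt_eqF// powRr1// divr_ge0// ltW.
rewrite gt0_ltr_powR// ?nnegrE ?powR_ge0 ?(ltW x0)//.
by apply: lt_trans xx; rewrite ltrDl.
Qed.

(** * Moments of the truncated polynomial *)

Section MomentsOfTruncation.
Context {R : realType}.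
Variable B : set nat.
Hypothesis B_ge2 : B `<=` [set b | 2 <= b]%N.
Hypothesis B_cop : {in B &, forall b c, b != c -> coprime b c}.
Variables (alpha : R) (alpha01 : 0 < alpha < 1).
Hypothesis B_regular : regularly_varying (generated_semigroup B) alpha.
Local Notation sqf := (bsqf (inB B)).
Local Notation N := (counting_function (generated_semigroup B) : R -> R).
Variables (phi : R -> R) (c V : R).
Hypothesis supp : forall x, phi x != 0 -> 0 <= x <= c.
Hypothesis varV : forall K (x : nat -> R), (forall i, (i < K)%N -> x i < x i.+1) ->
  \sum_(i < K) `|phi (x i.+1) - phi (x i)| <= V.
Variable q : nat.
Hypothesis q0 : (0 < q)%N.

Lemma counting_poly_lower beta : beta < alpha -> exists C x0, [/\ 1 <= x0, 0 < C &
  forall x, x0 <= x -> C * x `^ beta <= N x].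
Proof.
move=> ba; have /andP[a0 a1] := alpha01.
pose eta := Num.min (alpha - beta) (alpha / 2).
have eta0 : 0 < eta by rewrite lt_min subr_gt0 ba divr_gt0.
have ea : eta <= alpha / 2 by rewrite ge_min lexx orbT.
have eb : eta <= alpha - beta by rewrite ge_min lexx.
have etaa : 0 < eta < alpha by rewrite eta0 /=; lra.
have [C [x0 [x01 C0 H]]] := counting_potter B_regular etaa.
have x00 : 0 < x0 by exact: lt_le_trans x01.
have [Nx0 _ _] := H x0 x0 (lexx _) (lexx _).
exists (N x0 / (C * x0 `^ (alpha - eta))), x0; split => //.
  by rewrite divr_gt0// mulr_gt0// powR_gt0.
move=> x xx0; have xp : 0 < x by exact: lt_le_trans xx0.
have [_ _] := H x0 x (lexx _) xx0.
have -> : (x0 / x) `^ (alpha - eta) = x0 `^ (alpha - eta) / x `^ (alpha - eta).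
  rewrite powRM ?invr_ge0 ?(ltW x00) ?(ltW xp)//; congr (_ * _).
  by rewrite -[x^-1]powR_inv1 ?(ltW xp)// -powRrM mulN1r powRN.
have p1 : 0 < x0 `^ (alpha - eta) by exact: powR_gt0.
have p2 : 0 < x `^ (alpha - eta) by exact: powR_gt0.
move=> h; rewrite mulrAC ler_pdivrMr ?mulr_gt0//.
apply: (@le_trans _ _ (N x0 * x `^ (alpha - eta))).
  rewrite ler_wpM2l ?(ltW Nx0)// ler_powR//; last by rewrite lerBrDl -lerBrDr.
  exact: le_trans xx0.
rewrite -ler_pdivlMr//; apply: le_trans h _; rewrite le_eqVlt; apply/orP; left; apply/eqP.
by field; rewrite gt_eqF.
Qed.

Lemma counting_upper1 beta : alpha < beta -> exists C, 0 < C /\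
  forall x, 1 <= x -> N x <= C * x `^ beta.
Proof.
move=> ab; have [C [x0 [x01 C0 H]]] := counting_poly_upper alpha01 B_regular ab.
have /andP[a0 a1] := alpha01.
exists (C + N x0); split; first by rewrite ltr_wpDr ?counting_function_ge0.
move=> x x1; rewrite mulrDl; have Nx0 : 0 <= N x0 by exact: counting_function_ge0.
have [xx0|xx0] := leP x0 x.
  by apply: le_trans (H x xx0) _; rewrite lerDl mulr_ge0 ?powR_ge0.
apply: (@le_trans _ _ (N x0)); first by apply: le_counting_function => //; exact: ltW.
have xb : 1 <= x `^ beta by rewrite -[leLHS](powRr0 x) ler_powR//; lra.
apply: (@le_trans _ _ (N x0 * x `^ beta)); first by rewrite ler_peMr.
by rewrite lerDr mulr_ge0 ?powR_ge0// ltW.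
Qed.

Let s h := Num.sqrt (N h).

Let s_lower beta : beta < alpha -> exists C x0, [/\ 1 <= x0, 0 < C &
  forall x, x0 <= x -> C * x `^ (beta / 2) <= s x].
Proof.
move=> /counting_poly_lower[C [x0 [x01 C0 H]]].
exists (Num.sqrt C), x0; split => //; first by rewrite sqrtr_gt0.
move=> x xx0; have xp : 0 < x by apply: lt_le_trans xx0; exact: lt_le_trans x01.
rewrite /s -[leLHS]ger0_norm ?mulr_ge0 ?sqrtr_ge0 ?powR_ge0// -sqrtr_sqr ler_wsqrtr//.
apply: le_trans (H x xx0); rewrite exprMn sqr_sqrtr ?(ltW C0)// -powR_mulrn ?powR_ge0// -powRrM.
by rewrite divfK.
Qed.

Lemma powR_root (m j : nat) (x : R) : (0 < j)%N -> 0 <= x -> (m ^ j)%N%:R <= x -> m%:R <= x `^ (j%:R^-1).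
Proof.
move=> j0 x0 mx; have j0' : 0 < j%:R :> R by rewrite ltr0n.
apply: (@le_trans _ _ (((m ^ j)%N%:R : R) `^ (j%:R^-1))).
  by rewrite natrX -powR_mulrn// -powRrM divff ?gt_eqF// powRr1.
by rewrite ge0_ler_powR ?nnegrE ?invr_ge0.
Qed.

(** The integers [m] of the code are $\ll h^\theta$ with $\theta = (k^2-1)/(2k)$. Counting them
    costs the exponent $\alpha + \epsilon$, and the $k + 1$ divisor factors cost one more
    $\epsilon$. *)
Lemma irreducible_poly_bound k : (2 < k)%N -> exists K x0, [/\ 1 <= x0, 0 < K & forall h, x0 <= h ->
  (irreducible_count (@tsg R B q h) (@tneg R B q h) k)%:R <=
  K * h `^ ((k%:R ^+ 2 - 1) / (2 * k%:R) * (alpha + 2 * (alpha / (4 * k%:R ^+ 2))))].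
Proof.
move=> k2; have /andP[a0 a1] := alpha01.
have k0 : 0 < k%:R :> R by rewrite ltr0n (ltn_trans _ k2).
have k1 : (1 < k)%N by exact: ltnW.
set th := (k%:R ^+ 2 - 1) / (2 * k%:R); set ep := alpha / (4 * k%:R ^+ 2).
have ep0 : 0 < ep by rewrite divr_gt0// mulr_gt0// exprn_gt0.
have th0 : 0 <= th by rewrite divr_ge0 ?mulr_ge0// subr_ge0 exprn_ege1// ler1n ltnW.
have qp : 0 < q%:R :> R by rewrite ltr0n.
have [Cn [Cn0 HN]] := @counting_upper1 (alpha + ep) ltac:(by rewrite ltrDl).
(* With $\tau(n) \ll n^{1/j}$ the factor $\tau^{k+1}$ costs the exponent $(k+1)/j \le \epsilon$. *)
pose j := (Num.truncn (k.+1%:R / ep)).+1.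
have jep : k.+1%:R / j%:R <= ep.
  by rewrite ler_pdivrMr ?ltr0n// mulrC -ler_pdivrMr// ltW// truncnS_gt.
have [Cd HD] := size_divisors_bound j.
pose A2 := (2 * q ^ 3).+1.
pose C4 : R := Cd%:R * A2%:R + 1.
have C41 : 1 <= C4 by rewrite lerDr mulr_ge0.
have C40 : 0 < C4 by exact: lt_le_trans C41.
(* From $z \ge h/(2q)$ and $Z \le qh$ the condition on [m] becomes $m^{2k} \le 2 q^{k^2+1}
   h^{k^2-1}$. *)
pose C1 : R := (2 * q%:R ^+ (k * k).+1) `^ ((2 * k)%N%:R^-1) + 1.
have C11 : 1 <= C1 by rewrite lerDr powR_ge0.
have C10 : 0 < C1 by exact: lt_le_trans C11.
pose K1 := (k * k)%N%:R * Cn * A2%:R ^+ k * C4 `^ ep.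
have K10 : 0 < K1.
  rewrite !mulr_gt0 ?exprn_gt0 ?ltr0n ?powR_gt0// muln_gt0 (ltn_trans _ k2)//.
exists (K1 * C1 `^ (alpha + 2 * ep)), (Num.max 1 q%:R); split.
- by rewrite le_max lexx.
- by rewrite mulr_gt0 ?powR_gt0.
move=> h; rewrite ge_max => /andP[h1 hq].
have h0 : 0 < h by exact: lt_le_trans h1.
pose Mb := C1 * h `^ th.
have hth : 1 <= h `^ th by rewrite -[leLHS](powRr0 h) ler_powR.
have Mb1 : 1 <= Mb by rewrite mulr_ege1.
have Mb0 : 0 < Mb by exact: lt_le_trans Mb1.
pose M := Num.truncn Mb.
have MMb : M%:R <= Mb by rewrite truncn_le// ltW.
pose T := (C4 * Mb) `^ (j%:R^-1).
have T0 : 0 < T by rewrite powR_gt0// mulr_gt0.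
pose tau := Num.truncn T.
have tauT : tau%:R <= T by rewrite truncn_le// ltW.
have tauP n : (0 < n <= A2 * M)%N -> (size (divisors n) <= tau)%N.
  move=> /andP[n0 nA]; rewrite truncn_ge_nat ?(ltW T0)//.
  apply: powR_root => //; first by rewrite mulr_ge0// ltW.
  apply: (@le_trans _ _ (Cd * n)%N%:R); first by rewrite ler_nat HD.
  rewrite natrM; apply: (@le_trans _ _ (Cd%:R * (A2%:R * Mb))).
    rewrite ler_wpM2l//; apply: (@le_trans _ _ (A2 * M)%N%:R); first by rewrite ler_nat.
    by rewrite natrM ler_wpM2l.
  by rewrite mulrA ler_wpM2r ?(ltW Mb0)// /C4 lerDl.
have hq1 : 1 <= h / q%:R by rewrite ler_pdivlMr// mul1r.
pose z := Num.truncn (h / q%:R); pose Z := Num.truncn (q%:R * h).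
have zh : z%:R <= h / q%:R by rewrite truncn_le// (le_trans ler01).
have z1 : 1 <= z%:R :> R by rewrite ler1n truncn_gt0.
have zlow : h / (2 * q%:R) <= z%:R.
  have : h / q%:R < z.+1%:R by exact: truncnS_gt.
  rewrite -natr1 invfM => hz; lra.
have ZH : Z%:R <= q%:R * h by rewrite truncn_le// mulr_ge0// ltW.
have HM m : (m ^ (2 * k) * z <= Z ^ (k * k))%N -> (m <= M)%N.
  rewrite -(ler_nat R) natrM [X in _ <= X]natrX => hm.
  rewrite truncn_ge_nat ?(ltW Mb0)//.
  have kk0 : (0 < 2 * k)%N by rewrite muln_gt0 (ltn_trans _ k2).
  have hm2 : (m ^ (2 * k))%N%:R <= (2 * q%:R ^+ (k * k).+1) * h ^+ (k * k).-1 :> R.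
    have e : ((2 * q%:R ^+ (k * k).+1) * h ^+ (k * k).-1) * (h / (2 * q%:R)) = (q%:R * h) ^+ (k * k) :> R.
      have kk1 : (k * k = (k * k).-1.+1)%N by rewrite prednK// muln_gt0 (ltn_trans _ k2).
      rewrite exprMn [in X in _ = _ * X]kk1 exprS exprS; field; exact: lt0r_neq0.
    have p : 0 < h / (2 * q%:R) by rewrite divr_gt0// mulr_gt0.
    rewrite -(ler_pM2r p) e; apply: (@le_trans _ _ ((m ^ (2 * k))%N%:R * z%:R)).
      by rewrite ler_wpM2l.
    by apply: le_trans hm _; apply: lerXn2r; rewrite ?nnegrE ?mulr_ge0 ?(ltW h0) ?(ltW qp).
  have p0 : 0 <= (2 * q%:R ^+ (k * k).+1) * h ^+ (k * k).-1.
    by rewrite !mulr_ge0 ?exprn_ge0// ltW.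
  apply: le_trans (powR_root kk0 p0 hm2) _.
  rewrite powRM ?mulr_ge0 ?exprn_ge0 ?(ltW h0)// /Mb.
  have -> : (h ^+ (k * k).-1) `^ ((2 * k)%N%:R^-1) = h `^ th.
    rewrite -powR_mulrn ?(ltW h0)// -powRrM; congr (_ `^ _); rewrite /th -subn1 natrB ?muln_gt0 ?(ltn_trans _ k2)//.
    by rewrite !natrM expr2.
  by rewrite ler_wpM2r ?powR_ge0// /C1 lerDl.
have := irreducible_trunc_le B_ge2 B_cop alpha01 q0 k1 zh (erefl Z) tauP HM.
move/le_trans; apply.
have NM : N M%:R <= Cn * Mb `^ (alpha + ep).
  by apply: le_trans (HN Mb Mb1); apply: le_counting_function.
have TT : tau%:R ^+ k * tau%:R <= C4 `^ ep * Mb `^ ep.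
  rewrite -exprSr; apply: (@le_trans _ _ (T ^+ k.+1)); first by apply: lerXn2r; rewrite ?nnegrE ?(ltW T0).
  rewrite -powRM ?(ltW C40) ?(ltW Mb0)// /T -powR_mulrn ?powR_ge0// -powRrM ler_powR//.
    by rewrite mulr_ege1.
  by rewrite mulrC.
have e3 : h `^ (th * (alpha + 2 * ep)) * C1 `^ (alpha + 2 * ep) = Mb `^ (alpha + ep) * Mb `^ ep.
  rewrite -powRD ?(gt_eqF Mb0) ?implybT//.
  have -> : alpha + ep + ep = alpha + 2 * ep by ring.
  by rewrite /Mb powRM ?powR_ge0 ?(ltW C10)// powRrM mulrC.
rewrite [leRHS](_ : _ = K1 * (h `^ (th * (alpha + 2 * ep)) * C1 `^ (alpha + 2 * ep))); last by ring.
rewrite e3 /K1 [leLHS](_ : _ = (k * k)%N%:R * N M%:R * A2%:R ^+ k * (tau%:R ^+ k * tau%:R)); last by ring.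
rewrite [leRHS](_ : _ = (k * k)%N%:R * (Cn * Mb `^ (alpha + ep)) * A2%:R ^+ k * (C4 `^ ep * Mb `^ ep)); last by ring.
have NM0 : 0 <= N M%:R by exact: counting_function_ge0.
apply: ler_pM => //; rewrite ?mulr_ge0 ?exprn_ge0//.
by rewrite ler_wpM2r ?exprn_ge0// ler_wpM2l.
Qed.

(** The exponent of $s^k$ exceeds that of the count: with $\epsilon = \alpha/(4k^2)$,
    $\frac{k(\alpha-\epsilon)}2 - \theta(\alpha + 2\epsilon) = \frac{\alpha/4 + 2\epsilon}{2k} >
    0$. *)
Lemma irreducible_vanish k : (2 < k)%N ->
  (irreducible_count (@tsg R B q h) (@tneg R B q h) k)%:R / s h ^+ k @[h --> +oo] --> (0 : R).
Proof.
move=> k2; have /andP[a0 a1] := alpha01.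
have [K [x0 [x01 K0 HK]]] := irreducible_poly_bound k2.
have k0 : 0 < k%:R :> R by rewrite ltr0n (ltn_trans _ k2).
set ep := alpha / (4 * k%:R ^+ 2) in HK; set th := (k%:R ^+ 2 - 1) / (2 * k%:R) in HK.
have ep0 : 0 < ep by rewrite divr_gt0// mulr_gt0// exprn_gt0.
have [C [x1 [x11 C0 HC]]] := @s_lower (alpha - ep) ltac:(by rewrite ltrBlDr ltrDl).
pose g := k%:R * ((alpha - ep) / 2) - th * (alpha + 2 * ep).
have g0 : 0 < g.
  have -> : g = (alpha / 4 + 2 * ep) / (2 * k%:R).
    by rewrite /g /th /ep; field; rewrite gt_eqF.
  by apply: divr_gt0; [apply: addr_gt0; [exact: divr_gt0|exact: mulr_gt0]|exact: mulr_gt0].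
apply: (@squeeze_cvgr _ _ _ _ (fun=> 0) (fun h => K / C ^+ k * h `^ (- g))); [|exact: cvg_cst|]; last first.
  by apply: powRN_cvg0 => //; rewrite divr_ge0 ?exprn_ge0// ltW.
exists (Num.max x0 x1); split; first exact: num_real.
move=> h; rewrite gt_max => /andP[/ltW h0 /ltW h1].
have hp : 0 < h by apply: lt_le_trans h0; exact: lt_le_trans x01.
have sh := HC h h1; have Cp : 0 < C * h `^ ((alpha - ep) / 2) by rewrite mulr_gt0// powR_gt0.
have s0 : 0 < s h by exact: lt_le_trans sh.
rewrite divr_ge0 ?exprn_ge0 ?(ltW s0)//= ler_pdivrMr ?exprn_gt0//.
apply: le_trans (HK h h0) _.
apply: (@le_trans _ _ (K / C ^+ k * h `^ (- g) * (C * h `^ ((alpha - ep) / 2)) ^+ k)).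
  rewrite exprMn -[(h `^ _) ^+ k]powR_mulrn ?powR_ge0// -powRrM.
  rewrite [leRHS](_ : _ = K * (h `^ (- g) * h `^ ((alpha - ep) / 2 * k%:R))); last first.
    by field; rewrite expf_neq0// gt_eqF.
  rewrite -powRD ?(gt_eqF hp) ?implybT// le_eqVlt; apply/orP; left; apply/eqP; congr (_ * _ `^ _).
  by rewrite /g; ring.
rewrite ler_wpM2l ?mulr_ge0 ?powR_ge0 ?invr_ge0 ?exprn_ge0 ?(ltW K0) ?(ltW C0)//.
by apply: lerXn2r; rewrite ?nnegrE ?(ltW Cp) ?(ltW s0).
Qed.

(** [tuple_moment_cvg] with the scale $s = \sqrt{N(h)}$: coefficients are bounded, the number of
    fractions is $O(s^2)$ by Potter's bounds for fixed [q], and the hypothesis makes the standard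
    deviation at least a multiple of [s]. *)
Lemma truncated_moments_cvg (a1 : R) : 0 < a1 ->
  (\forall h \near +oo, a1 * N h <= trunc_variance B phi q h (frac_bound q h)) ->
  forall k, complex.Re (tuple_moment (@tsg R B q h) (@tcoef R B phi q h) k) /
    Num.sqrt (trunc_variance B phi q h (frac_bound q h)) ^+ k @[h --> +oo] -->
    normal_mean (fun y : R => y ^+ k).
Proof.
move=> a10 var_ge k; have /andP[a0 _] := alpha01.
have [C [x1 [x11 C0 HC]]] := @s_lower (alpha / 2) ltac:(by rewrite ltr_pdivrMr// mulr_natr mulr2n ltrDl).
have etaa : 0 < alpha / 2 < alpha by apply/andP; split; lra.
have [C2 [x2 [x21 C20 H2]]] := counting_potter B_regular etaa.
have s_pos h : x1 <= h -> 0 < s h.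
  move=> xh; apply: lt_le_trans (HC h xh); rewrite mulr_gt0// powR_gt0//.
  by apply: lt_le_trans xh; exact: lt_le_trans x11.
have near_ge (y : R) : \forall h \near +oo, y <= h by exists y; split; [exact: num_real|move=> x /ltW].
pose Cc := Num.max (1 + 2 * V) ((2 * q ^ 3).+1%:R * (C2 * q%:R `^ (alpha + alpha / 2))).
have V0 := window_V_ge0 supp varV.
under eq_fun => h do rewrite -trunc_weightE.
apply: (@tuple_moment_cvg R R +oo _ (trunc_frac B q) (fun h => @tsg R B q h) (fun h => @tcoef R B phi q h)
  (fun h => @tneg R B q h) s Cc (Num.sqrt a1)).
- by move=> h u w; exact: (tsg_neg B_ge2 B_cop alpha01 q0).
- by move=> h u; exact: (tsgN B_ge2 B_cop).
- by move=> h u; exact: (tcoef_neg B_ge2 B_cop supp q0).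
- by rewrite /Cc le_max lerDl mulr_ge0.
- by rewrite sqrtr_gt0.
- by apply: filterS (near_ge x1) => h; exact: s_pos.
- apply: (@squeeze_cvgr _ _ _ _ (fun=> 0) (fun h => C^-1 * h `^ (- (alpha / 2 / 2)))); [|exact: cvg_cst|]; last first.
    by apply: powRN_cvg0; rewrite ?invr_ge0 ?divr_gt0// ltW.
  apply: filterS (near_ge x1) => h xh; have sp := s_pos h xh.
  have hp : 0 < h by apply: lt_le_trans xh; exact: lt_le_trans x11.
  rewrite invr_ge0 (ltW sp)/= powRN -invfM lef_pV2 ?posrE// ?HC// mulr_gt0// powR_gt0//.
- by move=> h u; rewrite /Cc le_max (tcoef_le B_ge2 B_cop alpha01 B_regular supp varV q0).
- apply: filterS (near_ge (Num.max x1 x2)) => h; rewrite ge_max => /andP[xh xh2].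
  have hp : 0 < h by apply: lt_le_trans xh; exact: lt_le_trans x11.
  apply: le_trans (card_trunc_frac B_ge2 B_cop alpha01 q0 hp) _.
  rewrite /s sqr_sqrtr ?counting_function_ge0//.
  apply: (@le_trans _ _ ((2 * q ^ 3).+1%:R * (C2 * q%:R `^ (alpha + alpha / 2)) * N h)); last first.
    by rewrite ler_wpM2r ?counting_function_ge0// /Cc le_max lexx orbT.
  rewrite -mulrA ler_wpM2l//.
  have hqh : h <= q%:R * h by rewrite ler_peMl ?ler1n// ltW.
  have [_ + _] := H2 h (q%:R * h) xh2 hqh.
  by rewrite mulfK// gt_eqF.
- by move=> j; exact: irreducible_vanish.
- apply: filterS2 var_ge (near_ge 1) => h hv h1.
  rewrite trunc_weightE /s -sqrtrM ?(ltW a10)//; exact: ler_wsqrtr.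
Qed.

End MomentsOfTruncation.

Lemma expr_6n2 (T : comPzRingType) (x : T) n :
  x ^+ (6 * n + 2) = x ^+ (2 * n) * (x ^+ (2 * n) * x) ^+ 2.
Proof. by rewrite -exprSr -exprM -exprD; congr (_ ^+ _); lia. Qed.

Section Arithmetic.
Context {R : realFieldType}.
Implicit Types q y h : R.

Lemma level_square_bound q y h : 1 <= h -> (q * y + q + 1) * h <= h * h -> q * h * (y + 1) <= h * h - 1.
Proof. nra. Qed.

Lemma le_trans_pred (a b e : R) : a * 1 <= b -> b <= e - 1 -> a <= e.
Proof. lra. Qed.

Lemma lt_trans_pred (a b e f D : R) : b <= e - 1 -> e <= f -> f < D + 1 -> a <= b -> a < D.
Proof. lra. Qed.

Lemma level_exponent_bound (E b : R) : 1 <= E * (1 - b) -> E * (b - 1) <= - 1.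
Proof. lra. Qed.

Lemma chebyshev_tail_share (d s T : R) : 20 * T <= s * d ^+ 2 -> 4 * T <= d / 5 * (d * s).
Proof. rewrite expr2; lra. Qed.

Lemma chebyshev_share_sum (k d z : R) : k / d ^+ 2 = z ->
  48 * k / d ^+ 2 + d / 5 + 8 * k / d ^+ 2 = 56 * z + d / 5.
Proof. by move=> <-; ring. Qed.

Lemma chebyshev_share_total (d : R) : 0 < d -> 56 * (d / 80) + d / 5 <= d.
Proof. lra. Qed.

End Arithmetic.

(** * Comparison of the deviation with the truncated polynomial *)

Section Approximation.
Context {R : realType}.
Variable B : set nat.
Hypothesis B_ge2 : B `<=` [set b | 2 <= b]%N.
Hypothesis B_cop : {in B &, forall b c, b != c -> coprime b c}.
Variables (alpha : R) (alpha01 : 0 < alpha < 1).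
Hypothesis B_regular : regularly_varying (generated_semigroup B) alpha.
Local Notation sqf := (bsqf (inB B)).
Local Notation J := (generated_semigroup B).
Local Notation N := (counting_function (generated_semigroup B) : R -> R).
Variables (phi : R -> R) (c V : R).
Hypothesis supp : forall x, phi x != 0 -> 0 <= x <= c.
Hypothesis varV : forall K (x : nat -> R), (forall i, (i < K)%N -> x i < x i.+1) ->
  \sum_(i < K) `|phi (x i.+1) - phi (x i)| <= V.
Hypothesis phi_neq0 : exists a b : R, a < b /\ forall x, a < x < b -> phi x != 0.
Hypothesis c0 : 0 <= c.
Let V0 := window_V_ge0 supp varV.
Local Notation wt q h := (trunc_weight B q h).
Implicit Types (q D M : nat) (h d : R).

Lemma trig_widen D D' (w : nat -> nat -> R) h n : (D <= D')%N ->
  (forall r a, (D <= r)%N -> w r a = 0) -> trig B phi h D' w n = trig B phi h D w n.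
Proof.
move=> DD w0; rewrite /trig.
rewrite (sum_reduced_pair B (fun r a => ((w r a)%:C%C * Phi_ phi h (a%:R / r%:R)) * e_ (n%:R * (a%:R / r%:R)))).
rewrite (sum_reduced_pair B (fun r a => ((w r a)%:C%C * Phi_ phi h (a%:R / r%:R)) * e_ (n%:R * (a%:R / r%:R)))).
pose G r := \sum_(a < r | breduced B a r) (w r a)%:C%C * Phi_ phi h (a%:R / r%:R) * e_ (n%:R * (a%:R / r%:R)).
rewrite -/(G _) [RHS](big_ord_widen_cond D' (fun r => sqf r && (1 < r)%N) G)// [RHS]big_mkcondr /=.
apply: eq_bigr => r _; case: ltnP => // Dr; rewrite big1// => a _.
by rewrite w0// rmorph0 !mul0r.
Qed.

Lemma trunc_weight_eq0 q h r a : q%:R * h < r%:R -> wt q h r a = 0.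
Proof. by move=> qr; rewrite /trunc_weight /in_window [r%:R <= _]leNgt qr andbF mulr0. Qed.

Lemma trigB D (w w' : nat -> nat -> R) h n :
  trig B phi h D (fun r a => w r a - w' r a) n = trig B phi h D w n - trig B phi h D w' n.
Proof.
rewrite /trig -sumrB; apply: eq_bigr => p _.
by rewrite rmorphB /= mulrBl mulrBl.
Qed.

Lemma counting_infty (x : R) : exists h1, 1 <= h1 /\ forall h, h1 <= h -> x <= N h.
Proof.
have /andP[a0 a1] := alpha01.
have [C [x0 [x01 C0 H]]] := @counting_poly_lower R B alpha alpha01 B_regular (alpha / 2) ltac:(by rewrite ltr_pdivrMr// mulr_natr mulr2n ltrDl).
pose b := alpha / 2; have b0 : 0 < b by rewrite divr_gt0.
exists (Num.max x0 ((`|x| / C) `^ b^-1)); split; first by rewrite le_max x01.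
move=> h; rewrite ge_max => /andP[h1 h2]; apply: le_trans (H h h1).
have h0 : 0 < h by apply: lt_le_trans h1; exact: lt_le_trans x01.
apply: le_trans (ler_norm _) _; rewrite mulrC -ler_pdivrMr//.
apply: (@le_trans _ _ (((`|x| / C) `^ b^-1) `^ b)).
  by rewrite -powRrM mulVf ?gt_eqF// powRr1// divr_ge0// ltW.
by rewrite ge0_ler_powR ?nnegrE ?powR_ge0 ?(ltW b0) ?(ltW h0).
Qed.

(** A discrepancy above [d] requires [diff / s] or [T / s] to reach $d/4$ in absolute value, or the
    normalization error $(1-\rho)|y|$ to reach $d/2$. [T] enters to the first power because it is
    controlled only in mean; the other two enter by their squares. *)
Lemma deviation_termwise (d s rho diff T y eta : R) : 0 < d -> 0 < s -> 0 <= eta -> 1 - eta <= rho <= 1 ->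
  (d < `|s^-1 * (y * (s * rho) + diff + T) - y|)%R%:R <=
  16 / (d ^+ 2 * s ^+ 2) * diff ^+ 2 + 4 / (d * s) * `|T| + 4 / d ^+ 2 * eta ^+ 2 * y ^+ 2.
Proof.
move=> d0 s0 eta0 /andP[r1 r2].
have t1 : 0 <= 16 / (d ^+ 2 * s ^+ 2) * diff ^+ 2.
  by apply: mulr_ge0; [rewrite divr_ge0// mulr_ge0 ?sqr_ge0|exact: sqr_ge0].
have t2 : 0 <= 4 / (d * s) * `|T| by rewrite mulr_ge0// divr_ge0// mulr_ge0// ltW.
have t3 : 0 <= 4 / d ^+ 2 * eta ^+ 2 * y ^+ 2.
  by apply: mulr_ge0; [apply: mulr_ge0; [rewrite divr_ge0 ?sqr_ge0|exact: sqr_ge0]|exact: sqr_ge0].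
case: ltP => [dlt|_]; last by rewrite !addr_ge0.
have [c1|c1] := leP (d / 4) (`|diff| / s).
  apply: (@le_trans _ _ (16 / (d ^+ 2 * s ^+ 2) * diff ^+ 2)); last by rewrite -addrA lerDl addr_ge0.
  have -> : 16 / (d ^+ 2 * s ^+ 2) * diff ^+ 2 = ((`|diff| / s) / (d / 4)) ^+ 2.
    rewrite -[diff ^+ 2]real_normK ?num_real//; field; by rewrite !gt_eqF.
  by rewrite exprn_ege1// ler_pdivlMr ?mul1r// divr_gt0.
have [c2|c2] := leP (d / 4) (`|T| / s).
  apply: (@le_trans _ _ (4 / (d * s) * `|T|)); last by rewrite addrAC lerDr addr_ge0.
  have -> : 4 / (d * s) * `|T| = (`|T| / s) / (d / 4) by field; rewrite !gt_eqF.
  by rewrite ler_pdivlMr ?mul1r// divr_gt0.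
apply: (@le_trans _ _ (4 / d ^+ 2 * eta ^+ 2 * y ^+ 2)); last by rewrite lerDr addr_ge0.
have h3 : d / 2 <= `|y| * eta.
  have e : s^-1 * (y * (s * rho) + diff + T) - y = diff / s + T / s + y * (rho - 1) by field; rewrite gt_eqF.
  rewrite e in dlt.
  have n1 := ler_normD (diff / s + T / s) (y * (rho - 1)).
  have n2 := ler_normD (diff / s) (T / s).
  have n3 : `|y * (rho - 1)| <= `|y| * eta.
    by rewrite normrM ler_wpM2l// distrC ger0_norm ?subr_ge0//; lra.
  have n4 : `|diff / s| = `|diff| / s by rewrite normrM normfV (gtr0_norm s0).
  have n5 : `|T / s| = `|T| / s by rewrite normrM normfV (gtr0_norm s0).
  rewrite n4 n5 in n2; lra.
have -> : 4 / d ^+ 2 * eta ^+ 2 * y ^+ 2 = ((`|y| * eta) / (d / 2)) ^+ 2.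
  rewrite -[y ^+ 2]real_normK ?num_real//; field; by rewrite gt_eqF.
by rewrite exprn_ege1// ler_pdivlMr ?mul1r// divr_gt0.
Qed.

Section Level.
Variables (h : R) (M D : nat) (q : nat) (C t x tau : R).
Hypothesis h1 : 1 <= h.
Hypothesis q0 : (0 < q)%N.
Hypothesis Kq : (window_size c h)%:R <= q%:R * h.
Hypothesis qD : q%:R * h < D%:R.
Hypothesis gC : forall r, sqf r -> `|gD B D r : R| <= C / r%:R.
Hypothesis gt : forall r, sqf r -> r%:R <= q%:R * h -> `|g_B B r - gD B D r : R| <= t / r%:R.
Hypothesis Hx : forall M, outside_bound B c V q h M <= x.
Hypothesis C1 : 1 <= C.
Hypothesis t1 : t <= 1.
Hypothesis tailD : forall L, \sum_(d < L | sqf d && (D <= d)%N) (d%:R)^-1 <= tau.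
Local Notation K := (window_size c h).
Local Notation s := (Num.sqrt (C2 B phi h)).
Local Notation v := (trunc_variance B phi q h (frac_bound q h)).
Local Notation Y n := (complex.Re (trig B phi h (frac_bound q h) (wt q h) n)).

Let h0 : 0 < h := lt_le_trans ltr01 h1.

(** Summed Chebyshev bounds. The discrepancy consists of the difference between the polynomial of
    level [D] and the truncated one, the remainder of the moduli beyond [D], and the normalization
    by the truncated variance instead of [C2]. *)
Lemma level_bound (d eta : R) : 0 < d -> 0 <= eta -> 0 < v -> C2 B phi h * (1 - eta) <= v ->
  \sum_(n < M) (d < `|s^-1 * weighted_deviation B phi h n.+1 - Y n.+1 / Num.sqrt v|)%R%:R <=
  16 / (d ^+ 2 * C2 B phi h) * (M%:R * (C ^+ 2 * x + t ^+ 2 * (16 * V ^+ 2 * N (q%:R * h)))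
     + 2 * (D * D)%N%:R * ((D * D)%N%:R * (2 * C * V * K%:R)) ^+ 2) +
  4 / (d * s) * (K%:R * V * tau * (3 * M + K)%N%:R) +
  4 / d ^+ 2 * eta ^+ 2 * \sum_(n < M) (Y n.+1 / Num.sqrt v) ^+ 2.
Proof.
move=> d0 eta0 v0 vC.
have vC2 : v <= C2 B phi h := trunc_variance_le B_ge2 B_cop alpha01 B_regular supp varV q (frac_bound q h) h0.
have C20 : 0 < C2 B phi h by exact: lt_le_trans vC2.
have s0 : 0 < s by rewrite sqrtr_gt0.
have sv0 : 0 < Num.sqrt v by rewrite sqrtr_gt0.
have [T [TE TS]] := deviation_decomposition B_ge2 B_cop supp varV h0 (window_sizeP c h) M tailD.
pose df := trig B phi h D (fun r a => gD B D r - wt q h r a).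
have fD : (frac_bound q h <= D)%N.
  by rewrite /frac_bound -(ltr_nat R); apply: le_lt_trans qD; rewrite truncn_le// mulr_ge0// ltW.
have dfE n : df n = trig B phi h D (fun r _ => gD B D r) n - trig B phi h (frac_bound q h) (wt q h) n.
  rewrite /df trigB; congr (_ - _); apply: (trig_widen _ _ fD) => r a Dr.
  apply: trunc_weight_eq0; apply: lt_le_trans (truncnS_gt _) _; by rewrite ler_nat.
(* Ratio of the truncated to the full standard deviation; $1 - \eta \le \rho^2 \le \rho \le 1$. *)
pose rho := Num.sqrt v / s.
have WE n : (n < M)%N -> weighted_deviation B phi h n.+1 = (Y n.+1 / Num.sqrt v) * (s * rho) + complex.Re (df n.+1) + T n.+1.
  move=> nM; have := TE n.+1; rewrite /= nM => /(_ isT)/(congr1 (@complex.Re R)).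
  move=> e; have {e} -> : weighted_deviation B phi h n.+1 = complex.Re (trig B phi h D (fun r _ => gD B D r) n.+1) + T n.+1.
    exact: etrans e (raddfD _ _ _).
  have -> : Y n.+1 / Num.sqrt v * (s * rho) = Y n.+1 by rewrite /rho; field; rewrite !gt_eqF.
  by rewrite dfE raddfB /=; ring.
have rho2 : rho ^+ 2 = v / C2 B phi h.
  by rewrite /rho exprMn exprVn !sqr_sqrtr ?(ltW v0) ?(ltW C20).
have rho0 : 0 <= rho by rewrite divr_ge0 ?sqrtr_ge0.
have rho1 : rho <= 1 by rewrite ler_pdivrMr// mul1r; apply: ler_wsqrtr.
have rhoeta : 1 - eta <= rho.
  apply: (@le_trans _ _ (rho ^+ 2)); last by rewrite expr2 ler_piMr.
  by rewrite rho2 ler_pdivlMr// mulrC.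
have s2 : s ^+ 2 = C2 B phi h by rewrite sqr_sqrtr ?(ltW C20).
apply: (@le_trans _ _ (\sum_(n < M) (16 / (d ^+ 2 * s ^+ 2) * complex.Re (df n.+1) ^+ 2 + 4 / (d * s) * `|T n.+1| +
   4 / d ^+ 2 * eta ^+ 2 * (Y n.+1 / Num.sqrt v) ^+ 2))).
  apply: ler_sum => n _; rewrite WE//; apply: deviation_termwise => //.
  by rewrite rhoeta rho1.
rewrite s2 !big_split /= -!mulr_sumr; apply: lerD => //; apply: lerD; last first.
  by apply: ler_wpM2l => //; rewrite divr_ge0// mulr_ge0// ltW.
apply: ler_wpM2l; first by rewrite divr_ge0// mulr_ge0 ?sqr_ge0// ltW.
apply: (@le_trans _ _ (\sum_(n < M) cnorm (df n.+1) ^+ 2)).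
  apply: ler_sum => n _; rewrite sqr_cnormE lerDl; exact: sqr_ge0.
apply: le_trans (trig_mean_square B_ge2 B_cop alpha01 supp varV h0 (window_sizeP c h) _ _ _) _.
apply: lerD.
  apply: ler_wpM2l => //.
  exact: (trunc_diff_le B_ge2 B_cop supp varV h0 q0 Kq gC gt Hx C1 t1).
apply: ler_wpM2l => //; apply: lerXn2r; rewrite ?nnegrE.
- by apply: sumr_ge0 => p _; rewrite mulr_ge0 ?cnorm_ge0.
- by rewrite !mulr_ge0// (le_trans ler01).
rewrite mulr_natl; have -> : (D * D)%N = #|{: 'I_D * 'I_D}| by rewrite card_prod card_ord.
rewrite -sumr_const; apply: (@le_trans _ _ (\sum_(p : 'I_D * 'I_D) if reduced_pair B p then
   (2 * C * V * K%:R) else 0)); last first.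
  by apply: ler_sum => p _; case: ifP => // _; rewrite !mulr_ge0// (le_trans ler01).
rewrite -big_mkcond /=; apply: ler_sum => p /and4P[sr r1 _ _].
rewrite -mulrA; apply: ler_pM; rewrite ?cnorm_ge0//; last exact: (cnorm_Phi_le supp varV h0 (window_sizeP c h)).
have rr : ((p.1 : nat)%:R : R)^-1 <= 1 by rewrite invf_le1 ?ler1n ?ltr0n ltnW.
apply: le_trans (ler_normB _ _) _; rewrite mulr_natl mulr2n; apply: lerD.
  by apply: le_trans (gC sr) _; rewrite ler_piMr// (le_trans ler01).
rewrite /trunc_weight normrM normr_nat; apply: le_trans C1.
have g1 := le_trans (gB_abs_le B_ge2 B_cop alpha01 B_regular sr) rr.
by case: in_window; rewrite ?mulr1// mulr0.
Qed.

End Level.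

(** [q] is fixed by [d] before [h] grows. The level is a fixed power $h^E$, so the off-diagonal
    terms require [M] to exceed only a fixed power of [h]. The assumed bound on the second moment is
    available later because that moment tends to [1]. *)
Lemma approximation (d : R) : 0 < d < 1 -> exists q, [/\ (0 < q)%N,
  exists2 a1, 0 < a1 & \forall h \near +oo, a1 * N h <= trunc_variance B phi q h (frac_bound q h) &
  exists m (Cm h1 : R), 0 <= Cm /\ forall h M, h1 <= h -> Cm * h ^+ m <= M%:R ->
   \sum_(n < M) (complex.Re (trig B phi h (frac_bound q h) (wt q h) n.+1) /
      Num.sqrt (trunc_variance B phi q h (frac_bound q h))) ^+ 2 <= 2 * M%:R ->
   \sum_(n < M) (d < `|(Num.sqrt (C2 B phi h))^-1 * weighted_deviation B phi h n.+1 -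
      complex.Re (trig B phi h (frac_bound q h) (wt q h) n.+1) /
      Num.sqrt (trunc_variance B phi q h (frac_bound q h))|)%R%:R <= d * M%:R].
Proof.
move=> /andP[d0 d1]; have /andP[a0 a1] := alpha01.
have [c1 [hc [c10 hc1 Hc]]] := C2_lower B_ge2 B_cop alpha01 B_regular supp varV phi_neq0 c0.
have [Cr [Cr0 HCr]] := recip_sum_bounded B_ge2 alpha01 B_regular.
pose C := Num.max 1 Cr; have C1 : 1 <= C by rewrite le_max lexx.
have C0 : 0 < C by exact: lt_le_trans C1.
(* The three Chebyshev contributions add up to $56\kappa/d^2 + d/5 = \frac{7}{10} d + \frac15 d$,
   below [d]. *)
pose kap := d ^+ 3 / 80; have d30 : 0 < d ^+ 3 by exact: exprn_gt0.
have kap0 : 0 < kap by rewrite divr_gt0.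
have kap1 : kap <= 80^-1 by rewrite /kap ler_piMl// exprn_ile1// ltW.
have kaple : kap <= 1 by lra.
have kaplt : kap < 1 by lra.
have kaph : 2^-1 <= 1 - kap by lra.
(* The energy outside the window enters with the factor $C^2$ and must stay below $\kappa c_1 N(h)$,
   hence below $\kappa C_2$. *)
pose eta1 := c1 * kap / C ^+ 2; have eta10 : 0 < eta1 by rewrite divr_gt0 ?mulr_gt0 ?exprn_gt0.
have eta1k : eta1 <= c1 * kap.
  by rewrite ler_pdivrMr ?exprn_gt0// ler_peMr ?exprn_ege1// mulr_ge0 ?ltW.
have [q [q0 qc [hq [hq1 Hq]]]] := outside_small alpha01 B_regular V c0 eta10.
have qp : 0 < q%:R :> R by rewrite ltr0n.
have q1 : 1 <= q%:R :> R by rewrite ler1n.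
have near_ge (y : R) : \forall h \near +oo, y <= h by exists y; split; [exact: num_real|move=> x /ltW].
have Kq h : 1 <= h -> (window_size c h)%:R <= q%:R * h.
  move=> h1; apply: le_trans (window_size_le c0 h1) _; rewrite ler_wpM2r// (le_trans ler01)//.
have Cc h : Num.max hc hq <= h -> C2 B phi h * (1 - kap) <= trunc_variance B phi q h (frac_bound q h) /\
    c1 * N h <= C2 B phi h.
  rewrite ge_max => /andP[hh1 hh2]; have h1 : 1 <= h by exact: le_trans hh1.
  have h0 : 0 < h by exact: lt_le_trans h1.
  have cN := Hc h hh1; split => //.
  have qD : q%:R * h < (frac_bound q h)%:R by exact: truncnS_gt.
  have := trunc_variance_ge B_ge2 B_cop alpha01 B_regular supp varV h0 q0 (Kq h h1) qD (fun M => Hq h M hh2).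
  have : eta1 * N h <= kap * C2 B phi h.
    apply: (@le_trans _ _ (kap * (c1 * N h))); last by rewrite ler_wpM2l// ltW.
    by rewrite mulrA [kap * c1]mulrC ler_wpM2r// counting_function_ge0.
  lra.
exists q; split => //.
  exists (c1 / 2); first by rewrite divr_gt0.
  apply: filterS (near_ge (Num.max hc hq)) => h hh; have [vC cN] := Cc h hh.
  apply: le_trans vC.
  have Nh0 : 0 <= N h by exact: counting_function_ge0.
  have C20 : 0 <= C2 B phi h by apply: le_trans cN; rewrite mulr_ge0// ltW.
  have : C2 B phi h * 2^-1 <= C2 B phi h * (1 - kap) by rewrite ler_wpM2l//; exact: kaph.
  lra.
have etaa : 0 < alpha / 2 < alpha by rewrite divr_gt0// ltr_pdivrMr// mulr_natr mulr2n ltrDl.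
have [Cp [xp [xp1 Cp0 Hp]]] := counting_potter B_regular etaa.
pose Cq := Cp * q%:R `^ (alpha + alpha / 2).
have Cq0 : 0 < Cq by rewrite mulr_gt0// powR_gt0.
pose W := 16 * V ^+ 2 * Cq; have W0 : 0 <= W by rewrite !mulr_ge0 ?sqr_ge0// ltW.
(* Accuracy of [gD] as a substitute for [g_B] inside the window: small enough for $t^2 W \le \kappa
   c_1$ and $t \le 1$. *)
pose t := kap * c1 / (W + c1).
have Wc : 0 < W + c1 by rewrite ltr_wpDl.
have t0 : 0 < t by rewrite divr_gt0// mulr_gt0.
have t1 : t <= 1 by rewrite ler_pdivrMr// mul1r; apply: (@le_trans _ _ c1); [rewrite ler_piMl ?ltW//|rewrite lerDr].
have tW : t ^+ 2 * W <= kap * c1.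
  apply: (@le_trans _ _ (t * W)); first by rewrite ler_wpM2r// expr2 ler_piMr// ltW.
  rewrite /t mulrAC ler_pdivrMr// ler_wpM2l ?lerDl ?ltW//.
  by rewrite mulr_gt0.
have [y0 [y01 Hy0]] := recip_tail_small alpha01 B_regular t0.
pose beta := (alpha + 1) / 2.
have ab : alpha < beta < 1 by apply/andP; rewrite /beta; split; lra.
have [Ct [xt [xt1 Ct0 Ht]]] := recip_tail alpha01 B_regular ab.
(* $E(1-\beta) \ge 1$ makes the reciprocal tail beyond $h^E$ of order $1/h$, which offsets the
   window size; $E \ge 2$ puts the level far above $qh$. *)
pose E := (Num.truncn ((1 - beta)^-1)).+2.
have b1 : 0 < 1 - beta by have /andP[_ ?] := ab; rewrite subr_gt0.
have E1 : 1 <= E%:R * (1 - beta).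
  rewrite -ler_pdivrMr// mul1r; apply: le_trans (ltW (truncnS_gt _)) _; by rewrite ler_nat.
have E2 : (1 < E)%N by [].
clearbody E.
pose CT := 4 * (c + 1) * V * Ct.
have CT0 : 0 <= CT by rewrite !mulr_ge0 ?addr_ge0// ltW.
(* Makes [C2] so large that its square root dominates the bounded average of the remainder, and that
   the off-diagonal total [M] is at most $\kappa C_2 M$. *)
have [hN [hN1 HN]] := counting_infty ((1 + (20 * CT / d ^+ 2) ^+ 2 + kap^-1) / c1).
(* With $D \ll h^E$ and $K \ll h$ the off-diagonal term $D^2 (D^2 K)^2$ has order $h^{6E+2}$; the
   summand $c + 1$ ensures $K \le M$. *)
pose Cm := 8 * (8 * C * V * (c + 1)) ^+ 2 + (c + 1).
have Cm0 : 0 <= Cm by apply: addr_ge0; [apply: mulr_ge0 => //; exact: sqr_ge0|exact: addr_ge0].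
exists (6 * E + 2)%N, Cm, (Num.max (Num.max (Num.max hc hq) (Num.max xp xt)) (Num.max hN (q%:R * y0 + q%:R + 1))).
split => // h M; rewrite [Num.max _ _ <= h]ge_max => /andP[]; rewrite [Num.max _ _ <= h]ge_max => /andP[hcq].
rewrite [Num.max _ _ <= h]ge_max => /andP[hxp hxt]; rewrite ge_max => /andP[hhN hhy] hM hY.
have h1 : 1 <= h by exact: le_trans hxp.
have h0 : 0 < h by exact: lt_le_trans h1.
have [vC cN] := Cc h hcq.
have hqq : hq <= h by move: hcq; rewrite ge_max => /andP[].
set C2h := C2 B phi h in vC cN *.
have C2big : 1 + (20 * CT / d ^+ 2) ^+ 2 + kap^-1 <= C2h.
  by apply: le_trans cN; rewrite [c1 * _]mulrC -ler_pdivrMr//; exact: HN.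
have C20 : 0 < C2h.
  by apply: lt_le_trans C2big; rewrite -addrA ltr_pwDl// addr_ge0 ?sqr_ge0// invr_ge0 ltW.
have Nh0 : 0 < N h.
  rewrite lt0r counting_function_ge0 andbT; apply/eqP => N0; have := HN h hhN.
  by rewrite N0 leNgt divr_gt0// -addrA ltr_pwDl// addr_ge0 ?sqr_ge0// invr_ge0 ltW.
have v0 : 0 < trunc_variance B phi q h (frac_bound q h).
  by apply: lt_le_trans vC; rewrite mulr_gt0// subr_gt0.
have hE1 : 1 <= h ^+ E by rewrite exprn_ege1.
have hE0 : 0 < h ^+ E by exact: lt_le_trans hE1.
pose D := (Num.truncn (h ^+ E)).+1.
have DhE : h ^+ E < D%:R by exact: truncnS_gt.
have D2 : D%:R <= 2 * h ^+ E.
  rewrite /D -natr1 mulr_natl mulr2n; apply: lerD => //; rewrite truncn_le// ltW//.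
have hEh : h ^+ 2 <= h ^+ E by rewrite ler_weXn2l.
have hh2 : q%:R * h * (y0 + 1) <= h ^+ 2 - 1.
  rewrite expr2; have : (q%:R * y0 + q%:R + 1) * h <= h * h by rewrite ler_wpM2r// ltW.
  exact: level_square_bound.
have qD : q%:R * h < D%:R.
  apply: le_lt_trans DhE; apply: le_trans hEh.
  have : q%:R * h * 1 <= q%:R * h * (y0 + 1) by rewrite ler_wpM2l ?mulr_ge0 ?(ltW h0)// lerDr (le_trans ler01).
  by move=> A; exact: le_trans_pred A hh2.
have gC r : sqf r -> `|gD B D r : R| <= C / r%:R.
  move=> sr; apply: (gD_abs_le B_ge2 B_cop) => // L; apply: le_trans (HCr L) _.
  by rewrite /C le_max lexx orbT.
have gt r : sqf r -> r%:R <= q%:R * h -> `|g_B B r - gD B D r : R| <= t / r%:R.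
  move=> sr rq; have r0 : (0 < r)%N := sqf_gt0 B_ge2 sr.
  have rp : 0 < r%:R :> R by rewrite ltr0n.
  apply: (gD_gB B_ge2 B_cop) => // L.
  apply: le_trans (Hy0 L); apply: (sqf_tail_le B_ge2).
  have d1' : D.-1%:R < ((D.-1 %/ r).+1)%:R * r%:R :> R by rewrite -natrM ltr_nat ltn_ceil.
  rewrite -(ltr_pM2r rp); apply: le_lt_trans d1'.
  have d2' : h ^+ E < D.-1%:R + 1 by rewrite natr1.
  apply: (@le_trans _ _ (y0 * (q%:R * h))).
    by rewrite ler_wpM2l// (le_trans ler01).
  have : y0 * (q%:R * h) <= q%:R * h * (y0 + 1).
    by rewrite mulrDr mulrC lerDl mulr1 mulr_ge0// ltW.
  by move=> A; exact/ltW/(lt_trans_pred hh2 hEh d2' A).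
have tailD L : \sum_(d < L | sqf d && (D <= d)%N) (d%:R)^-1 <= Ct / h.
  apply: le_trans (sqf_tail_le B_ge2 L DhE) _.
  have hx : xt <= h ^+ E by apply: le_trans hxt _; rewrite ler_eXnr// ltnW.
  apply: le_trans (Ht (h ^+ E) L hx) _; rewrite ler_wpM2l ?(ltW Ct0)//.
  rewrite -powR_mulrn ?(ltW h0)// -powRrM -[h^-1]powR_inv1 ?(ltW h0)// ler_powR//.
  exact: level_exponent_bound E1.
have := level_bound M h1 q0 (Kq h h1) qD gC gt (fun L => Hq h L hqq) C1 t1 tailD d0 (ltW kap0) v0 vC.
move/le_trans; apply; rewrite -/C2h.
have Mp : 0 <= M%:R :> R by [].
have d20 : 0 < d ^+ 2 by exact: exprn_gt0.
have Kc : (window_size c h)%:R <= (c + 1) * h by exact: window_size_le.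
set K := window_size c h in Kc *.
have hm1 : 1 <= h ^+ (6 * E + 1) by rewrite exprn_ege1.
have hmE : h ^+ (6 * E + 2) = h * h ^+ (6 * E + 1) by rewrite -exprS -addnS.
have cm1 : 0 <= 8 * (8 * C * V * (c + 1)) ^+ 2 by rewrite mulr_ge0 ?sqr_ge0.
have KM : K%:R <= M%:R :> R.
  apply: le_trans hM; apply: le_trans Kc _; rewrite hmE /Cm mulrA.
  apply: (@le_trans _ _ ((8 * (8 * C * V * (c + 1)) ^+ 2 + (c + 1)) * h)).
    by rewrite ler_wpM2r ?(ltW h0)// lerDr.
  by rewrite ler_peMr// mulr_ge0// ltW.
have big : 2 * (D * D)%N%:R * ((D * D)%N%:R * (2 * C * V * K%:R)) ^+ 2 <= M%:R :> R.
  have D20 : (D * D)%N%:R <= 4 * h ^+ (2 * E) :> R.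
    rewrite natrM; have -> : 4 * h ^+ (2 * E) = (2 * h ^+ E) * (2 * h ^+ E) by rewrite mulnC exprM expr2; ring.
    by apply: ler_pM.
  have p1 : 0 <= 2 * C * V by rewrite !mulr_ge0// ltW.
  have p2 : 0 <= h ^+ (2 * E) by rewrite exprn_ge0// ltW.
  apply: (@le_trans _ _ (2 * (4 * h ^+ (2 * E)) * ((4 * h ^+ (2 * E)) * (2 * C * V * ((c + 1) * h))) ^+ 2)).
    apply: ler_pM; [by rewrite mulr_ge0|exact: sqr_ge0|by rewrite ler_wpM2l|].
    apply: lerXn2r; rewrite ?nnegrE ?mulr_ge0 ?addr_ge0 ?(ltW h0) ?(ltW C0)//.
    by apply: ler_pM => //; [rewrite mulr_ge0|rewrite ler_wpM2l].
  apply: le_trans hM; apply: (@le_trans _ _ (8 * (8 * C * V * (c + 1)) ^+ 2 * h ^+ (6 * E + 2))).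
    rewrite le_eqVlt; apply/orP; left; apply/eqP.
    rewrite expr_6n2; move: (h ^+ (2 * E)) => z; ring.
  by rewrite ler_wpM2r ?exprn_ge0 ?(ltW h0)// /Cm lerDl addr_ge0.
have NqN : N (q%:R * h) <= Cq * N h.
  have hqh : h <= q%:R * h by rewrite ler_peMl// ltW.
  have [_ + _] := Hp h (q%:R * h) hxp hqh.
  by rewrite mulfK// gt_eqF.
have B1 : 16 / (d ^+ 2 * C2h) * (M%:R * (C ^+ 2 * (eta1 * N h) + t ^+ 2 * (16 * V ^+ 2 * N (q%:R * h))) +
   2 * (D * D)%N%:R * ((D * D)%N%:R * (2 * C * V * K%:R)) ^+ 2) <= 48 * kap / d ^+ 2 * M%:R.
  have e1 : C ^+ 2 * (eta1 * N h) <= kap * C2h.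
    have -> : C ^+ 2 * (eta1 * N h) = kap * (c1 * N h) by rewrite /eta1; field; rewrite gt_eqF.
    by rewrite ler_wpM2l// ltW.
  have e2 : t ^+ 2 * (16 * V ^+ 2 * N (q%:R * h)) <= kap * C2h.
    apply: (@le_trans _ _ (t ^+ 2 * W * N h)).
      rewrite -[leRHS]mulrA ler_wpM2l ?sqr_ge0// /W -[leRHS]mulrA; apply: ler_wpM2l => //.
      by apply: mulr_ge0 => //; exact: sqr_ge0.
    apply: (@le_trans _ _ (kap * c1 * N h)); first by rewrite ler_wpM2r ?(ltW Nh0).
    by rewrite -mulrA ler_wpM2l// ltW.
  have e3 : 1 <= kap * C2h.
    rewrite -ler_pdivrMl// mulr1; apply: le_trans C2big; rewrite lerDr addr_ge0 ?sqr_ge0//.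
  have e4 : M%:R <= M%:R * (kap * C2h) by rewrite ler_peMr.
  apply: (@le_trans _ _ (16 / (d ^+ 2 * C2h) * (M%:R * (kap * C2h + kap * C2h) + M%:R * (kap * C2h)))).
    apply: ler_wpM2l; first by rewrite divr_ge0// mulr_ge0 ?ltW.
    by apply: lerD; [rewrite ler_wpM2l// lerD|exact: le_trans e4].
  by rewrite le_eqVlt; apply/orP; left; apply/eqP; field; rewrite !gt_eqF.
have B2 : 4 / (d * Num.sqrt C2h) * (K%:R * V * (Ct / h) * (3 * M + K)%N%:R) <= d / 5 * M%:R.
  have sg : 20 * CT / d ^+ 2 <= Num.sqrt C2h.
    have p : 0 <= 20 * CT / d ^+ 2 by rewrite divr_ge0 ?sqr_ge0// mulr_ge0.
    rewrite -[leLHS]ger0_norm// -sqrtr_sqr ler_wsqrtr//; apply: le_trans C2big.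
    by rewrite addrAC lerDr addr_ge0// invr_ge0 ltW.
  have s0 : 0 < Num.sqrt C2h by rewrite sqrtr_gt0.
  have e1 : K%:R * V * (Ct / h) * (3 * M + K)%N%:R <= CT * M%:R.
    have -> : CT * M%:R = (c + 1) * h * V * (Ct / h) * (4 * M%:R) by rewrite /CT; field; rewrite gt_eqF.
    have p3 : 0 <= Ct / h by rewrite divr_ge0 ?ltW.
    apply: ler_pM => //.
    - by apply: mulr_ge0 => //; exact: mulr_ge0.
    - by apply: ler_wpM2r => //; exact: ler_wpM2r.
    - rewrite natrD natrM [leRHS](_ : _ = 3 * M%:R + M%:R) ?lerD2l//; ring.
  apply: (@le_trans _ _ (4 / (d * Num.sqrt C2h) * (CT * M%:R))).
    by rewrite ler_wpM2l// divr_ge0// mulr_ge0 ?ltW.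
  rewrite [leLHS](_ : _ = (4 * CT / (d * Num.sqrt C2h)) * M%:R); last by ring.
  apply: ler_wpM2r => //; rewrite ler_pdivrMr ?mulr_gt0//.
  have : 20 * CT <= Num.sqrt C2h * d ^+ 2 by rewrite -ler_pdivrMr.
  exact: chebyshev_tail_share.
have B3 : 4 / d ^+ 2 * kap ^+ 2 * \sum_(n < M) (complex.Re (trig B phi h (frac_bound q h) (wt q h) n.+1) /
      Num.sqrt (trunc_variance B phi q h (frac_bound q h))) ^+ 2 <= 8 * kap / d ^+ 2 * M%:R.
  apply: (@le_trans _ _ (4 / d ^+ 2 * kap ^+ 2 * (2 * M%:R))).
    by rewrite ler_wpM2l// mulr_ge0 ?sqr_ge0// divr_ge0// ltW.
  have -> : 8 * kap / d ^+ 2 * M%:R = 4 / d ^+ 2 * kap * (2 * M%:R) by ring.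
  rewrite ler_wpM2r ?mulr_ge0// ler_wpM2l ?divr_ge0 ?(ltW d20)// expr2 ler_piMr ?ltW//.
apply: le_trans (lerD (lerD B1 B2) B3) _; rewrite -!mulrDl ler_wpM2r//.
have kd : kap / d ^+ 2 = d / 80 by rewrite /kap; field; rewrite gt_eqF.
rewrite (chebyshev_share_sum kd); exact: chebyshev_share_total d0.
Qed.

End Approximation.

(** * Convergence in distribution *)

Section MeanOver.
Context {R : realType}.
Implicit Types (M : nat) (f u y : nat -> R) (t d : R).

Definition mean_over M f : R := M%:R^-1 * \sum_(n < M) f n.+1.

Lemma mean_functional_over M y : (0 < M)%N ->
  mean_functional (fun g : R -> R => mean_over M (fun n => g (y n))).
Proof.
move=> M0; split => [f g _ _|a f _|f g _ _ fg|].
- by rewrite /mean_over big_split mulrDr.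
- by rewrite /mean_over -mulr_sumr mulrCA.
- by rewrite ler_wpM2l ?invr_ge0//; apply: ler_sum.
- by rewrite /mean_over sumr_const card_ord mulVf// pnatr_eq0 -lt0n.
Qed.

(** Closeness outside a proportion [d] of the integers moves distribution functions by at most [d]
    in the argument and [d] in the value. *)
Lemma mean_over_close M u y t d : (0 < M)%N ->
  \sum_(n < M) (d < `|u n.+1 - y n.+1|)%R%:R <= d * M%:R ->
  mean_over M (fun n => (y n <= t - d)%R%:R) - d <= mean_over M (fun n => (u n <= t)%R%:R) <=
  mean_over M (fun n => (y n <= t + d)%R%:R) + d.
Proof.
move=> M0 close; have Mp : 0 < M%:R :> R by rewrite ltr0n.
have b01 (b : bool) : 0 <= b%:R :> R by [].
have step (p r : nat -> R) : (forall n, p n <= r n + (d < `|u n - y n|)%R%:R) ->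
    mean_over M p <= mean_over M r + d.
  move=> pr; rewrite /mean_over [X in _ <= _ + X](_ : d = M%:R^-1 * (d * M%:R)); last first.
    by field; rewrite gt_eqF.
  rewrite -mulrDr ler_wpM2l ?invr_ge0//.
  apply: le_trans (_ : \sum_(n < M) (r n.+1 + (d < `|u n.+1 - y n.+1|)%R%:R) <= _).
    by apply: ler_sum => n _; exact: pr.
  by rewrite big_split lerD2l.
have cmp (a b : R) : a <= b + d \/ d < `|b - a|.
  have [h|h] := leP a (b + d); [by left|right].
  rewrite distrC; apply: lt_le_trans (ler_norm _); lra.
apply/andP; split.
  rewrite lerBlDr; apply: step => n; have [h|h] := cmp (u n) (y n).
    apply: (@le_trans _ _ (u n <= t)%R%:R); last by rewrite lerDl.
    by rewrite ler_nat; case: (leP (y n) (t - d)) => // yt; rewrite (le_trans h)// -lerBrDr.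
  by rewrite distrC in h; rewrite h -natrD ler_nat; case: (y n <= t - d)%R; rewrite ?addn1.
apply: step => n; have [h|h] := cmp (y n) (u n).
  apply: (@le_trans _ _ (y n <= t + d)%R%:R); last by rewrite lerDl.
  by rewrite ler_nat; case: (leP (u n) t) => // ut; rewrite (le_trans h)// lerD2r.
by rewrite h -natrD ler_nat; case: (u n <= t)%R; rewrite ?addn1.
Qed.

End MeanOver.

(** Eventually $\log H \le \log X/(2(m+1))$, so $H^m \le \sqrt X$, which is $o(X)$. The [m.+1] keeps
    the quotient meaningful for [m = 0]. *)
Lemma pow_growth (R : realType) (H : R -> R) : H X @[X --> +oo] --> +oo ->
  ln (H X) / ln X @[X --> +oo] --> (0 : R) ->
  forall m (C e : R), 0 < e -> \forall X \near +oo, C * H X ^+ m <= e * (Num.truncn X)%:R.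
Proof.
move=> Hoo Hs m C e e0.
have Hge (y : R) : \forall X \near +oo, y <= H X by move/cvgryPge : Hoo; exact.
have near_ge (y : R) : \forall X \near +oo, y <= X :> R by exists y; split; [exact: num_real|move=> x /ltW].
pose k : R := (2 * m.+1%:R)^-1; have k0 : 0 < k by rewrite invr_gt0 mulr_gt0.
pose r0 := 2 * `|C| / e + 1; have r00 : 0 < r0 by rewrite ltr_wpDl// divr_ge0 ?mulr_ge0// ltW.
move/cvgrPdist_lt/(_ _ k0) : Hs => Hs.
near=> X.
have X2 : 2 <= X by near: X; exact: near_ge.
have Xr : r0 ^+ 2 <= X by near: X; exact: near_ge.
have H1 : 1 <= H X by near: X; exact: Hge.
have : `|0 - ln (H X) / ln X| < k by near: X.
have X0 : 0 < X by exact: lt_le_trans X2.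
have H0 : 0 < H X by exact: lt_le_trans H1.
have lX : 0 < ln X by apply: ln_gt0; apply: lt_le_trans X2; rewrite ltr1n.
rewrite sub0r normrN ger0_norm ?divr_ge0 ?ln_ge0 ?(ltW lX)// ltr_pdivrMr// => hk.
pose r := expR (ln X / 2); have rr : r * r = X.
  by rewrite -expRD -splitr lnK// posrE.
have r_ge : r0 <= r.
  rewrite leNgt; apply/negP => rlt.
  have r0' : 0 < r by exact: expR_gt0.
  have : r * r < r0 ^+ 2 by rewrite expr2; nra.
  by rewrite rr ltNge Xr.
have Hm : H X ^+ m <= r.
  apply: (@le_trans _ _ (H X ^+ m.+1)); first by rewrite ler_weXn2l.
  rewrite -[H X]lnK ?posrE// -expRM_natl ler_expR.
  have : m.+1%:R * ln (H X) <= m.+1%:R * (k * ln X) by rewrite ler_wpM2l// ltW.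
  rewrite /k invfM; have -> : m.+1%:R * (2^-1 / m.+1%:R * ln X) = ln X / 2 by field; rewrite nat1r pnatr_eq0.
  by [].
have tX : X / 2 <= (Num.truncn X)%:R.
  have : X < (Num.truncn X).+1%:R by exact: truncnS_gt.
  rewrite -natr1; lra.
have Hm0 : 0 <= H X ^+ m by rewrite exprn_ge0// ltW.
apply: (@le_trans _ _ (`|C| * r)).
  apply: le_trans (ler_wpM2r Hm0 (ler_norm C)) _; exact: ler_wpM2l.
apply: (@le_trans _ _ (e * (X / 2))); last by rewrite ler_wpM2l// ltW.
have : 2 * `|C| / e <= r by apply: le_trans r_ge; rewrite lerDl.
rewrite ler_pdivrMr// => hC.
have r0' : 0 < r by exact: expR_gt0.
rewrite -rr; nra.
Unshelve. all: by end_near. Qed.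

Section Sandwich.
Context {R : realType}.
Variable B : set nat.
Hypothesis B_ge2 : B `<=` [set b | 2 <= b]%N.
Hypothesis B_cop : {in B &, forall b c, b != c -> coprime b c}.
Variables (alpha : R) (alpha01 : 0 < alpha < 1).
Hypothesis B_regular : regularly_varying (generated_semigroup B) alpha.
Local Notation N := (counting_function (generated_semigroup B) : R -> R).
Variables (phi : R -> R) (c V : R).
Hypothesis supp : forall x, phi x != 0 -> 0 <= x <= c.
Hypothesis varV : forall K (x : nat -> R), (forall i, (i < K)%N -> x i < x i.+1) ->
  \sum_(i < K) `|phi (x i.+1) - phi (x i)| <= V.
Hypothesis phi_neq0 : exists a b : R, a < b /\ forall x, a < x < b -> phi x != 0.
Hypothesis c0 : 0 <= c.
Let V0 := window_V_ge0 supp varV.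

Section FixedWindow.
Variables (q : nat) (h : R).
Hypothesis q0 : (0 < q)%N.
Local Notation v := (trunc_variance B phi q h (frac_bound q h)).
Local Notation Y n := (complex.Re (trig B phi h (frac_bound q h) (trunc_weight B q h) n)).

(** Conjugation permutes the terms through [tneg]. *)
Lemma trunc_trig_real n : trig B phi h (frac_bound q h) (trunc_weight B q h) n = (Y n)%:C%C.
Proof.
have cj : (trig B phi h (frac_bound q h) (trunc_weight B q h) n)^*%C = trig B phi h (frac_bound q h) (trunc_weight B q h) n.
  rewrite trunc_trigE// rmorph_sum /=.
  have negK : involutive (@tneg R B q h) := negK (tsg_neg B_ge2 B_cop alpha01 q0).
  rewrite [RHS](reindex_inj (inv_inj negK)); apply: eq_bigr => x _.
  rewrite (tcoef_neg B_ge2 B_cop supp q0) rmorphM; congr (_ * _).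
  rewrite -[LHS]/((e_ _)^*%C) -e_N.
  have /intrP[m mE] : tsg x + tsg (tneg x) \is a Num.int by rewrite (tsg_neg B_ge2 B_cop alpha01 q0).
  have -> : tsg (tneg x) = - tsg x + m%:~R by rewrite -mE addrA addNr add0r.
  rewrite mulrDr mulrN -[n%:R in X in _ = e_ (_ + X)]/(n%:Z%:~R) -intrM e_Dint//.
by case: (trig _ _ _ _ _ _) cj => a b [] /eqP; rewrite eq_sym -addr_eq0 -mulr2n mulrn_eq0 /= => /eqP ->.
Qed.

(** Trivial counts suffice: $O(h^2)$ fractions and denominators $O(h)$ give $h^{3k}$, and every
    power of [h] is $o(M)$ in the application. *)
Lemma moment_average k M : 1 <= q%:R * h -> 0 < v -> 1 <= v -> (0 < M)%N ->
  `|mean_over M (fun n => (Y n / Num.sqrt v) ^+ k) -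
    complex.Re (tuple_moment (@tsg R B q h) (@tcoef R B phi q h) k) / Num.sqrt v ^+ k| <=
  2 * (4 * q%:R ^+ 2 * (1 + 2 * V) * (2 * q%:R)) ^+ k * h ^+ (3 * k) / M%:R.
Proof.
move=> qh1 v0 v1 M0; have Mp : 0 < M%:R :> R by rewrite ltr0n.
have sv : 1 <= Num.sqrt v by rewrite -[leLHS]sqrtr1 ler_wsqrtr.
have svk : 1 <= Num.sqrt v ^+ k by rewrite exprn_ege1.
have svk0 : 0 < Num.sqrt v ^+ k by exact: lt_le_trans svk.
set tm := tuple_moment _ _ k.
have den0 (x : trunc_frac B q h) : (0 < tden x)%N.
  by have [_ r1 _ _ _] := truncP B_ge2 B_cop x; exact: ltnW.
have denZ (x : trunc_frac B q h) : (tden x <= frac_bound q h)%N by exact/ltnW/ltn_ord.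
have denI (x : trunc_frac B q h) : (tden x)%:R * tsg x \is a Num.int.
  by rewrite /tsg /frac mulrC divfK ?intr_int// pnatr_eq0 -lt0n.
have := power_average M k den0 denZ denI (tcoef_le B_ge2 B_cop alpha01 B_regular supp varV q0).
rewrite -/tm => pa.
have E : mean_over M (fun n => (Y n / Num.sqrt v) ^+ k) - complex.Re tm / Num.sqrt v ^+ k =
  complex.Re (\sum_(n < M) (\sum_x tcoef phi x * e_ (n.+1%:R * @tsg R B q h x)) ^+ k - M%:R * tm) / (M%:R * Num.sqrt v ^+ k).
  have -> : \sum_(n < M) (\sum_x tcoef phi x * e_ (n.+1%:R * @tsg R B q h x)) ^+ k = (\sum_(n < M) Y n.+1 ^+ k)%:C%C.
    by rewrite rmorph_sum; apply: eq_bigr => n _; rewrite -trunc_trigE// trunc_trig_real rmorphXn.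
  have -> : complex.Re ((\sum_(n < M) Y n.+1 ^+ k)%:C%C - M%:R * tm) = \sum_(n < M) Y n.+1 ^+ k - M%:R * complex.Re tm.
    rewrite raddfB /=; congr (_ - _); rewrite -[M%:R]/(M%:R : R[i]) -(rmorph_nat (real_complex R)) /=.
    by case: tm {pa} => a b /=; rewrite mul0r subr0.
  rewrite /mean_over; under eq_bigr => n _ do rewrite exprMn exprVn.
  by rewrite -mulr_suml; field; rewrite !gt_eqF.
rewrite E normrM normfV (gtr0_norm (mulr_gt0 Mp svk0)) ler_pdivrMr ?mulr_gt0//.
apply: le_trans (normr_Re_le _) _; apply: le_trans pa _.
have h0 : 0 < h by move: (lt_le_trans ltr01 qh1); rewrite pmulr_rgt0// ltr0n.
have Z2 : (frac_bound q h)%:R <= 2 * (q%:R * h).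
  rewrite /frac_bound -natr1 (_ : 2 * (q%:R * h) = q%:R * h + q%:R * h); last by ring.
  by rewrite lerD// truncn_le// (le_trans ler01).
have I2 : #|{: trunc_frac B q h}|%:R <= 4 * (q%:R * h) ^+ 2.
  apply: (@le_trans _ _ (frac_bound q h * frac_bound q h)%N%:R).
    rewrite ler_nat card_sig; apply: leq_trans (max_card _) _; by rewrite card_prod card_ord.
  rewrite natrM; have -> : 4 * (q%:R * h) ^+ 2 = (2 * (q%:R * h)) * (2 * (q%:R * h)) by ring.
  by apply: ler_pM.
have CV : 0 <= 1 + 2 * V by rewrite addr_ge0// mulr_ge0.
apply: (@le_trans _ _ ((4 * (q%:R * h) ^+ 2) ^+ k * (1 + 2 * V) ^+ k * (2 * (2 * (q%:R * h)) ^+ k))).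
  apply: ler_pM.
  - by apply: mulr_ge0; exact: exprn_ge0.
  - by apply: mulr_ge0 => //; exact: exprn_ge0.
  - by apply: ler_wpM2r; [exact: exprn_ge0|apply: lerXn2r; rewrite ?nnegrE// mulr_ge0// sqr_ge0].
  - by apply: ler_wpM2l => //; apply: lerXn2r; rewrite ?nnegrE// mulr_ge0// (le_trans ler01).
apply: (@le_trans _ _ (2 * (4 * q%:R ^+ 2 * (1 + 2 * V) * (2 * q%:R)) ^+ k * h ^+ (3 * k) * Num.sqrt v ^+ k)).
  apply: (@le_trans _ _ (2 * (4 * q%:R ^+ 2 * (1 + 2 * V) * (2 * q%:R)) ^+ k * h ^+ (3 * k))); last first.
    rewrite ler_peMr// mulr_ge0 ?exprn_ge0 ?(ltW h0)// mulr_ge0// exprn_ge0// !mulr_ge0// sqr_ge0//.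
  rewrite le_eqVlt; apply/orP; left; apply/eqP.
  by rewrite exprM [LHS]mulrCA -[RHS]mulrA -!exprMn; congr (2 * _ ^+ k); ring.
rewrite le_eqVlt; apply/orP; left; apply/eqP; field; exact: lt0r_neq0.
Qed.

End FixedWindow.

Variable H : R -> R.
Hypothesis H_infty : H X @[X --> +oo] --> +oo.
Hypothesis H_small : ln (H X) / ln X @[X --> +oo] --> (0 : R).

Let eventually_H (P : R -> Prop) : (\forall h \near +oo, P h) -> \forall X \near +oo, P (H X).
Proof. by move=> Ph; exact: (H_infty Ph). Qed.

(** One shift by [d] comes from the method of moments for the truncated polynomial, the other from
    replacing that polynomial by the deviation. *)
Lemma deviation_cdf_bounds (t d : R) : 0 < d < 1 -> \forall X \near +oo,
  normal_mean (fun x => (x <= t - d - d)%R%:R) - d - d <=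
  mean_over (Num.truncn X) (fun n => ((Num.sqrt (C2 B phi (H X)))^-1 * weighted_deviation B phi (H X) n <= t)%R%:R) <=
  normal_mean (fun x => (x <= t + d + d)%R%:R) + d + d.
Proof.
move=> d01; have /andP[d0 d1] := d01.
have [q [q0 [a1 a10 var_ge] [m [Cm [h1 [Cm0 approx]]]]]] := approximation B_ge2 B_cop alpha01 B_regular supp varV phi_neq0 c0 d01.
have near_ge (y : R) : \forall X \near +oo, y <= X :> R by exists y; split; [exact: num_real|move=> x /ltW].
(* At least [1] for every [X], so that each average is a mean functional; it agrees with
   [Num.truncn X] for [X >= 1]. *)
pose M (X : R) : nat := maxn 1 (Num.truncn X); have M0 (X : R) : (0 < M X)%N by rewrite leq_max.
pose v (h : R) := trunc_variance B phi q h (frac_bound q h).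
pose y (X : R) n := complex.Re (trig B phi (H X) (frac_bound q (H X)) (trunc_weight B q (H X)) n) / Num.sqrt (v (H X)).
pose E (X : R) (f : R -> R) := mean_over (M X) (fun n => f (y X n)).
have mE X : mean_functional (E X) by exact: mean_functional_over.
have MX : \forall X \near +oo, M X = Num.truncn X.
  apply: filterS (near_ge 1) => X X1; apply/maxn_idPr; by rewrite truncn_gt0.
have [hN [hN1 HN]] := counting_infty alpha01 B_regular a1^-1.
have good : \forall X \near +oo, [/\ 1 <= H X, h1 <= H X, 1 <= v (H X) & 1 <= q%:R * H X].
  have g1 := eventually_H (near_ge (Num.max (Num.max 1 h1) hN)).
  apply: filterS2 (eventually_H var_ge) g1 => X hv; rewrite !ge_max => /andP[/andP[H1 Hh] HhN].
  split => //; last by rewrite mulr_ege1// ler1n.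
  apply: le_trans hv; rewrite mulrC -ler_pdivrMr// div1r; exact: HN.
have cvg_pow k : E X (fun x => x ^+ k) @[X --> +oo] --> normal_mean (fun x : R => x ^+ k).
  have lim : complex.Re (tuple_moment (@tsg R B q h) (@tcoef R B phi q h) k) / Num.sqrt (v h) ^+ k @[h --> +oo] -->
      normal_mean (fun x : R => x ^+ k).
    exact: (truncated_moments_cvg B_ge2 B_cop alpha01 B_regular supp varV q0 a10 var_ge).
  have limH : complex.Re (tuple_moment (@tsg R B q (H X)) (@tcoef R B phi q (H X)) k) / Num.sqrt (v (H X)) ^+ k @[X --> +oo] -->
      normal_mean (fun x : R => x ^+ k).
    exact: (cvg_comp _ _ H_infty lim).
  apply/cvgrPdist_lt => e e0; have e20 : 0 < e / 2 by rewrite divr_gt0.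
  move/cvgrPdist_lt/(_ _ e20) : limH => limH.
  pose Cst : R := 2 * (4 * q%:R ^+ 2 * (1 + 2 * V) * (2 * q%:R)) ^+ k.
  have e40 : 0 < e / 4 by rewrite divr_gt0.
  have gr := pow_growth H_infty H_small (3 * k) Cst e40.
  apply: filterS2 (filterI MX good) (filterI gr limH) => X [XE [g1 g2 g3 g4]] [gX lX].
  have v0 : 0 < v (H X) by exact: lt_le_trans g3.
  have ma := moment_average q0 k g4 v0 g3 (M0 X).
  have Mp : 0 < (M X)%:R :> R by rewrite ltr0n.
  have ma2 : `|mean_over (M X) (fun n => (y X n) ^+ k) -
    complex.Re (tuple_moment (@tsg R B q (H X)) (@tcoef R B phi q (H X)) k) / Num.sqrt (v (H X)) ^+ k| <= e / 4.
    by apply: le_trans ma _; rewrite ler_pdivrMr// XE.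
  rewrite -(subrKA (complex.Re (tuple_moment (@tsg R B q (H X)) (@tcoef R B phi q (H X)) k) / Num.sqrt (v (H X)) ^+ k)).
  apply: le_lt_trans (ler_normD _ _) _; rewrite distrC in ma2; rewrite /E.
  have := ltr_leD lX ma2; move/lt_le_trans; apply; lra.
have Zeven := @normal_mean_even R.
have FF : Filter (pinfty_nbhs R) by exact: _.
have cdfs := moments_cdf mE mean_functional_normal cvg_pow Zeven.
have up := cdfs FF (t + d) d d0; have lo := cdfs FF (t - d) d d0.
have m2 : \forall X \near +oo, E X (fun x => x ^+ 2) < 2.
  move/cvgrPdist_lt/(_ _ ltr01) : (cvg_pow 2%N); apply: filterS => X.
  rewrite (Zeven 1%N) (_ : (1.*2)`! = 2)%N// (_ : 1`! = 1)%N// expr1 mulr1 divff// ltr_norml => /andP[]; lra.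
have gr := pow_growth H_infty H_small m Cm ltr01.
apply: filterS2 (filterI (filterI MX good) gr) (filterI (filterI up lo) m2) => X [[XE [g1 g2 g3 g4]] gX] [[/andP[_ u2] /andP[l1 _]] mX].
have Mp : 0 < (M X)%:R :> R by rewrite ltr0n.
have cl := approx (H X) (M X) g2 ltac:(by rewrite XE; rewrite mul1r in gX) ltac:(by move/ltW: mX; rewrite /E /mean_over mulrC ler_pdivrMr).
have /andP[b1 b2] := @mean_over_close _ (M X) (fun n => (Num.sqrt (C2 B phi (H X)))^-1 * weighted_deviation B phi (H X) n) (y X) t d (M0 X) cl.
rewrite -XE; apply/andP; split.
  by apply: le_trans b1; rewrite lerB.
by apply: le_trans b2 _; rewrite lerD.
Qed.

End Sandwich.

Section MainTheorem.
Context {R : realType}.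

Lemma compact_supp (phi : R -> R) :
  (exists2 K : set R, compact K /\ K `<=` `[0, +oo[ & forall x, phi x != 0 -> K x) ->
  exists2 c : R, 0 <= c & forall x, phi x != 0 -> 0 <= x <= c.
Proof.
move=> [K [cK K0] phiK]; have [M [_ KM]] := compact_bounded cK.
exists (Num.max 0 (M + 1)); first by rewrite le_max lexx.
move=> x /phiK Kx; have := K0 x Kx; rewrite /= in_itv /= andbT => x0; rewrite x0 /=.
have := KM (M + 1) _ x Kx; rewrite /= ltrDl ltr01 => /(_ isT).
by rewrite ger0_norm// => xM; rewrite le_max xM orbT.
Qed.

Lemma bounded_variation_line_sum (phi : R -> R) : bounded_variation_line phi ->
  exists V : R, forall K (x : nat -> R), (forall i, (i < K)%N -> x i < x i.+1) ->
    \sum_(i < K) `|phi (x i.+1) - phi (x i)| <= V.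
Proof.
move=> [V bV]; exists V => K x xinc.
have nthx b i : (i <= K)%N -> nth b (x 0%N :: [seq x j.+1 | j <- iota 0 K]) i = x i.
  case: i => [//|i] iK /=; by rewrite (nth_map 0%N) ?size_iota// nth_iota.
have lastx : last (x 0%N) [seq x j.+1 | j <- iota 0 K] = x K.
  by rewrite (last_nth 0) size_map size_iota nthx.
have part : itv_partition (x 0%N) (x K) [seq x j.+1 | j <- iota 0 K].
  split; last by rewrite lastx.
  apply/(pathP 0) => i; rewrite size_map size_iota => iK.
  have := nthx 0 i (ltnW iK); rewrite /= => ->.
  by rewrite (nth_map 0%N) ?size_iota// nth_iota// xinc.
have le0K : x 0%N <= x K by have := itv_partition_le part.
apply: bV le0K _ _; exists [seq x j.+1 | j <- iota 0 K] => //.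
rewrite /variation size_map size_iota big_mkord; apply: eq_bigr => i _ /=.
have := nthx (x K) i (ltnW (ltn_ord i)); have := nthx (x K) i.+1 (ltn_ord i).
by rewrite /= => -> ->.
Qed.

Lemma cdf_uniform_upto (X : R) (f : nat -> R) (t : R) : 1 <= X ->
  cdf (nat_RV (uniform_upto X) f) t =
  (mean_over (Num.truncn X) (fun n => (f n <= t)%R%:R))%:E.
Proof.
move=> X1; have M0 : (0 < Num.truncn X)%N by rewrite truncn_gt0.
have msE A : msum (fun k : nat => \d_(k.+1) : {measure set nat -> \bar R}) (Num.truncn X) A =
    (\sum_(k < Num.truncn X) (k.+1 \in A)%:R)%:E.
  by rewrite /msum -sumEFin; apply: eq_bigr => k _; exact: diracE.
have ms1 : msum (fun k : nat => \d_(k.+1) : {measure set nat -> \bar R}) (Num.truncn X) [set: nat] =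
    (Num.truncn X)%:R%:E.
  rewrite msE; congr EFin; under eq_bigr => k _ do rewrite in_setT.
  by rewrite sumr_const card_ord.
rewrite /cdf /distribution /pushforward /uniform_upto /=.
rewrite /mnormalize ifF; last first.
  apply/negbTE; rewrite negb_or; apply/andP; split; apply/eqP => E.
    by have [/eqP] := etrans (esym ms1) E; rewrite pnatr_eq0 eqn0Ngt M0.
  by have := etrans (esym ms1) E.
transitivity ((\sum_(k < Num.truncn X) (k.+1 \in f @^-1` `]-oo, t])%:R : R)%:E * ((Num.truncn X)%:R^-1 : R)%:E)%E.
  by congr (_ * _)%E; [exact: msE|congr (_^-1)%:E; exact: (congr1 fine ms1)].
rewrite -EFinM mulrC /mean_over.
congr (_%:E); congr (_ * _); apply: eq_bigr => k _; congr (_%:R).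
by congr nat_of_bool; apply/idP/idP; rewrite inE /= in_itv.
Qed.

End MainTheorem.

(** Removes the shifts: the bounds for each fixed [d] hold eventually, and continuity of the limit
    at [t] lets [d] tend to [0]. *)
Lemma cvg_sandwich_shift {R : realType} (G : R -> R) (F : R -> R) (t : R) :
  {for t, continuous G} ->
  (forall d : R, 0 < d < 1 -> \forall X \near +oo,
     G (t - d - d) - d - d <= F X <= G (t + d + d) + d + d) ->
  F X @[X --> +oo] --> G t.
Proof.
move=> cG bnd; apply/cvgrPdist_le => e e0.
have e20 : 0 < e / 2 by rewrite divr_gt0.
move/cvgrPdist_le/(_ _ e20) : cG => [r /= r0 Hr].
pose d := Num.min (Num.min (r / 4) (e / 4)) (1 / 2).
have d0 : 0 < d by rewrite !lt_min !divr_gt0.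
have [dr de dh] : [/\ d <= r / 4, d <= e / 4 & d <= 1 / 2].
  by split; rewrite /d !ge_min lexx ?orbT.
have d01 : 0 < d < 1 by rewrite d0 /=; lra.
apply: filterS (bnd d d01) => X /andP[lo up].
have := Hr (t - d - d); have := Hr (t + d + d); rewrite /ball /=.
rewrite (_ : t - (t + d + d) = - (d + d)); last by ring.
rewrite (_ : t - (t - d - d) = d + d); last by ring.
rewrite normrN gtr0_norm ?addr_gt0// !ler_norml => H1 H2.
have dd : d + d < r by lra.
have := H1 dd; have := H2 dd; lra.
Qed.

Theorem theorem6p2 (R : realType) (H : R -> R) (B : set nat) (alpha : R)
    (phi : R -> R)
    (H_infty : H X @[X --> +oo] --> +oo)
    (H_small : ln (H X) / ln X @[X --> +oo] --> (0 : R))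
    (B_sieving : @sieving_set R B)
    (alpha01 : 0 < alpha < 1)
    (B_regular : regularly_varying (generated_semigroup B) alpha)
    (phi_BV : bounded_variation_line phi)
    (phi_supp : exists2 K : set R, compact K /\ K `<=` `[0, +oo[ &
       forall x, phi x != 0 -> K x)
    (phi_neq0 : exists a b : R, a < b /\ forall x, a < x < b -> phi x != 0) :
  cvg_in_distribution (pinfty_nbhs R)
    (fun X => nat_RV (uniform_upto X)
       (fun n => (Num.sqrt (C2 B phi (H X)))^-1
                 * weighted_deviation B phi (H X) n))
    (normal_prob (0 : R) 1).
Proof.
have [_ B_ge2 B_cop _] := B_sieving.
have [c c0 supp] := compact_supp phi_supp.
have [V varV] := bounded_variation_line_sum phi_BV.
move=> t; pose G (s : R) : R := normal_mean (fun x : R => (x <= s)%R%:R).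
rewrite (_ : (fun s => _) = EFin \o G); last first.
  by apply/funext => s; rewrite /G /= normal_mean_le_indic.
move=> cG; rewrite [X in _ --> X](_ : _ = (G t)%:E); last first.
  by rewrite /G normal_mean_le_indic.
have cGt : {for t, continuous G} by exact: (fine_cvg cG).
have := cvg_sandwich_shift cGt (deviation_cdf_bounds B_ge2 B_cop alpha01 B_regular supp varV phi_neq0 c0 H_infty H_small t).
move=> cF; have X1 : \forall X \near +oo, (1 : R) <= X.
  by exists 1; split; [exact: num_real|move=> x /ltW].
apply: cvg_EFin.
  apply: filterS X1 => X X1.
  exact: (eq_ind_r (fun x : \bar R => x \is a fin_num) _ (cdf_uniform_upto _ _ X1)).
apply: cvg_trans cF; apply: near_eq_cvg; apply: filterS X1 => X X1.
exact: (esym (congr1 fine (cdf_uniform_upto _ _ X1))).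
Qed.
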